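(* Let $G_{n+1}$ be the $n$-step nilpotent Lie group described in the context, with coordinates $(a,\mathbf z)\in\mathbb R^{n+1}$, $\mathbf z=(z_1,\dots,z_n)$, and with the left-invariant sub-Riemannian structure for which $\widetilde{X_1},\widetilde{X_2}$ are an orthonormal horizontal frame. The hypoelliptic heat kernel on $G_{n+1}$ is given by $$p_t(a,\mathbf z)=\int_{\mathbb R^{n-1}}\int_{\mathbb R}e^{2\pi i\left(\sum_{k=1}^{n-1}\lambda_kB_k(x,\mathbf z)\right)}\,k_t^{\mathbf\Lambda_{n-1}}(x+a,x)\,dx\,|\lambda_{n-1}|\,d\mathbf\Lambda_{n-1},$$ where $k_t^{\mathbf\Lambda_{n-1}}(x,y)$ is the fundamental solution to a Schrödinger equation with a polynomial potential (specified in the context), $$B_k(x,\mathbf z)=\sum_{i=1}^k\frac{z_i}{(k-i)!}x^{k-i},\qquad k=1,2,\dots,n-1,$$ and $d\mathbf\Lambda_{n-1}=d\lambda_1\cdots d\lambda_{n-1}$ is the Lebesgue measure.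
   Context: $G_{n+1}$ is the connected, simply connected nilpotent Lie group with Lie algebra spanned by $X,Y_1,\dots,Y_n$ with $[X,Y_i]=Y_{i+1}$ for $1\le i\le n-1$, $[X,Y_n]=0$, $[Y_i,Y_j]=0$. The element $\exp(aX+\sum_{i=1}^nb_iY_i)$ has coordinates $(a,\mathbf z)$ with $z_j=\sum_{k=0}^{j-1}\frac{a^kb_{j-k}}{(k+1)!}$; this identifies $G_{n+1}$ with $\mathbb R^{n+1}$ with the group law $(a,\mathbf z)\cdot(a',\mathbf z')=(a+a',\mathbf z'')$, $z_j''=z_j+\sum_{i=0}^{j-1}\frac{a^i}{i!}z'_{j-i}$. The left-invariant vector fields corresponding to $X$ and $Y_1$ are $$\widetilde{X_1}=\frac{\partial}{\partial a},\qquad\widetilde{X_2}=\frac{\partial}{\partial z_1}+a\frac{\partial}{\partial z_2}+\frac{a^2}{2!}\frac{\partial}{\partial z_3}+\dots+\frac{a^{n-1}}{(n-1)!}\frac{\partial}{\partial z_n}.$$ The hypoelliptic Laplacian is $\Delta_Hf=(\widetilde{X_1}^2+\widetilde{X_2}^2)f$ for $f\in C_c^\infty(G_{n+1})$, and $\Delta_H$ also denotes its Friedrichs self-adjoint extension to $L^2(G_{n+1},dg)$, $dg$ a Haar measure. The hypoelliptic heat kernel $p_t$ is the function with $(e^{t\Delta_H}f)(h)=\int_{G_{n+1}}f(hg)\,p_t(g)\,dg$ for all $f\in C_c^\infty(G_{n+1})$. Here $\mathbf\Lambda_{n-1}=(\lambda_1,\dots,\lambda_{n-1})\in\mathbb R^{n-1}$;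 the integral should be taken over those with $\lambda_{n-1}\ne0$, but the integrand is $0$ when $\lambda_{n-1}=0$. The kernel $k_t^{\mathbf\Lambda_{n-1}}(x,y)$ is the fundamental solution for the operator $\partial_t-\mathcal L_{\mathbf\Lambda_{n-1}}$ on $\mathbb R$, where $$\mathcal L_{\mathbf\Lambda_{n-1}}f=f''-V_{\mathbf\Lambda_{n-1}}f,\qquad V_{\mathbf\Lambda_{n-1}}(x)=4\pi^2\Big(\frac{\lambda_{n-1}}{(n-1)!}x^{n-1}+\sum_{j=1}^{n-2}\frac{\lambda_j}{(j-1)!}x^{j-1}\Big)^2.$$
   Formalization: The printed phase does not involve z_n, so the printed formula is false; here λ_{n-1}B_{n-1} is replaced by λ_{n-1}B_n in the exponent, p_t is continuous, dg is da dz, and k_t gives bounded solutions on bounded times for compactly supported data. *)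

(* Defs.v *)
From HB Require Import structures.
From mathcomp Require Import all_boot all_order all_algebra.
From mathcomp Require Import all_classical all_reals all_analysis.
From mathcomp Require Export complex.

Set Implicit Arguments.
Unset Strict Implicit.
Unset Printing Implicit Defensive.

Import Order.TTheory GRing.Theory Num.Theory.
Import numFieldNormedType.Exports.

Local Open Scope classical_set_scope.
Local Open Scope ring_scope.

Definition rV_display : measure_display. Proof. exact: default_measure_display. Qed.

Section rV_measurable.
Context {R : realType} {m : nat}.

Let coor : 'I_m -> 'rV[R]_m -> measurableTypeR R := fun i v => v ord0 i.

Let rV_set0 : g_sigma_preimage coor set0.
Proof. exact: sigma_algebra0. Qed.

Let rV_setC A : g_sigma_preimage coor A -> g_sigma_preimage coor (~` A).
Proof. exact: sigma_algebraC. Qed.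

Let rV_bigcup (F : (set 'rV[R]_m)^nat) : (forall i, g_sigma_preimage coor (F i)) ->
  g_sigma_preimage coor (\bigcup_i (F i)).
Proof. exact: sigma_algebra_bigcup. Qed.

HB.instance Definition _ := @isMeasurable.Build rV_display 'rV[R]_m
  (g_sigma_preimage coor) rV_set0 rV_setC rV_bigcup.

Lemma measurable_coor (i : 'I_m) :
  measurable_fun setT ((fun v => v ord0 i) : 'rV[R]_m -> measurableTypeR R).
Proof.
move=> _ Y mY; rewrite setTI; apply: sub_sigma_algebra => /=.
rewrite -bigcup_seq/=; exists i => /=; first by rewrite mem_index_enum.
by exists Y => //; rewrite setTI.
Qed.

Lemma measurable_fun_coor d (T : measurableType d) (f : T -> 'rV[R]_m) :
  (forall i, measurable_fun setT ((fun x => f x ord0 i) : T -> measurableTypeR R)) ->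
  measurable_fun setT f.
Proof.
move=> mf _ A mA; rewrite setTI.
pose G : set (set 'rV[R]_m) := [set B | measurable (f @^-1` B)].
suff : g_sigma_preimage coor `<=` G by apply.
apply: smallest_sub.
  split => [|B mB|F mF]; rewrite /G /=.
  - by rewrite preimage_set0.
  - by rewrite setTD preimage_setC; exact: measurableC.
  - by rewrite preimage_bigcup; exact: bigcupT_measurable.
rewrite -bigcup_seq; apply: bigcup_sub => i _ B [Y mY <-].
by rewrite /G /= setTI; have := mf i measurableT _ mY; rewrite setTI.
Qed.

End rV_measurable.

Section leb.
Context {R : realType}.

Definition rV_cons (m : nat) (p : measurableTypeR R * 'rV[R]_m) : 'rV[R]_m.+1 :=
  row_mx (p.1 : R)%:M p.2.

Definition rV_uncons (m : nat) (v : 'rV[R]_m.+1) : measurableTypeR R * 'rV[R]_m :=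
  (v ord0 ord0, \row_j v ord0 (lift ord0 j)).

Lemma rV_consK m : cancel (@rV_cons m) (@rV_uncons m).
Proof.
case=> x v; rewrite /rV_cons /rV_uncons /=; congr pair.
  rewrite mxE; case: splitP => j //= _.
  by rewrite [j]ord1 mxE eqxx mulr1n.
apply/rowP => j; rewrite mxE.
have -> : lift ord0 j = rshift 1 j :> 'I_(1 + m) by exact: val_inj.
exact: row_mxEr.
Qed.

Lemma measurable_rV_cons m : measurable_fun setT (@rV_cons m).
Proof.
apply: measurable_fun_coor => i.
have [j ij|j ij] := @split_ordP 1 m i.
  rewrite (_ : (fun _ => _) = fst)//.
  apply/funext => x; rewrite ij.
  apply: etrans (row_mxEl _ _ _ _) _.
  by rewrite [j]ord1 mxE eqxx mulr1n.
rewrite (_ : (fun _ => _) =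
  ((fun v : 'rV[R]_m => v ord0 j) : _ -> measurableTypeR R) \o snd); last first.
  by apply/funext => x /=; rewrite ij; exact: row_mxEr.
exact: measurableT_comp (measurable_coor j) measurable_snd.
Qed.

Lemma measurable_rV_uncons m : measurable_fun setT (@rV_uncons m).
Proof.
apply/measurable_fun_pairP; split.
  exact: (measurable_coor (ord0 : 'I_m.+1)).
apply: measurable_fun_coor => i.
rewrite (_ : (fun _ => _) = fun v : 'rV[R]_m.+1 => v ord0 (lift ord0 i)).
  exact: measurable_coor.
by apply/funext => v /=; rewrite mxE.
Qed.

Section step.
Variables (m : nat) (mu : {sigma_finite_measure set 'rV[R]_m -> \bar R}).

Definition leb_step : set 'rV[R]_m.+1 -> \bar R :=
  pushforward (lebesgue_measure \x mu)%E (@rV_cons m).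

Let pushM : {measure set 'rV[R]_m.+1 -> \bar R} :=
  measure_function_pushforward__canonical__measure_function_Measure
    (lebesgue_measure \x mu)%E (@measurable_rV_cons m).

HB.instance Definition _ := isMeasure.Build _ _ _ leb_step
  (measure0 pushM) (@measure_ge0 _ _ _ pushM) (@measure_semi_sigma_additive _ _ _ pushM).

Let leb_step_sigma_finite : sigma_finite setT leb_step.
Proof.
have /sigma_finiteP[F [TF ndF Foo]] := sigma_finiteT (@lebesgue_measure R).
have /sigma_finiteP[G [TG ndG Goo]] := sigma_finiteT mu.
exists (fun i => @rV_uncons m @^-1` (F i `*` G i)).
  rewrite -preimage_bigcup (_ : \bigcup_i _ = setT) ?preimage_setT//.
  rewrite predeqE => -[x y]; split=> // _.
  have [i _ Fx] : (\bigcup_i F i) x by rewrite -TF.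
  have [j _ Gy] : (\bigcup_i G i) y by rewrite -TG.
  exists (maxn i j) => //; split.
    by move: x Fx; exact/subsetPset/ndF/leq_maxl.
  by move: y Gy; exact/subsetPset/ndG/leq_maxr.
move=> i; have [mF Fi] := Foo i; have [mG Gi] := Goo i; split.
  by rewrite -[X in measurable X]setTI; apply: measurable_rV_uncons => //;
    exact: measurableX.
rewrite /leb_step /pushforward -comp_preimage.
rewrite (_ : _ \o _ = id); last by apply/funext => x /=; exact: rV_consK.
by rewrite preimage_id product_measure1E// lte_mul_pinfty// ge0_fin_numE.
Qed.

HB.instance Definition _ := Measure_isSigmaFinite.Build _ _ _ leb_step
  leb_step_sigma_finite.
End step.

(* Lebesgue measure on R^m *)
Fixpoint leb (m : nat) : {sigma_finite_measure set 'rV[R]_m -> \bar R} :=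
  match m with
  | 0 => [the {sigma_finite_measure set _ -> \bar R} of dirac (0 : 'rV[R]_0)]
  | m'.+1 => [the {sigma_finite_measure set _ -> \bar R} of leb_step (leb m')]
  end.

End leb.

(* One-based coordinates v_1, ..., v_m; only used for 1 <= j <= m. *)
Definition crd {R : realType} {m : nat} (v : 'rV[R]_m) (j : nat) : R :=
  if insub j.-1 is Some i then v ord0 i else 0.

Section group.
Context {R : realType} {n : nat}.
Implicit Types (g h : R * 'rV[R]_n) (f : R * 'rV[R]_n -> R).

(* (a, z) stands for exp(a X + sum_i b_i Y_i) with
   z_j = sum_(k < j) a^k b_(j-k) / (k+1)!, where [X, Y_i] = Y_(i+1) are the only
   nonzero brackets; X1 and X2 are the left-invariant fields of X and Y_1. *)
Definition Gmul g h : R * 'rV[R]_n :=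
  (g.1 + h.1,
   \row_(j < n) (crd g.2 j.+1 +
     \sum_(0 <= i < j.+1) g.1 ^+ i / i`!%:R * crd h.2 (j.+1 - i))).

Definition X1 f : R * 'rV[R]_n -> R := 'D_(1, 0) f.

Definition X2 f : R * 'rV[R]_n -> R := fun g =>
  \sum_(i < n) g.1 ^+ i / i`!%:R * 'D_(0, delta_mx ord0 i) f g.

Definition sublaplacian f : R * 'rV[R]_n -> R := X1 (X1 f) \+ X2 (X2 f).

(* Lebesgue measure da dz, which is bi-invariant for Gmul; this is the
   normalisation of Haar measure for which the kernel formula has constant 1. *)
Definition haar : {measure set (measurableTypeR R * 'rV[R]_n) -> \bar R} :=
  [the {measure set _ -> \bar R} of (@lebesgue_measure R \x @leb R n)%E].

End group.

Section smooth.
Context {R : realType} {V : normedModType R}.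

Definition smooth (f : V -> R) := forall s : seq V,
  let g := foldr (fun v h => 'D_v h) f s in
  continuous g /\ forall x v, derivable g x v.

Definition compactly_supported (f : V -> R) := compact (closure [set x | f x != 0]).

Definition test_function : set (V -> R) :=
  [set f | smooth f /\ compactly_supported f].

End smooth.

Section L2.
Context {d} {T : measurableType d} {R : realType} (mu : {measure set T -> \bar R}).
Implicit Types (u v phi psi : T -> R).

Definition inL2 u := u \in Lfun mu 2%:E.

Definition L2dist u v : \bar R := Lnorm mu 2%:E (EFin \o (u \- v)).

(* Friedrichs extension of a symmetric operator A <= 0 with domain D, as a
   graph: the restriction of the adjoint of A to the form domain, i.e. to the
   completion of D for the norm <phi, phi> - <A phi, phi>. *)
Section friedrichs.
Variables (D : set (T -> R)) (A : (T -> R) -> (T -> R)).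

Definition energy phi : R := \int[mu]_x (- A phi x * phi x).

Definition form_domain u := inL2 u /\
  exists phi : nat -> T -> R, [/\ (forall k, D (phi k)),
    L2dist (phi k) u @[k --> \oo] --> 0%E &
    forall e : R, 0 < e -> exists N : nat, forall k l : nat,
      (N <= k)%N -> (N <= l)%N -> energy (phi k \- phi l) < e].

Definition friedrichs u v := [/\ form_domain u, inL2 v &
  forall psi, D psi -> \int[mu]_x (u x * A psi x) = \int[mu]_x (v x * psi x)].

End friedrichs.

Record C0_semigroup (S : R -> (T -> R) -> (T -> R)) : Prop := {
  semigroup_L2 : forall t u, 0 <= t -> inL2 u -> inL2 (S t u);
  semigroup_linear : forall t (c : R) u v, 0 <= t -> inL2 u -> inL2 v ->
    L2dist (S t (fun x => c * u x + v x)) (fun x => c * S t u x + S t v x) = 0%E;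
  semigroup_bounded : forall t, 0 <= t -> exists M : R, forall u, inL2 u ->
    (Lnorm mu 2%:E (EFin \o S t u) <= M%:E * Lnorm mu 2%:E (EFin \o u))%E;
  semigroup_0 : forall u, inL2 u -> L2dist (S 0 u) u = 0%E;
  semigroup_add : forall s t u, 0 <= s -> 0 <= t -> inL2 u ->
    L2dist (S (s + t) u) (S s (S t u)) = 0%E;
  semigroup_cont : forall u, inL2 u -> L2dist (S h u) u @[h --> 0^'+] --> 0%E
}.

(* S_t = e^{tB}, where B is given by its graph *)
Definition generated_by (B : (T -> R) -> (T -> R) -> Prop)
    (S : R -> (T -> R) -> (T -> R)) :=
  C0_semigroup S /\ forall u v, inL2 u -> inL2 v ->
    (B u v <-> L2dist (fun x => h^-1 * (S h u x - u x)) v @[h --> 0^'+] --> 0%E).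

End L2.

(* The heat kernel is smooth by hypoellipticity; continuity of p_t selects the
   representative for which a pointwise formula makes sense. *)
Definition hypoelliptic_heat_kernel {R : realType} {n : nat}
    (p : R -> R * 'rV[R]_n -> R) :=
  exists2 S : R -> (R * 'rV[R]_n -> R) -> (R * 'rV[R]_n -> R),
    generated_by haar (friedrichs haar test_function sublaplacian) S &
    forall t, 0 < t -> continuous (p t) /\
      forall f, test_function f ->
        {ae haar, forall h : R * 'rV[R]_n,
          S t f h = \int[haar]_g (f (Gmul h g) * p t g)}.

(* Fundamental solution of d/dt - (d^2/dx^2 - V), with k t x y for k_t(x, y): a
   classical solution in (t, x) which tends to the Dirac mass at y as t -> 0+.
   For potentials growing faster than quadratically neither these two conditions
   nor positivity determine k; the last clause is the usual uniqueness class: the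
   solution of the Cauchy problem produced by k from a datum in C_c(R) is bounded
   on bounded time intervals. *)
Record fundamental_solution {R : realType} (V : R -> R) (k : R -> R -> R -> R)
    : Prop := {
  fs_cont : forall t x y, 0 < t ->
    {for (t, x, y), continuous (fun q : R * R * R => k q.1.1 q.1.2 q.2)};
  fs_derivable : forall t x y, 0 < t -> [/\ derivable (fun s => k s x y) t 1,
    derivable (fun w => k t w y) x 1 &
    derivable (derive1 (fun w => k t w y)) x 1];
  fs_C12 : forall t x y, 0 < t ->
    [/\ {for (t, x), continuous (fun q : R * R => derive1 (fun s => k s q.2 y) q.1)},
        {for (t, x), continuous (fun q : R * R => derive1 (fun w => k q.1 w y) q.2)} &
        {for (t, x), continuous (fun q : R * R => derive1n 2 (fun w => k q.1 w y) q.2)}];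
  fs_equation : forall t x y, 0 < t ->
    derive1 (fun s => k s x y) t = derive1n 2 (fun w => k t w y) x - V x * k t x y;
  fs_initial : forall f : R -> R, continuous f -> compactly_supported f ->
    forall x, \int[lebesgue_measure]_y (k t x y * f y) @[t --> 0^'+] --> f x;
  fs_bounded : forall f : R -> R, continuous f -> compactly_supported f ->
    forall t0, exists M : R, forall t x, 0 < t <= t0 ->
      `|\int[lebesgue_measure]_y (k t x y * f y)| <= M
}.

Section formula.
Context {R : realType}.

Definition potential (n : nat) (L : 'rV[R]_n.-1) (x : R) : R :=
  4 * pi ^+ 2 *
  (crd L n.-1 / (n.-1)`!%:R * x ^+ n.-1 +
   \sum_(1 <= j < n.-1) crd L j / (j.-1)`!%:R * x ^+ j.-1) ^+ 2.

Definition Bpoly (n k : nat) (x : R) (z : 'rV[R]_n) : R :=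
  \sum_(1 <= i < k.+1) crd z i / (k - i)`!%:R * x ^+ (k - i).

(* lambda_{n-1} multiplies x^{n-1}/(n-1)! in the potential, so it is paired with
   B_n (which involves all of z_1, ..., z_n), while lambda_k, k <= n-2,
   multiplies x^{k-1}/(k-1)! and is paired with B_k.  Pairing lambda_{n-1} with
   B_{n-1} would give a kernel independent of the central coordinate z_n. *)
Definition phase (n : nat) (L : 'rV[R]_n.-1) (x : R) (z : 'rV[R]_n) : R :=
  crd L n.-1 * Bpoly n x z + \sum_(1 <= k < n.-1) crd L k * Bpoly k x z.

Definition expi (r : R) : R[i] := (cos r +i* sin r)%C.

Section cintegral.
Context {d} {T : measurableType d} (mu : {measure set T -> \bar R}).

Definition cintegrable (f : T -> R[i]) :=
  mu.-integrable setT (EFin \o (fun x => complex.Re (f x))) /\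
  mu.-integrable setT (EFin \o (fun x => complex.Im (f x))).

Definition cintegral (f : T -> R[i]) : R[i] :=
  ((\int[mu]_x complex.Re (f x)) +i* (\int[mu]_x complex.Im (f x)))%C.

End cintegral.
End formula.

(* Main.v *)
Require Import Defs.
From HB Require Import structures.
From mathcomp Require Import all_boot all_order all_algebra.
From mathcomp Require Import all_classical all_reals all_analysis.
From mathcomp Require Import measurable_realfun ring lra.
Import Order.TTheory GRing.Theory Num.Theory.
Import numFieldNormedType.Exports.
Local Open Scope classical_set_scope.
Local Open Scope ring_scope.

(* For a frequency eta in R^n, integrating p_t(a, z) against exp(2 pi i eta.z)
   makes the heat semigroup of the group act on functions of one real variable,
   with generator f'' - V f, where V is the square of a polynomial of degree
   n - 1 with coefficients proportional to eta.  The Friedrichs extension yields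
   p_t >= 0, a total mass at most 1 and a weak heat equation; in one variable weak
   solutions are classical, and the maximum principle gives positivity, a bound
   which is uniform in eta and, when eta_n <> 0, exponential decay.  Pairing this
   semigroup at time t - s with the solutions at time s produced by k gives a
   quantity which does not depend on s, so both have the same kernel.  Hence the
   Fourier transform in z of p_t(a, .) at the frequency eta obtained from
   (Lambda, x) by the coadjoint action is k_t^Lambda(x + a, x).  This map
   (Lambda, x) -> eta has Jacobian |lambda_{n-1}|, and the formula is Fourier
   inversion in z. *)

Set Implicit Arguments.
Unset Strict Implicit.
Unset Printing Implicit Defensive.

(** * Integration and measurability *)

(** The kernel [p] is tied only almost everywhere to an abstract L^2 semigroup, and [k] is known
    only through the clauses of [fundamental_solution]. Hence every estimate has to come from the
    Friedrichs form or from comparison functions, and sine and cosine are handled together through a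
    phase [c]. The order of limits shapes the end of the proof. No decay of p_t in z is available,
    so inversion is regularised by a Gaussian in eta, and the point a is approached by bumps. The
    bump shrinks while the Gaussian is fixed, dominated because the bound on the transformed kernel
    is uniform in eta. When the Gaussian is removed afterwards there is no majorant at hand:
    positivity of the transformed kernel and Fatou's lemma at z = 0 first give absolute convergence
    of the double integral, and this integrand then dominates for every z. The identification with
    [k] concerns one pair (Lambda, x) at a time with lambda_{n-1} <> 0; the other pairs carry the
    weight 0. *)

Section integration.
Context d (T : measurableType d) (R : realType).
Variable mu : {measure set T -> \bar R}.
Implicit Types f g : T -> R.

Definition integ f := mu.-integrable setT (EFin \o f).

Lemma integ_measurable f : integ f -> measurable_fun setT f.
Proof. by move=> /integrableP[/measurable_EFinP]. Qed.

Lemma le_integ f g : measurable_fun setT f -> (forall x, `|f x| <= g x) ->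
  integ g -> integ f.
Proof.
move=> mf fg; apply: le_integrable => //=; first exact/measurable_EFinP.
by move=> x _ /=; rewrite lee_fin (le_trans (fg x))// ler_norm.
Qed.

Lemma integD f g : integ f -> integ g -> integ (fun x => f x + g x).
Proof. by move=> hf hg; exact: (@integrableD _ _ _ mu setT measurableT _ _ hf hg). Qed.

Lemma integZ c f : integ f -> integ (fun x => c * f x).
Proof. by move=> hf; exact: (@integrableZl _ _ _ mu setT measurableT c _ hf). Qed.

Lemma integN f : integ f -> integ (fun x => - f x).
Proof.
move=> /(integZ (-1)); rewrite (_ : (fun x => -1 * f x) = (fun x => - f x))//.
by apply/funext => x; rewrite mulN1r.
Qed.

Lemma integB f g : integ f -> integ g -> integ (fun x => f x - g x).
Proof. by move=> hf /integN; exact: integD. Qed.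

Lemma integ_norm f : integ f -> integ (fun x => `|f x|).
Proof. exact: integrable_norm. Qed.

Lemma integ0 : integ (fun=> 0).
Proof. exact: integrable0. Qed.

(** Dominated convergence with convergence and domination at every point, the form in which all
    limits below are taken; integrability of the limit is part of the conclusion. *)
Lemma Rint_cvg (f_ : nat -> T -> R) f g :
  (forall n, measurable_fun setT (f_ n)) ->
  (forall x, f_ n x @[n --> \oo] --> f x) ->
  integ g -> (forall n x, `|f_ n x| <= g x) ->
  integ f /\ \int[mu]_x f_ n x @[n --> \oo] --> \int[mu]_x f x.
Proof.
move=> mf cf ig fg.
have mf' : measurable_fun setT f by apply: (measurable_fun_cvg mf) => x _; exact: cf.
have fle x : `|f x| <= g x.
  by apply: (cvgr_to_le (cvg_norm (cf x))); apply: nearW.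
have [|||||_ _] := @dominated_convergence _ _ _ mu setT measurableT
  (fun n x => (f_ n x)%:E) (EFin \o f) (EFin \o g).
- by move=> n; exact/measurable_EFinP.
- exact/measurable_EFinP.
- by apply: aeW => x _; apply: cvg_EFin; [exact: nearW|exact: cf].
- exact: ig.
- by apply: aeW => x n _; rewrite lee_fin.
move=> h.
have i1 : integ f by exact: le_integ fle ig.
split=> //.
apply: (@fine_cvg R nat \oo _ (fun n => \int[mu]_x (f_ n x)%:E)%E (\int[mu]_x f x)).
by rewrite /Rintegral fineK//; exact: integrable_fin_num.
Qed.

Lemma Rint_le f g : integ f -> integ g -> (forall x, f x <= g x) ->
  \int[mu]_x f x <= \int[mu]_x g x.
Proof. by move=> hf hg fg; apply: le_Rintegral. Qed.

Lemma Rint_norm f : integ f -> `|\int[mu]_x f x| <= \int[mu]_x `|f x|.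
Proof. by move=> hf; exact: (@le_normr_Rintegral _ _ _ mu setT f measurableT hf). Qed.

Lemma Rint_norm_le f g : integ f -> integ g -> (forall x, `|f x| <= g x) ->
  `|\int[mu]_x f x| <= \int[mu]_x g x.
Proof.
move=> hf hg fg; apply: (le_trans (Rint_norm hf)).
by apply: Rint_le => //; exact: integ_norm.
Qed.

Lemma RintD f g : integ f -> integ g ->
  \int[mu]_x (f x + g x) = \int[mu]_x f x + \int[mu]_x g x.
Proof. by move=> hf hg; exact: (@RintegralD _ _ _ mu setT f g measurableT hf hg). Qed.

Lemma RintB f g : integ f -> integ g ->
  \int[mu]_x (f x - g x) = \int[mu]_x f x - \int[mu]_x g x.
Proof. by move=> hf hg; exact: (@RintegralB _ _ _ mu setT f g measurableT hf hg). Qed.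

Lemma RintZ c f : integ f -> \int[mu]_x (c * f x) = c * \int[mu]_x f x.
Proof. by move=> hf; exact: (@RintegralZl _ _ _ mu setT f c measurableT hf). Qed.

Lemma RintN f : integ f -> \int[mu]_x (- f x) = - \int[mu]_x f x.
Proof.
move=> hf; rewrite -[RHS]mulN1r -RintZ//.
by apply: eq_Rintegral => x _; rewrite mulN1r.
Qed.

Lemma Rint0 : \int[mu]_x (0 : R) = 0.
Proof. by rewrite /Rintegral integral0. Qed.

Lemma eq_Rint f g : (forall x, f x = g x) -> \int[mu]_x f x = \int[mu]_x g x.
Proof. by move=> h; congr (Rintegral _ _); exact/funext. Qed.

Lemma eq_integ f g : (forall x, f x = g x) -> integ f -> integ g.
Proof. by move=> /funext->. Qed.

Lemma Rint_ge0 f : (forall x, 0 <= f x) -> 0 <= \int[mu]_x f x.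
Proof. by move=> f0; apply: Rintegral_ge0 => x _; exact: f0. Qed.

Lemma integE f : measurable_fun setT f -> (forall x, 0 <= f x) ->
  (\int[mu]_x (f x)%:E < +oo)%E -> integ f.
Proof.
move=> mf f0 h; apply/integrableP; split; first exact/measurable_EFinP.
rewrite (le_lt_trans _ h)// le_eqVlt; apply/orP; left; apply/eqP.
by apply: eq_integral => x _ /=; rewrite ger0_norm.
Qed.

Lemma EFin_Rint f : integ f -> (\int[mu]_x f x)%:E = (\int[mu]_x (f x)%:E)%E.
Proof. by move=> hf; rewrite /Rintegral fineK//; exact: integrable_fin_num. Qed.

(** Uniformly bounded integrals replace a majorant here. This is how the integrability of p_t, and
    later that of the weighted trace of [k], is obtained. *)
Lemma integ_fatou (f_ : nat -> T -> R) f C :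
  (forall n, integ (f_ n)) -> (forall n x, 0 <= f_ n x) ->
  (forall x, f_ n x @[n --> \oo] --> f x) ->
  (forall n, \int[mu]_x f_ n x <= C) ->
  integ f /\ \int[mu]_x f x <= C.
Proof.
move=> i_ f0 cf bC.
have m_ n : measurable_fun setT (f_ n) by exact: integ_measurable (i_ n).
have mf' : measurable_fun setT f by apply: (measurable_fun_cvg m_) => x _; exact: cf.
have fx0 x : 0 <= f x by apply: (cvgr_to_ge (cf x)); apply: nearW => n; exact: f0.
have h : (\int[mu]_x (f x)%:E <= C%:E)%E.
  have -> : (\int[mu]_x (f x)%:E = \int[mu]_x (limn_einf (fun n => (f_ n x)%:E)))%E.
    apply: eq_integral => x _; apply/esym.
    have hx : (f_ n x)%:E @[n --> \oo] --> (f x)%:E.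
      by apply: cvg_EFin; [exact: nearW|exact: cf].
    by rewrite (is_cvg_limn_einfE (cvgP _ hx)); exact: cvg_lim hx.
  apply: le_trans (fatou _ measurableT _ _) _ => [n|n x _|].
  - exact/measurable_EFinP.
  - by rewrite lee_fin.
  - rewrite limn_einf_lim; apply: lime_le; first exact: is_cvg_einfs.
    apply: nearW => n; apply: (@le_trans _ _ (\int[mu]_x (f_ n x)%:E)%E).
      by apply: ereal_inf_lbound; exists n => /=.
    by rewrite -(EFin_Rint (i_ n)) lee_fin.
have i1 : integ f by apply: integE => //; rewrite (le_lt_trans h)// ltry.
by split=> //; rewrite -lee_fin EFin_Rint.
Qed.

Lemma integ_mulr_bounded f g C : integ f -> measurable_fun setT g ->
  (forall x, `|g x| <= C) -> integ (fun x => g x * f x).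
Proof.
move=> hf mg gC; apply: (@le_integ _ (fun x => C * `|f x|)).
- by apply: measurable_funM => //; exact: integ_measurable.
- by move=> x; rewrite normrM ler_wpM2r.
- by apply: integZ; exact: integ_norm.
Qed.

End integration.

(** * Measurability of continuous functions of several variables *)

Section approx_measurable.
Context d (T : measurableType d) (R : realType).

(** The sigma-algebra of ['rV[R]_n] is generated by the coordinates, so continuity does not give
    measurability by definition. A pointwise limit of functions that factor through a measurable
    code with countably many values is measurable, since each preimage is a countable union of level
    sets of the code. *)
Lemma measurable_fun_discretisation (f : T -> R) (C : countType)
    (c : nat -> T -> C) (i : nat -> C -> T) :
  (forall m k, measurable (c m @^-1` [set k])) ->
  (forall x, f (i m (c m x)) @[m --> \oo] --> f x) -> measurable_fun setT f.
Proof.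
move=> mc cf; apply: (@measurable_fun_cvg _ _ _ _ (fun m x => f (i m (c m x)))).
  move=> m _ B mB; rewrite setTI.
  rewrite (_ : _ @^-1` _ = \bigcup_k (if f (i m k) \in B then c m @^-1` [set k] else set0)).
    apply: countable_bigcupT_measurable; first exact: countableP.
    by move=> k; case: ifP => _; [exact: mc|exact: measurable0].
  apply/seteqP; split=> [x /= Bx|x [k _]].
    by exists (c m x) => //; rewrite mem_set.
  by case: ifPn => // /set_mem Bk /= ->.
by move=> x _; exact: cf.
Qed.

End approx_measurable.

Section floor.
Context {R : realType}.

Lemma floor_approx_cvg (x : R) :
  (Num.floor (m.+1%:R * x))%:~R / m.+1%:R @[m --> \oo] --> x.
Proof.
apply/cvgrPdist_le => e e0; near=> m.
have m0 : 0 < m.+1%:R :> R by rewrite ltr0n.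
rewrite -[X in X - _](mulfK (lt0r_neq0 m0)) -mulrBl normrM.
have h1 := Num.Theory.floor_le (m.+1%:R * x).
have h2 := Num.Theory.floorD1_gt (m.+1%:R * x).
rewrite intrD mulr1z in h2.
have h3 : `|x * m.+1%:R - (Num.floor (m.+1%:R * x))%:~R| <= 1.
  by rewrite mulrC ler_norml; apply/andP; split; lra.
rewrite normfV (ger0_norm (ltW m0)).
have h4 : m.+1%:R^-1 <= (e : R).
  apply/ltW; near: m; exact: (near_infty_natSinv_lt (PosNum e0)).
apply: (le_trans _ h4); rewrite -[leRHS]mul1r.
by apply: ler_wpM2r h3; rewrite invr_ge0 ltW.
Unshelve. all: by end_near. Qed.

Lemma measurable_floor_eq (c : R) (k : int) :
  measurable ((fun x : R => Num.floor (c * x)) @^-1` [set k]).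
Proof.
rewrite (_ : _ @^-1` _ = ( *%R c) @^-1` `[k%:~R, (k + 1)%:~R[%classic).
  rewrite -[X in measurable X]setTI; apply: measurable_funM => //.
apply/seteqP; split=> x /=.
  by move=> <-; rewrite in_itv/= floor_le floorD1_gt.
rewrite in_itv/= => h; apply: floor_def.
by rewrite h.
Qed.

End floor.

Section rV_topology.
Context {R : realType} {n : nat}.
Local Notation V := (R * 'rV[R]_n)%type.

Lemma rV_norm_le (v : 'rV[R]_n) (c : R) : 0 <= c ->
  (forall i, `|v ord0 i| <= c) -> `|v| <= c.
Proof.
move=> c0 h; rewrite [leLHS]mx_normrE; apply: bigmax_le => // -[i j] _ /=.
by rewrite ord1; exact: h.
Qed.

Lemma rV_coord_le (v : 'rV[R]_n) i : `|v ord0 i| <= `|v|.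
Proof.
by rewrite [leRHS]mx_normrE; exact: (le_bigmax _ (fun ij => `|v ij.1 ij.2|) (ord0, i)).
Qed.

Lemma cvg_rV (F : set_system 'rV[R]_n) {FF : Filter F} (v : 'rV[R]_n) :
  (forall i, (fun w : 'rV[R]_n => w ord0 i) @ F --> v ord0 i) -> F --> v.
Proof.
move=> h; apply/cvgrPdist_lt => e e0.
have : \forall w \near F, forall i : 'I_n, `|v ord0 i - (w : 'rV[R]_n) ord0 i| < e / 2.
  apply: filter_forall => i; have /cvgrPdist_lt := h i; apply.
  by rewrite divr_gt0.
apply: filterS => w hw.
rewrite (@le_lt_trans _ _ (e / 2))//; last by rewrite gtr_pMr// invf_lt1// ltr1n.
apply: rV_norm_le; first by rewrite divr_ge0// ltW.
by move=> i; rewrite !mxE; exact/ltW.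
Qed.

Lemma rV_coord_continuous (i : 'I_n) : continuous (fun w : 'rV[R]_n => w ord0 i).
Proof. by move=> v; exact: differentiable_continuous (differentiable_coord _ _ _). Qed.

Lemma measurable_continuous_prod_rV (f : V -> R) : continuous f ->
  measurable_fun [set: measurableTypeR R * 'rV[R]_n] f.
Proof.
move=> cf.
(* The code rounds every coordinate down to a multiple of 1/(m+1), and [i] reads the code back as a
   point. *)
pose c (m : nat) (x : V) : int * 'rV[int]_n :=
  (Num.floor (m.+1%:R * x.1), \row_j Num.floor (m.+1%:R * x.2 ord0 j)).
pose i (m : nat) (k : int * 'rV[int]_n) : V :=
  (k.1%:~R / m.+1%:R, \row_j ((k.2 ord0 j)%:~R / m.+1%:R)).
apply: (@measurable_fun_discretisation _ _ _ _ (int * 'rV[int]_n)%type c i).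
- move=> m [k1 k2].
  rewrite (_ : _ @^-1` _ = (fst @^-1` ((fun x : R => Num.floor (m.+1%:R * x)) @^-1` [set k1]))
    `&` \bigcap_(j : 'I_n) ((fun x : V => x.2 ord0 j) @^-1`
        ((fun x : R => Num.floor (m.+1%:R * x)) @^-1` [set k2 ord0 j]))); last first.
    apply/seteqP; split=> [x [<- <-]|x [/= xk1 xk2]]/=.
      by split=> // j _; rewrite mxE.
    rewrite /c xk1; congr pair; apply/rowP => j; rewrite mxE.
    exact: (xk2 j).
  apply: measurableI.
    rewrite -[X in measurable X]setTI; apply: measurable_fst => //.
    exact: measurable_floor_eq.
  apply: fin_bigcap_measurable => // j _.
  rewrite -[X in measurable X]setTI.
  have h := measurableT_comp (@measurable_coor R n j) (@measurable_snd _ _ (measurableTypeR R) 'rV[R]_n).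
  by apply: h => //; exact: measurable_floor_eq.
- move=> x; apply: (@cvg_comp _ _ _ (fun m => i m (c m x)) f _ (nbhs x)); last exact: cf.
  apply: (@cvg_pair _ _ _ \oo (nbhs x.1) (nbhs x.2) _ _ _ (fun m => (i m (c m x)).1)
    (fun m => (i m (c m x)).2)); first exact: floor_approx_cvg.
  apply: cvg_rV => j /=.
  have E : (fun m => (Num.floor (m.+1%:R * x.2 ord0 j))%:~R / m.+1%:R) =
      (fun m => (i m (c m x)).2 ord0 j) by apply/funext => m; rewrite /= !mxE.
  by have := @floor_approx_cvg R (x.2 ord0 j); rewrite E.
Qed.

Lemma measurable_continuous_rV (f : 'rV[R]_n -> R) : continuous f ->
  measurable_fun setT f.
Proof.
move=> cf.
have h : measurable_fun [set: measurableTypeR R * 'rV[R]_n] (f \o snd).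
  by apply: measurable_continuous_prod_rV => x; apply: continuous_comp; [exact: cvg_snd|exact: cf].
exact: (measurable_fun_pair2 (0 : measurableTypeR R) h).
Qed.

End rV_topology.

Lemma measurable_continuous_prod {R : realType} (f : R * R -> R) : continuous f ->
  measurable_fun [set: measurableTypeR R * measurableTypeR R] f.
Proof.
move=> cf.
pose c (m : nat) (x : R * R) : int * int :=
  (Num.floor (m.+1%:R * x.1), Num.floor (m.+1%:R * x.2)).
pose i (m : nat) (k : int * int) : R * R := (k.1%:~R / m.+1%:R, k.2%:~R / m.+1%:R).
apply: (@measurable_fun_discretisation _ _ _ _ (int * int)%type c i).
- move=> m [k1 k2].
  rewrite (_ : _ @^-1` _ = ((fun x : R => Num.floor (m.+1%:R * x)) @^-1` [set k1])
    `*` ((fun x : R => Num.floor (m.+1%:R * x)) @^-1` [set k2])).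
    by apply: measurableX; exact: measurable_floor_eq.
  by apply/seteqP; split=> [[x y] [<- <-]|[x y] [/= <- <-]].
- move=> x; apply: (@cvg_comp _ _ _ (fun m => i m (c m x)) f _ (nbhs x)); last exact: cf.
  by apply: (@cvg_pair _ _ _ \oo (nbhs x.1) (nbhs x.2) _ _ _ (fun m => (i m (c m x)).1)
    (fun m => (i m (c m x)).2)); exact: floor_approx_cvg.
Qed.

(** * Translations and dilations of Lebesgue measure *)

Section lebesgue_invariance.
Context {R : realType}.
Local Notation mu := (@lebesgue_measure R).
Implicit Types f : R -> \bar R.

(** The image measure agrees with Lebesgue measure on half-open intervals, and those determine it.
    The dilation below follows the same route after rescaling the image measure. *)
Lemma lebesgue_shift f c : measurable_fun setT f -> (forall x, (0 <= f x)%E) ->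
  (\int[mu]_x f (x + c)%R = \int[mu]_x f x)%E.
Proof.
move=> mf f0.
pose g : R -> measurableTypeR R := fun x => x + c.
have ms : measurable_fun setT g by apply: measurable_funD.
have -> : (\int[mu]_x f x = \int[pushforward mu g]_x f x)%E.
  apply: eq_measure_integral => A mA _.
  pose nu := measure_function_pushforward__canonical__measure_function_Measure mu ms.
  apply: (@lebesgue_measure_unique R nu) => // X [[a b] _ <-] /=.
  rewrite /pushforward.
  rewrite (_ : _ @^-1` _ = `]a - c, b - c]%classic); last first.
    by apply/seteqP; split=> x /=; rewrite !in_itv/= ltrBlDr lerBrDr.
  rewrite !lebesgue_measure_itv/= !lte_fin ltrD2r.
  by case: ifP => // _; rewrite -!EFinB; congr EFin; lra.
by rewrite ge0_integral_pushforward.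
Qed.

Lemma lebesgue_scale_pos f (c : R) : 0 < c -> measurable_fun setT f -> (forall x, (0 <= f x)%E) ->
  ((c%:E * \int[mu]_x f (c * x)%R) = \int[mu]_x f x)%E.
Proof.
move=> c0 mf f0.
pose g : R -> measurableTypeR R := fun x => c * x.
have ms : measurable_fun setT g by apply: measurable_funM.
pose nu := measure_function_pushforward__canonical__measure_function_Measure mu ms.
pose cc := NngNum (ltW c0).
have -> : (\int[mu]_x f x = \int[mscale cc nu]_x f x)%E.
  apply: eq_measure_integral => A mA _.
  apply: (@lebesgue_measure_unique R (mscale cc nu)) => // X [[a b] _ <-] /=.
  rewrite /mscale /= /pushforward.
  rewrite (_ : _ @^-1` _ = `]a / c, b / c]%classic); last first.
    by apply/seteqP; split=> x /=; rewrite !in_itv/= ltr_pdivrMr// ler_pdivlMr// mulrC.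
  rewrite !lebesgue_measure_itv/= !lte_fin ltr_pM2r ?invr_gt0//.
  case: ifP => // _; last by rewrite mule0.
  by rewrite -!EFinB -EFinM; congr EFin; field; rewrite gt_eqF.
rewrite ge0_integral_mscale//; congr (_ * _)%E.
by rewrite ge0_integral_pushforward.
Qed.

Lemma lebesgue_opp f : measurable_fun setT f -> (forall x, (0 <= f x)%E) ->
  (\int[mu]_x f (- x)%R = \int[mu]_x f x)%E.
Proof.
move=> mf f0.
have ms : measurable_fun setT (-%R : R -> measurableTypeR R) by exact: oppr_measurable.
have -> : (\int[mu]_x f x = \int[pushforward mu (-%R : R -> measurableTypeR R)]_x f x)%E.
  by apply: eq_measure_integral => A mA _; exact/esym/lebesgue_measureN.
by rewrite ge0_integral_pushforward.
Qed.

Lemma lebesgue_scale f (c : R) : c != 0 -> measurable_fun setT f -> (forall x, (0 <= f x)%E) ->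
  ((`|c|%:E * \int[mu]_x f (c * x)%R) = \int[mu]_x f x)%E.
Proof.
move=> c0 mf f0; have [cn|cp] := ltP c 0.
  have mo : measurable_fun setT (fun x : R => f (- x)).
    by apply: measurableT_comp => //; exact: oppr_measurable.
  rewrite -[RHS]lebesgue_opp// -[RHS](@lebesgue_scale_pos (fun x => f (- x)%R) (- c)) ?oppr_gt0//.
  by rewrite ltr0_norm//; congr (_ * _)%E; apply: eq_integral => x _; rewrite mulNr opprK.
by rewrite ger0_norm// lebesgue_scale_pos// lt_neqAle eq_sym c0.
Qed.

End lebesgue_invariance.

Section leb_integral.
Context {R : realType}.
Local Notation mu := (@lebesgue_measure R).

Lemma ge0_integral_lebS m (f : 'rV[R]_m.+1 -> \bar R) :
  measurable_fun setT f -> (forall x, (0 <= f x)%E) ->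
  (\int[leb m.+1]_v f v = \int[mu]_x \int[leb m]_w f (rV_cons (x, w)))%E.
Proof.
move=> mf f0 /=; rewrite ge0_integral_pushforward//; last exact: measurable_rV_cons.
rewrite preimage_setT fubini_tonelli1//; last by move=> ?; exact: f0.
by apply: measurableT_comp => //; exact: measurable_rV_cons.
Qed.

Lemma ge0_integral_lebS_swap m (f : 'rV[R]_m.+1 -> \bar R) :
  measurable_fun setT f -> (forall x, (0 <= f x)%E) ->
  (\int[leb m.+1]_v f v = \int[leb m]_w \int[mu]_x f (rV_cons (x, w)))%E.
Proof.
move=> mf f0 /=; rewrite ge0_integral_pushforward//; last exact: measurable_rV_cons.
rewrite preimage_setT fubini_tonelli2//; last by move=> ?; exact: f0.
by apply: measurableT_comp => //; exact: measurable_rV_cons.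
Qed.

Lemma ge0_integral_leb0 (f : 'rV[R]_0 -> \bar R) :
  measurable_fun setT f ->
  (\int[leb 0]_v f v = f 0%R)%E.
Proof. by move=> mf; rewrite /= integral_dirac// diracT mul1e. Qed.

Lemma rV_cons_uncons m : cancel (@rV_uncons R m) (@rV_cons R m).
Proof.
move=> v; apply/rowP => i; rewrite /rV_cons /rV_uncons /=.
have [j ij|j ij] := @split_ordP 1 m i.
  rewrite ij; apply: etrans (row_mxEl _ _ _ _) _.
  rewrite [j]ord1 mxE eqxx mulr1n; congr (v _ _); exact: val_inj.
rewrite ij; apply: etrans (row_mxEr _ _ _ _) _.
by rewrite mxE; congr (v _ _); exact: val_inj.
Qed.

Lemma rV_cons0 m x (w : 'rV[R]_m) : rV_cons (x, w) ord0 ord0 = x.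
Proof. by have := rV_consK (x, w) => /(congr1 fst). Qed.

Lemma rV_consS m x (w : 'rV[R]_m) i : rV_cons (x, w) ord0 (lift ord0 i) = w ord0 i.
Proof. by have := rV_consK (x, w) => /(congr1 snd)/rowP/(_ i); rewrite mxE. Qed.

Lemma rV_consD m x y (v w : 'rV[R]_m) :
  rV_cons (x, v) + rV_cons (y, w) = rV_cons (x + y, v + w).
Proof.
apply/rowP => i; rewrite mxE.
have := unliftP ord0 i; case=> [j ->|->].
  by rewrite !rV_consS mxE.
by rewrite !rV_cons0.
Qed.

Lemma measurable_fun_addrV d (T : measurableType d) m (f g : T -> 'rV[R]_m) :
  measurable_fun setT f -> measurable_fun setT g -> measurable_fun setT (fun x => f x + g x).
Proof.
move=> mf mg; apply: measurable_fun_coor => i.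
rewrite (_ : (fun _ => _) = (fun x => f x ord0 i + g x ord0 i)); last first.
  by apply/funext => x; rewrite mxE.
apply: measurable_funD.
  exact: (measurableT_comp (@measurable_coor R m i) mf).
exact: (measurableT_comp (@measurable_coor R m i) mg).
Qed.

Lemma leb_shift m (f : 'rV[R]_m -> \bar R) (c : 'rV[R]_m) :
  measurable_fun setT f -> (forall x, (0 <= f x)%E) ->
  (\int[leb m]_v f (v + c)%R = \int[leb m]_v f v)%E.
Proof.
elim: m f c => [|m ih] f c mf f0.
  rewrite !ge0_integral_leb0//.
    by congr f; apply/rowP => -[].
  by apply: measurableT_comp => //; apply: measurable_fun_addrV => //; exact: measurable_cst.
have mfc : measurable_fun setT (fun v : 'rV[R]_m.+1 => f (v + c)).
  by apply: measurableT_comp => //; apply: measurable_fun_addrV => //; exact: measurable_cst.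
have mfcons : measurable_fun setT (fun x => f (@rV_cons R m x)).
  by apply: measurableT_comp => //; exact: measurable_rV_cons.
rewrite (ge0_integral_lebS mfc (fun v => f0 _)) (ge0_integral_lebS mf f0).
rewrite -[c]rV_cons_uncons; case: (rV_uncons c) => c1 c2.
under eq_integral => x _ do under eq_integral => w _ do rewrite rV_consD.
transitivity (\int[mu]_x \int[leb m]_w f (rV_cons (x + c1, w)%R))%E.
  apply: eq_integral => x _; rewrite (ih (fun w => f (rV_cons (x + c1, w)%R)))//.
  exact: (measurable_fun_pair2 (x + c1 : measurableTypeR R) mfcons).
rewrite (@lebesgue_shift R (fun x => \int[leb m]_w f (rV_cons (x, w)))%E c1)//.
  exact: (measurable_fun_fubini_tonelli_F (fun x => f (rV_cons x)) mfcons).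
by move=> x; exact: integral_ge0.
Qed.

Lemma measurable_norm_le m (C : R) : measurable [set v : 'rV[R]_m | `|v| <= C].
Proof.
have h : measurable_fun setT (fun v : 'rV[R]_m => `|v|).
  by apply: measurable_continuous_rV; exact: norm_continuous.
rewrite -[X in measurable X]setTI.
rewrite (_ : [set v | _] = (fun v : 'rV[R]_m => `|v|) @^-1` `]-oo, C]%classic).
  exact: h.
by apply/seteqP; split=> v /=; rewrite in_itv.
Qed.

Lemma leb_ball_fin m (C : R) : (leb m [set v : 'rV[R]_m | (`|v| <= C)%R] < +oo)%E.
Proof.
elim: m => [|m ih].
  by rewrite /= diracE ltry.
apply: (@le_lt_trans _ _ ((lebesgue_measure \x leb m)%E
    (`[- C, C]%classic `*` [set v : 'rV[R]_m | `|v| <= C]))).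
  rewrite /= /leb_step /pushforward; apply: le_measure; rewrite ?inE.
  - rewrite -[X in measurable X]setTI; apply: measurable_rV_cons => //.
    exact: measurable_norm_le.
  - by apply: measurableX => //; exact: measurable_norm_le.
  - move=> [x w] /= h; split=> /=.
      have := le_trans (rV_coord_le (rV_cons (x, w)) ord0) h.
      by rewrite rV_cons0 in_itv/= ler_norml.
    have [C0|C0] := leP 0 C; last by have := le_lt_trans (le_trans (normr_ge0 _) h) C0; rewrite ltxx.
    apply: rV_norm_le => // i.
    by have := le_trans (rV_coord_le (rV_cons (x, w)) (lift ord0 i)) h; rewrite rV_consS.
rewrite product_measure1E//; last exact: measurable_norm_le.
have hC : (lebesgue_measure (`[(- C)%R, C]%classic : set R) < +oo)%E.
  exact: compact_finite_measure (@segment_compact _ _ _).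
apply: lte_mul_pinfty => //; first by rewrite ge0_fin_numE.
Qed.

End leb_integral.

Section bounded_support.
Context d (T : measurableType d) (R : realType).
Variable mu : {measure set T -> \bar R}.

Lemma integ_bounded_support (A : set T) (f : T -> R) M :
  measurable A -> (mu A < +oo)%E -> measurable_fun setT f ->
  (forall x, `|f x| <= M) -> (forall x, ~ A x -> f x = 0) -> integ mu f.
Proof.
move=> mA fA mf fM f0.
apply: (@le_integ _ _ _ mu f (fun x => M * \1_A x)) => //.
  move=> x; rewrite indicE; have [/set_mem Ax|] := boolP (x \in A).
    by rewrite mulr1.
  by move=> /negP xA; rewrite f0 ?normr0 ?mulr0// => Ax; apply: xA; rewrite inE.
apply: integZ; apply: integE.
- exact: measurable_indic.
- by move=> x; rewrite indicE.
- by rewrite integral_indic// setIT.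
Qed.

(** Invariance for nonnegative functions extends to signed ones through the positive and negative
    parts, and to integrability through the absolute value. *)
Lemma Rint_preserving (phi : T -> T) :
  measurable_fun setT phi ->
  (forall f : T -> \bar R, measurable_fun setT f -> (forall x, 0 <= f x)%E ->
    (\int[mu]_x f (phi x) = \int[mu]_x f x)%E) ->
  forall f : T -> R, measurable_fun setT f ->
    (integ mu (f \o phi) <-> integ mu f) /\ \int[mu]_x f (phi x) = \int[mu]_x f x.
Proof.
move=> mphi h f mf.
have mf' : measurable_fun setT (f \o phi) by exact: measurableT_comp.
split.
  have E : (\int[mu]_x (`|f (phi x)|)%:E = \int[mu]_x (`|f x|)%:E)%E.
    rewrite (h (fun x => (`|f x|)%:E))//.
    by apply/measurable_EFinP; exact: measurableT_comp.
  split=> /integrableP[_ hh]; apply/integrableP; split; try exact/measurable_EFinP.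
    by rewrite (_ : (\int[mu]_x _)%E = (\int[mu]_x (`|f x|)%:E)%E) -?E.
  by rewrite (_ : (\int[mu]_x _)%E = (\int[mu]_x (`|f (phi x)|)%:E)%E) ?E.
rewrite /Rintegral; congr fine.
rewrite [in LHS]integralE [in RHS]integralE; congr (_ - _)%E.
  have mp : measurable_fun setT ((EFin \o f)^\+)%E.
    by apply: measurable_funepos; exact/measurable_EFinP.
  rewrite -[RHS](h _ mp (fun x => funepos_ge0 _ x)).
  by apply: eq_integral => x _; rewrite !funeposE.
have mn : measurable_fun setT ((EFin \o f)^\-)%E.
  by apply: measurable_funeneg; exact/measurable_EFinP.
rewrite -[RHS](h _ mn (fun x => funeneg_ge0 _ x)).
by apply: eq_integral => x _; rewrite !funenegE.
Qed.

End bounded_support.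

Section vspace.
Context {R : realType} {n : nat}.
Local Notation V := (R * 'rV[R]_n)%type.
Local Notation haar := (@haar R n).

Lemma measurable_prod_norm_le (C : R) :
  measurable ([set v | `|v| <= C] : set (measurableTypeR R * 'rV[R]_n)).
Proof.
have h : measurable_fun [set: measurableTypeR R * 'rV[R]_n] (fun v : V => `|v|).
  by apply: measurable_continuous_prod_rV; exact: norm_continuous.
rewrite -[X in measurable X]setTI.
rewrite (_ : [set v | _] = (fun v : V => `|v|) @^-1` `]-oo, C]%classic).
  exact: h.
by apply/seteqP; split=> v /=; rewrite in_itv.
Qed.

Lemma haar_ball_fin (C : R) : (haar [set v : V | (`|v| <= C)%R] < +oo)%E.
Proof.
apply: (@le_lt_trans _ _ ((lebesgue_measure \x leb n)%E
    (`[- C, C]%classic `*` [set v : 'rV[R]_n | `|v| <= C]))).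
  apply: le_measure; rewrite ?inE.
  - exact: measurable_prod_norm_le.
  - by apply: measurableX => //; exact: measurable_norm_le.
  - move=> [x w] /=; rewrite prod_normE /= ge_max => /andP[h1 h2].
    by rewrite in_itv/= -ler_norml.
rewrite product_measure1E//; last exact: measurable_norm_le.
have hC : (lebesgue_measure (`[(- C)%R, C]%classic : set R) < +oo)%E.
  exact: compact_finite_measure (@segment_compact _ _ _).
apply: lte_mul_pinfty => //; first by rewrite ge0_fin_numE.
exact: leb_ball_fin.
Qed.

Lemma bounded_support_integ (f : V -> R) (C M : R) :
  measurable_fun [set: measurableTypeR R * 'rV[R]_n] f ->
  (forall x, `|f x| <= M) -> (forall x, C < `|x| -> f x = 0) -> integ haar f.
Proof.
move=> mf fM f0; apply: (integ_bounded_support (measurable_prod_norm_le C)).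
- exact: haar_ball_fin.
- exact: mf.
- exact: fM.
- by move=> x /negP; rewrite -ltNge; exact: f0.
Qed.

(** Heine-Borel in the maximum norm. Vanishing outside a ball is the form in which compact support
    is propagated through derivatives, products and sums. *)
Lemma compactly_supportedP (f : V -> R) :
  compactly_supported f <-> exists C, forall x, C < `|x| -> f x = 0.
Proof.
split=> [/compact_bounded [M [_ hM]]|[C hC]].
  exists (M + 1) => x xM; apply/eqP/negPn/negP => fx0.
  have := hM (M + 1); rewrite ltrDl => /(_ ltr01 x).
  move=> /(_ (@subset_closure _ [set x | f x != 0] x fx0)).
  by rewrite /= => h; have := le_lt_trans h xM; rewrite ltxx.
apply: (@subclosed_compact _ _ (`[- C, C]%classic `*` [set v : 'rV[R]_n | `|v| <= C])).
- exact: closed_closure.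
- apply: compact_setX; first exact: segment_compact.
  apply: bounded_closed_compact.
    by exists C; split=> [|M CM v]; [exact: num_real|move=> /= vC; rewrite (le_trans vC)// ltW].
  rewrite (_ : [set v | _] = (fun v : 'rV[R]_n => `|v|) @^-1` `]-oo, C]%classic).
    by apply: closed_comp => //; move=> v _; exact: norm_continuous.
  by apply/seteqP; split=> v /=; rewrite in_itv.
- have -> : `[- C, C]%classic `*` [set v : 'rV[R]_n | `|v| <= C] = [set x : V | `|x| <= C].
    apply/seteqP; split=> x /=; rewrite in_itv/= -ler_norml prod_normE ge_max.
      by case=> -> ->.
    by move=> /andP[-> ->].
  have : closed [set x : V | `|x| <= C].
    rewrite (_ : [set v | _] = (fun v : V => `|v|) @^-1` `]-oo, C]%classic).
      by apply: closed_comp => //; move=> v _; exact: norm_continuous.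
    by apply/seteqP; split=> v /=; rewrite in_itv.
  move=> /closure_id ->; apply: closure_subset => x /= fx0.
  by rewrite leNgt; apply/negP => /hC/eqP; apply/negP.
Qed.

Lemma compactly_supported_bounded (f : V -> R) : continuous f ->
  compactly_supported f -> exists M, forall x, `|f x| <= M.
Proof.
move=> cf kf.
have := continuous_compact (continuous_subspaceT cf) kf.
move=> /compact_bounded [M [_ hM]]; exists (Num.max 0 (M + 1)) => x.
have [->|fx] := eqVneq (f x) 0; first by rewrite normr0 le_max lexx.
rewrite le_max; apply/orP; right; apply: hM; first by rewrite ltrDl.
by exists x => //; exact: subset_closure.
Qed.

Lemma continuous_compact_integ (f : V -> R) : continuous f ->
  compactly_supported f -> integ haar f.
Proof.
move=> cf kf; have [M fM] := compactly_supported_bounded cf kf.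
have [C fC] := (compactly_supportedP f).1 kf.
exact: (bounded_support_integ (measurable_continuous_prod_rV cf) fM fC).
Qed.

Lemma haar_shift (f : V -> \bar R) (c : V) :
  measurable_fun [set: measurableTypeR R * 'rV[R]_n] f -> (forall x, 0 <= f x)%E ->
  (\int[haar]_x f (x + c)%R = \int[haar]_x f x)%E.
Proof.
move=> mf f0; case: c => c1 c2.
have mfc : measurable_fun [set: measurableTypeR R * 'rV[R]_n] (fun v : V => f (v + (c1, c2))).
  apply: measurableT_comp => //; apply/measurable_fun_pairP; split.
    by apply: measurable_funD => //; exact: measurable_fst.
  apply: measurable_fun_addrV; last exact: measurable_cst.
  exact: measurable_snd.
rewrite /haar /= (fubini_tonelli1 _ mfc (fun v => f0 _)) (fubini_tonelli1 _ mf f0).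
transitivity (\int[lebesgue_measure]_x \int[leb n]_w f (x + c1, w)%R)%E.
  apply: eq_integral => x _.
  rewrite /fubini_F -(leb_shift (f := fun w => f ((x + c1)%R, w)) c2)//.
  exact: (measurable_fun_pair2 (x + c1 : measurableTypeR R) mf).
rewrite (@lebesgue_shift R (fun x => \int[leb n]_w f (x, w))%E c1)//.
  exact: (measurable_fun_fubini_tonelli_F f mf).
by move=> x; exact: integral_ge0.
Qed.

Lemma Rint_haar_shift (f : V -> R) (c : V) :
  measurable_fun [set: measurableTypeR R * 'rV[R]_n] f ->
  (integ haar (fun x => f (x + c)) <-> integ haar f) /\
  \int[haar]_x f (x + c) = \int[haar]_x f x.
Proof.
move=> mf; apply: (@Rint_preserving _ (measurableTypeR R * 'rV[R]_n)%type R haar (fun x : V => x + c)) => //.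
  apply/measurable_fun_pairP; split.
    by apply: measurable_funD => //; exact: measurable_fst.
  apply: measurable_fun_addrV; last exact: measurable_cst.
  exact: measurable_snd.
by move=> g mg g0; exact: haar_shift.
Qed.

End vspace.

(** * Smooth functions and test functions *)

Section directional.
Context {R : realType} {V : normedModType R}.
Implicit Types (f g : V -> R) (x v : V).

(** Restriction to a line, which brings the chain rule and the mean value theorem of one variable to
    directional derivatives. *)
Lemma deriveE1 f x v : 'D_v f x = 'D_1 (fun h : R => f (h *: v + x)) 0.
Proof.
apply: (f_equal (fun F : R -> R => lim (F @ 0^'))).
by apply/funext => h /=; rewrite scale0r add0r addr0 /GRing.scale /= mulr1.
Qed.

Lemma is_derive_line f x v df :
  is_derive x v f df <-> is_derive (0 : R) 1 (fun h : R => f (h *: v + x)) df.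
Proof.
split=> -[d1 d2]; split.
- exact: (derivable1P f x v).1.
- by rewrite -deriveE1.
- exact: (derivable1P f x v).2.
- by rewrite deriveE1.
Qed.

Lemma is_derive_comp1 (h : R -> R) f x v (dh df : R) :
  is_derive (f x) 1 h dh -> is_derive x v f df -> is_derive x v (h \o f) (dh * df).
Proof.
move=> hh /is_derive_line hf; apply/is_derive_line.
apply: is_derive1_comp hf.
by rewrite scale0r add0r.
Qed.

Lemma derive_local f g x v : (\forall y \near x, f y = g y) ->
  (derivable f x v <-> derivable g x v) /\ 'D_v f x = 'D_v g x.
Proof.
move=> fg; split; last exact: near_eq_derive.
split; apply: near_eq_derivable => //.
by apply: filterS fg.
Qed.

End directional.

Section smooth.
Context {R : realType} {V : normedModType R}.
Implicit Types (f g : V -> R) (x v : V).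

Lemma smooth_continuous f : smooth f -> continuous f.
Proof. by move=> /(_ [::])[]. Qed.

Lemma smooth_derivable f x v : smooth f -> derivable f x v.
Proof. by move=> /(_ [::])[_]; exact. Qed.

Lemma smooth_is_derive f x v : smooth f -> is_derive x v f ('D_v f x).
Proof. by move=> sf; apply/derivableP; exact: smooth_derivable. Qed.

Lemma smoothD f v : smooth f -> smooth ('D_v f).
Proof. by move=> sf s; have := sf (rcons s v); rewrite foldr_rcons. Qed.

(** [smooth] quantifies over all words of directions and is thus a greatest fixed point. The
    matching proof principle is coinductive: put the function into a class of differentiable
    functions that is stable under every ['D_v]. *)
Lemma smooth_ind (P : (V -> R) -> Prop) :
  (forall f, P f -> continuous f /\ forall x v, derivable f x v) ->
  (forall f v, P f -> P ('D_v f)) -> forall f, P f -> smooth f.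
Proof.
move=> P1 P2 f Pf s; apply: P1.
by elim: s => //= v s ih; exact: P2.
Qed.

End smooth.

Section smooth_algebra.
Context {R : realType} {V : normedModType R}.
Implicit Types (f g : V -> R) (x v : V).

Lemma smooth_cst (c : R) : smooth (fun _ : V => c).
Proof.
apply: (@smooth_ind R V (fun f => exists c, f = fun=> c)); last by exists c.
- by move=> _ [c' ->]; split=> [x|x v]; [exact: cvg_cst|exact: derivable_cst].
- by move=> _ v [c' ->]; exists 0; apply/funext => x; rewrite derive_cst.
Qed.

(** Products or compositions alone are not stable under differentiation, but their joint closure
    with sums is, by the Leibniz and chain rules. One application of [smooth_ind] then settles all
    closure properties. *)
Inductive smooth_alg : (V -> R) -> Prop :=
| Alg_base f : smooth f -> smooth_alg f
| Alg_add f g : smooth_alg f -> smooth_alg g -> smooth_alg (fun x => f x + g x)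
| Alg_mul f g : smooth_alg f -> smooth_alg g -> smooth_alg (fun x => f x * g x)
| Alg_comp (h : R -> R) f : smooth h -> smooth_alg f -> smooth_alg (fun x => h (f x)).

Lemma smooth_alg_smooth f : smooth_alg f -> smooth f.
Proof.
have H1 g : smooth_alg g -> continuous g /\ forall x v, derivable g x v.
  elim=> {g} [g sg|g1 g2 _ [c1 d1] _ [c2 d2]|g1 g2 _ [c1 d1] _ [c2 d2]|h g sh _ [c1 d1]].
  - by split; [exact: smooth_continuous|move=> x v; exact: smooth_derivable].
  - split=> [x|x v]; first by apply: cvgD; [exact: c1|exact: c2].
    by apply: derivableD.
  - split=> [x|x v]; first by apply: cvgM; [exact: c1|exact: c2].
    by apply: derivableM.
  - split=> [x|x v].
      apply: continuous_comp; first exact: c1.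
      exact: (@smooth_continuous R R h sh (g x)).
    have /derivableP hg := d1 x v.
    by have [] := is_derive_comp1 (smooth_is_derive (g x) 1 sh) hg.
apply: smooth_ind => // g v ag; elim: ag v => {g}
  [g sg|g1 g2 a1 ih1 a2 ih2|g1 g2 a1 ih1 a2 ih2|h g sh ag ih] v.
- exact/Alg_base/smoothD.
- rewrite (_ : 'D_v _ = fun x => 'D_v g1 x + 'D_v g2 x); first exact: Alg_add.
  by apply/funext => x; apply: deriveD; [apply (H1 _ a1).2|apply (H1 _ a2).2].
- rewrite (_ : 'D_v _ = fun x => g1 x * 'D_v g2 x + g2 x * 'D_v g1 x).
    by apply: Alg_add; apply: Alg_mul.
  by apply/funext => x; apply: deriveM; [apply (H1 _ a1).2|apply (H1 _ a2).2].
- rewrite (_ : 'D_v _ = fun x => ('D_1 h) (g x) * 'D_v g x).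
    apply: Alg_mul; last exact: ih.
    by apply: (@Alg_comp ('D_1 h)); [exact: smoothD|exact: ag].
  apply/funext => x.
  have /derivableP hg := (H1 _ ag).2 x v.
  by have [_ ->] := is_derive_comp1 (smooth_is_derive (g x) 1 sh) hg.
Qed.

Lemma smooth_add f g : smooth f -> smooth g -> smooth (fun x => f x + g x).
Proof. by move=> sf sg; apply/smooth_alg_smooth/Alg_add; exact: Alg_base. Qed.

Lemma smooth_mul f g : smooth f -> smooth g -> smooth (fun x => f x * g x).
Proof. by move=> sf sg; apply/smooth_alg_smooth/Alg_mul; exact: Alg_base. Qed.

Lemma smooth_comp (h : R -> R) f : smooth h -> smooth f -> smooth (fun x => h (f x)).
Proof. by move=> sf sg; apply/smooth_alg_smooth/Alg_comp => //; exact: Alg_base. Qed.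

Lemma smooth_sum (I : Type) (r : seq I) (P : pred I) (F : I -> V -> R) :
  (forall i, smooth (F i)) -> smooth (fun x => \sum_(i <- r | P i) F i x).
Proof.
move=> sF; elim: r => [|i r ih].
  rewrite (_ : (fun _ => _) = fun=> 0); first exact: smooth_cst.
  by apply/funext => x; rewrite big_nil.
rewrite (_ : (fun _ => _) = fun x =>
    (if P i then F i x else 0) + \sum_(j <- r | P j) F j x); last first.
  by apply/funext => x; rewrite big_cons; case: ifP => //; rewrite add0r.
apply: smooth_add; last exact: ih.
by case: (P i); [exact: sF|exact: smooth_cst].
Qed.

Lemma smooth_exp f k : smooth f -> smooth (fun x => f x ^+ k).
Proof.
move=> sf; elim: k => [|k ih].
  by rewrite (_ : (fun _ => _) = fun=> 1); [exact: smooth_cst|apply/funext].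
rewrite (_ : (fun _ => _) = fun x => f x * f x ^+ k); first exact: smooth_mul.
by apply/funext => x; rewrite exprS.
Qed.

Lemma is_derive_linear (l : V -> R) x v :
  (forall (c : R) u w, l (c *: u + w) = c * l u + l w) -> is_derive x v l (l v).
Proof.
move=> ll; apply/is_derive_line.
have -> : (fun h : R => l (h *: v + x)) = (fun h => h * l v + l x).
  by apply/funext => h; rewrite ll.
apply: is_derive_eq; rewrite !scaler0 addr0 add0r.
by rewrite /GRing.scale /= mulr1.
Qed.

Lemma smooth_linear (l : V -> R) : continuous l ->
  (forall (c : R) u w, l (c *: u + w) = c * l u + l w) -> smooth l.
Proof.
move=> cl ll.
apply: (@smooth_ind R V (fun f => f = l \/ exists c, f = fun=> c)); last by left.
- move=> _ [->|[c ->]].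
    by split=> // x v; have [] := is_derive_linear x v ll.
  by split=> [x|x v]; [exact: cvg_cst|exact: derivable_cst].
- move=> _ v [->|[c ->]]; right.
    by exists (l v); apply/funext => x; have [_ ->] := is_derive_linear x v ll.
  by exists 0; apply/funext => x; rewrite derive_cst.
Qed.

End smooth_algebra.

(** * Smooth functions of one variable and bumps *)

Section smooth1.
Context {R : realType}.
Implicit Types (f g h : R -> R).

Lemma derive_scale1 f (x v : R) : derivable f x 1 -> is_derive x v f (v * 'D_1 f x).
Proof.
move=> /derivableP df; apply/is_derive_line.
have -> : (fun h : R => f (h *: v + x)) = f \o (fun h : R => h * (v : R) + x) by [].
rewrite mulrC; apply: is_derive1_comp.
  by rewrite mul0r add0r.
apply: is_derive_eq.
by rewrite !scaler0 !addr0 add0r /GRing.scale /= mulr1.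
Qed.

(** On the line a derivative in direction v is v times the derivative in direction 1, whence the
    closure under scalar multiples. *)
Lemma smooth1_ind (P : (R -> R) -> Prop) :
  (forall f c, P f -> P (fun x => c * f x)) ->
  (forall f, P f -> exists2 g, P g & forall x : R, is_derive x 1 f (g x)) ->
  forall f, P f -> smooth f.
Proof.
move=> PZ PD; apply: smooth_ind => f.
  move=> /PD[g _ fg]; split=> x.
    apply: differentiable_continuous; apply/derivable1_diffP.
    by have [] := fg x.
  move=> v; have [d _] := fg x; have [] := derive_scale1 v d; by [].
move=> v /PD[g Pg fg].
rewrite (_ : 'D_v f = fun x => v * g x); first exact: PZ.
apply/funext => x; have [d e] := fg x.
by have [_ ->] := derive_scale1 v d; rewrite e.
Qed.

Lemma smooth_sincos (a b w : R) : smooth (fun x => a * sin (w * x) + b * cos (w * x)).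
Proof.
apply: (@smooth1_ind (fun f => exists a b, f = fun x => a * sin (w * x) + b * cos (w * x))).
- move=> _ c [a' [b' ->]]; exists (c * a'), (c * b'); apply/funext => x; lra.
- move=> _ [a' [b' ->]].
  exists (fun x => (- b' * w) * sin (w * x) + (a' * w) * cos (w * x)).
    by exists (- b' * w), (a' * w).
  move=> x.
  have dw : is_derive x 1 (fun x : R => w * x) w.
    by have := is_deriveZ w (is_derive_id x (1 : R)); rewrite /GRing.scale /= mulr1.
  have ds := is_derive1_comp (is_derive_sin (w * x)) dw.
  have dc := is_derive1_comp (is_derive_cos (w * x)) dw.
  have := is_deriveD (is_deriveZ a' ds) (is_deriveZ b' dc).
  move=> h; apply: is_derive_eq h _.
  by rewrite /GRing.scale /=; lra.
- by exists a, b.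
Qed.

Lemma smooth_sin : smooth (@sin R).
Proof.
have := smooth_sincos 1 0 1; congr (smooth _); apply/funext => x.
by rewrite !mul1r mul0r addr0.
Qed.

Lemma smooth_cos : smooth (@cos R).
Proof.
have := smooth_sincos 0 1 1; congr (smooth _); apply/funext => x.
by rewrite !mul1r mul0r add0r.
Qed.

Lemma smooth_id : smooth (fun x : R => x).
Proof. by apply: smooth_linear => // x; exact: cvg_id. Qed.

(* Functions of this form are stable under differentiation. *)
Definition flat (p : {poly R}) (x : R) : R :=
  if 0 < x then p.[x^-1] * expR (- x^-1) else 0.

(** Each monomial is controlled by y^(i+2) <= (i+2)! e^y at y = 1/x. The two spare powers of x make
    the difference quotient at 0 tend to 0. *)
Lemma flat_bound p : exists2 C, 0 <= C & forall x, 0 <= x -> `|flat p x| <= C * x ^+ 2.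
Proof.
exists (\sum_(i < size p) `|p`_i| * (i.+2)`!%:R).
  by apply: sumr_ge0 => i _; rewrite mulr_ge0.
move=> x; rewrite /flat le_eqVlt => /predU1P[<-|x0].
  by rewrite ltxx normr0 expr0n /= mulr0.
rewrite x0 normrM [X in _ * X]ger0_norm ?expR_ge0// horner_coef.
apply: (@le_trans _ _ ((\sum_(i < size p) `|p`_i| * x^-1 ^+ i) * expR (- x^-1))).
  apply: ler_wpM2r; first exact: expR_ge0.
  apply: (le_trans (ler_norm_sum _ _ _)); apply: ler_sum => i _.
  by rewrite normrM normrX [X in _ * X ^+ _]ger0_norm// invr_ge0 ltW.
rewrite !mulr_suml; apply: ler_sum => i _; rewrite -!mulrA.
apply: ler_wpM2l => //.
have y0 : 0 < x^-1 by rewrite invr_gt0.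
have h : x^-1 ^+ i.+2 <= (i.+2)`!%:R * expR x^-1.
  have := expR_ge1Dxn i.+1 (ltW y0).
  have f0 : 0 < (i.+2)`!%:R :> R by rewrite ltr0n fact_gt0.
  move=> h; rewrite mulrC -ler_pdivrMr//; apply: le_trans h.
  by rewrite lerDr.
rewrite expRN -ler_pdivlMr ?invr_gt0 ?expR_gt0// invrK.
have x2 : 0 < x ^+ 2 by rewrite exprn_gt0.
rewrite mulrAC -ler_pdivrMr//.
apply: le_trans h; rewrite -exprVn -exprD addn2; exact: lexx.
Qed.

(** For x > 0 the derivative of p(1/x) e^(-1/x) is x^(-2) (p - p')(1/x) e^(-1/x), which is where the
    polynomial X^2 (p - p') comes from. At 0 the quadratic bound decides. *)
Lemma flat_derive p (x : R) : is_derive x 1 (flat p) (flat ('X^2 * (p - p^`())) x).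
Proof.
have [x0|x0|x0] := ltgtP x 0.
- have hl : \forall y \near x, flat p y = 0.
    near=> y; rewrite /flat ifN// -leNgt ltW//; near: y; exact: lt_nbhsl.
  have [[_ d1] e] := @derive_local R R (flat p) (fun=> 0) x 1 hl.
  split; first by apply/d1/derivable_cst.
  by rewrite e derive_cst /flat ifN// -leNgt ltW.
- have hl : \forall y \near x, flat p y = p.[y^-1] * expR (- y^-1).
    near=> y; rewrite /flat ifT//; near: y; exact: lt_nbhsr.
  have [[_ d1] e] := @derive_local R R (flat p) (fun y => p.[y^-1] * expR (- y^-1)) x 1 hl.
  have dV : is_derive x (1 : R) (fun y : R => y^-1) (- x ^- 2).
    have := is_deriveV (lt0r_neq0 x0) (is_derive_id x (1 : R)).
    by rewrite /GRing.scale /= mulr1.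
  have dh : is_derive (x^-1) (1 : R) (horner p) p^`().[x^-1].
    by split; [exact: derivable_horner|rewrite -derive1E -derivE].
  have dp := is_derive1_comp dh dV.
  have de := @is_derive1_comp R expR (fun y => - y^-1) x _ _ (is_derive_expR (- x^-1)) (is_deriveN dV).
  have [h1 h2] := is_deriveM dp de.
  split; first exact/d1.
  rewrite e; apply: etrans h2 _.
  rewrite /flat x0 !hornerE /GRing.scale /= exprVn; ring.
- rewrite x0 {x0 x}.
  have [C C0 hC] := flat_bound p.
  have f00 q : flat q 0 = 0 by rewrite /flat ltxx.
  have hc : (fun h : R => h^-1 *: ((flat p \o shift 0) (h *: (1 : R)) - flat p 0)) @ 0^' --> (0 : R).
    apply/cvgrPdist_le => e e0; near=> h.
    have hn : h != 0 by near: h; exact: nbhs_dnbhs_neq.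
    rewrite f00 subr0 sub0r normrN /= addr0 /GRing.scale /= mulr1 normrM normfV.
    have h0 : 0 < `|h| by rewrite normr_gt0.
    rewrite mulrC ler_pdivrMr//.
    apply: (@le_trans _ _ (C * `|h| ^+ 2)).
      have [h1|h1] := leP 0 h; first by rewrite [in leRHS]ger0_norm//; exact: hC.
      by rewrite /flat ifN ?normr0 ?mulr_ge0 ?exprn_ge0// -leNgt ltW.
    rewrite expr2 mulrA ler_wpM2r//.
    have : `|h| <= e / (C + 1).
      near: h; apply: dnbhs0_le; rewrite divr_gt0//; lra.
    rewrite ler_pdivlMr; last lra.
    apply: le_trans; rewrite mulrC ler_wpM2l//; lra.
  have d : derivable (flat p) 0 (1 : R) by apply/cvg_ex; exists 0.
  split=> //; rewrite f00; exact: cvg_lim hc.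
Unshelve. all: by end_near. Qed.

Lemma smooth_flat p : smooth (flat p).
Proof.
apply: (@smooth1_ind (fun f => exists p, f = flat p)); last by exists p.
- move=> _ c [q ->]; exists (c%:P * q); apply/funext => x.
  by rewrite /flat; case: ifP => _; rewrite ?mulr0// hornerM hornerC mulrA.
- move=> _ [q ->]; exists (flat ('X^2 * (q - q^`()))); first by exists ('X^2 * (q - q^`())).
  by move=> x; exact: flat_derive.
Qed.

Definition flat1 := flat 1.

Lemma flat1_ge0 x : 0 <= flat1 x.
Proof. by rewrite /flat1 /flat; case: ifP => // _; rewrite hornerE mul1r expR_ge0. Qed.

Lemma flat1_gt0 x : 0 < x -> 0 < flat1 x.
Proof. by rewrite /flat1 /flat => ->; rewrite hornerE mul1r expR_gt0. Qed.

Lemma flat1_le0 x : x <= 0 -> flat1 x = 0.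
Proof. by rewrite leNgt /flat1 /flat => /negbTE ->. Qed.

Lemma flat1_nd : {homo flat1 : x y / x <= y}.
Proof.
move=> x y xy; have [x0|x0] := leP x 0; first by rewrite flat1_le0// flat1_ge0.
rewrite /flat1 /flat x0 (lt_le_trans x0 xy) !hornerE ?mul1r ler_expR lerN2.
by rewrite lef_pV2// posrE// (lt_le_trans x0 xy).
Qed.

Definition bump (x : R) : R := flat1 (1 - x ^+ 2) / flat1 1.

Lemma smooth_bump : smooth bump.
Proof.
rewrite (_ : bump = fun x => (flat1 1)^-1 * flat1 (1 + -1 * x ^+ 2)).
  apply: smooth_mul; first exact: smooth_cst.
  apply: smooth_comp; first exact: smooth_flat.
  apply: smooth_add; first exact: smooth_cst.
  by apply: smooth_mul; [exact: smooth_cst|apply: smooth_exp; exact: smooth_id].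
by apply/funext => x; rewrite /bump mulrC mulN1r.
Qed.

Lemma bump_ge0 x : 0 <= bump x.
Proof. by rewrite divr_ge0 ?flat1_ge0. Qed.

Lemma bump_le1 x : bump x <= 1.
Proof.
rewrite ler_pdivrMr ?flat1_gt0// mul1r; apply: flat1_nd.
by rewrite gerBl sqr_ge0.
Qed.

Lemma bump0 : bump 0 = 1.
Proof. by rewrite /bump expr0n subr0 divff// gt_eqF// flat1_gt0. Qed.

Lemma bump_out x : 1 <= `|x| -> bump x = 0.
Proof.
move=> x1; rewrite /bump flat1_le0 ?mul0r// subr_le0 -real_normK ?num_real//.
by rewrite -[leLHS](expr1n _ 2) lerXn2r ?nnegrE.
Qed.

Lemma bump_cvg (x : R) : bump (x / m.+1%:R) @[m --> \oo] --> (1 : R).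
Proof.
suff : bump (x / m.+1%:R) @[m --> \oo] --> bump 0 by rewrite bump0.
apply: (@cvg_comp _ _ _ (fun m : nat => x / m.+1%:R : R) bump \oo (nbhs (0 : R)) (nbhs (bump 0))).
  rewrite -(mulr0 x); apply: cvgM; first exact: cvg_cst.
  exact: cvg_harmonic.
exact: (smooth_continuous smooth_bump).
Qed.

End smooth1.

Lemma quadratic_discriminant (R : realFieldType) (A B D : R) : 0 <= A ->
  (forall c, 0 <= c ^+ 2 * A + 2 * c * B + D) -> B ^+ 2 <= A * D.
Proof.
move=> A0 h; have [f0|f0] := eqVneq A 0.
  rewrite f0 mul0r; have [->|fg] := eqVneq B 0; first by rewrite expr0n.
  (* With A = 0 and B <> 0 the expression is affine in c, and this c gives it the value -1. *)
  have := h (- (D + 1) / (2 * B)); rewrite f0 mulr0 add0r.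
  rewrite (_ : 2 * _ * _ = - (D + 1)); last by field.
  lra.
have fp : 0 < A by rewrite lt_neqAle eq_sym f0.
have := h (- B / A).
rewrite (_ : _ + _ = D - B ^+ 2 / A); last by field.
by rewrite subr_ge0 ler_pdivrMr// mulrC.
Qed.

Section line.
Context {R : realType} {V : normedModType R}.
Implicit Types (f : V -> R) (x v : V).

Lemma is_derive_along f x v (t : R) : smooth f ->
  is_derive t 1 (fun h : R => f (h *: v + x)) ('D_v f (t *: v + x)).
Proof.
move=> sf.
have /is_derive_line h := smooth_is_derive (t *: v + x) v sf.
have -> : (fun h : R => f (h *: v + x)) =
    (fun h : R => f (h *: v + (t *: v + x))) \o (fun h => h - t).
  by apply/funext => s /=; rewrite addrA -scalerDl subrK.
rewrite -[X in is_derive _ _ _ X]mulr1; apply: is_derive1_comp.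
  by rewrite subrr.
have := is_deriveB (is_derive_id t (1 : R)) (is_derive_cst t t (1 : R)).
by rewrite subr0.
Qed.

Lemma quotient_bound f x v (t M : R) : smooth f -> 0 < t ->
  (forall y, `|'D_v f y| <= M) -> `|t^-1 * (f (t *: v + x) - f x)| <= M.
Proof.
move=> sf t0 hM.
have [|||c _] := @MVT_segment R (fun h : R => f (h *: v + x))
    (fun h : R => 'D_v f (h *: v + x)) 0 t.
- exact: ltW.
- by move=> y _; exact: is_derive_along.
- apply: derivable_within_continuous => y _.
  by have [] := is_derive_along x v y sf.
rewrite scale0r add0r subr0 => ->.
by rewrite mulrC mulfK ?gt_eqF.
Qed.

Lemma quotient_cvg f x v : smooth f ->
  (m.+1%:R^-1)^-1 * (f (m.+1%:R^-1 *: v + x) - f x) @[m --> \oo] --> 'D_v f x.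
Proof.
move=> sf; have d : derivable f x v by exact: smooth_derivable.
have h : (fun h : R => h^-1 *: (f (h *: v + x) - f x)) @ 0^' --> 'D_v f x by exact: d.
have [h1 _] := cvgr_dnbhsP (fun h : R => h^-1 *: (f (h *: v + x) - f x)) 0 ('D_v f x).
apply: (h1 h (fun m => m.+1%:R^-1)); split; last exact: cvg_harmonic.
by move=> m; rewrite invr_eq0 pnatr_eq0.
Qed.

End line.

(** * Test functions, the horizontal fields and the Dirichlet form *)

Section test.
Context {R : realType} {n : nat}.
Local Notation V := (R * 'rV[R]_n)%type.
Local Notation haar := (@haar R n).
Implicit Types (f g : V -> R) (x v : V).
Local Notation test := (@test_function R V).

Lemma support_derive f v (C : R) : (forall x, C < `|x| -> f x = 0) ->
  forall x, C < `|x| -> 'D_v f x = 0.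
Proof.
move=> fC x xC.
have hl : \forall y \near x, f y = 0.
  near=> y; apply: fC; near: y.
  have := @norm_continuous _ _ x; move=> /(cvgr_gt `|x|); exact.
have [_ ->] := @derive_local R V f (fun=> 0) x v hl.
by rewrite derive_cst.
Unshelve. all: by end_near. Qed.

Lemma testP f : test f <-> smooth f /\ exists C, forall x, C < `|x| -> f x = 0.
Proof. by split=> -[sf /compactly_supportedP]. Qed.

Lemma test_smooth f : test f -> smooth f. Proof. by case. Qed.

Lemma testD f v : test f -> test ('D_v f).
Proof.
move=> /testP[sf [C fC]]; apply/testP; split; first exact: smoothD.
by exists C; exact: support_derive.
Qed.

Lemma test_mull f g : smooth f -> test g -> test (fun x => f x * g x).
Proof.
move=> sf /testP[sg [C gC]]; apply/testP; split; first exact: smooth_mul.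
by exists C => x /gC ->; rewrite mulr0.
Qed.

Lemma test_mulr f g : test f -> smooth g -> test (fun x => f x * g x).
Proof.
move=> tf sg; have := test_mull sg tf; congr (test_function _).
by apply/funext => x; rewrite mulrC.
Qed.

Lemma test_add f g : test f -> test g -> test (fun x => f x + g x).
Proof.
move=> /testP[sf [C fC]] /testP[sg [D gD]]; apply/testP; split.
  exact: smooth_add.
exists (Num.max C D) => x; rewrite gt_max => /andP[/fC -> /gD ->].
by rewrite addr0.
Qed.

Lemma test_scale (c : R) f : test f -> test (fun x => c * f x).
Proof. by apply: test_mull; exact: smooth_cst. Qed.

Lemma test_sub f g : test f -> test g -> test (fun x => f x - g x).
Proof.
move=> tf tg; have := test_add tf (test_scale (-1) tg); congr (test_function _).
by apply/funext => x; rewrite mulN1r.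
Qed.

Lemma test_sum (I : Type) (r : seq I) (F : I -> V -> R) :
  (forall i, test (F i)) -> test (fun x => \sum_(i <- r) F i x).
Proof.
move=> sF; elim: r => [|i r ih].
  rewrite (_ : (fun _ => _) = fun=> 0).
    by apply/testP; split; [exact: smooth_cst|exists 0].
  by apply/funext => x; rewrite big_nil.
rewrite (_ : (fun _ => _) = fun x => F i x + \sum_(j <- r) F j x).
  by apply: test_add; [exact: sF|exact: ih].
by apply/funext => x; rewrite big_cons.
Qed.

Lemma test_integ f : test f -> integ haar f.
Proof.
by move=> [sf cf]; apply: continuous_compact_integ => //; exact: smooth_continuous.
Qed.

Lemma test_bounded f : test f -> exists M, forall x, `|f x| <= M.
Proof.
by move=> [sf cf]; apply: compactly_supported_bounded => //; exact: smooth_continuous.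
Qed.

Lemma smooth_measurable f : smooth f -> measurable_fun [set: measurableTypeR R * 'rV[R]_n] f.
Proof. by move=> sf; apply: measurable_continuous_prod_rV; exact: smooth_continuous. Qed.

Lemma smooth_fst : smooth (fun x : V => x.1).
Proof. by apply: smooth_linear => // x; exact: cvg_fst. Qed.

Lemma smooth_coord i : smooth (fun x : V => x.2 ord0 i).
Proof.
apply: smooth_linear => [x|c u w]; last by rewrite /= !mxE.
by apply: (@continuous_comp _ _ _ (fun x : V => x.2)
  (fun w : 'rV[R]_n => w ord0 i)); [exact: cvg_snd|exact: rV_coord_continuous].
Qed.

(** Translation invariance makes every difference quotient integrate to 0. The quotients converge to
    the derivative, are bounded by its supremum, and vanish outside the ball of radius C + |v|, so
    dominated convergence applies. *)
Lemma int_derive0 f v : test f -> \int[haar]_x 'D_v f x = 0.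
Proof.
move=> tf; have sf := test_smooth tf.
have [M fM] := test_bounded (testD v tf).
have [_ [C fC]] := (testP f).1 tf.
pose f_ (m : nat) x := (m.+1%:R^-1)^-1 * (f (m.+1%:R^-1 *: v + x) - f x).
have M0 : 0 <= M by rewrite (le_trans _ (fM 0)).
have mshift c : measurable_fun [set: measurableTypeR R * 'rV[R]_n] (fun x : V => f (c + x)).
  apply: measurable_continuous_prod_rV => x.
  apply: (@continuous_comp _ _ _ (fun x : V => c + x) f); last exact: smooth_continuous.
  by apply: cvgD; [exact: cvg_cst|exact: cvg_id].
have ishift c : integ haar (fun x : V => f (c + x)).
  have := (Rint_haar_shift c (smooth_measurable sf)).1.2 (test_integ tf).
  by apply: eq_integ => x; rewrite addrC.
have mf_ m : measurable_fun [set: measurableTypeR R * 'rV[R]_n] (f_ m).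
  apply: measurable_funM; first exact: measurable_cst.
  by apply: measurable_funB; [exact: mshift|exact: smooth_measurable].
pose B := [set x : V | `|x| <= C + `|v|].
have mB : measurable (B : set (measurableTypeR R * 'rV[R]_n)) by exact: measurable_prod_norm_le.
have iB : integ haar (fun x : V => M * \1_B x).
  apply: integZ; apply: (@integ_bounded_support _ _ _ haar B _ 1) => //.
  - exact: haar_ball_fin.
  - by move=> x; rewrite indicE ger0_norm// lern1 leq_b1.
  - by move=> x xB; rewrite indicE memNset.
have f_B m x : `|f_ m x| <= M * \1_B x.
  rewrite indicE; case: (boolP (x \in B)) => xB.
    by rewrite mulr1; apply: quotient_bound => //; rewrite invr_gt0.
  have {}xB : C + `|v| < `|x|.
    by move/negP : xB; rewrite inE /B /= => /negP; rewrite -ltNge.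
  rewrite /f_ !fC ?subr0 ?mulr0 ?normr0 //.
    by rewrite (le_lt_trans _ xB)// lerDl.
  have h1 : `|m.+1%:R^-1 *: v| <= `|v|.
    rewrite normrZ -[leRHS]mul1r ler_wpM2r// ger0_norm ?invr_ge0//.
    by rewrite invf_le1// ler1n.
  have := lerB_normD x (m.+1%:R^-1 *: v).
  rewrite [x + _]addrC; apply: lt_le_trans; rewrite ltrBrDr.
  by apply: le_lt_trans xB; rewrite lerD2l.
have [_ h] := @Rint_cvg _ _ _ haar f_ ('D_v f) _ mf_ (fun x => @quotient_cvg _ _ f x v sf) iB f_B.
suff E m : \int[haar]_x f_ m x = 0.
  by move: h; under eq_fun do rewrite E; move=> /cvg_lim <- //; rewrite lim_cst.
rewrite RintZ; last by apply: integB; [exact: ishift|exact: test_integ].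
rewrite RintB; [|exact: ishift|exact: test_integ].
have -> : \int[haar]_x f (m.+1%:R^-1 *: v + x) = \int[haar]_x f (x + m.+1%:R^-1 *: v).
  by apply: eq_Rint => x; rewrite addrC.
by rewrite (Rint_haar_shift _ (smooth_measurable sf)).2 subrr mulr0.
Qed.

Lemma X1D f g : smooth f -> smooth g ->
  X1 (fun x => f x * g x) = fun x => f x * X1 g x + g x * X1 f x.
Proof.
move=> sf sg; apply/funext => x.
by apply: deriveM; exact: smooth_derivable.
Qed.

Lemma X2D f g : smooth f -> smooth g ->
  X2 (fun x => f x * g x) = fun x => f x * X2 g x + g x * X2 f x.
Proof.
move=> sf sg; apply/funext => x; rewrite /X2 !mulr_sumr -big_split /=.
apply: eq_bigr => i _.
have -> : 'D_(0, delta_mx ord0 i) (fun x => f x * g x) x =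
    f x * 'D_(0, delta_mx ord0 i) g x + g x * 'D_(0, delta_mx ord0 i) f x.
  by apply: deriveM; exact: smooth_derivable.
ring.
Qed.

Lemma X1_comp (h : R -> R) f : smooth h -> smooth f ->
  X1 (fun x => h (f x)) = fun x => 'D_1 h (f x) * X1 f x.
Proof.
move=> sh sf; apply/funext => x.
have [_ e] := is_derive_comp1 (smooth_is_derive (f x) 1 sh) (smooth_is_derive x (1, 0) sf).
exact: e.
Qed.

Lemma X2_comp (h : R -> R) f : smooth h -> smooth f ->
  X2 (fun x => h (f x)) = fun x => 'D_1 h (f x) * X2 f x.
Proof.
move=> sh sf; apply/funext => x; rewrite /X2 mulr_sumr; apply: eq_bigr => i _.
have [_ e] := is_derive_comp1 (smooth_is_derive (f x) 1 sh)
  (smooth_is_derive x (0, delta_mx ord0 i) sf).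
by rewrite mulrCA; congr (_ * _); exact: e.
Qed.

Definition coef (i : nat) (x : V) : R := x.1 ^+ i / i`!%:R.

Lemma smooth_coef i : smooth (coef i).
Proof.
by apply: smooth_mul; [apply: smooth_exp; exact: smooth_fst|exact: smooth_cst].
Qed.

Lemma derive_coef i (w : 'rV[R]_n) x : 'D_(0, w) (coef i) x = 0.
Proof.
rewrite deriveE1 (_ : (fun h : R => _) = fun=> coef i x) ?derive_cst//.
by apply/funext => h; rewrite /coef /= scaler0 add0r.
Qed.

Lemma smooth_X1 f : smooth f -> smooth (X1 f). Proof. exact: smoothD. Qed.

Lemma smooth_X2 f : smooth f -> smooth (X2 f).
Proof.
move=> sf; apply: smooth_sum => i; apply: smooth_mul; last exact: smoothD.
exact: smooth_coef.
Qed.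

Lemma test_X1 f : test f -> test (X1 f). Proof. exact: testD. Qed.

Lemma test_X2 f : test f -> test (X2 f).
Proof.
move=> tf; apply: test_sum => i; apply: test_mull; last exact: testD.
exact: smooth_coef.
Qed.

Lemma smooth_sublaplacian f : smooth f -> smooth (sublaplacian f).
Proof.
by move=> sf; apply: smooth_add; [do 2!apply: smooth_X1|do 2!apply: smooth_X2].
Qed.

Lemma test_sublaplacian f : test f -> test (sublaplacian f).
Proof.
by move=> sf; apply: test_add; [do 2!apply: test_X1|do 2!apply: test_X2].
Qed.

Lemma int_X10 f : test f -> \int[haar]_x X1 f x = 0.
Proof. exact: int_derive0. Qed.

Lemma int_sum0 (I : Type) (r : seq I) (F : I -> V -> R) :
  (forall i, integ haar (F i)) -> (forall i, \int[haar]_x F i x = 0) ->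
  \int[haar]_x (\sum_(i <- r) F i x) = 0.
Proof.
move=> iF F0.
suff : integ haar (fun x => \sum_(i <- r) F i x) /\
  \int[haar]_x (\sum_(i <- r) F i x) = 0 by case.
elim: r => [|i r [ih1 ih2]].
  split; first by apply: eq_integ (integ0 haar) => x; rewrite big_nil.
  by transitivity (\int[haar]_x (0 : R)); [apply: eq_Rint => x; rewrite big_nil|exact: Rint0].
split; first by apply: eq_integ (integD (iF i) ih1) => x; rewrite big_cons.
transitivity (\int[haar]_x (F i x + \sum_(j <- r) F j x)).
  by apply: eq_Rint => x; rewrite big_cons.
by rewrite RintD// F0 ih2 addr0.
Qed.

(** The coefficients of [X2] depend on the first variable only and are differentiated in the
    directions z, so each term is an exact derivative: the field has zero divergence. *)
Lemma int_X20 f : test f -> \int[haar]_x X2 f x = 0.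
Proof.
move=> tf.
have tci i : test (fun x : V => coef i x * f x) by apply: test_mull => //; exact: smooth_coef.
have E i (w : 'rV[R]_n) x : coef i x * 'D_(0, w) f x = 'D_(0, w) (fun x => coef i x * f x) x.
  rewrite [RHS](_ : _ = coef i x * 'D_(0, w) f x + f x * 'D_(0, w) (coef i) x).
    by rewrite derive_coef mulr0 addr0.
  by apply: deriveM; apply: smooth_derivable; [exact: smooth_coef|exact: test_smooth].
apply: int_sum0 => i.
  apply: eq_integ (test_integ (testD (0, delta_mx ord0 i) (tci i))) => x.
  by rewrite -E.
by under eq_Rint do rewrite E; exact: int_derive0.
Qed.

Definition form f g : R := \int[haar]_x (X1 f x * X1 g x + X2 f x * X2 g x).

Lemma form_sublaplacian f g : smooth f -> test g ->
  \int[haar]_x (sublaplacian f x * g x) = - form f g.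
Proof.
move=> sf tg; have sg := test_smooth tg.
have t1 : test (fun x => X1 f x * g x) by apply: test_mull; [exact: smooth_X1|exact: tg].
have t2 : test (fun x => X2 f x * g x) by apply: test_mull; [exact: smooth_X2|exact: tg].
have i1 := test_integ (test_X1 t1); have i2 := test_integ (test_X2 t2).
have ig : integ haar (fun x => X1 f x * X1 g x + X2 f x * X2 g x).
  apply: test_integ; apply: test_add; apply: test_mull.
  - exact: smooth_X1.
  - exact: test_X1.
  - exact: smooth_X2.
  - exact: test_X2.
transitivity (\int[haar]_x ((X1 (fun x => X1 f x * g x) x + X2 (fun x => X2 f x * g x) x)
    - (X1 f x * X1 g x + X2 f x * X2 g x))).
  apply: eq_Rint => x; rewrite X1D; [|exact: smooth_X1|exact: sg].
  rewrite X2D; [|exact: smooth_X2|exact: sg].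
  rewrite /sublaplacian /=; ring.
rewrite RintB; [|exact: integD|exact: ig].
by rewrite RintD ?(int_X10 t1) ?(int_X20 t2) ?addr0 ?sub0r.
Qed.

Lemma formC f g : form f g = form g f.
Proof. by apply: eq_Rint => x; ring. Qed.

Lemma sublaplacian_sym f g : smooth f -> test g ->
  \int[haar]_x (f x * sublaplacian g x) = \int[haar]_x (sublaplacian f x * g x).
Proof.
move=> sf tg; have sg := test_smooth tg.
have t1 : test (fun x => f x * X1 g x) by apply: test_mull; [exact: sf|exact: test_X1].
have t2 : test (fun x => f x * X2 g x) by apply: test_mull; [exact: sf|exact: test_X2].
have i1 := test_integ (test_X1 t1); have i2 := test_integ (test_X2 t2).
have ig : integ haar (fun x => X1 f x * X1 g x + X2 f x * X2 g x).
  apply: test_integ; apply: test_add; apply: test_mull.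
  - exact: smooth_X1.
  - exact: test_X1.
  - exact: smooth_X2.
  - exact: test_X2.
rewrite (form_sublaplacian sf tg).
transitivity (\int[haar]_x ((X1 (fun x => f x * X1 g x) x + X2 (fun x => f x * X2 g x) x)
    - (X1 f x * X1 g x + X2 f x * X2 g x))).
  apply: eq_Rint => x; rewrite X1D; [|exact: sf|exact: smooth_X1].
  rewrite X2D; [|exact: sf|exact: smooth_X2].
  rewrite /sublaplacian /=; ring.
rewrite RintB; [|exact: integD|exact: ig].
by rewrite RintD ?(int_X10 t1) ?(int_X20 t2) ?addr0 ?sub0r.
Qed.

Lemma energyE f : test f -> energy haar sublaplacian f = form f f.
Proof.
move=> tf; rewrite -[RHS]opprK -form_sublaplacian//; last exact: test_smooth.
rewrite -RintN.
  by apply: eq_Rint => x; rewrite mulNr.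
by apply: test_integ; apply: test_mulr; [exact: test_sublaplacian|exact: test_smooth].
Qed.

Lemma form_integ f g : test f -> test g ->
  integ haar (fun x => X1 f x * X1 g x + X2 f x * X2 g x).
Proof.
move=> tf tg; apply: test_integ; apply: test_add; apply: test_mulr.
- exact: test_X1.
- exact/smooth_X1/test_smooth.
- exact: test_X2.
- exact/smooth_X2/test_smooth.
Qed.

Lemma form_ge0 f : 0 <= form f f.
Proof. by apply: Rint_ge0 => x; rewrite addr_ge0// -expr2 sqr_ge0. Qed.

Lemma X1_lin (c : R) f g : smooth f -> smooth g ->
  X1 (fun x => c * f x + g x) = fun x => c * X1 f x + X1 g x.
Proof.
move=> sf sg; apply/funext => x.
have [_ e] := is_deriveD (is_deriveZ c (smooth_is_derive x (1, 0) sf)) (smooth_is_derive x (1, 0) sg).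
exact: e.
Qed.

Lemma X2_lin (c : R) f g : smooth f -> smooth g ->
  X2 (fun x => c * f x + g x) = fun x => c * X2 f x + X2 g x.
Proof.
move=> sf sg; apply/funext => x; rewrite /X2 mulr_sumr -big_split /=.
apply: eq_bigr => i _; set w := (0, _).
have [_ e] := is_deriveD (is_deriveZ c (smooth_is_derive x w sf)) (smooth_is_derive x w sg).
rewrite -[c * (_ * _)]mulrCA -mulrDr; congr (_ * _); exact: e.
Qed.

Lemma form_lin (c : R) f g h : test f -> test g -> test h ->
  form (fun x => c * f x + g x) h = c * form f h + form g h.
Proof.
move=> tf tg th; rewrite /form X1_lin ?X2_lin; try exact: test_smooth.
rewrite -RintZ; last exact: form_integ.
rewrite -RintD; [|apply: integZ; exact: form_integ|exact: form_integ].
by apply: eq_Rint => x; ring.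
Qed.

Lemma form_cauchy_schwarz f g : test f -> test g -> form f g ^+ 2 <= form f f * form g g.
Proof.
move=> tf tg.
have h (c : R) : 0 <= c ^+ 2 * form f f + 2 * c * form f g + form g g.
  have tc : test (fun x => c * f x + g x) by apply: test_add => //; exact: test_scale.
  have := form_ge0 (fun x => c * f x + g x).
  rewrite (form_lin c tf tg tc) [form f (fun x => _)]formC [form g (fun x => _)]formC.
  rewrite (form_lin c tf tg tf) (form_lin c tf tg tg) [form g f]formC.
  move: (form f f) (form f g) (form g g) => A B D.
  by rewrite (_ : c * _ + _ = c ^+ 2 * A + 2 * c * B + D)//; ring.
exact: quadratic_discriminant (form_ge0 f) h.
Qed.

End test.

(** * Square-integrable functions and the semigroup *)

Section hilbert.
Context d (T : measurableType d) (R : realType).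
Variable mu : {measure set T -> \bar R}.
Implicit Types u v w : T -> R.

Definition ip u v : R := \int[mu]_x (u x * v x).
Definition nrm u : R := Num.sqrt (ip u u).
Definition L2 u := measurable_fun setT u /\ integ mu (fun x => u x ^+ 2).

Lemma LnormE u : L2 u -> Lnorm mu 2%:E (EFin \o u) = (nrm u)%:E.
Proof.
move=> [mu_ iu]; rewrite unlock /Lnorm.
have -> : (\int[mu]_x `|(EFin \o u) x| `^ 2 = (ip u u)%:E)%E.
  rewrite /ip (eq_Rint mu (g := fun x => u x ^+ 2)) ?EFin_Rint//.
  by apply: eq_integral => x _ /=; rewrite -[(2 : R)]/(2%:R) powR_mulrn// real_normK// num_real.
by rewrite poweR_EFin powR12_sqrt// Rint_ge0// => x; rewrite -expr2 sqr_ge0.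
Qed.

Lemma inL2P u : inL2 mu u <-> L2 u.
Proof.
split=> [h|h].
  split; last exact: Lfun2_integrable_sqr.
  by move: h; rewrite /inL2 inE => /andP[]; rewrite inE.
rewrite /inL2 inE; apply/andP; split; rewrite inE /=; first by case: h.
by rewrite /finite_norm LnormE// ltry.
Qed.

Lemma ip_integ u v : L2 u -> L2 v -> integ mu (fun x => u x * v x).
Proof.
move=> [mu_ iu] [mv iv]; apply: le_integ (integD iu iv).
  exact: measurable_funM.
move=> x; rewrite normrM -(real_normK (num_real (u x))) -(real_normK (num_real (v x))).
move: `|u x| `|v x| (normr_ge0 (u x)) (normr_ge0 (v x)) => a b a0 b0; nra.
Qed.

Lemma L2D u v : L2 u -> L2 v -> L2 (fun x => u x + v x).
Proof.
move=> hu hv; have iuv := ip_integ hu hv; case: hu hv => [mu_ iu] [mv iv]; split.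
  exact: measurable_funD.
apply: eq_integ (integD (integD iu iv) (integZ 2 iuv)) => x; ring.
Qed.

Lemma L2Z c u : L2 u -> L2 (fun x => c * u x).
Proof.
move=> [mu_ iu]; split; first by apply: measurable_funM => //; exact: measurable_cst.
by apply: eq_integ (integZ (c ^+ 2) iu) => x; rewrite exprMn.
Qed.

Lemma L2B u v : L2 u -> L2 v -> L2 (fun x => u x - v x).
Proof.
move=> hu /(L2Z (-1)) /(L2D hu); congr L2; apply/funext => x; by rewrite mulN1r.
Qed.

Lemma L2_0 : L2 (fun=> 0).
Proof.
split; first exact: measurable_cst.
by apply: eq_integ (integ0 mu) => x; rewrite expr0n.
Qed.

Lemma ipC u v : ip u v = ip v u.
Proof. by apply: eq_Rint => x; rewrite mulrC. Qed.

Lemma ipDl u v w : L2 u -> L2 v -> L2 w -> ip (fun x => u x + v x) w = ip u w + ip v w.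
Proof.
move=> hu hv hw; rewrite /ip -RintD; [|exact: ip_integ|exact: ip_integ].
by apply: eq_Rint => x; rewrite mulrDl.
Qed.

Lemma ipZl c u w : L2 u -> L2 w -> ip (fun x => c * u x) w = c * ip u w.
Proof.
move=> hu hw; rewrite /ip -RintZ; last exact: ip_integ.
by apply: eq_Rint => x; rewrite mulrA.
Qed.

Lemma ipBl u v w : L2 u -> L2 v -> L2 w -> ip (fun x => u x - v x) w = ip u w - ip v w.
Proof.
move=> hu hv hw; rewrite /ip -RintB; [|exact: ip_integ|exact: ip_integ].
by apply: eq_Rint => x; rewrite mulrBl.
Qed.

Lemma ip_ge0 u : 0 <= ip u u.
Proof. by apply: Rint_ge0 => x; rewrite -expr2 sqr_ge0. Qed.

Lemma cauchy_schwarz u v : L2 u -> L2 v -> `|ip u v| <= nrm u * nrm v.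
Proof.
move=> hu hv.
have h : ip u v ^+ 2 <= ip u u * ip v v.
  apply: (quadratic_discriminant (ip_ge0 u)) => c.
  have := ip_ge0 (fun x => c * u x + v x).
  have hw := L2D (L2Z c hu) hv.
  rewrite ipDl//; last exact: L2Z.
  rewrite ipZl// [ip u (fun x => _)]ipC [ip v (fun x => _)]ipC !ipDl//; try exact: L2Z.
  rewrite !ipZl// [ip v u]ipC.
  move: (ip u u) (ip u v) (ip v v) => A B D.
  by rewrite (_ : c * _ + _ = c ^+ 2 * A + 2 * c * B + D)//; ring.
rewrite -sqrtr_sqr /nrm -sqrtrM ?ip_ge0//.
by rewrite ler_sqrt// mulr_ge0 ?ip_ge0.
Qed.

Lemma nrm_ge0 u : 0 <= nrm u.
Proof. exact: sqrtr_ge0. Qed.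

Lemma nrmK u : nrm u ^+ 2 = ip u u.
Proof. by rewrite sqr_sqrtr// ip_ge0. Qed.

Lemma nrmD u v : L2 u -> L2 v -> nrm (fun x => u x + v x) <= nrm u + nrm v.
Proof.
move=> hu hv; rewrite -(@ler_pXn2r _ 2)// ?nnegrE ?addr_ge0 ?nrm_ge0//.
rewrite nrmK sqrrD !nrmK ipDl//; last exact: L2D.
rewrite [ip u (fun x => _)]ipC [ip v (fun x => _)]ipC !ipDl// [ip v u]ipC.
have := le_trans (ler_norm _) (cauchy_schwarz hu hv).
move: (ip u u) (ip v v) (ip u v) (nrm u * nrm v) => A B C E; rewrite mulr2n; lra.
Qed.

Lemma nrmZ c u : L2 u -> nrm (fun x => c * u x) = `|c| * nrm u.
Proof.
move=> hu; rewrite /nrm ipZl//; last exact: L2Z.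
rewrite ipC ipZl// mulrA -expr2 sqrtrM ?sqr_ge0//.
by rewrite sqrtr_sqr.
Qed.

Lemma eq_nrm u v : (forall x, u x = v x) -> nrm u = nrm v.
Proof. by move=> /funext ->. Qed.

Lemma nrmBC u v : L2 u -> L2 v -> nrm (fun x => u x - v x) = nrm (fun x => v x - u x).
Proof.
move=> hu hv; rewrite -[LHS]mul1r -(normr1 R) -normrN -nrmZ; last exact: L2B.
by apply: eq_nrm => x; ring.
Qed.

Lemma nrmB_triangle u v w : L2 u -> L2 v -> L2 w ->
  nrm (fun x => u x - w x) <= nrm (fun x => u x - v x) + nrm (fun x => v x - w x).
Proof.
move=> hu hv hw; apply: le_trans (nrmD (L2B hu hv) (L2B hv hw)).
by rewrite le_eqVlt; apply/orP; left; apply/eqP; apply: eq_nrm => x; ring.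
Qed.

Lemma L2distE u v : L2 u -> L2 v -> L2dist mu u v = (nrm (fun x => u x - v x))%:E.
Proof. by move=> hu hv; rewrite /L2dist LnormE//; exact: L2B. Qed.

Lemma L2dist_cvg (I : Type) (F : set_system I) {FF : Filter F} (u_ : I -> T -> R) u :
  (forall i, L2 (u_ i)) -> L2 u ->
  L2dist mu (u_ i) u @[i --> F] --> 0%E <->
  nrm (fun x => u_ i x - u x) @[i --> F] --> 0.
Proof.
move=> hu_ hu; rewrite (_ : (fun i => L2dist _ _ _) = EFin \o (fun i => nrm (fun x => u_ i x - u x))).
  split=> [/fine_cvg//|h].
  by apply: cvg_EFin => //; exact: nearW.
by apply/funext => i; rewrite L2distE.
Qed.

Lemma ip_nrm0 u v w : L2 u -> L2 v -> L2 w -> nrm (fun x => u x - v x) = 0 ->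
  ip u w = ip v w.
Proof.
move=> hu hv hw h; apply/eqP; rewrite -subr_eq0 -ipBl// -normr_le0.
by rewrite (le_trans (cauchy_schwarz (L2B hu hv) hw))// h mul0r.
Qed.

End hilbert.

(** * One-sided growth estimates and points of continuity *)

Section real_lemmas.
Context {R : realType}.
Implicit Types (phi : R -> R) (a b : R).

(** Continuity induction in place of the mean value theorem: along an orbit of the semigroup only
    right difference quotients are estimated, together with the absence of upward jumps when a time
    is approached from the left. *)
Lemma dini_le phi a b M : a <= b ->
  (forall s, a < s <= b -> forall e : R, 0 < e ->
    exists2 r : R, 0 < r & forall h : R, 0 < h < r -> a <= s - h -> phi s <= phi (s - h) + e) ->
  (forall s, a <= s < b -> forall e : R, 0 < e ->
    exists2 r : R, 0 < r & forall h : R, 0 < h < r -> s + h <= b -> phi (s + h) - phi s <= (M + e) * h) ->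
  phi b - phi a <= M * (b - a).
Proof.
move=> ab hl hr.
suff H e : 0 < e -> phi b - phi a <= (M + e) * (b - a).
  have [->|ab'] := eqVneq a b; first by rewrite !subrr mulr0.
  have ba : 0 < b - a by rewrite subr_gt0 lt_neqAle ab' ab.
  apply/ler_addgt0Pr => e e0.
  have := H (e / (b - a)) (divr_gt0 e0 ba).
  by rewrite mulrDl divfK ?gt_eqF.
move=> e0.
(* [E] collects the times up to which the slope M + e is respected. The left hypothesis carries the
   bound to the supremum [c], and the right one would push [E] past [c] if c < b. *)
pose E := [set s | a <= s <= b /\ forall r, a <= r <= s -> phi r - phi a <= (M + e) * (r - a)].
have Ea : E a.
  split; first by rewrite lexx.
  move=> r /andP[r1 r2]; have -> : r = a by apply/eqP; rewrite eq_le r2 r1.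
  by rewrite !subrr mulr0.
have ubE : ubound E b by move=> s [/andP[]].
have hsE : has_sup E by split; [exists a|exists b].
pose c := sup E.
have ac : a <= c by exact: sup_upper_bound.
have cb : c <= b by apply: sup_le_ub => //; exists a.
have below r : a <= r -> r < c -> phi r - phi a <= (M + e) * (r - a).
  move=> ar rc; have [s [sE hs] rs] := sup_adherent (ltac:(by rewrite subr_gt0) : 0 < c - r) hsE.
  by apply: hs; rewrite ar/= ltW// -[r](subKr c).
have Ec : phi c - phi a <= (M + e) * (c - a).
  move: ac; rewrite le_eqVlt => /predU1P[<-|ac]; first by rewrite !subrr mulr0.
  apply/ler_addgt0Pr => x x0.
  have [||r r0 hr'] := hl c _ (x / 2); first by rewrite ac.
    by rewrite divr_gt0.
  pose K := `|M + e| + 1.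
  have K0 : 0 < K by rewrite ltr_pwDr.
  (* The step is so short that stepping back by h costs at most x / 2 through the slope and at most
     x / 2 through the left hypothesis. *)
  pose h := Num.min (Num.min (r / 2) (c - a)) (x / 2 / K).
  have h0 : 0 < h by rewrite !lt_min subr_gt0 ac !divr_gt0.
  have h1 : h < r by rewrite !gt_min ltr_pdivrMr// ltr_pMr// ltr1n.
  have h2 : a <= c - h by rewrite lerBrDr -lerBrDl !ge_min lexx orbT.
  have h3 : K * h <= x / 2 by rewrite mulrC -ler_pdivlMr// !ge_min lexx orbT.
  have := hr' h; rewrite h0 h1 => /(_ isT h2) hh.
  have := below (c - h) h2; rewrite ltrBlDr ltrDl => /(_ h0) hb.
  have h4 : (M + e) * (- h) <= x / 2.
    apply: le_trans h3; rewrite mulrN -mulNr ler_wpM2r ?(ltW h0)//.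
    by rewrite (le_trans (ler_norm _))// normrN lerDl.
  nra.
move: cb; rewrite le_eqVlt => /predU1P[<- //|cb].
exfalso.
have [||r r0 hr'] := hr c _ e => //; first by rewrite ac.
pose h := Num.min (r / 2) (b - c).
have h0 : 0 < h by rewrite lt_min subr_gt0 cb divr_gt0.
have h1 : h < r by rewrite gt_min ltr_pdivrMr// ltr_pMr// ltr1n.
have h2 : c + h <= b by rewrite -lerBrDl ge_min lexx orbT.
have : E (c + h).
  split; first by rewrite h2 (le_trans ac)// lerDl ltW.
  move=> s /andP[as_ sc]; have [sc'|cs|->//] := ltgtP s c; first exact: below.
  have := hr' (s - c); rewrite subr_gt0 cs ltrBlDl (le_lt_trans sc) ?ltrD2l//.
  rewrite addrC subrK => /(_ isT (le_trans sc h2)) hs.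
  lra.
by move=> /(sup_upper_bound hsE); rewrite -/c leNgt ltrDl h0.

Qed.

(** A right-continuous orbit has points of two-sided continuity, by nested intervals on which the
    oscillation is below 1/(k+1). [dd s t] stands for the distance of the orbit at two times. Since
    a bound on S_t is only given for each t separately, left continuity has to be found at one time
    first. *)
Lemma right_continuous_point (dd : R -> R -> R) (r : R) :
  (forall s t, dd s t = dd t s) ->
  (forall s t u : R, 0 < s -> 0 < t -> 0 < u -> dd s u <= dd s t + dd t u) ->
  (forall t e : R, 0 < t -> 0 < e -> exists2 q : R, 0 < q & forall h : R, 0 < h < q -> dd (t + h) t < e) ->
  0 < r ->
  exists t0 : R, 0 < t0 < r /\ forall e : R, 0 < e ->
    exists2 q : R, 0 < q & forall s : R, `|s - t0| < q -> dd s t0 < e.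
Proof.
move=> dC dT dr r0.
have step (p : nat * (R * R)) : exists q : R * R, 0 < p.2.1 -> p.2.1 < p.2.2 ->
    [/\ p.2.1 < q.1, q.1 < q.2, q.2 < p.2.2 &
     forall s t, q.1 <= s <= q.2 -> q.1 <= t <= q.2 -> dd s t < p.1.+1%:R^-1].
  case: p => k [a b] /=.
  have [ab|ab] := ltP a b; last by exists (a, b) => /= _ h.
  have [a0|a0] := ltP 0 a; last by exists (a, b) => /= h.
  pose m := (a + b) / 2.
  have am : a < m by rewrite /m; lra.
  have mb : m < b by rewrite /m; lra.
  have m0 : 0 < m by rewrite (lt_trans a0).
  have k0 : 0 < k.+1%:R^-1 / 2 :> R by rewrite divr_gt0.
  have [q q0 hq] := dr m (k.+1%:R^-1 / 2) m0 k0.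
  (* Closeness to the orbit at m is known only on the right of m, so the next interval
     [m + l, m + 2 l] lies strictly on that side, inside both the range q and (m, b). *)
  pose l := Num.min q (b - m) / 3.
  have l0 : 0 < l by rewrite divr_gt0// lt_min q0 subr_gt0.
  have lq : 3 * l <= q by rewrite mulrC divfK// ge_min lexx.
  have lb : 3 * l <= b - m by rewrite mulrC divfK// ge_min lexx orbT.
  exists (m + l, m + 2 * l) => _ _ /=; split; try lra.
  move=> s t /andP[s1 s2] /andP[t1 t2].
  have hs : dd s m < k.+1%:R^-1 / 2.
    by rewrite -[s](subrK m) addrC; apply: hq; apply/andP; split; lra.
  have ht : dd t m < k.+1%:R^-1 / 2.
    by rewrite -[t](subrK m) addrC; apply: hq; apply/andP; split; lra.
  have := @dT s m t; rewrite [dd m t]dC => /(_ ltac:(lra) m0 ltac:(lra)) h.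
  move: hs ht h; move: (k.+1%:R^-1) => w; lra.
have /choice[nx hnx] := step.
pose I := fix I k := if k is k'.+1 then nx (k', I k') else (r / 3, r / 2).
have I0 k : 0 < (I k).1 /\ (I k).1 < (I k).2.
  elim: k => [|k [h1 h2]] /=; first by split; lra.
  have [h3 h4 h5 _] := hnx (k, I k) h1 h2.
  by split=> //; exact: lt_trans h3.
have IS k : [/\ (I k).1 < (I k.+1).1, (I k.+1).2 < (I k).2 &
     forall s t, (I k.+1).1 <= s <= (I k.+1).2 -> (I k.+1).1 <= t <= (I k.+1).2 ->
       dd s t < k.+1%:R^-1].
  by have [h1 h2] := I0 k; have [h3 h4 h5 h6] := hnx (k, I k) h1 h2.
have nd1 : {homo (fun k => (I k).1) : k l / (k <= l)%N >-> k <= l}.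
  by apply: homo_leq => // [x y z|k]; [exact: le_trans|have [/ltW] := IS k].
have nd2 : {homo (fun k => (I k).2) : k l / (k <= l)%N >-> k >= l}.
  by apply: homo_leq => // [x y z h1 h2|k]; [exact: le_trans h2 h1|have [_ /ltW] := IS k].
have I12 k l : (I k).1 <= (I l).2.
  apply: (@le_trans _ _ (I (maxn k l)).1); first exact/nd1/leq_maxl.
  apply: (@le_trans _ _ (I (maxn k l)).2); first exact/ltW/(I0 _).2.
  exact/nd2/leq_maxr.
pose E := range (fun k => (I k).1).
have hE : has_sup E.
  by split; [exists (I 0%N).1, 0%N|exists (I 0%N).2 => _ [k _ <-]].
pose t0 := sup E.
have t1 k : (I k).1 <= t0 by apply: sup_upper_bound => //; exists k.
have t2 k : t0 <= (I k).2.
  by apply: sup_le_ub; [by exists (I 0%N).1, 0%N|move=> _ [l _ <-]].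
exists t0; split.
  have /= := t1 0%N; have /= := t2 0%N; move=> h1 h2; apply/andP; split; lra.
move=> e e0.
have [k ke] : exists k : nat, k.+1%:R^-1 < e.
  have := near_infty_natSinv_lt (PosNum e0) => -[k _ /(_ k)]/= h.
  by exists k; exact: h.
have [h1 h2 h3] := IS k; have [g1 g2 _] := IS k.+1.
pose q := Num.min (t0 - (I k.+1).1) ((I k.+1).2 - t0).
have tt1 : (I k.+1).1 < t0 by exact: lt_le_trans (t1 k.+2).
have tt2 : t0 < (I k.+1).2 by exact: le_lt_trans (t2 k.+2) _.
exists q; first by rewrite lt_min !subr_gt0 tt1.
move=> s; rewrite lt_min => /andP[s1 s2].
apply: lt_trans ke; apply: h3; last by rewrite !ltW.
move: s1 s2; rewrite !ltr_norml => /andP[s1 s2] /andP[s3 s4].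
by apply/andP; split; lra.
Qed.

End real_lemmas.

Lemma at_right0P (R : realType) (P : R -> Prop) :
  (\forall h \near 0^'+, P h) <-> exists2 q : R, 0 < q & forall h, 0 < h < q -> P h.
Proof.
split.
  rewrite /at_right /within /= => /nbhs_ballP[q /= q0 hq]; exists q => // h /andP[h0 hq'].
  apply: hq => //=; rewrite /ball /= sub0r normrN gtr0_norm//.
move=> [q q0 hq]; near=> h; apply: hq; apply/andP; split.
  by near: h; exact: nbhs_right_gt.
by near: h; exact: nbhs_right_lt.
Unshelve. all: by end_near. Qed.

(** * Orbits of a strongly continuous semigroup *)

Section semigroup.
Context d (T : measurableType d) (R : realType).
Variable mu : {measure set T -> \bar R}.
Variables (B : (T -> R) -> (T -> R) -> Prop) (S : R -> (T -> R) -> T -> R).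
Hypothesis gen : generated_by mu B S.
Implicit Types u v w : T -> R.
Local Notation L2 := (L2 mu).
Local Notation nrm := (nrm mu).
Local Notation ip := (ip mu).

Lemma S_L2 t u : 0 <= t -> L2 u -> L2 (S t u).
Proof.
by move=> t0 hu; apply/inL2P; apply: (semigroup_L2 gen.1) => //; exact/inL2P.
Qed.

Lemma S_sub t u v : 0 <= t -> L2 u -> L2 v ->
  nrm (fun x => S t (fun y => u y - v y) x - (S t u x - S t v x)) = 0.
Proof.
move=> t0 hu hv.
have := semigroup_linear gen.1 (-1) t0 ((inL2P mu v).2 hv) ((inL2P mu u).2 hu).
have E : (fun x => -1 * v x + u x) = (fun x => u x - v x).
  by apply/funext => x; ring.
rewrite E L2distE; last 2 first.
- by apply: S_L2 => //; exact: L2B.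
- by apply: L2D; [apply: L2Z|]; exact: S_L2.
move=> [<-]; apply: eq_nrm => x; ring.
Qed.

Lemma S_scale t c u : 0 <= t -> L2 u ->
  nrm (fun x => S t (fun y => c * u y) x - c * S t u x) = 0.
Proof.
move=> t0 hu.
have h0 : nrm (S t (fun=> 0)) = 0.
  have := semigroup_linear gen.1 1 t0 ((inL2P mu _).2 (L2_0 mu)) ((inL2P mu _).2 (L2_0 mu)).
  have E : (fun x : T => 1 * 0 + 0 : R) = (fun=> 0) by apply/funext => x; ring.
  have hS := S_L2 t0 (L2_0 mu).
  rewrite E L2distE//; last by apply: L2D => //; exact: L2Z.
  move=> [h]; rewrite -[LHS]mul1r -(normrN1 R) -nrmZ// -[RHS]h.
  by apply: eq_nrm => x; ring.
have := semigroup_linear gen.1 c t0 ((inL2P mu u).2 hu) ((inL2P mu _).2 (L2_0 mu)).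
have E : (fun x => c * u x + 0) = (fun x => c * u x) by apply/funext => x; ring.
have hS := S_L2 t0 (L2_0 mu).
have h1 := S_L2 t0 (L2Z c hu); have h2 := L2Z c (S_L2 t0 hu).
rewrite E L2distE//; last by apply: L2D.
move=> [h]; apply/eqP; rewrite eq_le nrm_ge0 andbT.
apply: (@le_trans _ _ (nrm (fun x => S t (fun y => c * u y) x -
    (c * S t u x + S t (fun=> 0) x)) + nrm (S t (fun=> 0)))); last by rewrite h h0 addr0.
apply: le_trans (nrmD (L2B h1 (L2D h2 hS)) hS).
by rewrite le_eqVlt; apply/orP; left; apply/eqP; apply: eq_nrm => x; ring.
Qed.

Lemma nrm_eq0_add u v : L2 u -> L2 v -> nrm (fun x => u x - v x) = 0 -> nrm u = nrm v.
Proof.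
move=> hu hv h.
have H a b : L2 a -> L2 b -> nrm (fun x => a x - b x) = 0 -> nrm a <= nrm b.
  move=> ha hb hab; rewrite -[leRHS]add0r -hab.
  apply: le_trans (nrmD (L2B ha hb) hb).
  by rewrite le_eqVlt; apply/orP; left; apply/eqP; apply: eq_nrm => x; ring.
by apply/eqP; rewrite eq_le !H// nrmBC.
Qed.

Lemma S_bound t : 0 <= t -> exists2 M : R, 0 <= M & forall u v, L2 u -> L2 v ->
  nrm (fun x => S t u x - S t v x) <= M * nrm (fun x => u x - v x).
Proof.
move=> t0; have [M hM] := semigroup_bounded gen.1 t0.
exists (Num.max M 0); first by rewrite le_max lexx orbT.
move=> u v hu hv; have huv := L2B hu hv.
have h := hM _ ((inL2P mu _).2 huv).
have hS := S_L2 t0 huv.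
rewrite !LnormE// -EFinM lee_fin in h.
rewrite -(nrm_eq0_add hS (L2B (S_L2 t0 hu) (S_L2 t0 hv)) (S_sub t0 hu hv)).
by apply: (le_trans h); rewrite ler_wpM2r ?nrm_ge0// le_max lexx.
Qed.

Lemma S_add s t u : 0 <= s -> 0 <= t -> L2 u ->
  nrm (fun x => S (s + t) u x - S s (S t u) x) = 0.
Proof.
move=> s0 t0 hu; have := semigroup_add gen.1 s0 t0 ((inL2P mu u).2 hu).
rewrite L2distE; [by move=> [] | |].
- by apply: S_L2 => //; rewrite addr_ge0.
- by do 2! apply: S_L2 => //.
Qed.

Lemma L2dist_right0 (u_ : R -> T -> R) v : (forall h, 0 < h -> L2 (u_ h)) -> L2 v ->
  (L2dist mu (u_ h) v @[h --> 0^'+] --> 0%E <->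
  forall e : R, 0 < e -> exists2 q : R, 0 < q & forall h, 0 < h < q -> nrm (fun x => u_ h x - v x) < e).
Proof.
move=> hu hv.
have E h : 0 < h -> (fine \o (fun h => L2dist mu (u_ h) v)) h = nrm (fun x => u_ h x - v x).
  by move=> h0; rewrite /= L2distE//; exact: hu.
split.
  move=> /fine_cvgP[_ /cvgrPdist_lt hc] e e0.
  have /at_right0P[q q0 hq] := hc e e0.
  exists q => // h hhq; have h0 : 0 < h by case/andP: hhq.
  by have := hq h hhq; rewrite E// sub0r normrN ger0_norm// nrm_ge0.
move=> H; apply/fine_cvgP; split.
  apply/at_right0P; exists 1 => // h /andP[h0 _].
  by rewrite L2distE//; exact: hu.
apply/cvgrPdist_lt => e e0; apply/at_right0P; have [q q0 hq] := H e e0.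
exists q => // h hhq; have h0 : 0 < h by case/andP: hhq.
by rewrite E// sub0r normrN ger0_norm ?nrm_ge0//; exact: hq.
Qed.

Lemma S_right_cont u t (e : R) : L2 u -> 0 <= t -> 0 < e -> exists2 q : R, 0 < q &
  forall h, 0 < h < q -> nrm (fun x => S (t + h) u x - S t u x) < e.
Proof.
move=> hu t0 e0; have hS := S_L2 t0 hu.
have hl h : 0 < h -> L2 (S h (S t u)) by move=> h0; apply: S_L2 => //; exact: ltW.
have [q q0 hq] := (L2dist_right0 hl hS).1 (semigroup_cont gen.1 ((inL2P mu _).2 hS)) e e0.
exists q => // h hhq; have h0 : 0 < h by case/andP: hhq.
have h0' := ltW h0.
apply: le_lt_trans (hq h hhq).
have hth : 0 <= h + t by rewrite addr_ge0.
apply: le_trans (nrmB_triangle (S_L2 _ hu) (hl h h0) hS) _; first by rewrite addrC.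
by rewrite addrC [t + h]addrC S_add// addr0.
Qed.

(** One time t1 < t of two-sided continuity is enough: the single bounded operator S_(t - t1)
    carries left continuity from t1 to t. *)
Lemma S_left_cont u t (e : R) : L2 u -> 0 < t -> 0 < e -> exists2 q : R, 0 < q &
  forall h, 0 < h < q -> 0 <= t - h -> nrm (fun x => S t u x - S (t - h) u x) <= e.
Proof.
move=> hu t0 e0.
have hS s : 0 < s -> L2 (S s u) by move=> s0; exact: S_L2 (ltW s0) hu.
have [||| |t1 [/andP[t10 t1t] ht1]] := @right_continuous_point R
  (fun s r => if (0 < s) && (0 < r) then nrm (fun x => S s u x - S r u x) else 0) t.
- move=> s r; rewrite andbC; case: ifP => // /andP[r0 s0].
  by rewrite nrmBC//; exact: hS.
- move=> s r q s0 r0 q0; rewrite s0 r0 q0 /=.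
  by apply: nrmB_triangle; exact: hS.
- move=> s e' s0 e'0; have [q q0 hq] := S_right_cont hu (ltW s0) e'0.
  exists q => // h hhq; rewrite ifT; first exact: hq.
  by rewrite s0 andbT addr_gt0//; case/andP: hhq.
- exact: t0.
have tt1 : 0 <= t - t1 by rewrite subr_ge0 ltW.
have [M M0 hM] := S_bound tt1.
have M1 : 0 < M + 1 by rewrite ltr_wpDl.
have [q q0 hq] := ht1 (e / (M + 1)) (divr_gt0 e0 M1).
exists (Num.min q t1); first by rewrite lt_min q0.
move=> h /andP[h0]; rewrite lt_min => /andP[hhq ht].
move=> th0.
have t1h : 0 < t1 - h by rewrite subr_gt0.
have := hq (t1 - h); rewrite addrAC subrr add0r normrN gtr0_norm// => /(_ hhq).
rewrite t1h t10 /= => hn.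
have h1 := S_add tt1 (ltW t10) hu; have h2 := S_add tt1 (ltW t1h) hu.
rewrite subrK in h1; rewrite addrA subrK in h2.
have a1 := S_L2 (ltW t0) hu; have a2 := S_L2 th0 hu.
have a3 := S_L2 tt1 (hS _ t10); have a4 := S_L2 tt1 (hS _ t1h).
apply: le_trans (nrmB_triangle a1 a3 a2) _; rewrite h1 add0r.
apply: le_trans (nrmB_triangle a3 a4 a2) _.
rewrite [X in _ + X]nrmBC// h2 addr0.
apply: le_trans (hM _ _ (hS _ t10) (hS _ t1h)) _.
rewrite nrmBC; [|exact: hS|exact: hS].
apply: (@le_trans _ _ (M * (e / (M + 1)))); first by rewrite ler_wpM2l// ltW.
by rewrite mulrCA ger_pMr// ler_pdivrMr// mul1r lerDl.
Qed.

(** S_t commutes with the difference quotient at 0, and its bound M transports the convergence.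
    Linearity and the semigroup law hold only up to functions of norm 0, which is why the quotients
    are compared through the chain of zero norms [E1] to [E5]. *)
Lemma gen_orbit u v t : B u v -> L2 u -> L2 v -> 0 <= t ->
  B (S t u) (S t v) /\
  forall e : R, 0 < e -> exists2 q : R, 0 < q & forall h, 0 < h < q ->
    nrm (fun x => h^-1 * (S (t + h) u x - S t u x) - S t v x) < e.
Proof.
move=> Buv hu hv t0.
have h0u h : 0 <= h -> L2 (S h u) by move=> ?; exact: S_L2.
have Stu := S_L2 t0 hu; have Stv := S_L2 t0 hv.
have lq w (h : R) : L2 w -> 0 < h -> L2 (fun x => h^-1 * (S h w x - w x)).
  by move=> hw h0; apply: L2Z; apply: L2B => //; exact: S_L2 (ltW h0) hw.
have H0 := (L2dist_right0 (fun h => lq u h hu) hv).1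
  ((gen.2 u v ((inL2P mu u).2 hu) ((inL2P mu v).2 hv)).1 Buv).
have [M M0 hM] := S_bound t0.
have key (h : R) : 0 < h -> nrm (fun x => h^-1 * (S (t + h) u x - S t u x) - S t v x) <=
    M * nrm (fun x => h^-1 * (S h u x - u x) - v x) /\
    nrm (fun x => h^-1 * (S h (S t u) x - S t u x) - S t v x) <=
    M * nrm (fun x => h^-1 * (S h u x - u x) - v x).
  move=> h0; have h0' := ltW h0.
  have th : 0 <= t + h by rewrite addr_ge0.
  have b1 := L2Z h^-1 (L2B (h0u _ th) Stu).
  have Shu := h0u _ h0'.
  have b2 := S_L2 t0 (lq u h hu h0).
  have b0 := S_L2 h0' Stu.
  have b3 := L2Z h^-1 (L2B b0 Stu).
  have StShu := S_L2 t0 Shu.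
  have E1 : nrm (fun x => S (t + h) u x - S t (S h u) x) = 0 by exact: S_add.
  have b4 := S_L2 t0 (L2B Shu hu).
  have b5 := L2B StShu Stu.
  have E2 : nrm (fun x => S t (fun x => h^-1 * (S h u x - u x)) x - h^-1 * (S t (S h u) x - S t u x)) = 0.
    apply/eqP; rewrite eq_le nrm_ge0 andbT.
    apply: le_trans (nrmB_triangle b2 (L2Z h^-1 b4) (L2Z h^-1 b5)) _.
    rewrite S_scale ?add0r//; last exact: L2B.
    rewrite (@eq_nrm _ _ _ mu _ (fun x => h^-1 * (S t (fun x => S h u x - u x) x - (S t (S h u) x - S t u x)))); last first.
      by move=> x; ring.
    by rewrite nrmZ ?S_sub ?mulr0//; exact: L2B.
  have E3 : nrm (fun x => h^-1 * (S t (S h u) x - S t u x) - h^-1 * (S (t + h) u x - S t u x)) = 0.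
    rewrite (@eq_nrm _ _ _ mu _ (fun x => - h^-1 * (S (t + h) u x - S t (S h u) x))); last first.
      by move=> x; ring.
    by rewrite nrmZ ?E1 ?mulr0//; apply: L2B => //; exact: h0u.
  have E4 : nrm (fun x => S (t + h) u x - S h (S t u) x) = 0 by rewrite addrC; exact: S_add.
  have E5 : nrm (fun x => h^-1 * (S (t + h) u x - S t u x) - h^-1 * (S h (S t u) x - S t u x)) = 0.
    rewrite (@eq_nrm _ _ _ mu _ (fun x => h^-1 * (S (t + h) u x - S h (S t u) x))); last first.
      by move=> x; ring.
    by rewrite nrmZ ?E4 ?mulr0//; apply: L2B => //; exact: h0u.
  have F1 : nrm (fun x => h^-1 * (S (t + h) u x - S t u x) - S t v x) <=
    M * nrm (fun x => h^-1 * (S h u x - u x) - v x).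
    apply: le_trans (nrmB_triangle b1 (L2Z h^-1 b5) Stv) _.
    rewrite nrmBC ?E3 ?add0r//; last exact: L2Z.
    apply: le_trans (nrmB_triangle (L2Z h^-1 b5) b2 Stv) _.
    rewrite nrmBC ?E2 ?add0r//; last exact: L2Z.
    by apply: hM => //; exact: lq.
  split=> //; apply: le_trans F1.
  apply: le_trans (nrmB_triangle b3 b1 Stv) _.
  by rewrite nrmBC// E5 add0r.
have Hq e : 0 < e -> exists2 q : R, 0 < q & forall h, 0 < h < q ->
    M * nrm (fun x => h^-1 * (S h u x - u x) - v x) < e.
  move=> e0; have M1 : 0 < M + 1 by rewrite ltr_wpDl.
  have [q q0 hq] := H0 (e / (M + 1)) (divr_gt0 e0 M1).
  exists q => // h /hq hn.
  apply: (@le_lt_trans _ _ ((M + 1) * nrm (fun x => h^-1 * (S h u x - u x) - v x))).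
    by rewrite ler_wpM2r ?nrm_ge0// lerDl.
  by rewrite mulrC -ltr_pdivlMr.
split.
  apply/(gen.2 _ _ ((inL2P mu _).2 Stu) ((inL2P mu _).2 Stv)).
  apply/(L2dist_right0 (fun h => lq _ h Stu) Stv) => e /Hq[q q0 hq].
  exists q => // h hh; have h0 : 0 < h by case/andP: hh.
  exact: le_lt_trans (key h h0).2 (hq h hh).
move=> e /Hq[q q0 hq]; exists q => // h hh; have h0 : 0 < h by case/andP: hh.
exact: le_lt_trans (key h h0).1 (hq h hh).
Qed.

End semigroup.

(** * A smooth convex substitute for the squared positive part *)

Section convex_cutoff.
Context {R : realType}.

(** For x > 0 this is x^2 e^(-1/x). The factor x^2 cancels the x^(-2) produced by the exponential,
    so the derivative is (2 x + 1) e^(-1/x). The function vanishes for x <= 0, is positive for x >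
    0, is at most x^2, and is convex with a Lipschitz derivative: exactly what a truncation in L^2
    requires. *)
Definition cutJ (x : R) : R := x ^+ 2 * flat1 x.
Definition cutJ' (x : R) : R := (2 * x + 1) * flat1 x.

Lemma smooth_cutJ' : smooth cutJ'.
Proof.
apply: smooth_mul; last exact: smooth_flat.
apply: smooth_add; last exact: smooth_cst.
by apply: smooth_mul; [exact: smooth_cst|exact: smooth_id].
Qed.

Lemma flat1_le1 (x : R) : flat1 x <= 1.
Proof.
rewrite /flat1 /flat; case: ifP => x0; last exact: ler01.
rewrite hornerE ?mul1r -(expR0 R) ler_expR oppr_le0 invr_ge0 ltW//.
Qed.

Lemma cutJ_ge0 x : 0 <= cutJ x.
Proof. by rewrite mulr_ge0 ?sqr_ge0 ?flat1_ge0. Qed.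

Lemma cutJ_le x : cutJ x <= x ^+ 2.
Proof. by rewrite -[leRHS]mulr1 ler_wpM2l ?sqr_ge0 ?flat1_le1. Qed.

Lemma cutJ_le0 x : x <= 0 -> cutJ x = 0.
Proof. by move=> x0; rewrite /cutJ flat1_le0// mulr0. Qed.

Lemma cutJ'_le0 x : x <= 0 -> cutJ' x = 0.
Proof. by move=> x0; rewrite /cutJ' flat1_le0// mulr0. Qed.

Lemma flatXn_pos k (x : R) : 0 < x -> flat 'X^k x = x^-1 ^+ k * expR (- x^-1).
Proof. by rewrite /flat => ->; rewrite hornerXn. Qed.

Lemma flat1_derive (x : R) : is_derive x 1 flat1 (flat 'X^2 x).
Proof. by have := flat_derive 1 x; rewrite derivC subr0 mulr1. Qed.

Lemma cutJ_derive (x : R) : is_derive x 1 cutJ (cutJ' x).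
Proof.
have d2 : is_derive x (1 : R) (fun y : R => y ^+ 2) (2 * x).
  have := is_deriveX 2 (is_derive_id x (1 : R)).
  by rewrite /GRing.scale /= expr1 mulr1.
have := is_deriveM d2 (flat1_derive x).
move=> h; apply: is_derive_eq h _; rewrite /GRing.scale /= /cutJ'.
have [x0|x0] := leP x 0.
  by rewrite [flat _ x]/flat ifN -?leNgt// flat1_le0// !(mulr0, mul0r) addr0.
rewrite flatXn_pos// /flat1 /flat x0 hornerC mul1r; field.
by rewrite gt_eqF.
Qed.

Lemma cutJ'_derive (x : R) : is_derive x 1 cutJ' (2 * flat1 x + (2 * x + 1) * flat 'X^2 x).
Proof.
have d2 : is_derive x (1 : R) (fun y : R => 2 * y + 1) 2.
  have := is_deriveD (is_deriveZ 2 (is_derive_id x (1 : R))) (is_derive_cst (1 : R) x (1 : R)).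
  by rewrite /GRing.scale /= mulr1 addr0.
have := is_deriveM d2 (flat1_derive x).
move=> h; apply: is_derive_eq h _; rewrite /GRing.scale /=; ring.
Qed.

Lemma derive_cutJ'_ge0 x : 0 <= 'D_1 cutJ' x.
Proof.
have [_ ->] := cutJ'_derive x.
have [x0|x0] := leP x 0.
  by rewrite [flat _ x]/flat ifN -?leNgt// flat1_le0// !mulr0 addr0.
rewrite addr_ge0 ?mulr_ge0 ?flat1_ge0//; first lra.
by rewrite flatXn_pos// mulr_ge0 ?expR_ge0// exprn_ge0// invr_ge0 ltW.
Qed.

Lemma derive_cutJ'_le x : 'D_1 cutJ' x <= 6.
Proof.
have [_ ->] := cutJ'_derive x.
have [x0|x0] := leP x 0.
  by rewrite [flat _ x]/flat ifN -?leNgt// flat1_le0// !mulr0 addr0.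
rewrite flatXn_pos// /flat1 /flat x0 hornerC mul1r.
have y0 : 0 < x^-1 by rewrite invr_gt0.
have xy : x * x^-1 = 1 by rewrite mulfV// gt_eqF.
move: (x^-1) y0 xy => y y0 xy.
have xyy : x * y ^+ 2 = y by rewrite expr2 mulrA xy mul1r.
(* With y = 1/x the second derivative is (2 + 2 y + y^2) e^(-y), and both e^y >= 1 + y and e^y >= 1
   + y^2/2 bound it; 6 is a convenient constant. *)
have -> : 2 * expR (- y) + (2 * x + 1) * (y ^+ 2 * expR (- y)) =
    (2 + 2 * (x * y ^+ 2) + y ^+ 2) * expR (- y) by ring.
rewrite xyy.
rewrite expRN ler_pdivrMr ?expR_gt0//.
have h1 := expR_ge1Dx y.
have h2 := expR_ge1Dxn 1 (ltW y0).
have E2 : (2`!%:R : R) = 2 by [].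
rewrite E2 in h2.
move: (expR y) h1 h2 => E h1 h2; nra.
Qed.

Lemma cutJ'_nd : {homo cutJ' : x y / x <= y}.
Proof.
move=> x y xy.
have [||c _ e] := @MVT_segment R cutJ' ('D_1 cutJ') x y xy.
- by move=> z _; apply: smooth_is_derive; exact: smooth_cutJ'.
- by apply: continuous_subspaceT; exact: (smooth_continuous smooth_cutJ').
by rewrite -subr_ge0 e mulr_ge0 ?subr_ge0// derive_cutJ'_ge0.
Qed.

Lemma cutJ'_lip x y : `|cutJ' y - cutJ' x| <= 6 * `|y - x|.
Proof.
wlog xy : x y / x <= y.
  move=> h; have [/h//|/ltW/h] := leP x y.
  by rewrite distrC [`|x - y|]distrC.
have [||c _ ->] := @MVT_segment R cutJ' ('D_1 cutJ') x y xy.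
- by move=> z _; apply: smooth_is_derive; exact: smooth_cutJ'.
- by apply: continuous_subspaceT; exact: (smooth_continuous smooth_cutJ').
rewrite normrM ler_wpM2r// ger0_norm ?derive_cutJ'_ge0//.
exact: derive_cutJ'_le.
Qed.

Lemma continuous_cutJ : continuous cutJ.
Proof.
move=> x; apply: differentiable_continuous; apply/derivable1_diffP.
by have [] := cutJ_derive x.
Qed.

Lemma cutJ_convex x y : cutJ y - cutJ x <= cutJ' y * (y - x).
Proof.
have H a b : a <= b -> exists2 c, a <= c <= b & cutJ b - cutJ a = cutJ' c * (b - a).
  move=> ab; have [||c cab e] := @MVT_segment R cutJ cutJ' a b ab.
  - by move=> z _; exact: cutJ_derive.
  - by apply: continuous_subspaceT; exact: continuous_cutJ.
  by exists c => //; move: cab; rewrite in_itv.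
have [xy|/ltW xy] := leP x y.
  have [c /andP[c1 c2] ->] := H _ _ xy.
  by rewrite ler_wpM2r ?subr_ge0// cutJ'_nd.
have [c /andP[c1 c2] e] := H _ _ xy.
rewrite -[leLHS]opprB e -mulrN opprB -subr_ge0 -mulrBl mulr_le0//.
  by rewrite subr_le0 cutJ'_nd.
by rewrite subr_le0.
Qed.

End convex_cutoff.

Section misc_topology.
Context {R : realType}.

Lemma continuous_seq (V : normedModType R) (G : V -> R) (x : V) :
  (forall u : nat -> V, u m @[m --> \oo] --> x -> G (u m) @[m --> \oo] --> G x) ->
  {for x, continuous G}.
Proof.
move=> H; apply/cvgrPdist_lt => e e0; apply: contrapT => hn.
have h1 m : exists y : V, `|x - y| < m.+1%:R^-1 /\ e <= `|G x - G y|.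
  apply: contrapT => h; apply: hn; apply/nbhs_ballP.
  exists m.+1%:R^-1 => /=; first by rewrite invr_gt0.
  move=> y; rewrite -ball_normE /= => xy; rewrite ltNge; apply/negP => ey.
  by apply: h; exists y.
have /choice[u hu] := h1.
have cu : u m @[m --> \oo] --> x.
  apply/cvgrPdist_lt => r r0; near=> m.
  rewrite (lt_trans (hu m).1)//; near: m; exact: (near_infty_natSinv_lt (PosNum r0)).
have /cvgrPdist_lt/(_ e e0) := H u cu.
move=> [N _ /(_ N)] /= h; have := h (leqnn N).
by rewrite ltNge (hu N).2.
Unshelve. all: by end_near. Qed.

End misc_topology.

Lemma smooth_prod {R : realType} {V : normedModType R} (I : Type) (r : seq I) (F : I -> V -> R) :
  (forall i, smooth (F i)) -> smooth (fun x => \prod_(i <- r) F i x).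
Proof.
move=> sF; elim: r => [|i r ih].
  rewrite (_ : (fun _ => _) = fun=> 1); first exact: smooth_cst.
  by apply/funext => x; rewrite big_nil.
rewrite (_ : (fun _ => _) = fun x => F i x * \prod_(j <- r) F j x); last first.
  by apply/funext => x; rewrite big_cons.
by apply: smooth_mul; [exact: sF|exact: ih].
Qed.

(** * Positive integrals and localisation by bumps *)

Section positivity.
Context {R : realType}.

Lemma itv_gt0 (C : R) : 0 < C -> (0 < lebesgue_measure (`[(- C)%R, C]%classic : set R))%E.
Proof.
move=> C0; have := @lebesgue_measure_itv R `[- C, C].
by rewrite /= lte_fin gtrN ?C0// => ->; rewrite lte_fin; lra.
Qed.

Lemma leb_ball_gt0 m (C : R) : 0 < C -> (0 < leb m [set v : 'rV[R]_m | (`|v| <= C)%R])%E.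
Proof.
move=> C0; elim: m => [|m ih].
  by rewrite /= diracE mem_set ?lte01//= normr0; exact: ltW.
apply: (@lt_le_trans _ _ ((lebesgue_measure \x leb m)%E
    (`[- C, C]%classic `*` [set v : 'rV[R]_m | `|v| <= C]))).
  rewrite product_measure1E//; last exact: measurable_norm_le.
  by apply: mule_gt0 => //; exact: itv_gt0.
rewrite /= /leb_step /pushforward; apply: le_measure; rewrite ?inE.
- by apply: measurableX => //; exact: measurable_norm_le.
- rewrite -[X in measurable X]setTI; apply: measurable_rV_cons => //.
  exact: measurable_norm_le.
- move=> [x w] /= []; rewrite in_itv/= -ler_norml => hx hw.
  apply: rV_norm_le => [|i]; first exact: ltW.
  have := unliftP ord0 i; case=> [j ->|->].
    by rewrite rV_consS (le_trans (rV_coord_le _ _)).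
  by rewrite rV_cons0.
Qed.

Context {n : nat}.
Local Notation V := (R * 'rV[R]_n)%type.
Local Notation haar := (@haar R n).
Local Notation test := (@test_function R V).

Lemma haar_ball_gt0 (C : R) : 0 < C -> (0 < haar [set v : V | (`|v| <= C)%R])%E.
Proof.
move=> C0; apply: (@lt_le_trans _ _ ((lebesgue_measure \x leb n)%E
    (`[- C, C]%classic `*` [set v : 'rV[R]_n | `|v| <= C]))).
  rewrite product_measure1E//; last exact: measurable_norm_le.
  by apply: mule_gt0; [exact: itv_gt0|exact: leb_ball_gt0].
apply: le_measure; rewrite ?inE.
- by apply: measurableX => //; exact: measurable_norm_le.
- exact: measurable_prod_norm_le.
- by move=> [x w] /= []; rewrite in_itv/= -ler_norml prod_normE /= ge_max => -> ->.
Qed.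

Definition bumpV (x0 : V) (m : nat) (x : V) : R :=
  bump ((x.1 - x0.1) * m.+1%:R) * \prod_(i < n) bump ((x.2 ord0 i - x0.2 ord0 i) * m.+1%:R).

Lemma smooth_bumpV x0 m : smooth (bumpV x0 m).
Proof.
apply: smooth_mul.
  apply: smooth_comp; first exact: smooth_bump.
  apply: smooth_mul; last exact: smooth_cst.
  by apply: smooth_add; [exact: smooth_fst|exact: smooth_cst].
apply: smooth_prod => i; apply: smooth_comp; first exact: smooth_bump.
apply: smooth_mul; last exact: smooth_cst.
by apply: smooth_add; [exact: smooth_coord|exact: smooth_cst].
Qed.

Lemma bumpV_ge0 x0 m x : 0 <= bumpV x0 m x.
Proof. by rewrite mulr_ge0 ?bump_ge0// prodr_ge0// => i _; exact: bump_ge0. Qed.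

Lemma bumpV_le1 x0 m x : bumpV x0 m x <= 1.
Proof.
have h : \prod_(i < n) bump ((x.2 ord0 i - x0.2 ord0 i) * m.+1%:R) <= 1.
  by apply: prodr_ile1 => i _; rewrite bump_ge0 bump_le1.
rewrite -[leRHS]mulr1 ler_pM ?bump_ge0 ?bump_le1//.
by apply: prodr_ge0 => i _; exact: bump_ge0.
Qed.

Lemma bumpV_center x0 m : bumpV x0 m x0 = 1.
Proof.
rewrite /bumpV subrr mul0r bump0 mul1r; apply: big1 => i _.
by rewrite subrr mul0r bump0.
Qed.

Lemma bumpV_out x0 m x : m.+1%:R^-1 < `|x - x0| -> bumpV x0 m x = 0.
Proof.
have m0 : 0 < m.+1%:R :> R by rewrite ltr0n.
have hb (y : R) : m.+1%:R^-1 <= `|y| -> bump (y * m.+1%:R) = 0.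
  by move=> h; rewrite bump_out// normrM [X in _ * X]ger0_norm// -ler_pdivrMr// div1r.
rewrite prod_normE lt_max => /orP[h|h].
  by rewrite /bumpV hb ?mul0r// ltW.
rewrite /bumpV.
have [i hi] : exists i, m.+1%:R^-1 < `|x.2 ord0 i - x0.2 ord0 i|.
  apply: contrapT => hn; move: h; rewrite ltNge => /negP; apply.
  apply: rV_norm_le => [|i]; first by rewrite invr_ge0.
  by rewrite leNgt; apply/negP => hi; apply: hn; exists i; move: hi; rewrite !mxE.
by rewrite (bigD1 i)//= [X in _ * (X * _)]hb ?mul0r ?mulr0//; exact: ltW.
Qed.

Lemma test_bumpV x0 m : test (bumpV x0 m).
Proof.
apply/testP; split; first exact: smooth_bumpV.
exists (`|x0| + m.+1%:R^-1) => x hx; apply: bumpV_out.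
have := lerB_normD (x : V) (- x0); rewrite normrN; apply: lt_le_trans.
by rewrite ltrBrDl.
Qed.

Lemma int_test_gt0 (f : V -> R) (x0 : V) : test f -> (forall x, 0 <= f x) -> 0 < f x0 ->
  0 < \int[haar]_x f x.
Proof.
move=> tf f0 fx0; have sf := test_smooth tf.
have := @smooth_continuous _ _ _ sf x0 => /cvgrPdist_lt/(_ (f x0 / 2)).
rewrite divr_gt0// => /(_ isT)/nbhs_ballP[r /= r0 hr].
rewrite -(Rint_haar_shift x0 (smooth_measurable sf)).2.
pose B := [set v : V | `|v| <= r / 2].
have mB : measurable (B : set (measurableTypeR R * 'rV[R]_n)) by exact: measurable_prod_norm_le.
have iB : integ haar (\1_B : V -> R).
  apply: (@integ_bounded_support _ _ _ haar B _ 1) => //.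
  - exact: haar_ball_fin.
  - by move=> x; rewrite indicE ger0_norm// lern1 leq_b1.
  - by move=> x xB; rewrite indicE memNset.
apply: (@lt_le_trans _ _ (\int[haar]_x (f x0 / 2 * \1_B x))).
  rewrite RintZ// mulr_gt0 ?divr_gt0// -lte_fin EFin_Rint// integral_indic// setIT.
  by apply: haar_ball_gt0; rewrite divr_gt0.
apply: Rint_le => [||x]; first exact: integZ.
  exact: (Rint_haar_shift x0 (smooth_measurable sf)).1.2 (test_integ tf).
rewrite indicE; case: (boolP (x \in B)) => xB; last by rewrite mulr0.
rewrite mulr1; have : ball x0 r (x + x0).
  rewrite -ball_normE /= opprD addrCA subrr addr0 normrN.
  move: xB; rewrite inE /B /= => xB; apply: le_lt_trans xB _.
  by rewrite ltr_pdivrMr// ltr_pMr// ltr1n.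
move=> /hr; rewrite ltr_norml => /andP[_]; lra.
Qed.

(** The passage from integrated to pointwise inequalities. Facts about the class of S_t F in L^2
    become facts about its continuous representative at every point. *)
Lemma test_localization (G : V -> R) : continuous G ->
  (forall psi, test psi -> (forall x, 0 <= psi x) -> \int[haar]_x (G x * psi x) <= 0) ->
  forall x, G x <= 0.
Proof.
move=> cG H x0; rewrite leNgt; apply/negP => G0.
have := cG x0 => /cvgrPdist_lt/(_ (G x0 / 2)).
rewrite divr_gt0// => /(_ isT)/nbhs_ballP[r /= r0 hr].
have [m mr] : exists m : nat, m.+1%:R^-1 < r.
  by have := near_infty_natSinv_lt (PosNum r0) => -[k _ /(_ k)]/= h; exists k; exact: h.
pose psi := bumpV x0 m; have tpsi : test psi := test_bumpV x0 m.
have := H _ tpsi (bumpV_ge0 x0 m); rewrite leNgt => /negP; apply.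
apply: (@lt_le_trans _ _ (\int[haar]_x (G x0 / 2 * psi x))).
  rewrite RintZ ?test_integ// mulr_gt0 ?divr_gt0//.
  by apply: (@int_test_gt0 psi x0) => //; [exact: bumpV_ge0|rewrite /psi bumpV_center].
apply: Rint_le => [||x]; first by apply: integZ; exact: test_integ.
  have [C [M hM]] : exists C, exists M, forall x : V, `|x| <= C -> `|psi x| <= M /\ True.
    by exists 0, 1 => x _; split=> //; rewrite ger0_norm ?bumpV_le1// bumpV_ge0.
  have [_ /compactly_supportedP[D hD]] := tpsi.
  apply: continuous_compact_integ.
    by move=> x; apply: cvgM; [exact: cG|exact: smooth_continuous tpsi.1 _].
  by apply/compactly_supportedP; exists D => x /hD ->; rewrite mulr0.
have [xr|xr] := ltP `|x - x0| r.
  rewrite ler_wpM2r ?bumpV_ge0//.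
  have : ball x0 r x by rewrite -ball_normE /= distrC.
  move=> /hr; rewrite ltr_norml => /andP[_]; lra.
by rewrite /psi bumpV_out ?mulr0// (lt_le_trans mr).
Qed.

End positivity.

(** * The group and its Friedrichs Laplacian *)

Section group.
Context {R : realType} {n : nat}.
Local Notation V := (R * 'rV[R]_n)%type.
Implicit Types (g h : V).

Lemma crd_ord (z : 'rV[R]_n) (j : 'I_n) : crd z j.+1 = z ord0 j.
Proof. by rewrite /crd /= valK. Qed.

Lemma crd_le (z : 'rV[R]_n) j : `|crd z j| <= `|z|.
Proof. by rewrite /crd; case: insubP => [u _ _|_]; rewrite ?rV_coord_le// normr0. Qed.

Lemma smooth_crd (W : normedModType R) (l : W -> 'rV[R]_n) k :
  (forall i, smooth (fun x => l x ord0 i)) -> smooth (fun x : W => crd (l x) k).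
Proof.
move=> sl; rewrite /crd; case: insubP => [u _ _|_]; first exact: sl.
exact: smooth_cst.
Qed.

Definition GmulS (h g : V) (j : nat) : R :=
  crd h.2 j.+1 + \sum_(0 <= i < j.+1) h.1 ^+ i / i`!%:R * crd g.2 (j.+1 - i).

Lemma GmulE h g j : (Gmul h g).2 ord0 j = GmulS h g j.
Proof. by rewrite /Gmul mxE. Qed.

Lemma continuous_Gmul : continuous (fun x : V * V => Gmul x.1 x.2).
Proof.
pose W := (V * V)%type.
have s1 : smooth (fun x : W => x.1.1).
  apply: smooth_linear => // x.
  by apply: (@continuous_comp _ _ _ (fun x : W => x.1) fst); exact: cvg_fst.
have s2 : smooth (fun x : W => x.2.1).
  apply: smooth_linear => // x.
  by apply: (@continuous_comp _ _ _ (fun x : W => x.2) fst); [exact: cvg_snd|exact: cvg_fst].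
have c1 : continuous (fun x : W => x.1.2).
  by move=> x; apply: (@continuous_comp _ _ _ (fun x : W => x.1) snd); [exact: cvg_fst|exact: cvg_snd].
have c2 : continuous (fun x : W => x.2.2).
  by move=> x; apply: (@continuous_comp _ _ _ (fun x : W => x.2) snd); exact: cvg_snd.
have s3 i : smooth (fun x : W => x.1.2 ord0 i).
  apply: smooth_linear => [x|c u w]; last by rewrite /= !mxE.
  by apply: (@continuous_comp _ _ _ (fun x : W => x.1.2) (fun w : 'rV[R]_n => w ord0 i));
    [exact: c1|exact: rV_coord_continuous].
have s4 i : smooth (fun x : W => x.2.2 ord0 i).
  apply: smooth_linear => [x|c u w]; last by rewrite /= !mxE.
  by apply: (@continuous_comp _ _ _ (fun x : W => x.2.2) (fun w : 'rV[R]_n => w ord0 i));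
    [exact: c2|exact: rV_coord_continuous].
have s5 j : smooth (fun x : W => GmulS x.1 x.2 j).
  have s6 i : smooth (fun x : W => crd x.1.2 i) by exact: smooth_crd s3.
  have s7 i : smooth (fun x : W => crd x.2.2 i) by exact: smooth_crd s4.
  apply: (smooth_add (s6 j.+1)); apply: smooth_sum => i.
  exact: (smooth_mul (smooth_mul (smooth_exp i s1) (smooth_cst _)) (s7 _)).
move=> x; apply: (@cvg_pair _ _ _ (nbhs x) (nbhs (Gmul x.1 x.2).1) (nbhs (Gmul x.1 x.2).2)
  _ _ _ (fun x : W => (Gmul x.1 x.2).1) (fun x : W => (Gmul x.1 x.2).2)).
  by apply: cvgD; [exact: (smooth_continuous s1)|exact: (smooth_continuous s2)].
apply: cvg_rV => j /=.
have E : (fun x : W => GmulS x.1 x.2 j) = (fun x : W => (Gmul x.1 x.2).2 ord0 j).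
  by apply/funext => y; rewrite GmulE.
have := @smooth_continuous _ _ _ (s5 j) x; rewrite E; exact.
Qed.

Lemma Gmul0 g : Gmul 0 g = g.
Proof.
case: g => a z; rewrite /Gmul /= add0r; congr pair; apply/rowP => j.
rewrite mxE big_nat_recl// big1_seq ?addr0; last first.
  by move=> i _; rewrite expr0n mul0r mul0r.
rewrite expr0 fact0 divr1 mul1r subn0 !crd_ord.
by rewrite mxE add0r.
Qed.

(** Properness of the group law, without inverses: the product is triangular, so the coordinate of
    index k of g equals that of h g minus terms in h and in earlier coordinates of g, and the bound
    follows by induction on k. *)
Lemma Gmul_bound (C : R) : 0 <= C -> exists D, forall h g, `|h| <= C -> `|Gmul h g| <= C -> `|g| <= D.
Proof.
move=> C0.
have H m : exists2 D, 0 <= D & forall h g, `|h| <= C -> `|Gmul h g| <= C ->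
    forall k, (0 < k <= m)%N -> (k <= n)%N -> `|crd g.2 k| <= D.
  elim: m => [|m [D D0 hD]]; first by exists 0 => // h g _ _ [|k].
  exists (D + (C + C + \sum_(0 <= i < m) C ^+ i.+1 / (i.+1)`!%:R * D)).
    rewrite !addr_ge0// sumr_ge0// => i _.
    by rewrite mulr_ge0// divr_ge0// exprn_ge0.
  move=> h g hC gC k /andP[k0]; rewrite leq_eqVlt => /predU1P[->|km] kn; last first.
    apply: le_trans (hD h g hC gC k _ kn) _; first by rewrite k0.
    rewrite lerDl !addr_ge0// sumr_ge0// => i _.
    by rewrite mulr_ge0// divr_ge0// exprn_ge0.
  have := GmulE h g (Ordinal kn); rewrite /GmulS /= big_nat_recl//.
  rewrite expr0 fact0 divr1 mul1r subn0 => e.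
  have -> : crd g.2 m.+1 = (Gmul h g).2 ord0 (Ordinal kn) - crd h.2 m.+1 -
     \sum_(0 <= i < m) h.1 ^+ i.+1 / (i.+1)`!%:R * crd g.2 (m.+1 - i.+1) by rewrite e; ring.
  apply: (@le_trans _ _ (C + C + \sum_(0 <= i < m) C ^+ i.+1 / (i.+1)`!%:R * D)); last by rewrite lerDr.
  apply: (le_trans (ler_normB _ _)); apply: lerD.
    apply: (le_trans (ler_normB _ _)); apply: lerD.
      apply: le_trans (rV_coord_le _ _) _; apply: le_trans gC.
      by rewrite [leRHS]prod_normE le_max lexx orbT.
    apply: le_trans (crd_le _ _) _; apply: le_trans hC.
    by rewrite [leRHS]prod_normE le_max lexx orbT.
  apply: (le_trans (ler_norm_sum _ _ _)); apply: ler_sum_nat => i /andP[_ im].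
  rewrite normrM ler_pM//.
    rewrite normrM normfV [X in _ / X]ger0_norm// ler_wpM2r ?invr_ge0//.
    rewrite normrX lerXn2r ?nnegrE// (le_trans _ hC)//.
    by rewrite [leRHS]prod_normE le_max lexx.
  apply: hD hC gC _ _ _; last by rewrite (leq_trans _ (ltnW kn))// leq_subLR addSn ltnS leq_addl.
  by rewrite subSS subn_gt0 im leq_subr.
have [D D0 hD] := H n.
exists (C + C + D) => h g hC gC; rewrite prod_normE ge_max; apply/andP; split.
  have -> : g.1 = (Gmul h g).1 - h.1 by rewrite /Gmul /= addrC addKr.
  apply: (le_trans (ler_normB _ _)); apply: (@le_trans _ _ (C + C)); last by rewrite lerDl.
  apply: lerD; [apply: le_trans gC|apply: le_trans hC]; by rewrite [leRHS]prod_normE le_max lexx.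
apply: rV_norm_le => [|i]; first by rewrite !addr_ge0.
rewrite -crd_ord; apply: (le_trans (hD h g hC gC i.+1 _ _)); [exact: ltn_ord|exact: ltn_ord|].
by rewrite lerDr addr_ge0.
Qed.

End group.

Lemma oppr_add_le {R : realType} (x y c : R) : 0 <= y -> `|x| <= c -> - (x + y) <= c.
Proof. by rewrite ler_norml => y0 /andP[h _]; lra. Qed.

Lemma le_half_dist {R : realType} (x y e : R) : y <= e / 2 -> `|x - y| <= e / 2 -> x <= e.
Proof. by rewrite ler_norml => h /andP[_ h']; lra. Qed.

(** * Dissipativity of the Friedrichs extension and the Markov property *)

Section friedrichs.
Context {R : realType} {n : nat}.
Local Notation V := (R * 'rV[R]_n)%type.
Local Notation haar := (@haar R n).
Local Notation test := (@test_function R V).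
Local Notation A := (@sublaplacian R n).
Local Notation B := (friedrichs haar test A).
Local Notation L2 := (L2 haar).
Local Notation nrm := (nrm haar).
Local Notation ip := (ip haar).
Implicit Types (f g psi : V -> R).

Lemma test_L2 f : test f -> L2 f.
Proof.
move=> tf; split; first exact: smooth_measurable tf.1.
by apply: eq_integ (test_integ (test_mulr tf tf.1)) => x; rewrite expr2.
Qed.

Lemma friedrichs_test f : test f -> B f (A f).
Proof.
move=> tf; have lf := test_L2 tf; split.
- split; first exact/inL2P.
  exists (fun=> f); split=> //.
    rewrite L2distE// (_ : nrm _ = 0); first exact: cvg_cst.
    rewrite /nrm /ip (eq_Rint haar (g := fun=> 0)) ?Rint0 ?sqrtr0// => x.
    by rewrite subrr mul0r.
  move=> e e0; exists 0%N => k l _ _; rewrite /energy (eq_Rint haar (g := fun=> 0)) ?Rint0// => x.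
  by rewrite [X in _ * X](_ : _ = 0) ?mulr0//= subrr.
- exact/inL2P/test_L2/test_sublaplacian.
- by move=> psi tpsi; rewrite sublaplacian_sym//; exact: tf.1.
Qed.

Lemma friedrichs_weak (u v : V -> R) psi : B u v -> test psi -> ip u (A psi) = ip v psi.
Proof. by move=> [_ _]; exact. Qed.

(** The contraction property of the Dirichlet form: by the chain rule every horizontal derivative of
    J1(f) is that of f times a factor in [0, K]. *)
Lemma form_comp (J1 : R -> R) (K : R) f g : smooth J1 -> J1 0 = 0 ->
  (forall s, 0 <= 'D_1 J1 s <= K) -> test f ->
  let psi := fun x => J1 (f x) in
  [/\ test psi, 0 <= form f psi & form psi psi <= K ^+ 2 * form f f].
Proof.
move=> sJ J0 JK tf psi.
have tpsi : test psi.
  have /testP[sf [C fC]] := tf; apply/testP; split; first exact: smooth_comp.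
  by exists C => x /fC e; rewrite /psi e.
split=> //.
  apply: Rint_ge0 => x; rewrite X1_comp ?X2_comp//; try exact: tf.1.
  have /andP[h _] := JK (f x).
  by rewrite mulrCA [X2 f x * _]mulrCA -mulrDr mulr_ge0// addr_ge0// -expr2 sqr_ge0.
rewrite /form -RintZ; last exact: form_integ.
apply: Rint_le => [||x]; [exact: form_integ|apply: integZ; exact: form_integ|].
rewrite X1_comp ?X2_comp//; try exact: tf.1.
have /andP[h1 h2] := JK (f x).
rewrite -!expr2 !exprMn -mulrDr ler_wpM2r ?addr_ge0 ?sqr_ge0//.
by rewrite lerXn2r ?nnegrE// (le_trans h1).
Qed.

Lemma lipschitz_L2 (J1 : R -> R) (K : R) (u : V -> R) : measurable_fun setT J1 ->
  J1 0 = 0 -> (forall x y, `|J1 y - J1 x| <= K * `|y - x|) -> L2 u -> L2 (fun x => J1 (u x)).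
Proof.
move=> mJ J0 JK [mu_ iu]; split; first exact: measurableT_comp.
have mm : measurable_fun [set: measurableTypeR R * 'rV[R]_n] (fun x => J1 (u x) ^+ 2).
  by apply: measurable_funX; exact: measurableT_comp.
apply: (@le_integ _ _ _ haar _ (fun x => K ^+ 2 * u x ^+ 2)) => //; last exact: integZ.
move=> x; rewrite ger0_norm ?sqr_ge0// -real_normK ?num_real//.
have := JK 0 (u x); rewrite J0 !subr0 => h.
rewrite -[X in _ * X]real_normK ?num_real// -exprMn lerXn2r ?nnegrE//.
exact: le_trans h.
Qed.

Lemma lipschitz_nrm (J1 : R -> R) (K : R) (u v : V -> R) : 0 <= K -> measurable_fun setT J1 ->
  J1 0 = 0 -> (forall x y, `|J1 y - J1 x| <= K * `|y - x|) -> L2 u -> L2 v ->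
  nrm (fun x => J1 (u x) - J1 (v x)) <= K * nrm (fun x => u x - v x).
Proof.
move=> K0 mJ J0 JK hu hv.
have h1 := lipschitz_L2 mJ J0 JK hu; have h2 := lipschitz_L2 mJ J0 JK hv.
rewrite -[X in X * _]ger0_norm// -nrmZ; last exact: L2B.
rewrite /nrm ler_sqrt ?ip_ge0//; apply: Rint_le => [||x].
- by apply: ip_integ; exact: L2B.
- by apply: ip_integ; apply: L2Z; exact: L2B.
- rewrite -!expr2 -real_normK ?num_real// -[leRHS]real_normK ?num_real//.
  by rewrite lerXn2r ?nnegrE// normrM (ger0_norm K0).
Qed.

(* Dissipativity with respect to every monotone function of [u], and not only
   [u] itself, is what makes the semigroup Markovian. *)
Lemma friedrichs_dissipative (u v : V -> R) (J1 : R -> R) (K : R) : 0 <= K ->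
  smooth J1 -> J1 0 = 0 -> (forall s, 0 <= 'D_1 J1 s <= K) ->
  (forall x y, `|J1 y - J1 x| <= K * `|y - x|) ->
  B u v -> ip v (fun x => J1 (u x)) <= 0.
Proof.
move=> K0 sJ J0 JK JL Buv; have [[/inL2P hu [phi [tphi cphi ephi]]] /inL2P hv _] := Buv.
have mJ : measurable_fun setT J1.
  by apply: continuous_measurable_fun; exact: (smooth_continuous sJ).
have hphi k : L2 (phi k) by exact: test_L2.
move/(L2dist_cvg hphi hu) : cphi => /cvgrPdist_lt cphi.
have lJu := lipschitz_L2 mJ J0 JL hu.
have {}ephi (e : R) : 0 < e -> exists N, forall k l, (N <= k)%N -> (N <= l)%N ->
    form (fun x => phi k x - phi l x) (fun x => phi k x - phi l x) < e.
  move=> /ephi[N hN]; exists N => k l Nk Nl; have := hN k l Nk Nl.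
  by rewrite energyE//; exact: test_sub.
have [N1 hN1] := ephi 1 ltr01.
(* An energy bound valid for all k >= N1: write phi_k = w + phi_N1 with w of energy below 1 and use
   form(w + f) <= 2 form(w) + 2 form(f). *)
pose F := 2 * form (phi N1) (phi N1) + 2.
have F0 : 0 < F by rewrite ltr_wpDl// mulr_ge0// form_ge0.
have hF k : (N1 <= k)%N -> form (phi k) (phi k) <= F.
  move=> Nk; have h0 := hN1 k N1 Nk (leqnn _).
  have t1 := test_sub (tphi k) (tphi N1).
  pose w := fun x => phi k x - phi N1 x; rewrite -/w in h0.
  have tw : test w by [].
  have E : phi k = fun x => 1 * w x + phi N1 x by apply/funext => x; rewrite /w; ring.
  have tk : test (fun x => 1 * w x + phi N1 x) by rewrite -E.
  have -> : form (phi k) (phi k) = form (fun x => 1 * w x + phi N1 x) (fun x => 1 * w x + phi N1 x) by rewrite -E.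
  rewrite (form_lin 1 tw (tphi N1) tk) [form w (fun x => _)]formC [form (phi N1) (fun x => _)]formC.
  rewrite (form_lin 1 tw (tphi N1) tw) (form_lin 1 tw (tphi N1) (tphi N1)) [form (phi N1) w]formC.
  move: h0; have := form_cauchy_schwarz tw (tphi N1).
  rewrite /F; move: (form_ge0 w) (form_ge0 (phi N1)).
  move: (form w w) (form w (phi N1)) (form (phi N1) (phi N1)) => a b c a0 c0 h1 h2.
  have h3 : b ^+ 2 <= (a + c) ^+ 2 / 4.
    by apply: (le_trans h1); have := sqr_ge0 (a - c); nra.
  have : `|b| <= (a + c) / 2.
    rewrite -(@ler_pXn2r _ 2)// ?nnegrE//; last by rewrite divr_ge0// addr_ge0.
    by rewrite real_normK ?num_real// expr_div_n; have -> : (2 ^+ 2 = 4 :> R) by rewrite -natrX.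
  rewrite ler_norml => /andP[_]; lra.
(* With psi = J1(phi_k), the pairing of v with psi is that of u with A psi, hence the limit in l of
   -form(phi_l, psi) = -form(phi_l - phi_k, psi) - form(phi_k, psi). The last term is nonpositive,
   and the other is small by Cauchy-Schwarz because the energies form a Cauchy sequence. *)
have key (e : R) : 0 < e -> exists N, forall k, (N <= k)%N ->
    ip v (fun x => J1 (phi k x)) <= e.
  move=> e0; pose q := (e / 2) ^+ 2 / (K ^+ 2 * F + 1).
  have KF : 0 < K ^+ 2 * F + 1 by rewrite ltr_wpDl// mulr_ge0 ?sqr_ge0// ltW.
  have q0 : 0 < q by rewrite divr_gt0// exprn_gt0// divr_gt0.
  have [N hN] := ephi q q0.
  exists (maxn N N1) => k; rewrite geq_max => /andP[Nk N1k].
  have [tpsi f0 fK] := form_comp (fun=> 0) sJ J0 JK (tphi k).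
  set psi := fun x => _ in tpsi f0 fK *.
  rewrite -(friedrichs_weak Buv tpsi).
  have hA := test_L2 (test_sublaplacian tpsi).
  have h1 l : (N <= l)%N -> ip (phi l) (A psi) <= e / 2.
    move=> Nl; rewrite /ip sublaplacian_sym//; last exact: (tphi l).1.
    rewrite form_sublaplacian//; last exact: (tphi l).1.
    set w := fun x => phi l x - phi k x.
    have tw : test w by exact: test_sub.
    have E : phi l = fun x => 1 * w x + phi k x by apply/funext => x; rewrite /w; ring.
    rewrite E (form_lin 1 tw (tphi k) tpsi) mul1r.
    have h2 : form w psi ^+ 2 <= (e / 2) ^+ 2.
      apply: (le_trans (form_cauchy_schwarz tw tpsi)).
      apply: (@le_trans _ _ (q * (K ^+ 2 * F))).
        apply: ler_pM; rewrite ?form_ge0//; first exact/ltW/hN.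
        by apply: (le_trans fK); rewrite ler_wpM2l ?sqr_ge0// hF.
      rewrite /q -mulrA ger_pMr ?exprn_gt0 ?divr_gt0//.
      by rewrite mulrC ler_pdivrMr// mul1r lerDl.
    apply: oppr_add_le f0 _.
      rewrite -(@ler_pXn2r _ 2)// ?nnegrE ?divr_ge0 ?(ltW e0)//.
      by rewrite real_normK ?num_real.
  have hAn : 0 < nrm (A psi) + 1 by rewrite ltr_wpDl// nrm_ge0.
  have [M _ hM] := cphi (e / 2 / (nrm (A psi) + 1)) (divr_gt0 (divr_gt0 e0 (ltr0n _ 2)) hAn).
  have /= hM' := hM (maxn M N) (leq_maxl _ _).
  rewrite sub0r normrN ger0_norm ?nrm_ge0// in hM'.
  have h3 := h1 (maxn M N) (leq_maxr _ _).
  have h4 := cauchy_schwarz (L2B hu (hphi (maxn M N))) hA.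
  rewrite ipBl// nrmBC// in h4.
  have h5 : nrm (fun x => phi (maxn M N) x - u x) * nrm (A psi) <= e / 2.
    apply: (@le_trans _ _ (e / 2 / (nrm (A psi) + 1) * nrm (A psi))).
      by rewrite ler_wpM2r ?nrm_ge0// ltW.
    by rewrite -mulrA ger_pMr ?divr_gt0// mulrC ler_pdivrMr// mul1r lerDl.
  exact: le_half_dist h3 (le_trans h4 h5).
(* It remains to replace phi_k by u inside J1, which is continuous on L^2 because J1 is
   Lipschitz. *)
apply/ler_addgt0Pr => e e0; rewrite add0r.
have [N hN] := key (e / 2) (divr_gt0 e0 (ltr0n _ 2)).
have hvn : 0 < K * nrm v + 1 by rewrite ltr_wpDl// mulr_ge0// nrm_ge0.
have [M _ hM] := cphi (e / 2 / (K * nrm v + 1)) (divr_gt0 (divr_gt0 e0 (ltr0n _ 2)) hvn).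
have /= hM' := hM (maxn M N) (leq_maxl _ _).
rewrite sub0r normrN ger0_norm ?nrm_ge0// in hM'.
have h1 := hN (maxn M N) (leq_maxr _ _).
have lJp := lipschitz_L2 mJ J0 JL (hphi (maxn M N)).
have h2 := cauchy_schwarz (L2B lJu lJp) hv.
rewrite ipBl// in h2.
have h3 := lipschitz_nrm K0 mJ J0 JL hu (hphi (maxn M N)).
rewrite [X in _ <= _ * X]nrmBC// in h3.
rewrite ipC in h2.
have h4 : nrm (fun x => J1 (u x) - J1 (phi (maxn M N) x)) * nrm v <= e / 2.
  apply: (@le_trans _ _ (e / 2 / (K * nrm v + 1) * (K * nrm v))).
    rewrite mulrCA mulrA ler_wpM2r ?nrm_ge0// (le_trans h3)// ler_wpM2l//.
    exact: ltW.
  by rewrite -mulrA ger_pMr ?divr_gt0// mulrC ler_pdivrMr// mul1r lerDl.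
have h5 : `|ip v (fun x => J1 (u x)) - ip (fun x => J1 (phi (maxn M N) x)) v| <= e / 2.
  exact: le_trans h2 h4.
rewrite [ip (fun x => _) v]ipC in h5.
exact: le_half_dist h1 h5.
Qed.

Variable S : R -> (V -> R) -> (V -> R).
Hypothesis gen : generated_by haar B S.

Lemma orbit_B f t : test f -> 0 <= t -> B (S t f) (S t (A f)) /\
  forall e : R, 0 < e -> exists2 q : R, 0 < q & forall h, 0 < h < q ->
    nrm (fun x => h^-1 * (S (t + h) f x - S t f x) - S t (A f) x) < e.
Proof.
move=> tf t0; apply: (gen_orbit gen) => //; first exact: friedrichs_test.
- exact: test_L2.
- exact/test_L2/test_sublaplacian.
Qed.

Section markov.
Variables (a b : R).
Hypothesis a1 : a ^+ 2 = 1.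
Hypothesis b0 : 0 <= b.

Let cut (x : R) := cutJ (a * x - b).
Let cut' (x : R) := a * cutJ' (a * x - b).

Let cut_le x : cut x <= x ^+ 2.
Proof.
rewrite /cut; have [h|h] := leP (a * x - b) 0; first by rewrite cutJ_le0// sqr_ge0.
apply: (le_trans (cutJ_le _)); rewrite -[leRHS]mul1r -a1 -exprMn.
by apply: lerXn2r; rewrite ?nnegrE ?(ltW h) ?gerBl// ltW// (lt_le_trans h)// gerBl.
Qed.

Let smooth_cut' : smooth cut'.
Proof.
apply: smooth_mul; first exact: smooth_cst.
apply: smooth_comp; first exact: smooth_cutJ'.
apply: smooth_add; last exact: smooth_cst.
by apply: smooth_mul; [exact: smooth_cst|exact: smooth_id].
Qed.

Let cut'0 : cut' 0 = 0.
Proof. by rewrite /cut' mulr0 sub0r cutJ'_le0 ?mulr0// oppr_le0. Qed.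

Let derive_cut' s : 0 <= 'D_1 cut' s <= 6.
Proof.
have d0 : is_derive s (1 : R) (fun x : R => a * x - b) a.
  have := is_deriveB (is_deriveZ a (is_derive_id s (1 : R))) (is_derive_cst b s (1 : R)).
  by rewrite /GRing.scale /= mulr1 subr0.
have := is_deriveZ a (@is_derive1_comp R (@cutJ' R) (fun x => a * x - b) s _ _ (smooth_is_derive (a * s - b) 1 (@smooth_cutJ' R)) d0).
move=> [_ e]; rewrite (_ : 'D_1 cut' s = 'D_1 cutJ' (a * s - b)).
  by rewrite derive_cutJ'_ge0 derive_cutJ'_le.
apply: etrans e _; rewrite /GRing.scale /= mulrCA -expr2 a1 mulr1.
by [].
Qed.

Let a_norm : `|a| = 1.
Proof. by apply/eqP; rewrite -sqrp_eq1// real_normK ?num_real// a1. Qed.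

Let cut'_lip x y : `|cut' y - cut' x| <= 6 * `|y - x|.
Proof.
rewrite /cut' -mulrBr normrM a_norm mul1r; apply: (le_trans (cutJ'_lip _ _)).
by rewrite opprB addrA subrK -mulrBr normrM a_norm mul1r.
Qed.

Let cut_convex x y : cut y - cut x <= cut' y * (y - x).
Proof.
apply: (le_trans (cutJ_convex _ _)); rewrite /cut' opprB addrA subrK -mulrBr.
by rewrite mulrCA mulrA.
Qed.

Let m_cut' : measurable_fun setT cut'.
Proof. by apply: continuous_measurable_fun; exact: (smooth_continuous smooth_cut'). Qed.

Let cut_integ u : L2 u -> integ haar (fun x => cut (u x)).
Proof.
move=> [mu_ iu]; apply: (le_integ _ _ iu) => [|x].
  have m1 : measurable_fun setT (@cutJ R).
    by apply: continuous_measurable_fun; exact: continuous_cutJ.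
  apply: (measurableT_comp m1).
  by apply: measurable_funB => //; apply: measurable_funM.
by rewrite (ger0_norm (cutJ_ge0 _)) cut_le.
Qed.

(** The convex functional u |-> integral of [cutJ] (a u - b) starts at 0 and does not increase along
    the orbit, since its formal derivative is the pairing of the generator with a monotone function
    of u. The condition [a ^+ 2 = 1] treats upper bounds (a = 1) and lower bounds (a = -1)
    together. *)
Lemma markov_cut f t : test f -> (forall x, a * f x <= b) -> 0 <= t ->
  \int[haar]_x cutJ (a * S t f x - b) <= 0.
Proof.
move=> tf fb t0; pose Phi s := \int[haar]_x cut (S s f x).
have lf := test_L2 tf.
have hS s : 0 <= s -> L2 (S s f) by move=> s0; exact: (S_L2 gen s0 lf).
have hSA s : 0 <= s -> L2 (S s (A f)).
  by move=> s0; apply: (S_L2 gen s0); exact/test_L2/test_sublaplacian.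
have lc u : L2 u -> L2 (fun x => cut' (u x)) by exact: lipschitz_L2.
have lcn u : L2 u -> nrm (fun x => cut' (u x)) <= 6 * nrm u.
  move=> hu; have := lipschitz_nrm (ler0n _ 6) m_cut' cut'0 cut'_lip hu (L2_0 haar).
  rewrite (@eq_nrm _ _ _ haar (fun x => cut' (u x) - cut' 0) (fun x => cut' (u x))); last first.
    by move=> x; rewrite cut'0 subr0.
  by rewrite (@eq_nrm _ _ _ haar (fun x => u x - 0) u)// => x; rewrite subr0.
(* Convexity bounds the increments of Phi from above by a pairing with the increment of the orbit,
   the one direction that [dini_le] asks for. *)
have conv s r : 0 <= s -> 0 <= r -> Phi s - Phi r <= ip (fun x => cut' (S s f x)) (fun x => S s f x - S r f x).
  move=> s0 r0; rewrite /Phi -RintB; [|exact/cut_integ/hS|exact/cut_integ/hS].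
  apply: Rint_le => [||x]; last exact: cut_convex.
    by apply: integB; exact/cut_integ/hS.
  by apply: ip_integ; [exact/lc/hS|apply: L2B; exact: hS].
have Phi0 : Phi 0 = 0.
  have := semigroup_0 gen.1 ((inL2P haar f).2 lf).
  have hS0 := hS 0 (lexx _).
  rewrite L2distE// => -[h].
  have h1 : Phi 0 <= 0.
    have Ef : \int[haar]_x cut (f x) = 0.
      rewrite (eq_Rint haar (g := fun=> 0)) ?Rint0// => x.
      by rewrite /cut cutJ_le0// subr_le0.
    rewrite -[leLHS]subr0 -[X in _ - X]Ef /Phi -RintB; [|exact: (cut_integ hS0)|exact: (cut_integ lf)].
    apply: (@le_trans _ _ (ip (fun x => cut' (S 0 f x)) (fun x => S 0 f x - f x))).
      apply: Rint_le => [||x]; last exact: cut_convex.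
        by apply: integB; exact/cut_integ.
      by apply: ip_integ; [exact/lc|exact: L2B].
    apply: (le_trans (ler_norm _)); apply: (le_trans (cauchy_schwarz (lc _ hS0) (L2B hS0 lf))).
    by rewrite h mulr0.
  by apply/eqP; rewrite eq_le h1/= Rint_ge0// => x; exact: cutJ_ge0.
suff : Phi t - Phi 0 <= 0 * (t - 0) by rewrite Phi0 subr0 mul0r.
apply: dini_le => //.
  move=> s /andP[s0 _] e e0.
  have K0 : 0 < nrm (fun x => cut' (S s f x)) + 1 by rewrite ltr_wpDl// nrm_ge0.
  have [q q0 hq] := S_left_cont gen lf s0 (divr_gt0 e0 K0).
  exists q => // h hh sh; have h0 : 0 < h by case/andP: hh.
  rewrite -lerBlDl; apply: (le_trans (conv _ _ (ltW s0) sh)).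
  apply: (le_trans (ler_norm _)).
  apply: (le_trans (cauchy_schwarz (lc _ (hS _ (ltW s0))) (L2B (hS _ (ltW s0)) (hS _ sh)))).
  have := hq h hh sh; rewrite ler_pdivlMr// => hn.
  apply: le_trans hn; rewrite mulrC ler_wpM2l ?nrm_ge0//.
  by rewrite lerDl.
move=> s /andP[s0 _] e e0.
have [Bs dS] := orbit_B tf s0.
pose c := nrm (S s f); pose c' := nrm (S s (A f)).
have c0 : 0 <= c by exact: nrm_ge0.
have c'0 : 0 <= c' by exact: nrm_ge0.
(* 6 (c + 1) bounds the norm of [cut'] at the later time once the orbit has moved by less than 1; 6
   c' + 1 absorbs the change of [cut'] between the two times. Each error is then at most e / 2. *)
have k1 : 0 < 6 * (c + 1) by lra.
have k2 : 0 < 6 * c' + 1 by lra.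
have e2 : 0 < e / 2 by lra.
have [q1 q10 hq1] := dS _ (divr_gt0 e2 k1).
have [q2 q20 hq2] := S_right_cont gen lf s0 ltr01.
have [q3 q30 hq3] := S_right_cont gen lf s0 (divr_gt0 e2 k2).
exists (Num.min q1 (Num.min q2 q3)); first by rewrite !lt_min q10 q20.
move=> h /andP[h0]; rewrite !lt_min => /andP[h1 /andP[h2 h3]] _.
have sh : 0 <= s + h by rewrite addr_ge0// ltW.
have := hq1 h; have := hq2 h; have := hq3 h; rewrite h0 h1 h2 h3.
move=> /(_ isT) g3 /(_ isT) g2 /(_ isT) g1.
set u := S s f in Bs g1 g2 g3 *; set u' := S (s + h) f in g1 g2 g3 *.
have lu : L2 u by exact: hS.
have lu' : L2 u' by exact: hS.
have ld := L2Z h^-1 (L2B lu' lu).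
have lA := hSA s s0.
apply: (le_trans (conv _ _ sh s0)); rewrite -/u -/u'.
have -> : ip (fun x => cut' (u' x)) (fun x => u' x - u x) =
  h * ip (fun x => cut' (u' x)) (fun x => h^-1 * (u' x - u x)).
  rewrite [in RHS]ipC (ipZl h^-1 (L2B lu' lu) (lc _ lu')).
  by rewrite mulrA mulfV ?gt_eqF// mul1r ipC.
rewrite add0r mulrC ler_wpM2r ?(ltW h0)//.
have E1 := ipBl ld lA (lc _ lu').
have E2 := ipBl (lc _ lu') (lc _ lu) lA.
have D := friedrichs_dissipative (ler0n _ 6) smooth_cut' cut'0 derive_cut' cut'_lip Bs.
have H1 : `|ip (fun x => h^-1 * (u' x - u x) - S s (A f) x) (fun x => cut' (u' x))| <= e / 2.
  apply: (le_trans (cauchy_schwarz (L2B ld lA) (lc _ lu'))).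
  apply: (@le_trans _ _ (e / 2 / (6 * (c + 1)) * (6 * (c + 1)))); last by rewrite divfK// gt_eqF.
  apply: ler_pM; rewrite ?nrm_ge0//; first exact: ltW.
  apply: (le_trans (lcn _ lu')); rewrite ler_wpM2l//.
  have := nrmD lu (L2B lu' lu).
  rewrite (@eq_nrm _ _ _ haar _ u'); last by move=> x; rewrite addrC subrK.
  by move=> /le_trans; apply; rewrite lerD2l ltW.
have H2 : `|ip (fun x => cut' (u' x) - cut' (u x)) (S s (A f))| <= e / 2.
  apply: (le_trans (cauchy_schwarz (L2B (lc _ lu') (lc _ lu)) lA)).
  have := lipschitz_nrm (ler0n _ 6) m_cut' cut'0 cut'_lip lu' lu => hl.
  apply: (@le_trans _ _ (6 * (e / 2 / (6 * c' + 1)) * c')).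
    rewrite ler_wpM2r// (le_trans hl)// ler_wpM2l//.
    exact: ltW.
  have -> : 6 * (e / 2 / (6 * c' + 1)) * c' = e / 2 * (6 * c') / (6 * c' + 1) by ring.
  by rewrite ler_pdivrMr// ler_pM2l// lerDl.
rewrite ipC; move: E1 E2 H1 H2 D; rewrite [ip (S s (A f)) (fun x => cut' (u' x))]ipC.
rewrite [ip (S s (A f)) (fun x => cut' (u x))]ipC => -> ->.
move: (ip _ _) (ip _ _) (ip _ _) => x y z.
rewrite !ler_norml => /andP[_ g4] /andP[_ g5]; lra.
Qed.

(** The truncated integral of a S_t f - b is zero, and [cutJ] controls the positive part up to an
    arbitrarily small constant d. *)
Lemma markov f t psi : test f -> (forall x, a * f x <= b) -> 0 <= t ->
  test psi -> (forall x, 0 <= psi x) ->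
  \int[haar]_x ((a * S t f x - b) * psi x) <= 0.
Proof.
move=> tf fb t0 tpsi psi0.
have hS : L2 (S t f) := S_L2 gen t0 (test_L2 tf).
have ipsi := test_integ tpsi.
have [M hM] := test_bounded tpsi.
have M0 : 0 <= M by rewrite (le_trans _ (hM 0)).
have H (d : R) : 0 < d -> \int[haar]_x ((a * S t f x - b) * psi x) <= d * \int[haar]_x psi x.
  move=> d0; pose C := (d * flat1 d)^-1.
  have C0 : 0 < C by rewrite invr_gt0 mulr_gt0// flat1_gt0.
  have hx (x : R) : x <= d + C * cutJ x.
    have [xd|dx] := leP x d; first by rewrite (le_trans xd)// lerDl mulr_ge0 ?cutJ_ge0// ltW.
    have x0 : 0 < x by exact: lt_trans dx.
    rewrite -[leLHS]add0r lerD ?(ltW d0)// /C ler_pdivlMl ?mulr_gt0 ?flat1_gt0//.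
    rewrite /cutJ expr2 -[x * x * _]mulrA [x * flat1 x]mulrC mulrC [leRHS]mulrC.
    rewrite mulrC [leRHS]mulrC.
    rewrite ler_pM2r// ler_pM ?flat1_ge0 ?(ltW d0) ?(ltW dx)//.
    by apply: flat1_nd; exact: ltW.
  have i1 : integ haar (fun x => (a * S t f x - b) * psi x).
    apply: (@eq_integ _ _ _ haar (fun x => a * (S t f x * psi x) - b * psi x)).
      by move=> x; ring.
    apply: integB; apply: integZ => //.
    by apply: ip_integ => //; exact: test_L2.
  have ic := cut_integ hS.
  apply: (@le_trans _ _ (\int[haar]_x (d * psi x + C * M * cutJ (a * S t f x - b)))).
    apply: Rint_le => // [|x]; first by apply: integD; exact: integZ.
    apply: (@le_trans _ _ ((d + C * cutJ (a * S t f x - b)) * psi x)).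
      by rewrite ler_wpM2r.
    have h1 := le_trans (ler_norm _) (hM x).
    rewrite mulrDl lerD2l -(mulrA C (cutJ _)) -(mulrA C M) (ler_pM2l C0) [M * _]mulrC.
    exact: (ler_wpM2l (cutJ_ge0 _) h1).
  rewrite RintD; [|exact: integZ|exact: integZ].
  rewrite !RintZ// gerDl mulr_ge0_le0//; first by rewrite mulr_ge0// ltW.
  exact: markov_cut.
have p0 : 0 <= \int[haar]_x psi x by exact: Rint_ge0.
apply/ler_addgt0Pr => e e0; rewrite add0r.
have k0 : 0 < \int[haar]_x psi x + 1 by rewrite ltr_wpDl.
apply: (le_trans (H _ (divr_gt0 e0 k0))).
by rewrite -mulrA ger_pMr// mulrC ler_pdivrMr// mul1r lerDl.
Qed.

End markov.

End friedrichs.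

Section chi.
Context {R : realType} {n : nat}.

Definition chi (z : 'rV[R]_n) : R := \prod_(i < n) bump (z ord0 i).

Lemma smooth_chi : smooth chi.
Proof.
apply: smooth_prod => i; apply: smooth_comp; first exact: smooth_bump.
by apply: smooth_linear => [|c u w]; [exact: rV_coord_continuous|rewrite !mxE].
Qed.

Lemma chi_ge0 z : 0 <= chi z.
Proof. by apply: prodr_ge0 => i _; exact: bump_ge0. Qed.

Lemma chi_le1 z : chi z <= 1.
Proof. by apply: prodr_ile1 => i _; rewrite bump_ge0 bump_le1. Qed.

Lemma chi0 : chi 0 = 1.
Proof. by apply: big1 => i _; rewrite mxE bump0. Qed.

Lemma chi_out z : 1 < `|z| -> chi z = 0.
Proof.
move=> z1; have [i hi] : exists i, 1 < `|z ord0 i|.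
  apply/existsP; apply: contraLR z1 => /existsPn h; rewrite -leNgt.
  by apply: rV_norm_le => // i; rewrite leNgt; exact: h.
by rewrite /chi (bigD1 i)//= bump_out ?mul0r// ltW.
Qed.

Lemma chi_cvg z : chi (m.+1%:R^-1 *: z) @[m --> \oo] --> (1 : R).
Proof.
have h : m.+1%:R^-1 *: z @[m --> \oo] --> (0 : 'rV[R]_n).
  by rewrite -(scale0r z); apply: cvgZr_tmp; exact: cvg_harmonic.
have c := @smooth_continuous R _ chi smooth_chi 0.
by have := cvg_comp _ _ h c; rewrite chi0.
Qed.

End chi.

(** * Positivity and weak equation for the heat kernel *)

Section heat_integral.
Context {R : realType} {n : nat}.
Local Notation V := (R * 'rV[R]_n)%type.
Local Notation haar := (@haar R n).
Local Notation test := (@test_function R V).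
Local Notation A := (@sublaplacian R n).
Local Notation ip := (ip haar).
Implicit Types (F G psi : V -> R).

Lemma sublaplacian_lin (c : R) F G : smooth F -> smooth G ->
  A (fun x => c * F x + G x) = fun x => c * A F x + A G x.
Proof.
move=> sF sG; rewrite /sublaplacian X1_lin// X2_lin//.
rewrite (X1_lin c (smooth_X1 sF) (smooth_X1 sG)) (X2_lin c (smooth_X2 sF) (smooth_X2 sG)).
apply/funext => x /=; move: (X1 _ _) (X2 _ _) (X1 _ _) (X2 _ _) => a b a' b'; ring.
Qed.

Lemma sublaplacianN F : smooth F -> A (fun x => - F x) = fun x => - A F x.
Proof.
move=> sF; have E : A (fun=> 0) = fun=> 0.
  have := sublaplacian_lin (-1) (smooth_cst 0) (smooth_cst 0).
  rewrite [X in A X](_ : _ = fun=> 0); last by apply/funext => x; rewrite mulr0 addr0.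
  by move=> h; rewrite h; apply/funext => x; rewrite mulN1r addNr.
have := sublaplacian_lin (-1) sF (smooth_cst 0); rewrite E => h.
rewrite [X in A X](_ : _ = fun x => -1 * F x + 0); last first.
  by apply/funext => x; rewrite mulN1r addr0.
by rewrite h; apply/funext => x; rewrite mulN1r addr0.
Qed.

Lemma testN F : test F -> test (fun x => - F x).
Proof.
move=> tF; rewrite (_ : (fun x => - F x) = fun x => -1 * F x); first exact: test_scale.
by apply/funext => x; rewrite mulN1r.
Qed.

Lemma Gmul_support F (C r : R) : (forall x, C < `|x| -> F x = 0) ->
  exists D, forall h g, `|h| <= r -> D < `|g| -> F (Gmul h g) = 0.
Proof.
move=> FC; pose C' := Num.max 0 (Num.max C r).
have C0 : 0 <= C' by rewrite le_max lexx.
have [D hD] := @Gmul_bound R n C' C0.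
exists D => h g hr Dg; apply: FC; rewrite ltNge; apply/negP => gC.
have := hD h g; rewrite !(leNgt _ D) Dg.
have -> : `|h| <= C' by rewrite (le_trans hr)// /C' !le_max lexx !orbT.
have -> : `|Gmul h g| <= C' by rewrite (le_trans gC)// /C' !le_max lexx !orbT.
by move=> /(_ isT isT).
Qed.

Lemma continuous_pair (X Y Z : topologicalType) (f : X -> Y) (g : X -> Z) :
  continuous f -> continuous g -> continuous (fun x => (f x, g x)).
Proof.
move=> cf cg x.
exact: (@cvg_pair _ _ _ (nbhs x) (nbhs (f x)) (nbhs (g x)) _ _ _ f g (cf x) (cg x)).
Qed.

Lemma continuous_Gmulr h : continuous (fun g : V => Gmul h g).
Proof.
move=> g; apply: (@continuous_comp _ _ _ (fun g : V => (h, g)) (fun x : V * V => Gmul x.1 x.2)).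
  by apply: continuous_pair => x; [exact: cvg_cst|exact: cvg_id].
exact: continuous_Gmul.
Qed.

Lemma continuous_Gmull g : continuous (fun h : V => Gmul h g).
Proof.
move=> h; apply: (@continuous_comp _ _ _ (fun h : V => (h, g)) (fun x : V * V => Gmul x.1 x.2)).
  by apply: continuous_pair => x; [exact: cvg_id|exact: cvg_cst].
exact: continuous_Gmul.
Qed.

Lemma Gmul_test_integ F (q : V -> R) h : test F -> continuous q ->
  integ haar (fun g => F (Gmul h g) * q g).
Proof.
move=> /testP[sF [C FC]] cq; apply: continuous_compact_integ.
  move=> g; apply: cvgM; last exact: cq.
  apply: (@continuous_comp _ _ _ (fun g : V => Gmul h g) F); first exact: continuous_Gmulr.
  exact: (smooth_continuous sF).
have [D hD] := Gmul_support `|h| FC.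
by apply/compactly_supportedP; exists D => g Dg; rewrite (hD h)// mul0r.
Qed.

Lemma Gmul_test_continuous F (q : V -> R) : test F -> continuous q ->
  continuous (fun h => \int[haar]_g (F (Gmul h g) * q g)).
Proof.
move=> tF cq h0; have /testP[sF [C FC]] := tF.
apply: continuous_seq => u uh.
have [r hr] : exists r, forall m, `|u m| <= r.
  have /cvg_seq_bounded[r [_ hr]] : cvgn u by apply/cvg_ex; exists h0.
  by exists (r + 1) => m; apply: hr => //; rewrite ltrDl.
have [D hD] := Gmul_support r FC.
have [M hM] := test_bounded tF.
have M0 : 0 <= M by rewrite (le_trans _ (hM 0)).
(* A piecewise linear cutoff, 1 for |g| <= D and 0 for |g| > D + 1. It makes the majorant continuous
   with bounded support, hence integrable. *)
pose zeta (g : V) : R := (`|D + 1 - `|g| | - `|D - `|g| | + 1) / 2.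
have cz : continuous zeta.
  move=> g; apply: cvgM; last exact: cvg_cst.
  apply: cvgD; last exact: cvg_cst.
  by apply: cvgB; apply: cvg_norm; apply: cvgB; [exact: cvg_cst|exact: norm_continuous|
    exact: cvg_cst|exact: norm_continuous].
have z0 g : 0 <= zeta g.
  have := ler_normB (D + 1 - `|g|) 1; rewrite normr1 /zeta.
  by rewrite (_ : D + 1 - `|g| - 1 = D - `|g|); [lra|ring].
have z1 (g : V) : `|g| <= D -> zeta g = 1.
  by move=> h; rewrite /zeta !ger0_norm; lra.
have zD (g : V) : D + 1 < `|g| -> zeta g = 0.
  by move=> h; rewrite /zeta !ler0_norm; lra.
apply: (proj2 (@Rint_cvg _ _ _ haar (fun m g => F (Gmul (u m) g) * q g) (fun g => F (Gmul h0 g) * q g) (fun g => M * (zeta g * `|q g|)) _ _ _ _)).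
- by move=> m; exact: integ_measurable (Gmul_test_integ _ tF cq).
- move=> g; apply: cvgM; last exact: cvg_cst.
  apply: (cvg_comp u (fun h => F (Gmul h g)) uh).
  apply: (@continuous_comp _ _ _ (fun h : V => Gmul h g) F); first exact: continuous_Gmull.
  exact: (smooth_continuous sF).
- apply: integZ; apply: continuous_compact_integ.
    by move=> g; apply: cvgM; [exact: cz|apply: cvg_norm; exact: cq].
  apply/compactly_supportedP; exists (D + 1) => g Dg.
  by rewrite zD// mul0r.
- move=> m g; rewrite normrM; have [gD|gD] := leP `|g| D; last first.
    by rewrite (hD (u m))// normr0 mul0r mulr_ge0// mulr_ge0.
  by rewrite ler_pM// z1// mul1r.
Qed.

Variables (S : R -> (V -> R) -> (V -> R)) (p : R -> V -> R).
Hypothesis gen : generated_by haar (friedrichs haar test A) S.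
Hypothesis hp : forall t, 0 < t -> continuous (p t) /\ forall f, test f ->
  {ae haar, forall h : V, S t f h = \int[haar]_g (f (Gmul h g) * p t g)}.

(** The continuous representative of S_t F. The convolution with p_t is only meaningful for t > 0,
    so the value at t = 0 is set to F, which makes the estimates valid on closed time intervals. *)
Definition U F (t : R) (h : V) : R :=
  if t == 0 then F h else \int[haar]_g (F (Gmul h g) * p t g).

Lemma U_pos F t h : 0 < t -> U F t h = \int[haar]_g (F (Gmul h g) * p t g).
Proof. by move=> t0; rewrite /U gt_eqF. Qed.

Lemma U_continuous F t : test F -> 0 <= t -> continuous (U F t).
Proof.
move=> tF; rewrite le_eqVlt => /predU1P[<-|t0] h; rewrite /U ?eqxx ?gt_eqF//.
  exact: (smooth_continuous tF.1).
by apply: Gmul_test_continuous => //; exact: (hp t0).1.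
Qed.

Lemma U_test_integ F psi t : test F -> test psi -> 0 <= t ->
  integ haar (fun x => U F t x * psi x).
Proof.
move=> tF tpsi t0; apply: continuous_compact_integ.
  by move=> x; apply: cvgM; [exact: U_continuous|exact: (smooth_continuous tpsi.1)].
have /testP[_ [C hC]] := tpsi.
by apply/compactly_supportedP; exists C => x /hC ->; rewrite mulr0.
Qed.

Lemma U_ip F psi t : test F -> test psi -> 0 <= t ->
  ip (S t F) psi = \int[haar]_x (U F t x * psi x).
Proof.
move=> tF tpsi t0; have lF := test_L2 tF; have lS := S_L2 gen t0 lF.
have lpsi := test_L2 tpsi.
have [t00|t1] := eqVneq t 0.
  transitivity (ip F psi); last by apply: eq_Rint => x; rewrite /U t00 eqxx.
  apply: (ip_nrm0 lS lF lpsi); rewrite t00 in lS *.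
  have := semigroup_0 gen.1 ((inL2P haar F).2 lF).
  by rewrite L2distE// => -[].
have {}t0 : 0 < t by rewrite lt_def t1.
have m1 := integ_measurable (ip_integ lS lpsi).
have m2 := integ_measurable (U_test_integ tF tpsi (ltW t0)).
rewrite /ip /Rintegral; congr fine; apply: ae_eq_integral => //.
- exact/measurable_EFinP.
- exact/measurable_EFinP.
- have := (hp t0).2 F tF; apply: filterS; first exact: (ae_filter_ringOfSetsType haar).
  move=> x hx _ /=.
  by rewrite hx U_pos.
Qed.

Lemma U_sub F G t h : test F -> test G -> 0 <= t ->
  U (fun x => F x - G x) t h = U F t h - U G t h.
Proof.
move=> tF tG; rewrite le_eqVlt => /predU1P[<-|t0]; first by rewrite /U eqxx.
have cp := (hp t0).1; rewrite !U_pos// -RintB; try exact: Gmul_test_integ.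
by apply: eq_Rint => x; rewrite mulrBl.
Qed.

Lemma U_N F t h : test F -> 0 <= t -> U (fun x => - F x) t h = - U F t h.
Proof.
move=> tF; rewrite le_eqVlt => /predU1P[<-|t0]; first by rewrite /U eqxx.
rewrite !U_pos// -RintN; last exact: Gmul_test_integ tF (hp t0).1.
by apply: eq_Rint => x; rewrite mulNr.
Qed.

Lemma U_markov (a b : R) F t h : a ^+ 2 = 1 -> 0 <= b -> test F ->
  (forall x, a * F x <= b) -> 0 <= t -> a * U F t h <= b.
Proof.
move=> a1 b0 tF Fb t0; rewrite -subr_le0.
apply: (test_localization (G := fun h => a * U F t h - b)) => [x|psi tpsi psi0].
  apply: cvgB; last exact: cvg_cst.
  by apply: cvgM; [exact: cvg_cst|exact: U_continuous].
have := markov gen a1 b0 tF Fb t0 tpsi psi0.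
have lS := S_L2 gen t0 (test_L2 tF); have lp := test_L2 tpsi.
have i1 := ip_integ lS lp; have i2 := U_test_integ tF tpsi t0; have i3 := test_integ tpsi.
rewrite (eq_Rint haar (g := fun x => a * (S t F x * psi x) - b * psi x)); last by move=> x; ring.
rewrite (eq_Rint haar (f := fun x => (a * U F t x - b) * psi x)
  (g := fun x => a * (U F t x * psi x) - b * psi x)); last by move=> x; ring.
rewrite !RintB; try exact: integZ.
rewrite !RintZ//; have := U_ip tF tpsi t0; rewrite /ip => ->; exact.
Qed.

Lemma U_le F (M : R) t h : test F -> 0 <= M -> (forall x, F x <= M) -> 0 <= t -> U F t h <= M.
Proof.
move=> tF M0 FM t0; rewrite -[leLHS]mul1r; apply: U_markov => //; first by rewrite expr1n.
by move=> x; rewrite mul1r.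
Qed.

Lemma U_ge0 F t h : test F -> (forall x, 0 <= F x) -> 0 <= t -> 0 <= U F t h.
Proof.
move=> tF F0 t0; rewrite -oppr_le0 -mulN1r; apply: U_markov => //; first by rewrite sqrrN expr1n.
by move=> x; rewrite mulN1r oppr_le0.
Qed.

(** At the identity of the group, U psi t is the integral of psi against p_t; it is nonnegative for
    psi >= 0, and localisation concludes. *)
Lemma p_ge0 t g : 0 < t -> 0 <= p t g.
Proof.
move=> t0; have cp := (hp t0).1; rewrite -oppr_le0.
apply: (test_localization (G := fun g => - p t g)) => [x|psi tpsi psi0].
  by apply: cvgN; exact: cp.
have := U_ge0 0 tpsi psi0 (ltW t0); rewrite U_pos// => h.
rewrite (eq_Rint haar (g := fun x => - (psi (Gmul 0 x) * p t x))); last first.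
  by move=> x; rewrite Gmul0; ring.
by rewrite RintN ?oppr_le0//; exact: Gmul_test_integ.
Qed.

Lemma p_integ t : 0 < t -> integ haar (p t) /\ \int[haar]_g p t g <= 1.
Proof.
move=> t0; have cp := (hp t0).1.
pose c m (x : V) : R := bump (x.1 / m.+1%:R) * chi (m.+1%:R^-1 *: x.2).
have tc m : test (c m).
  apply/testP; split.
    apply: smooth_mul.
      apply: smooth_comp; first exact: smooth_bump.
      by apply: smooth_mul; [exact: smooth_fst|exact: smooth_cst].
    rewrite /chi; apply: smooth_prod => i; apply: smooth_comp; first exact: smooth_bump.
    rewrite (_ : (fun x : V => _) = fun x : V => m.+1%:R^-1 * x.2 ord0 i); last first.
      by apply/funext => x; rewrite mxE.
    by apply: smooth_mul; [exact: smooth_cst|exact: smooth_coord].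
  exists m.+1%:R => x; rewrite prod_normE lt_max => /orP[h|h]; rewrite /c.
    rewrite bump_out ?mul0r// normrM [X in _ * X]ger0_norm ?invr_ge0//.
    by rewrite ler_pdivlMr ?ltr0n// mul1r ltW.
  rewrite chi_out ?mulr0// normrZ ger0_norm ?invr_ge0//.
  by rewrite mulrC ltr_pdivlMr ?ltr0n// mul1r.
have c0 m x : 0 <= c m x by rewrite mulr_ge0 ?bump_ge0 ?chi_ge0.
have c1 m x : c m x <= 1 by rewrite mulr_ile1 ?bump_ge0 ?chi_ge0 ?bump_le1 ?chi_le1.
(* The cutoffs [c m] converge to 1 and are bounded by 1, so the Markov bound gives every truncated
   mass at most 1. *)
apply: (@integ_fatou _ _ _ haar (fun m x => c m (Gmul 0 x) * p t x) (p t) 1).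
- by move=> m; apply: Gmul_test_integ.
- by move=> m x; rewrite mulr_ge0// p_ge0.
- move=> x; rewrite -[X in _ --> X]mul1r; apply: cvgM; last exact: cvg_cst.
  rewrite /c Gmul0 -[X in _ --> X]mul1r; apply: cvgM; [exact: bump_cvg|exact: chi_cvg].
- by move=> m; have := U_le 0 (tc m) ler01 (c1 m) (ltW t0); rewrite U_pos.
Qed.

(** The orbit has a right derivative in the L^2 norm only. Paired with a fixed psi it becomes a real
    function to which [dini_le] applies, with the pairing of S_s (A F) as slope. *)
Lemma ip_growth F psi r t M : test F -> test psi -> 0 <= r -> r <= t ->
  (forall s, r <= s < t -> ip (S s (A F)) psi <= M) ->
  ip (S t F) psi - ip (S r F) psi <= M * (t - r).
Proof.
move=> tF tpsi r0 rt hM; have lF := test_L2 tF; have lpsi := test_L2 tpsi.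
have lA := test_L2 (test_sublaplacian tF).
have k0 : 0 < nrm haar psi + 1 by rewrite ltr_wpDl// nrm_ge0.
have knrm (x e : R) : 0 <= x -> x <= e / (nrm haar psi + 1) -> x * nrm haar psi <= e.
  move=> x0; rewrite ler_pdivlMr// => /(le_trans _); apply.
  by rewrite ler_wpM2l// lerDl.
apply: (dini_le (phi := fun s => ip (S s F) psi)) => //.
  move=> s /andP[rs _] e e0; have s0 : 0 < s by exact: le_lt_trans rs.
  have [q q0 hq] := S_left_cont gen lF s0 (divr_gt0 e0 k0).
  exists q => // h hh sh; have sh0 : 0 <= s - h by exact: le_trans sh.
  have l1 := S_L2 gen (ltW s0) lF; have l2 := S_L2 gen sh0 lF.
  rewrite -lerBlDl -ipBl//; apply: (le_trans (ler_norm _)).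
  apply: (le_trans (cauchy_schwarz (L2B l1 l2) lpsi)); apply: knrm; first exact: nrm_ge0.
  exact: hq.
move=> s /andP[rs st] e e0; have s0 : 0 <= s by exact: le_trans rs.
have [_ /(_ _ (divr_gt0 e0 k0))[q q0 hq]] := orbit_B gen tF s0.
exists q => // h hh _; have /andP[h0 _] := hh.
have sh0 : 0 <= s + h by rewrite addr_ge0// ltW.
have l1 := S_L2 gen s0 lF; have l2 := S_L2 gen sh0 lF; have l3 := S_L2 gen s0 lA.
have ld := L2Z h^-1 (L2B l2 l1).
have := cauchy_schwarz (L2B ld l3) lpsi.
rewrite ipBl// ipZl//; last exact: L2B.
rewrite ipBl// => /le_trans /(_ (knrm _ _ (nrm_ge0 _ _) (ltW (hq h hh)))).
have := hM s; rewrite rs st => /(_ isT).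
rewrite -ler_pdivrMr//; move: (ip _ _) (ip _ _) (ip _ _) => x y z.
by rewrite mulrC => h1; rewrite ler_norml => /andP[_ h2]; lra.
Qed.

Lemma U_growth_le F (M : R) r t h : test F -> 0 <= M -> (forall x, A F x <= M) ->
  0 <= r <= t -> U F t h - U F r h <= M * (t - r).
Proof.
move=> tF M0 hM /andP[r0 rt]; have t0 := le_trans r0 rt.
have tA := test_sublaplacian tF.
rewrite -subr_le0.
apply: (test_localization (G := fun h => U F t h - U F r h - M * (t - r))) => [x|psi tpsi psi0].
  by apply: cvgB; [apply: cvgB; exact: U_continuous|exact: cvg_cst].
rewrite (eq_Rint haar (g := fun x => U F t x * psi x - U F r x * psi x - M * (t - r) * psi x)); last by move=> x; ring.
have i1 := U_test_integ tF tpsi t0; have i2 := U_test_integ tF tpsi r0.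
have i3 := test_integ tpsi.
rewrite RintB; [|exact: integB|exact: integZ].
rewrite RintB// RintZ// -!U_ip// subr_le0 mulrAC.
apply: ip_growth => // s /andP[rs _]; have s0 := le_trans r0 rs.
rewrite U_ip// -RintZ//; apply: Rint_le; [exact: U_test_integ|exact: integZ|].
by move=> x; rewrite ler_wpM2r// U_le.
Qed.

Lemma U_lip F (M : R) r t h : test F -> (forall x, `|A F x| <= M) ->
  0 <= r <= t -> `|U F t h - U F r h| <= M * (t - r).
Proof.
move=> tF hM rt; have M0 : 0 <= M by rewrite (le_trans _ (hM 0)).
have /andP[r0 tr] := rt; have t0 := le_trans r0 tr.
rewrite ler_norml; apply/andP; split.
  rewrite lerNl opprB -[X in X - _]opprK addrC -(U_N _ tF r0) -(U_N _ tF t0) [X in X <= _](_ : _ = U (fun x => - F x) t h - U (fun x => - F x) r h); last first.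
    by rewrite (U_N _ tF r0).
  apply: U_growth_le => //; first exact: testN.
  move=> x; rewrite sublaplacianN; last exact: tF.1.
  by have := hM x; rewrite ler_norml lerNl => /andP[].
by apply: U_growth_le => // x; exact: le_trans (ler_norm _) (hM x).
Qed.

(** Growth is integrated twice: U of A F moves by at most M (s - r), and that bound serves as the
    slope for U F. The increment is bounded by its largest value on [r, t], so the constant is M
    rather than M / 2; only the quadratic order matters later. *)
Lemma U_taylor_le F (M : R) r t h : test F -> (forall x, `|A (A F) x| <= M) ->
  0 <= r <= t -> U F t h - U F r h - (t - r) * U (A F) r h <= M * (t - r) ^+ 2.
Proof.
move=> tF hM /andP[r0 rt]; have M0 : 0 <= M by rewrite (le_trans _ (hM 0)).
have t0 := le_trans r0 rt; have tA := test_sublaplacian tF.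
rewrite -subr_le0.
apply: (test_localization (G := fun h => U F t h - U F r h - (t - r) * U (A F) r h - M * (t - r) ^+ 2)) => [x|psi tpsi psi0].
  apply: cvgB; last exact: cvg_cst.
  apply: cvgB; first by apply: cvgB; exact: U_continuous.
  by apply: cvgM; [exact: cvg_cst|exact: U_continuous].
have i1 := U_test_integ tF tpsi t0; have i2 := U_test_integ tF tpsi r0.
have i3 := test_integ tpsi; have i4 := U_test_integ tA tpsi r0.
rewrite (eq_Rint haar (g := fun x => U F t x * psi x - U F r x * psi x -
  ((t - r) * (U (A F) r x * psi x) + M * (t - r) ^+ 2 * psi x))); last by move=> x; ring.
rewrite RintB; [|exact: integB|by apply: integD; exact: integZ].
rewrite RintB// RintD; [|exact: integZ|exact: integZ].
rewrite !RintZ// -!U_ip// subr_le0.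
rewrite (_ : (t - r) * _ + _ = (ip (S r (A F)) psi + M * (t - r) * \int[haar]_x psi x) * (t - r)); last by ring.
apply: ip_growth => // s /andP[rs st]; have s0 := le_trans r0 rs.
rewrite addrC -lerBlDr !U_ip// -RintB -?RintZ//; last exact: U_test_integ.
have is_ := U_test_integ tA tpsi s0.
apply: Rint_le => [||x]; [exact: integB|exact: integZ|].
rewrite -mulrBl ler_wpM2r//; apply: (@le_trans _ _ (M * (s - r))).
  apply: U_growth_le => //; last by rewrite r0.
  by move=> y; exact: le_trans (ler_norm _) (hM y).
by rewrite ler_wpM2l// lerD2r ltW.
Qed.

Lemma U_taylor F (M : R) r t h : test F -> (forall x, `|A (A F) x| <= M) ->
  0 <= r <= t -> `|U F t h - U F r h - (t - r) * U (A F) r h| <= M * (t - r) ^+ 2.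
Proof.
move=> tF hM rt; have sF := tF.1; have sA := smooth_sublaplacian sF.
rewrite ler_norml; apply/andP; split; last exact: U_taylor_le.
have hN x : `|A (A (fun y => - F y)) x| <= M.
  by rewrite (sublaplacianN sF) (sublaplacianN sA) normrN.
have /andP[r0 tr] := rt; have t0 := le_trans r0 tr.
have := U_taylor_le h (testN tF) hN rt; rewrite (sublaplacianN sF).
rewrite (U_N h tF t0) (U_N h tF r0) (U_N h (test_sublaplacian tF) r0).
by move: (U F t h) (U F r h) (U (A F) r h) => x y z h1; lra.
Qed.

Lemma U_weak F psi t : test F -> test psi -> 0 <= t ->
  \int[haar]_x (U F t x * A psi x) = \int[haar]_x (U (A F) t x * psi x).
Proof.
move=> tF tpsi t0; rewrite -!U_ip//; try exact: test_sublaplacian.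
by apply: (friedrichs_weak _ tpsi); exact: (orbit_B gen tF t0).1.
Qed.

End heat_integral.

(** * Fubini's theorem for real-valued integrals *)

Section real_fubini.
Context d1 d2 (T1 : measurableType d1) (T2 : measurableType d2) (R : realType).
Variable m1 : {sigma_finite_measure set T1 -> \bar R}.
Variable m2 : {sigma_finite_measure set T2 -> \bar R}.
Local Notation mm := (m1 \x m2)%E.

Lemma integ_fine d (T : measurableType d) (mu : {measure set T -> \bar R}) (F : T -> \bar R) :
  mu.-integrable setT F ->
  integ mu (fun x => fine (F x)) /\ (\int[mu]_x fine (F x))%:E = (\int[mu]_x F x)%E.
Proof.
move=> iF; have mF := measurable_int mu iF.
have i : integ mu (fun x => fine (F x)).
  apply: (le_integrable measurableT _ _ iF).
    by apply/measurable_EFinP; apply: (@measurableT_comp _ _ _ _ _ _ fine _ F) => //.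
  move=> x _ /=; case: (F x) => [r| |] //=; last by rewrite normr0 leey.
  by rewrite normr0 leey.
split=> //; rewrite EFin_Rint//; apply: ae_eq_integral => //.
  exact: measurable_int i.
apply: (@filterS _ _ (ae_filter_ringOfSetsType mu) _ _ _ (integrable_ae measurableT iF)).
by move=> x /(_ I) fx _ /=; rewrite fineK.
Qed.

Lemma Rint_prod1 (f : T1 * T2 -> R) : integ mm f ->
  integ m1 (fun x => \int[m2]_y f (x, y)) /\
  \int[mm]_z f z = \int[m1]_x \int[m2]_y f (x, y).
Proof.
move=> i; have [i1 e1] := integ_fine (integrable_fubini_F i).
split; first exact: i1.
apply: EFin_inj; rewrite (EFin_Rint i) -integral12_prod_meas1//.
Qed.

Lemma Rint_prod2 (f : T1 * T2 -> R) : integ mm f ->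
  integ m2 (fun y => \int[m1]_x f (x, y)) /\
  \int[mm]_z f z = \int[m2]_y \int[m1]_x f (x, y).
Proof.
move=> i; have mf := measurable_int _ i.
have iG : m2.-integrable setT (fun y => \int[m1]_x (f (x, y))%:E)%E.
  apply/integrableP; split; first exact: (measurable_fubini_G i).
  apply: le_lt_trans ((integrable21ltyP _ _ mf).1 i); apply: ge0_le_integral => //.
  - by apply: measurableT_comp => //; exact: (measurable_fubini_G i).
  - apply: (@measurable_fun_fubini_tonelli_G _ _ _ _ _ m1 (abse \o (EFin \o f))) => //=.
    exact: measurableT_comp.
  - move=> y _; apply: le_abse_integral => //.
    by apply: (measurableT_comp mf); exact: measurable_pair2.
have [i1 e1] := integ_fine iG.
split; first exact: i1.
apply: EFin_inj; rewrite (EFin_Rint i) -integral21_prod_meas1//.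
Qed.

Lemma integ_prod (f g : T1 * T2 -> R) : measurable_fun setT f ->
  (forall z, `|f z| <= g z) -> (forall x, integ m2 (fun y => g (x, y))) ->
  integ m1 (fun x => \int[m2]_y g (x, y)) -> integ mm f.
Proof.
move=> mf fg i2 i1; apply/integrable12ltyP; first exact/measurable_EFinP.
have g0 z : 0 <= g z by exact: le_trans (fg z).
apply: (@le_lt_trans _ _ (\int[m1]_x (\int[m2]_y g (x, y))%:E)%E).
  apply: ge0_le_integral => //.
  - by move=> x _; apply: integral_ge0 => y _; rewrite lee_fin.
  - apply: (@measurable_fun_fubini_tonelli_F _ _ _ _ _ m2 (fun z => `|f z|%:E)) => //.
    by apply/measurable_EFinP; exact: measurableT_comp.
  - by apply/measurable_EFinP; exact: integ_measurable i1.
  - move=> x _; rewrite (EFin_Rint (i2 x)); apply: ge0_le_integral => //.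
    + apply/measurable_EFinP; apply: measurableT_comp => //.
      exact: (measurableT_comp mf (measurable_pair1 x)).
    + by apply/measurable_EFinP; exact: integ_measurable (i2 x).
    + by move=> y _; rewrite lee_fin.
by rewrite -(EFin_Rint i1) ltry.
Qed.

Lemma Rint_tensor (h : T1 -> R) (k : T2 -> R) : integ m1 h -> integ m2 k ->
  integ mm (fun z => h z.1 * k z.2) /\
  \int[mm]_z (h z.1 * k z.2) = (\int[m1]_x h x) * \int[m2]_y k y.
Proof.
move=> ih ik; have i : integ mm (fun z => h z.1 * k z.2).
  apply: (integ_prod (g := fun z => `|h z.1| * `|k z.2|)).
  - apply: measurable_funM.
      exact: measurableT_comp (integ_measurable ih) measurable_fst.
    exact: measurableT_comp (integ_measurable ik) measurable_snd.
  - by move=> z; rewrite normrM.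
  - by move=> x /=; apply: (integZ `|h x|); exact: integ_norm.
  - apply: (@eq_integ _ _ _ m1 (fun x => (\int[m2]_y `|k y|) * `|h x|)) => [x|].
      by rewrite /= (RintZ `|h x| (integ_norm ik)) mulrC.
    by apply: integZ; exact: integ_norm.
split=> //; rewrite (Rint_prod1 i).2.
rewrite (eq_Rint m1 (g := fun x => (\int[m2]_y k y) * h x)) ?RintZ// 1?mulrC// => x.
by rewrite /= (RintZ (h x) ik) mulrC.
Qed.

End real_fubini.

Section bounded_support.
Context {R : realType}.

Definition bsupp (W : normedModType R) (f : W -> R) := exists C : R, forall x, C < `|x| -> f x = 0.

(** Support in a ball, stated on any normed space, so that the factors on [R] and on ['rV[R]_n] of a
    test function on the group share one theory. *)
Definition tst (W : normedModType R) (f : W -> R) := smooth f /\ bsupp f.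

Lemma tst_smooth (W : normedModType R) (f : W -> R) : tst f -> smooth f.
Proof. by case. Qed.

Lemma bsupp_derive (W : normedModType R) (f : W -> R) (C : R) v :
  (forall x, C < `|x| -> f x = 0) -> forall x, C < `|x| -> 'D_v f x = 0.
Proof.
move=> hC x hx; have oC : open [set y : W | C < `|y|].
  by apply: (@open_comp _ _ (fun y : W => `|y|) [set y | C < y]);
    [move=> y _; exact: norm_continuous|exact: open_gt].
have := @derive_local _ _ f (fun=> 0) x v; case.
  by apply: filterS (open_nbhs_nbhs (conj oC hx)) => y; exact: hC.
by move=> _ ->; rewrite derive_cst.
Qed.

Lemma tstD (W : normedModType R) (f : W -> R) v : tst f -> tst ('D_v f).
Proof.
move=> [sf [C hC]]; split; first exact: smoothD.
by exists C; exact: bsupp_derive.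
Qed.

Lemma tst_mulr (W : normedModType R) (f g : W -> R) : tst f -> smooth g -> tst (fun x => f x * g x).
Proof.
move=> [sf [C hC]] sg; split; first exact: smooth_mul.
by exists C => x /hC ->; rewrite mul0r.
Qed.

Lemma tst_mull (W : normedModType R) (f g : W -> R) : smooth f -> tst g -> tst (fun x => f x * g x).
Proof.
move=> sf tg; have := tst_mulr tg sf.
by rewrite [X in tst X](_ : _ = fun x => f x * g x)//; apply/funext => x; rewrite mulrC.
Qed.

Lemma tst_add (W : normedModType R) (f g : W -> R) : tst f -> tst g -> tst (fun x => f x + g x).
Proof.
move=> [sf [C hC]] [sg [D hD]]; split; first exact: smooth_add.
by exists (Num.max C D) => x; rewrite gt_max => /andP[/hC -> /hD ->]; rewrite addr0.
Qed.

Lemma tst0 (W : normedModType R) : tst (fun _ : W => 0 : R).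
Proof. by split; [exact: smooth_cst|exists 0]. Qed.

Lemma tst_chi n : tst (@chi R n).
Proof. by split; [exact: smooth_chi|exists 1; exact: chi_out]. Qed.

Lemma tst_bump : tst (@bump R).
Proof. by split; [exact: smooth_bump|exists 1 => x /ltW; exact: bump_out]. Qed.

End bounded_support.

Lemma derive_dir0 {R : realType} (W : normedModType R) (f : W -> R) x : 'D_0 f x = 0.
Proof.
rewrite deriveE1 (_ : (fun h : R => _) = fun=> f x) ?derive_cst//.
by apply/funext => h; rewrite scaler0 add0r.
Qed.

Lemma tst_derive1 {R : realType} (f : R -> R) : tst f -> tst ('D_(1 : R) f).
Proof. exact: tstD. Qed.

Section dilation.
Context {R : realType} {n : nat}.
Local Notation V := (R * 'rV[R]_n)%type.
Implicit Types (f : R -> R) (X : 'rV[R]_n -> R).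

Lemma derive_snd X e (x v : V) : smooth X ->
  is_derive x v (fun y : V => X (e *: y.2)) (e * 'D_(v.2) X (e *: x.2)).
Proof.
move=> sX; apply/is_derive_line.
have d1 := is_derive_along (e *: x.2) v.2 (e * 0) sX.
have d2 : is_derive (0 : R) 1 (fun h : R => e * h) (e * 1).
  by have := is_deriveZ e (is_derive_id (0 : R) (1 : R)).
have := is_derive_comp1 d1 d2; rewrite mulr1 mulr0 scale0r add0r mulrC.
rewrite (_ : _ \o _ = fun h : R => X (e *: (h *: v + x).2))//.
by apply/funext => h /=; rewrite scalerDr scalerA.
Qed.

Lemma smooth_snd X e : smooth X -> smooth (fun y : V => X (e *: y.2)).
Proof.
(* This class is stable: a derivative falls on Y and contributes a factor e to the constant. *)
move=> sX; pose P (f : V -> R) := exists c Y, smooth Y /\ f = fun y => c * Y (e *: y.2).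
have : P (fun y => X (e *: y.2)) by exists 1, X; split=> //; apply/funext => y; rewrite mul1r.
apply: smooth_ind => {X sX} [f [c [X [sX ->]]]|f v [c [X [sX ->]]]].
  split=> [x|x v]; last first.
    by have [] := is_deriveZ c (derive_snd e x v sX).
  apply: cvgM; first exact: cvg_cst.
  apply: (@continuous_comp _ _ _ (fun y : V => e *: y.2) X); last exact: smooth_continuous.
  by apply: (@cvgZl_tmp _ _ _ _ _ e snd); exact: cvg_snd.
exists (c * e), ('D_(v.2) X); split; first exact: smoothD.
apply/funext => x; have [_] := is_deriveZ c (derive_snd e x v sX).
by rewrite /GRing.scale /= mulrA.
Qed.

Lemma derive_fst f (x v : V) : smooth f ->
  is_derive x v (fun y : V => f y.1) ('D_1 f x.1 * v.1).
Proof.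
move=> sf; apply: (@is_derive_comp1 _ _ f (fun y : V => y.1)); first exact: smooth_is_derive.
by apply: is_derive_linear.
Qed.

Lemma smooth_fst_comp f : smooth f -> smooth (fun y : V => f y.1).
Proof. by move=> sf; apply: smooth_comp => //; exact: smooth_fst. Qed.

End dilation.

Lemma tensor_test {R : realType} {n : nat} (f : R -> R) (X : 'rV[R]_n -> R) : tst f -> tst X ->
  test_function (fun x : R * 'rV[R]_n => f x.1 * X x.2).
Proof.
move=> [sf [C fC]] [sX [D XD]]; apply/testP; split.
  apply: smooth_mul; first exact: smooth_fst_comp.
  rewrite (_ : (fun x : R * 'rV[R]_n => X x.2) = fun x => X (1 *: x.2)); first exact: smooth_snd.
  by apply/funext => x; rewrite scale1r.
exists (Num.max C D) => x; rewrite gt_max => /andP[h1 h2].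
have [h|h] := leP `|x.1| `|x.2|.
  by move: h2; rewrite prod_normE (max_idPr h) => /XD ->; rewrite mulr0.
by move: h1; rewrite prod_normE (max_idPl (ltW h)) => /fC ->; rewrite !mul0r.
Qed.

(** * Partial Fourier transform of the heat semigroup *)

Section family.
Context {R : realType} {n : nat} (eta : 'rV[R]_n).
Local Notation V := (R * 'rV[R]_n)%type.
Local Notation test := (@test_function R V).
Local Notation A := (@sublaplacian R n).
Implicit Types (f : R -> R) (X : 'rV[R]_n -> R) (F G : R -> V -> R).

Definition dotv (z : 'rV[R]_n) : R := \sum_(i < n) eta ord0 i * z ord0 i.

Definition wave (c : R) (z : 'rV[R]_n) : R := cos (2 * pi * dotv z + c).

Lemma dotv_lin (c : R) u w : dotv (c *: u + w) = c * dotv u + dotv w.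
Proof.
rewrite /dotv mulr_sumr -big_split; apply: eq_bigr => i _ /=.
by rewrite !mxE mulrDr mulrCA.
Qed.

Lemma smooth_dotv : smooth dotv.
Proof.
apply: smooth_sum => i; apply: smooth_mul; first exact: smooth_cst.
by apply: smooth_linear => [|c u w]; [exact: rV_coord_continuous|rewrite !mxE].
Qed.

Lemma smooth_phase c : smooth (fun z => 2 * pi * dotv z + c).
Proof.
apply: smooth_add; last exact: smooth_cst.
by apply: smooth_mul; [exact: smooth_cst|exact: smooth_dotv].
Qed.

Lemma smooth_wave c : smooth (wave c).
Proof. by apply: smooth_comp; [exact: smooth_cos|exact: smooth_phase]. Qed.

Lemma derive_wave c z v : is_derive z v (wave c) (2 * pi * dotv v * wave (c + pi / 2) z).
Proof.
have d1 : is_derive z v (fun z => 2 * pi * dotv z + c) (2 * pi * dotv v).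
  have := is_deriveD (is_deriveZ (2 * pi) (is_derive_linear z v dotv_lin)) (is_derive_cst c z v).
  by rewrite addr0.
have := @is_derive_comp1 _ _ (@cos R) _ z v _ _ (is_derive_cos (2 * pi * dotv z + c)) d1.
by rewrite /wave addrA cosDpihalf [X in is_derive _ _ _ X]mulrC.
Qed.

Lemma wave_le1 c z : `|wave c z| <= 1.
Proof. by rewrite ler_norml cos_geN1 cos_le1. Qed.

Lemma wave_pi c z : wave (c + pi) z = - wave c z.
Proof. by rewrite /wave addrA cosDpi. Qed.

Lemma wave_add c d z : wave (c + d) z = cos d * wave c z + sin d * wave (c + pi / 2) z.
Proof. by rewrite /wave addrA cosD addrA cosDpihalf; ring. Qed.

(* [e -> 0] removes the cutoff in the central directions. *)
Definition base f X c (e : R) (x : V) : R := f x.1 * X (e *: x.2) * wave c x.2.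

Lemma smooth_base f X c e : smooth f -> smooth X -> smooth (base f X c e).
Proof.
move=> sf sX; apply: smooth_mul.
  by apply: smooth_mul; [exact: smooth_fst_comp|exact: smooth_snd].
rewrite (_ : (fun x : V => _) = fun x : V => wave c (1 *: x.2)).
  by apply: smooth_snd; exact: smooth_wave.
by apply/funext => x; rewrite scale1r.
Qed.

Lemma test_base f X c e : tst f -> tst X -> 0 < e -> test (base f X c e).
Proof.
move=> [sf [C fC]] [sX [D XD]] e0; apply/testP; split; first exact: smooth_base.
exists (Num.max C (D / e)) => x; rewrite gt_max => /andP[h1 h2]; rewrite /base.
have [h|h] := leP `|x.1| `|x.2|.
  move: h2; rewrite prod_normE (max_idPr h) => h2.
  by rewrite XD ?mulr0 ?mul0r// normrZ gtr0_norm// mulrC -ltr_pdivrMr.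
by move: h1; rewrite prod_normE (max_idPl (ltW h)) => /fC ->; rewrite !mul0r.
Qed.

Lemma base_bounded f X c : tst f -> tst X -> exists M, forall e x, `|base f X c e x| <= M.
Proof.
move=> tf tX.
have /test_bounded[M hM] := tensor_test tf tX; exists M => e x.
have := hM (x.1, e *: x.2); rewrite /= /base [X in _ -> X <= _]normrM => h.
by apply: le_trans h; rewrite ler_piMr// wave_le1.
Qed.

(** The smallest class containing the cut-off waves in which error terms live. It is stable under
    the sub-Laplacian, and its members are bounded uniformly for 0 < e <= 1, so a term with an
    explicit factor e disappears in the limit. *)
Inductive fam : (R -> V -> R) -> Prop :=
| fam_base f X c : tst f -> tst X -> fam (base f X c)
| fam_add F G : fam F -> fam G -> fam (fun e x => F e x + G e x)
| fam_eps F : fam F -> fam (fun e x => e * F e x).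

Lemma fam_smooth F e : fam F -> smooth (F e).
Proof.
elim=> {F} [f X c tf tX|F G _ sF _ sG|F _ sF].
- exact: smooth_base (tst_smooth tf) (tst_smooth tX).
- exact: smooth_add.
- by apply: smooth_mul; [exact: smooth_cst|exact: sF].
Qed.

Lemma fam_bounded F : fam F -> exists M, forall e x, 0 < e <= 1 -> `|F e x| <= M.
Proof.
elim=> {F} [f X c tf tX|F G _ [M hM] _ [N hN]|F _ [M hM]].
- by have [M hM] := base_bounded c tf tX; exists M.
- exists (M + N) => e x he; apply: (le_trans (ler_normD _ _)).
  by apply: lerD; [exact: hM|exact: hN].
- exists M => e x he; have := hM e x he; apply: le_trans; have /andP[e0 e1] := he.
  by rewrite normrM (gtr0_norm e0) ler_piMl.
Qed.

Lemma eq_fam F G : (forall e x, F e x = G e x) -> fam F -> fam G.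
Proof. by move=> FG; rewrite (_ : F = G)//; apply/funext => e; apply/funext => x. Qed.

Lemma fam_sum (I : Type) (r : seq I) (F : I -> R -> V -> R) :
  (forall i, fam (F i)) -> fam (fun e x => \sum_(i <- r) F i e x).
Proof.
move=> hF; elim: r => [|i r ih].
  apply: (eq_fam _ (fam_base 0 (@tst0 R R) (@tst0 R 'rV[R]_n))) => e x.
  by rewrite big_nil /base !mul0r.
by apply: (eq_fam _ (fam_add (hF i) ih)) => e x; rewrite big_cons.
Qed.

Definition cf (i : nat) (a : R) : R := a ^+ i / i`!%:R.
(** The symbol of [X2] on the wave of frequency eta: [X2] multiplies the wave by [wv] and shifts its
    phase by pi / 2. *)
Definition wv (a : R) : R := 2 * pi * \sum_(i < n) eta ord0 i * cf i a.

Lemma smooth_cf i : smooth (cf i).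
Proof. by apply: smooth_mul; [apply: smooth_exp; exact: smooth_id|exact: smooth_cst]. Qed.

Lemma smooth_wv : smooth wv.
Proof.
apply: smooth_mul; first exact: smooth_cst.
by apply: smooth_sum => i; apply: smooth_mul; [exact: smooth_cst|exact: smooth_cf].
Qed.

Lemma derive_base f X c e (x v : V) : smooth f -> smooth X ->
  'D_v (base f X c e) x = 'D_1 f x.1 * v.1 * X (e *: x.2) * wave c x.2 +
    e * (f x.1 * 'D_(v.2) X (e *: x.2) * wave c x.2) +
    2 * pi * dotv v.2 * (f x.1 * X (e *: x.2) * wave (c + pi / 2) x.2).
Proof.
move=> sf sX.
have d1 := derive_fst x v sf; have d2 := derive_snd e x v sX.
have d3 : is_derive x v (fun y : V => wave c y.2) (2 * pi * dotv v.2 * wave (c + pi / 2) x.2).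
  have := derive_snd 1 x v (smooth_wave c).
  have [_ ->] := derive_wave c (1 *: x.2) v.2.
  rewrite mul1r scale1r (_ : (fun y : V => wave c (1 *: y.2)) = fun y => wave c y.2)//.
  by apply/funext => y; rewrite scale1r.
have [_ h] := is_deriveM (is_deriveM d1 d2) d3.
transitivity (f x.1 * X (e *: x.2) * (2 * pi * dotv v.2 * wave (c + pi / 2) x.2) +
  wave c x.2 * (f x.1 * (e * 'D_(v.2) X (e *: x.2)) + X (e *: x.2) * ('D_1 f x.1 * v.1))); first exact: h.
by ring.
Qed.

Lemma X1_base f X c : tst f -> tst X -> forall e x, X1 (base f X c e) x = base ('D_(1 : R) f) X c e x.
Proof.
move=> [sf _] [sX _] e x; rewrite /X1 derive_base//= /base mulr1.
have d0 : dotv 0 = 0 by rewrite /dotv big1// => i _; rewrite mxE mulr0.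
by rewrite derive_dir0 d0; ring.
Qed.

Lemma X2_base f X c : tst f -> tst X -> forall e x, X2 (base f X c e) x =
  base (fun a => wv a * f a) X (c + pi / 2) e x +
  e * \sum_(i < n) base (fun a => cf i a * f a) ('D_(delta_mx ord0 i) X) c e x.
Proof.
move=> [sf _] [sX _] e x; rewrite /X2.
rewrite (eq_bigr (fun i : 'I_n => e * base (fun a => cf i a * f a) ('D_(delta_mx ord0 i) X) c e x +
   eta ord0 i * cf i x.1 * (2 * pi * base f X (c + pi / 2) e x))).
  rewrite big_split /= -mulr_sumr addrC; congr (_ + _).
  by rewrite -mulr_suml /base /wv; ring.
move=> i _; rewrite derive_base//= mulr0 !mul0r add0r.
rewrite (_ : dotv (delta_mx ord0 i) = eta ord0 i); last first.
  rewrite /dotv (bigD1 i)//= mxE !eqxx mulr1 big1 ?addr0// => j ji.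
  by rewrite mxE eqxx (negPf ji) mulr0.
by rewrite /base /cf; ring.
Qed.

Lemma X1_add_scale (F G : V -> R) (e : R) : smooth F -> smooth G ->
  X1 (fun x => F x + e * G x) = fun x => X1 F x + e * X1 G x.
Proof.
move=> sF sG; rewrite (_ : (fun x => F x + _) = fun x => e * G x + F x).
  by rewrite X1_lin//; apply/funext => x; rewrite addrC.
by apply/funext => x; rewrite addrC.
Qed.

Lemma X2_add_scale (F G : V -> R) (e : R) : smooth F -> smooth G ->
  X2 (fun x => F x + e * G x) = fun x => X2 F x + e * X2 G x.
Proof.
move=> sF sG; rewrite (_ : (fun x => F x + _) = fun x => e * G x + F x).
  by rewrite X2_lin//; apply/funext => x; rewrite addrC.
by apply/funext => x; rewrite addrC.
Qed.

Lemma fam_X2_base f X c : tst f -> tst X ->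
  fam (fun e x => \sum_(i < n) base (fun a => cf i a * f a) ('D_(delta_mx ord0 i) X) c e x).
Proof.
move=> tf tX; apply: fam_sum => i; apply: fam_base; last exact: tstD.
exact: tst_mull (smooth_cf i) tf.
Qed.

Lemma fam_X1 F : fam F -> fam (fun e => X1 (F e)).
Proof.
elim=> {F} [f X c tf tX|F G fF hF fG hG|F fF hF].
- by apply: (eq_fam _ (fam_base c (tst_derive1 tf) tX)) => e x; rewrite X1_base.
- apply: (eq_fam _ (fam_add hF hG)) => e x.
  have := X1_add_scale 1 (fam_smooth e fF) (fam_smooth e fG).
  rewrite (_ : (fun x => F e x + 1 * G e x) = fun x => F e x + G e x) => [->|]; first by rewrite mul1r.
  by apply/funext => y; rewrite mul1r.
- apply: (eq_fam _ (fam_eps hF)) => e x.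
  have := X1_add_scale e (smooth_cst 0) (fam_smooth e fF).
  rewrite (_ : (fun x => 0 + _) = fun x => e * F e x) => [->|]; last by apply/funext => y; rewrite add0r.
  by rewrite /X1 derive_cst add0r.
Qed.

Lemma fam_X2 F : fam F -> fam (fun e => X2 (F e)).
Proof.
elim=> {F} [f X c tf tX|F G fF hF fG hG|F fF hF].
- by apply: (eq_fam _ (fam_add (fam_base (c + pi / 2) (tst_mull smooth_wv tf) tX)
    (fam_eps (fam_X2_base c tf tX)))) => e x; rewrite X2_base.
- apply: (eq_fam _ (fam_add hF hG)) => e x.
  have := X2_add_scale 1 (fam_smooth e fF) (fam_smooth e fG).
  rewrite (_ : (fun x => F e x + 1 * G e x) = fun x => F e x + G e x) => [->|]; first by rewrite mul1r.
  by apply/funext => y; rewrite mul1r.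
- apply: (eq_fam _ (fam_eps hF)) => e x.
  have := X2_add_scale e (smooth_cst 0) (fam_smooth e fF).
  rewrite (_ : (fun x => 0 + _) = fun x => e * F e x) => [->|]; last by apply/funext => y; rewrite add0r.
  have -> : X2 (fun _ : V => 0 : R) x = 0.
    by rewrite /X2 big1// => i _; rewrite derive_cst mulr0.
  by rewrite add0r.
Qed.

Lemma fam_sublaplacian F : fam F -> fam (fun e => A (F e)).
Proof. by move=> fF; apply: fam_add; [exact: fam_X1 (fam_X1 fF)|exact: fam_X2 (fam_X2 fF)]. Qed.

Definition schr f (a : R) : R := 'D_(1 : R) ('D_(1 : R) f) a - wv a ^+ 2 * f a.

Lemma tst_schr f : tst f -> tst (schr f).
Proof.
move=> tf; rewrite (_ : schr f = fun a => 'D_1 ('D_1 f) a + (- wv a ^+ 2) * f a); last first.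
  by apply/funext => a; rewrite /schr mulNr.
apply: tst_add; first exact: tst_derive1 (tst_derive1 tf).
apply: tst_mull => //; rewrite (_ : (fun a => - wv a ^+ 2) = fun a => -1 * wv a ^+ 2).
  by apply: smooth_mul; [exact: smooth_cst|apply: smooth_exp; exact: smooth_wv].
by apply/funext => a; rewrite mulN1r.
Qed.

(** Two applications of [X2] shift the phase by pi, that is, change the sign, which produces the
    term - wv^2 f of [schr]. Any derivative that falls on the cutoff X brings out a factor e. *)
Lemma sublaplacian_base f X c : tst f -> tst X -> exists2 G, fam G &
  forall e x, A (base f X c e) x = base (schr f) X c e x + e * G e x.
Proof.
move=> tf tX; pose f1 a := wv a * f a.
have tf1 : tst f1 := tst_mull smooth_wv tf.
have fR := fam_X2_base c tf tX.
exists (fun e x => \sum_(i < n) base (fun a => cf i a * f1 a) ('D_(delta_mx ord0 i) X) (c + pi / 2) e x +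
  X2 (fun x => \sum_(i < n) base (fun a => cf i a * f a) ('D_(delta_mx ord0 i) X) c e x) x).
  by apply: fam_add; [exact: fam_X2_base|exact: fam_X2 fR].
move=> e x; rewrite /sublaplacian /=.
have E1 : X1 (base f X c e) = base ('D_(1 : R) f) X c e by apply/funext => y; exact: X1_base.
rewrite E1 (X1_base c (tst_derive1 tf) tX).
have E2 : X2 (base f X c e) = fun y => base f1 X (c + pi / 2) e y +
    e * \sum_(i < n) base (fun a => cf i a * f a) ('D_(delta_mx ord0 i) X) c e y.
  by apply/funext => y; exact: X2_base.
rewrite E2 X2_add_scale; [|exact: fam_smooth (fam_base _ tf1 tX)|exact: fam_smooth fR].
rewrite (X2_base _ tf1 tX) -addrA -mulrDr addrA; congr (_ + _).
rewrite /base (_ : c + pi / 2 + pi / 2 = c + pi); last by rewrite -addrA -splitr.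
by rewrite wave_pi /schr /f1; ring.
Qed.

End family.

Lemma cvg_norm_le {R : realType} (u : nat -> R) (l M K : R) : u m @[m --> \oo] --> l ->
  (forall m, `|u m| <= M + K * m.+1%:R^-1) -> `|l| <= M.
Proof.
move=> ul h.
have h1 : `|u m| @[m --> \oo] --> `|l| by exact: cvg_norm.
have h2 : M + K * m.+1%:R^-1 @[m --> \oo] --> M + K * 0.
  apply: cvgD; first exact: cvg_cst.
  by apply: cvgM; [exact: cvg_cst|exact: cvg_harmonic].
rewrite mulr0 addr0 in h2.
by apply: (ler_cvg_to h1 h2); exact: nearW.
Qed.

Lemma natSV_gt0 {R : realType} m : 0 < m.+1%:R^-1 :> R.
Proof. by rewrite invr_gt0 ltr0n. Qed.

Lemma natSV_le1 {R : realType} m : m.+1%:R^-1 <= 1 :> R.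
Proof. by rewrite invf_le1 ?ltr0n// ler1n. Qed.

Section finite_sums.
Context d (T : measurableType d) (R : realType) (mu : {measure set T -> \bar R}).

Lemma integ_sum (I : Type) (r : seq I) (F : I -> T -> R) : (forall i, integ mu (F i)) ->
  integ mu (fun x => \sum_(i <- r) F i x).
Proof.
move=> iF; elim: r => [|i r ih].
  by apply: (eq_integ _ (integ0 mu)) => x; rewrite big_nil.
by apply: (eq_integ _ (integD (iF i) ih)) => x; rewrite big_cons.
Qed.

Lemma Rint_sum (I : Type) (r : seq I) (F : I -> T -> R) : (forall i, integ mu (F i)) ->
  \int[mu]_x (\sum_(i <- r) F i x) = \sum_(i <- r) \int[mu]_x F i x.
Proof.
move=> iF; elim: r => [|i r ih].
  by rewrite big_nil -[RHS](Rint0 mu); apply: eq_Rint => x; rewrite big_nil.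
rewrite big_cons -ih -RintD//; last exact: integ_sum.
by apply: eq_Rint => x; rewrite big_cons.
Qed.

End finite_sums.

Lemma derive_smooth_sum {R : realType} (W : normedModType R) (I : Type) (r : seq I) (F : I -> W -> R) x v :
  (forall i, smooth (F i)) -> 'D_v (fun y => \sum_(i <- r) F i y) x = \sum_(i <- r) 'D_v (F i) x.
Proof.
move=> sF; have [//] : is_derive x v (fun y => \sum_(i <- r) F i y) (\sum_(i <- r) 'D_v (F i) x).
elim: r => [|i r ih].
  rewrite big_nil (_ : (fun _ => _) = fun=> 0); first exact: is_derive_cst.
  by apply/funext => y; rewrite big_nil.
rewrite big_cons (_ : (fun _ => _) = F i + (fun y => \sum_(j <- r) F j y)).
  by apply: is_deriveD; exact: smooth_is_derive.
by apply/funext => y; rewrite big_cons.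
Qed.

(** * Integration by parts against plane waves *)

Section tst_integrals.
Context {R : realType} {n : nat}.

Lemma tst1_bounded (f : R -> R) : tst f -> exists M, forall x, `|f x| <= M.
Proof.
move=> tf; have /test_bounded[M hM] := tensor_test tf (@tst_chi R 0).
by exists M => x; have := hM (x, 0); rewrite /= chi0 mulr1.
Qed.

Lemma tstV_bounded (X : 'rV[R]_n -> R) : tst X -> exists M, forall x, `|X x| <= M.
Proof.
move=> tX; have /test_bounded[M hM] := tensor_test (@tst_bump R) tX.
by exists M => x; have := hM (0, x); rewrite /= bump0 mul1r.
Qed.

Lemma tstV_integ (X : 'rV[R]_n -> R) : tst X -> integ (leb n) X.
Proof.
move=> tX; have [M hM] := tstV_bounded tX; have [sX [C XC]] := tX.
apply: (@integ_bounded_support _ _ _ (leb n) [set v | `|v| <= C] X M) => //.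
- exact: measurable_norm_le.
- exact: leb_ball_fin.
- by apply: measurable_continuous_rV; exact: smooth_continuous.
- by move=> x /negP; rewrite -ltNge => /XC.
Qed.

Lemma bounded_support_integ1 (h : R -> R) (C M : R) : measurable_fun setT h ->
  (forall x, `|h x| <= M) -> (forall x, C < `|x| -> h x = 0) -> integ lebesgue_measure h.
Proof.
move=> mh hM hC.
apply: (@integ_bounded_support _ _ _ lebesgue_measure (`[- C, C]%classic : set R) h M) => //.
- have := @lebesgue_measure_itv R `[- C, C]; rewrite /= => ->.
  by case: ifP => _; rewrite ?ltry// -EFinB ltry.
- move=> x /= h1; apply: hC; rewrite ltNge; apply/negP => h2; apply: h1.
  by rewrite in_itv /= -ler_norml.
Qed.

Lemma tst1_integ (f : R -> R) : tst f -> integ lebesgue_measure f.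
Proof.
move=> tf; have [M hM] := tst1_bounded tf; have [sf [C fC]] := tf.
apply: (bounded_support_integ1 _ hM fC).
by apply: continuous_measurable_fun; exact: smooth_continuous.
Qed.

Lemma continuous_tst_integ (a f : R -> R) : continuous a -> tst f ->
  integ lebesgue_measure (fun x => a x * f x).
Proof.
move=> ca tf; have [sf [C fC]] := tf; have sc := smooth_continuous sf.
have c : continuous (fun x => a x * f x) by move=> x; apply: cvgM; [exact: ca|exact: sc].
have [M hM] : exists M, forall x, `|a x * f x| <= M.
  have /compact_bounded[M [_ hM]] : compact ((fun x => a x * f x) @` `[- C, C]).
    by apply: continuous_compact; [exact: continuous_subspaceT|exact: segment_compact].
  exists (Num.max 0 (M + 1)) => x; rewrite le_max.
  have [xC|xC] := leP `|x| C; last by rewrite fC// mulr0 normr0 lexx.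
  apply/orP; right; apply: hM; first by rewrite ltrDl.
  by exists x => //=; rewrite in_itv /= -ler_norml.
apply: (bounded_support_integ1 (C := C) _ hM) => [|x xC]; last by rewrite fC// mulr0.
exact: continuous_measurable_fun.
Qed.

Lemma Rint_haarE (h : R -> R) (k : 'rV[R]_n -> R) :
  integ lebesgue_measure h -> integ (leb n) k ->
  integ haar (fun z => h z.1 * k z.2) /\
  \int[haar]_z (h z.1 * k z.2) = (\int[lebesgue_measure]_x h x) * \int[leb n]_y k y.
Proof. exact: Rint_tensor. Qed.

(** The statement on the group, applied to X times a bump in the first variable; the bump has
    nonzero mass, which can be cancelled. *)
Lemma tstV_int_derive0 (X : 'rV[R]_n -> R) v : tst X -> \int[leb n]_z 'D_v X z = 0.
Proof.
move=> tX; have tb := @tst_bump R; have tc := @tst_chi R n.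
have := int_derive0 (0, v) (tensor_test tb tX).
rewrite (eq_Rint haar (g := fun x => bump x.1 * 'D_v X x.2)); last first.
  move=> x; have d1 := derive_fst x (0, v) tb.1; have d2 := derive_snd 1 x (0, v) tX.1.
  have [_ h] := is_deriveM d1 d2.
  transitivity (bump x.1 * (1 * 'D_v X (1 *: x.2)) + X (1 *: x.2) * ('D_1 bump x.1 * 0)).
    by rewrite -[RHS]h; congr ('D_(0, v) _ x); apply/funext => y;
      exact: (congr1 (fun z => bump y.1 * X z) (esym (scale1r y.2))).
  by rewrite scale1r mul1r mulr0 mulr0 addr0.
have [_ ->] := Rint_haarE (tst1_integ tb) (tstV_integ (tstD v tX)).
have : 0 < \int[@haar R n]_x (bump x.1 * chi x.2).
  apply: (@int_test_gt0 R n _ 0 (tensor_test tb tc)) => [x|].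
    by rewrite mulr_ge0 ?bump_ge0 ?chi_ge0.
  by rewrite /= bump0 chi0 mulr1.
have [_ ->] := Rint_haarE (tst1_integ tb) (tstV_integ tc).
have [->|h] := eqVneq (\int[lebesgue_measure]_x bump x : R) 0; first by rewrite mul0r ltxx.
by move=> _ /eqP; rewrite mulf_eq0 (negPf h)/= => /eqP.
Qed.

Lemma wave_ibp (eta : 'rV[R]_n) c (k : 'rV[R]_n -> R) v : tst k ->
  \int[leb n]_z (wave eta c z * 'D_v k z) =
  - (2 * pi * dotv eta v) * \int[leb n]_z (wave eta (c + pi / 2) z * k z).
Proof.
move=> tk; have sw := smooth_wave eta c.
have t1 : tst (fun z => wave eta c z * 'D_v k z) by apply: tst_mull sw (tstD v tk).
have t2 : tst (fun z => wave eta (c + pi / 2) z * k z) by apply: tst_mull (smooth_wave _ _) tk.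
have := tstV_int_derive0 v (tst_mull sw tk).
rewrite (eq_Rint (leb n) (g := fun z => wave eta c z * 'D_v k z +
   2 * pi * dotv eta v * (wave eta (c + pi / 2) z * k z))); last first.
  move=> z; have [_] := is_deriveM (derive_wave eta c z v) (smooth_is_derive z v tk.1).
  by rewrite /GRing.scale /= => ->; ring.
rewrite RintD; [|exact: tstV_integ|by apply: integZ; exact: tstV_integ].
rewrite RintZ; last exact: tstV_integ.
by move=> /eqP; rewrite addr_eq0 => /eqP ->; rewrite mulNr.
Qed.

Lemma wave_ibp2 (eta : 'rV[R]_n) c (k : 'rV[R]_n -> R) v w : tst k ->
  \int[leb n]_z (wave eta c z * 'D_v ('D_w k) z) =
  - (2 * pi * dotv eta v * (2 * pi * dotv eta w)) * \int[leb n]_z (wave eta c z * k z).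
Proof.
move=> tk; rewrite wave_ibp; last exact: tstD.
rewrite wave_ibp// -addrA -splitr.
rewrite (eq_Rint (leb n) (g := fun z => -1 * (wave eta c z * k z))); last first.
  by move=> z; rewrite wave_pi; ring.
rewrite RintZ; last by apply: tstV_integ; apply: tst_mull (smooth_wave _ _) tk.
by ring.
Qed.

End tst_integrals.

Lemma weak_pair_algebra {R : realType} (a b e g u v x y : R) :
  a * x - b * y + (- e * x - - g * y) = u * x - v * y ->
  (a - e - u) * x = (b - g - v) * y.
Proof. by lra. Qed.

Section partial_fourier.
Context {R : realType} {n : nat} (eta : 'rV[R]_n).
Local Notation V := (R * 'rV[R]_n)%type.
Local Notation haar := (@haar R n).
Local Notation test := (@test_function R V).
Local Notation A := (@sublaplacian R n).

Variables (S : R -> (V -> R) -> (V -> R)) (p : R -> V -> R).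
Hypothesis gen : generated_by haar (friedrichs haar test A) S.
Hypothesis hp : forall t, 0 < t -> continuous (p t) /\ forall f, test f ->
  {ae haar, forall h : V, S t f h = \int[haar]_g (f (Gmul h g) * p t g)}.

(* The semigroup generated by [f'' - wv eta^2 f], obtained by pushing [p] forward
   through the representation of the group attached to [eta].  The phases [c = 0]
   and [c = pi / 2] give its real and imaginary parts. *)
Definition Q (f : R -> R) (c t x : R) : R :=
  if t == 0 then cos c * f x
  else \int[haar]_g (f (x + g.1) * wave eta c (Gmul (x, 0) g).2 * p t g).

Lemma Q_pos f c t x : 0 < t ->
  Q f c t x = \int[haar]_g (f (x + g.1) * wave eta c (Gmul (x, 0) g).2 * p t g).
Proof. by move=> t0; rewrite /Q gt_eqF. Qed.

Lemma dotv0 : dotv eta 0 = 0.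
Proof. by rewrite /dotv big1// => i _; rewrite mxE mulr0. Qed.

Lemma Gmul_split x w (g : V) : (Gmul (x, w) g).2 = w + (Gmul (x, 0) g).2.
Proof.
apply/rowP => j; rewrite !mxE /= crd_ord -[in LHS](crd_ord w).
by rewrite crd_ord (crd_ord (0 : 'rV[R]_n)) mxE add0r.
Qed.

(** A translation of the base point in z commutes with the group law and only changes the phase of
    the wave. This is how the dependence on z is separated from a function of one real variable. *)
Lemma wave_Gmul c x w (g : V) :
  wave eta c (Gmul (x, w) g).2 = wave eta (c + 2 * pi * dotv eta w) (Gmul (x, 0) g).2.
Proof.
rewrite Gmul_split /wave -[w in LHS]scale1r dotv_lin mul1r; congr cos; ring.
Qed.

Definition bs f c m := base eta f (@chi R n) c m.+1%:R^-1.

Lemma bs_cvg f c (g : V) : bs f c m g @[m --> \oo] --> f g.1 * wave eta c g.2.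
Proof.
apply: cvgM; last exact: cvg_cst.
rewrite -[X in _ --> X]mulr1; apply: cvgM; [exact: cvg_cst|exact: chi_cvg].
Qed.

Lemma bs_le f c (M : R) m g : (forall x, `|f x| <= M) -> `|bs f c m g| <= M.
Proof.
move=> hM; have M0 : 0 <= M by rewrite (le_trans _ (hM 0)).
rewrite /bs /base !normrM -[leRHS]mulr1 ler_pM ?mulr_ge0 ?wave_le1//.
by rewrite -[leRHS]mulr1 ler_pM// ger0_norm ?chi_ge0// chi_le1.
Qed.

Lemma test_bs f c m : tst f -> test (bs f c m).
Proof. by move=> tf; apply: test_base => //; exact: tst_chi. Qed.

Lemma U_norm_le F (M : R) t h : test F -> (forall x, `|F x| <= M) -> 0 <= t -> `|U p F t h| <= M.
Proof.
move=> tF hM t0; have M0 : 0 <= M by rewrite (le_trans _ (hM 0)).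
rewrite ler_norml; apply/andP; split.
  rewrite lerNl -(U_N hp)//; apply: (U_le gen hp _ (testN tF)) => // x.
  by have := hM x; rewrite ler_norml lerNl => /andP[].
by apply: (U_le gen hp) => // x; exact: le_trans (ler_norm _) (hM x).
Qed.

Lemma Q_integrand_measurable (f : R -> R) c x : continuous f ->
  measurable_fun [set: measurableTypeR R * 'rV[R]_n] (fun g : V => f (x + g.1) * wave eta c (Gmul (x, 0) g).2).
Proof.
move=> cf; apply: measurable_continuous_prod_rV => g; apply: cvgM.
  apply: (@continuous_comp _ _ _ (fun g : V => x + g.1) f); last exact: cf.
  by apply: cvgD; [exact: cvg_cst|exact: cvg_fst].
apply: (@continuous_comp _ _ _ (fun g : V => (Gmul (x, 0) g).2) (wave eta c)); last first.
  exact: (smooth_continuous (smooth_wave _ _)).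
apply: (@continuous_comp _ _ _ (fun g : V => Gmul (x, 0) g) snd); last exact: cvg_snd.
exact: continuous_Gmulr.
Qed.

Lemma Q_integ f c t x : tst f -> 0 < t ->
  integ haar (fun g => f (x + g.1) * wave eta c (Gmul (x, 0) g).2 * p t g).
Proof.
move=> tf t0; have [M hM] := tst1_bounded tf.
apply: (@integ_mulr_bounded _ _ _ haar (p t) _ M).
- exact: (p_integ gen hp t0).1.
- by apply: Q_integrand_measurable; exact: smooth_continuous tf.1.
- by move=> g; rewrite normrM -[leRHS]mulr1 ler_pM// wave_le1.
Qed.

(** The cutoff in z is removed by dominated convergence with a multiple of p_t, whose integrability
    comes from the Markov property. *)
Lemma U_bs_cvg f c t x w : tst f -> 0 <= t ->
  U p (bs f c m) t (x, w) @[m --> \oo] --> Q f (c + 2 * pi * dotv eta w) t x.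
Proof.
move=> tf; rewrite le_eqVlt => /predU1P[<-|t0].
  rewrite /U /Q eqxx; have := @bs_cvg f c (x, w).
  by rewrite /= mulrC /wave addrC.
have [M hM] := tst1_bounded tf; have M0 : 0 <= M by rewrite (le_trans _ (hM 0)).
rewrite Q_pos//.
under eq_fun do rewrite U_pos//.
apply: (proj2 (@Rint_cvg _ _ _ haar (fun m g => bs f c m (Gmul (x, w) g) * p t g) _ (fun g => M * p t g) _ _ _ _)).
- by move=> m; apply: integ_measurable; apply: Gmul_test_integ; [exact: test_bs|exact: (hp t0).1].
- move=> g; apply: cvgM; last exact: cvg_cst.
  by have := @bs_cvg f c (Gmul (x, w) g); rewrite wave_Gmul.
- by apply: integZ; exact: (p_integ gen hp t0).1.
- move=> m g; rewrite normrM (ger0_norm (p_ge0 gen hp _ t0)) ler_wpM2r ?(p_ge0 gen hp)//.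
  exact: bs_le.
Qed.

Lemma U_bs_cvg0 f c t x : tst f -> 0 <= t -> U p (bs f c m) t (x, 0) @[m --> \oo] --> Q f c t x.
Proof. by move=> tf t0; have := @U_bs_cvg f c t x 0 tf t0; rewrite dotv0 mulr0 addr0. Qed.

Lemma Q_le f c t x (M : R) : tst f -> (forall y, `|f y| <= M) -> 0 <= t -> `|Q f c t x| <= M.
Proof.
move=> tf hM t0; apply: (@cvg_norm_le _ _ _ M 0 (@U_bs_cvg0 f c t x tf t0)) => m.
by rewrite mul0r addr0; apply: U_norm_le => //; [exact: test_bs|move=> y; exact: bs_le].
Qed.

Lemma U_schr_approx f c : tst f -> exists N : R, forall m t h, 0 <= t ->
  `|U p (A (bs f c m)) t h - U p (bs (schr eta f) c m) t h| <= N * m.+1%:R^-1.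
Proof.
move=> tf; have [G fG eG] := sublaplacian_base eta c tf (@tst_chi R n).
have [N hN] := fam_bounded fG; exists N => m t h t0.
have tA := test_sublaplacian (test_bs c m tf); have tS := test_bs c m (tst_schr eta tf).
rewrite -(U_sub hp _ tA tS t0); apply: U_norm_le => //; first exact: test_sub.
move=> x; rewrite eG addrC addKr normrM ger0_norm ?invr_ge0// mulrC ler_wpM2r ?invr_ge0//.
by apply: hN; rewrite natSV_gt0 natSV_le1.
Qed.

Lemma AA_bounded f c : tst f -> exists M : R, forall m x, `|A (A (bs f c m)) x| <= M.
Proof.
move=> tf; have fb := fam_base eta c tf (@tst_chi R n).
have [M hM] := fam_bounded (fam_sublaplacian (fam_sublaplacian fb)).
by exists M => m x; apply: hM; rewrite natSV_gt0 natSV_le1.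
Qed.

Lemma A_bounded f c : tst f -> exists M : R, forall m x, `|A (bs f c m) x| <= M.
Proof.
move=> tf; have fb := fam_base eta c tf (@tst_chi R n).
have [M hM] := fam_bounded (fam_sublaplacian fb).
by exists M => m x; apply: hM; rewrite natSV_gt0 natSV_le1.
Qed.

Lemma Q_lip f c : tst f -> exists2 M : R, 0 <= M & forall r t x, 0 <= r <= t ->
  `|Q f c t x - Q f c r x| <= M * (t - r).
Proof.
move=> tf; have [M hM] := A_bounded c tf.
exists M => [|r t x rt]; first by rewrite (le_trans _ (hM 0%N 0)).
have /andP[r0 tr] := rt; have t0 := le_trans r0 tr.
apply: (@cvg_norm_le _ (fun m => U p (bs f c m) t (x, 0) - U p (bs f c m) r (x, 0)) _ _ 0).
  by apply: cvgB; exact: U_bs_cvg0.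
move=> m; rewrite mul0r addr0; apply: (U_lip gen hp) => //; exact: test_bs.
Qed.

(** [AA_bounded] makes the quadratic constant independent of the cutoff, and replacing the
    sub-Laplacian of the cut-off wave by the wave of [schr eta f] costs O(1/m). *)
Lemma Q_taylor f c : tst f -> exists2 M : R, 0 <= M & forall r t x, 0 <= r <= t ->
  `|Q f c t x - Q f c r x - (t - r) * Q (schr eta f) c r x| <= M * (t - r) ^+ 2.
Proof.
move=> tf; have [M hM] := AA_bounded c tf; have [N hN] := U_schr_approx c tf.
exists M => [|r t x rt]; first by rewrite (le_trans _ (hM 0%N 0)).
have /andP[r0 tr] := rt; have t0 := le_trans r0 tr.
have tS := tst_schr eta tf.
apply: (@cvg_norm_le _ (fun m => U p (bs f c m) t (x, 0) - U p (bs f c m) r (x, 0) -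
   (t - r) * U p (bs (schr eta f) c m) r (x, 0)) _ _ ((t - r) * N)).
  apply: cvgB; first by apply: cvgB; exact: U_bs_cvg0.
  by apply: cvgM; [exact: cvg_cst|exact: U_bs_cvg0].
move=> m; have h1 := U_taylor gen hp (x, 0) (test_bs c m tf) (hM m) rt.
have h2 := hN m r (x, 0) r0.
rewrite (_ : U p (bs f c m) t (x, 0) - _ - _ = (U p (bs f c m) t (x, 0) - U p (bs f c m) r (x, 0) -
   (t - r) * U p (A (bs f c m)) r (x, 0)) + (t - r) * (U p (A (bs f c m)) r (x, 0) - U p (bs (schr eta f) c m) r (x, 0))); last first.
  by move: (U p _ _ _) (U p _ _ _) (U p _ _ _) (U p _ _ _) => a b d e; ring.
apply: (le_trans (ler_normD _ _)); apply: lerD => //.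
rewrite normrM (@ger0_norm _ (t - r)) ?subr_ge0// -mulrA ler_wpM2l ?subr_ge0//.
Qed.

Lemma Q_add f c d t x : tst f -> 0 <= t ->
  Q f (c + d) t x = cos d * Q f c t x + sin d * Q f (c + pi / 2) t x.
Proof.
move=> tf; rewrite le_eqVlt => /predU1P[<-|t0].
  by rewrite /Q eqxx cosDpihalf cosD; ring.
have i1 := Q_integ c x tf t0; have i2 := Q_integ (c + pi / 2) x tf t0.
rewrite !Q_pos// -!RintZ// -RintD; [|exact: integZ|exact: integZ].
by apply: eq_Rint => g; rewrite wave_add; ring.
Qed.

Lemma Q_addpi f c t x : tst f -> 0 <= t -> Q f (c + pi) t x = - Q f c t x.
Proof. by move=> tf t0; rewrite Q_add// cospi sinpi; ring. Qed.

Lemma Q_wave f c t x w : tst f -> 0 <= t ->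
  Q f (c + 2 * pi * dotv eta w) t x = wave eta 0 w * Q f c t x - wave eta (pi / 2) w * Q f (c + pi / 2) t x.
Proof.
move=> tf t0; rewrite Q_add// /wave cosDpihalf addr0; ring.
Qed.

Lemma Q_continuous f c t : tst f -> 0 <= t -> continuous (Q f c t).
Proof.
move=> tf; have cf := smooth_continuous tf.1; rewrite le_eqVlt => /predU1P[<-|t0] x.
  by rewrite /Q eqxx; apply: cvgM; [exact: cvg_cst|exact: cf].
have [M hM] := tst1_bounded tf; have M0 : 0 <= M by rewrite (le_trans _ (hM 0)).
apply: continuous_seq => u ux; rewrite Q_pos//.
under eq_fun do rewrite Q_pos//.
apply: (proj2 (@Rint_cvg _ _ _ haar (fun m g => f (u m + g.1) * wave eta c (Gmul (u m, 0) g).2 * p t g) _ (fun g => M * p t g) _ _ _ _)).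
- by move=> m; apply: integ_measurable; exact: Q_integ.
- move=> g; apply: cvgM; last exact: cvg_cst.
  apply: cvgM.
    apply: (cvg_comp u (fun y => f (y + g.1)) ux).
    apply: (@continuous_comp _ _ _ (fun y : R => y + g.1) f); last exact: cf.
    by apply: cvgD; [exact: cvg_id|exact: cvg_cst].
  apply: (cvg_comp u (fun y => wave eta c (Gmul (y, 0) g).2) ux).
  apply: (@continuous_comp _ _ _ (fun y : R => (Gmul (y, 0) g).2) (wave eta c)); last first.
    exact: (smooth_continuous (smooth_wave _ _)).
  apply: (@continuous_comp _ _ _ (fun y : R => Gmul (y, 0) g) snd); last exact: cvg_snd.
  apply: (@continuous_comp _ _ _ (fun y : R => (y, 0) : V) (fun h : V => Gmul h g)); last exact: continuous_Gmull.
  by apply: continuous_pair => y; [exact: cvg_id|exact: cvg_cst].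
- by apply: integZ; exact: (p_integ gen hp t0).1.
- move=> m g; rewrite normrM (ger0_norm (p_ge0 gen hp _ t0)) ler_wpM2r ?(p_ge0 gen hp)//.
  by rewrite normrM -[leRHS]mulr1 ler_pM// wave_le1.
Qed.

Lemma Q_weakV f c t psi : tst f -> test psi -> 0 <= t ->
  \int[haar]_z (Q f (c + 2 * pi * dotv eta z.2) t z.1 * A psi z) =
  \int[haar]_z (Q (schr eta f) (c + 2 * pi * dotv eta z.2) t z.1 * psi z).
Proof.
move=> tf tpsi t0; have tS := tst_schr eta tf; have tA := test_sublaplacian tpsi.
have [M hM] := tst1_bounded tf; have [M' hM'] := A_bounded c tf.
have [N hN] := U_schr_approx c tf.
have h1 : \int[haar]_z (U p (bs f c m) t z * A psi z) @[m --> \oo] -->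
    \int[haar]_z (Q f (c + 2 * pi * dotv eta z.2) t z.1 * A psi z).
  apply: (proj2 (@Rint_cvg _ _ _ haar _ _ (fun z => M * `|A psi z|) _ _ _ _)).
  - by move=> m; apply: integ_measurable; exact: (U_test_integ hp (test_bs c m tf) tA t0).
  - by move=> -[x w]; apply: cvgM; [exact: U_bs_cvg|exact: cvg_cst].
  - by apply: integZ; apply: integ_norm; exact: test_integ.
  - move=> m z; rewrite normrM ler_wpM2r//; apply: U_norm_le => //; first exact: test_bs.
    by move=> x; exact: bs_le.
have h2 : \int[haar]_z (U p (A (bs f c m)) t z * psi z) @[m --> \oo] -->
    \int[haar]_z (Q (schr eta f) (c + 2 * pi * dotv eta z.2) t z.1 * psi z).
  apply: (proj2 (@Rint_cvg _ _ _ haar _ _ (fun z => M' * `|psi z|) _ _ _ _)).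
  - move=> m; apply: integ_measurable.
    exact: (U_test_integ hp (test_sublaplacian (test_bs c m tf)) tpsi t0).
  - move=> -[x w]; apply: cvgM; last exact: cvg_cst.
    have e : U p (A (bs f c m)) t (x, w) - U p (bs (schr eta f) c m) t (x, w) @[m --> \oo] --> (0 : R).
      apply/norm_cvg0P; apply: (@squeeze_cvgr _ _ _ _ (fun=> 0) (fun m => N * m.+1%:R^-1)).
      - by apply: nearW => m; rewrite normr_ge0 hN.
      - exact: cvg_cst.
      - by rewrite -(mulr0 N); apply: cvgM; [exact: cvg_cst|exact: cvg_harmonic].
    have := cvgD e (@U_bs_cvg (schr eta f) c t x w tS t0); rewrite add0r => /(_ _) h.
    rewrite (_ : (fun m => U p (A (bs f c m)) t (x, w)) =
      (fun m => U p (A (bs f c m)) t (x, w) - U p (bs (schr eta f) c m) t (x, w)) +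
      (fun m => U p (bs (schr eta f) c m) t (x, w))); first exact: h.
    by apply/funext => m; apply/esym; exact: subrK.
  - by apply: integZ; apply: integ_norm; exact: test_integ.
  - move=> m z; rewrite normrM ler_wpM2r//.
    exact: (U_norm_le _ (test_sublaplacian (test_bs c m tf)) (hM' m) t0).
have h3 : \int[haar]_z (U p (bs f c m) t z * A psi z) @[m --> \oo] -->
    \int[haar]_z (Q (schr eta f) (c + 2 * pi * dotv eta z.2) t z.1 * psi z).
  rewrite (_ : (fun m => _) = fun m => \int[haar]_z (U p (A (bs f c m)) t z * psi z)); first exact: h2.
  by apply/funext => m; exact: (U_weak gen hp (test_bs c m tf) tpsi t0).
exact: (cvg_unique (@norm_hausdorff _ _) h1 h3).
Qed.

Lemma Q_tensor f c t (h : R -> R) (k : 'rV[R]_n -> R) : tst f -> 0 <= t -> tst h -> tst k ->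
  integ haar (fun z => Q f (c + 2 * pi * dotv eta z.2) t z.1 * (h z.1 * k z.2)) /\
  \int[haar]_z (Q f (c + 2 * pi * dotv eta z.2) t z.1 * (h z.1 * k z.2)) =
    (\int[lebesgue_measure]_x (Q f c t x * h x)) * (\int[leb n]_w (wave eta 0 w * k w)) -
    (\int[lebesgue_measure]_x (Q f (c + pi / 2) t x * h x)) * (\int[leb n]_w (wave eta (pi / 2) w * k w)).
Proof.
move=> tf t0 th tk.
have i1 := continuous_tst_integ (@Q_continuous f c t tf t0) th.
have i2 := continuous_tst_integ (@Q_continuous f (c + pi / 2) t tf t0) th.
have j1 := tstV_integ (tst_mull (smooth_wave eta 0) tk).
have j2 := tstV_integ (tst_mull (smooth_wave eta (pi / 2)) tk).
have [k1 e1] := Rint_haarE i1 j1; have [k2 e2] := Rint_haarE i2 j2.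
have E z : Q f c t z.1 * h z.1 * (wave eta 0 z.2 * k z.2) -
    Q f (c + pi / 2) t z.1 * h z.1 * (wave eta (pi / 2) z.2 * k z.2) =
    Q f (c + 2 * pi * dotv eta z.2) t z.1 * (h z.1 * k z.2).
  by rewrite Q_wave//; ring.
split; first by apply: (@eq_integ _ _ _ haar _ _ E); exact: integB.
by rewrite (eq_Rint haar (fun z => esym (E z))) (RintB k1 k2) e1 e2.
Qed.

(* The weak equation on the group, tested on [h x * k z] and integrated by
   parts in [z]. *)
Lemma Q_weak_pair f c t (h : R -> R) (k : 'rV[R]_n -> R) : tst f -> 0 <= t -> tst h -> tst k ->
  (\int[lebesgue_measure]_x (Q f c t x * schr eta h x) -
   \int[lebesgue_measure]_x (Q (schr eta f) c t x * h x)) * \int[leb n]_w (wave eta 0 w * k w) =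
  (\int[lebesgue_measure]_x (Q f (c + pi / 2) t x * schr eta h x) -
   \int[lebesgue_measure]_x (Q (schr eta f) (c + pi / 2) t x * h x)) * \int[leb n]_w (wave eta (pi / 2) w * k w).
Proof.
move=> tf t0 th tk; have tS := tst_schr eta tf.
pose d i : 'rV[R]_n := delta_mx ord0 i.
pose h2 (i j : 'I_n) x := cf i x * (cf j x * h x).
have th2 i j : tst (h2 i j) by apply: tst_mull (smooth_cf i) (tst_mull (smooth_cf j) th).
have tD i j : tst ('D_(d i) ('D_(d j) k)) by apply: tstD; exact: tstD.
have thh := tst_derive1 (tst_derive1 th).
have EA z : A (fun z => h z.1 * k z.2) z = 'D_(1 : R) ('D_(1 : R) h) z.1 * k z.2 +
    \sum_(j < n) \sum_(i < n) h2 i j z.1 * 'D_(d i) ('D_(d j) k) z.2.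
  (* At frequency 0 and scale 1 a cut-off wave is a plain tensor product and its symbol vanishes, so
     the formulas for waves also compute the sub-Laplacian of h times k. *)
  have B g X : base 0 g X 0 1 = fun z : V => g z.1 * X z.2.
    apply/funext => y; rewrite /base scale1r /wave (_ : dotv 0 _ = 0) ?mulr0 ?addr0 ?cos0 ?mulr1//.
    by rewrite /dotv big1// => i _; rewrite mxE mul0r.
  have W0 a : wv 0 a = 0 :> R.
    by rewrite /wv big1 ?mulr0// => i _; rewrite mxE mul0r.
  have X2B g X : tst g -> tst X -> X2 (fun z : V => g z.1 * X z.2) =
      fun z => \sum_(i < n) (cf i z.1 * g z.1) * 'D_(d i) X z.2.
    move=> tg tX; rewrite -B; apply/funext => y; rewrite X2_base// mul1r.
    rewrite [X in X + _]/base W0 !mul0r add0r.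
    by apply: eq_bigr => i _; rewrite B.
  have X1B g X : tst g -> tst X -> X1 (fun z : V => g z.1 * X z.2) =
      fun z => 'D_(1 : R) g z.1 * X z.2.
    by move=> tg tX; rewrite -B; apply/funext => y; rewrite X1_base// B.
  rewrite /sublaplacian /= (X1B h k th tk) (X1B _ k (tst_derive1 th) tk).
  congr (_ + _); rewrite (X2B h k th tk).
  have sj (j : 'I_n) : smooth (fun z : V => cf j z.1 * h z.1 * 'D_(d j) k z.2).
    exact: (tensor_test (tst_mull (smooth_cf j) th) (tstD (d j) tk)).1.
  transitivity (\sum_(j < n) X2 (fun z : V => cf j z.1 * h z.1 * 'D_(d j) k z.2) z).
    rewrite /X2 exchange_big /=; apply: eq_bigr => i _; rewrite -mulr_sumr; congr (_ * _).
    exact: derive_smooth_sum.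
  apply: eq_bigr => j _.
  exact: (congr1 (fun G => G z) (X2B _ _ (tst_mull (smooth_cf j) th) (tstD (d j) tk))).
have := Q_weakV c tf (tensor_test th tk) t0.
have [_ e1] := Q_tensor c tS t0 th tk.
rewrite e1.
have ID a i j : \int[leb n]_w (wave eta a w * 'D_(d i) ('D_(d j) k) w) =
    - (2 * pi * eta ord0 i * (2 * pi * eta ord0 j)) * \int[leb n]_w (wave eta a w * k w).
  have dd l : dotv eta (d l) = eta ord0 l.
    rewrite /dotv (bigD1 l)//= mxE !eqxx mulr1 big1 ?addr0// => m ml.
    by rewrite mxE eqxx (negPf ml) mulr0.
  by rewrite wave_ibp2// !dd.
set I0 := \int[leb n]_w (wave eta 0 w * k w) in e1 *.
set I1 := \int[leb n]_w (wave eta (pi / 2) w * k w) in e1 *.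
have i0 := (Q_tensor c tf t0 thh tk).1.
have ij i j := (Q_tensor c tf t0 (th2 i j) (tD i j)).1.
rewrite (eq_Rint haar (g := fun z => Q f (c + 2 * pi * dotv eta z.2) t z.1 * ('D_(1 : R) ('D_(1 : R) h) z.1 * k z.2) +
   \sum_(j < n) \sum_(i < n) Q f (c + 2 * pi * dotv eta z.2) t z.1 * (h2 i j z.1 * 'D_(d i) ('D_(d j) k) z.2))); last first.
  move=> z; rewrite EA mulrDr; congr (_ + _); rewrite mulr_sumr; apply: eq_bigr => j _.
  by rewrite mulr_sumr.
rewrite RintD//; last by apply: integ_sum => j; exact: integ_sum.
rewrite Rint_sum; last by move=> j; exact: integ_sum.
rewrite (Q_tensor c tf t0 thh tk).2 -/I0 -/I1.
(* After integration by parts the double sum of products of frequencies and monomials is the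
   expansion of the square of [wv]. *)
have sumE (b : R) (I : R) : \sum_(j < n) \sum_(i < n) (\int[lebesgue_measure]_x (Q f b t x * h2 i j x)) *
     (- (2 * pi * eta ord0 i * (2 * pi * eta ord0 j)) * I) =
    - (\int[lebesgue_measure]_x (Q f b t x * (wv eta x ^+ 2 * h x))) * I.
  have tb i j := continuous_tst_integ (@Q_continuous f b t tf t0) (th2 i j).
  rewrite (eq_Rint lebesgue_measure (f := fun x => Q f b t x * (wv eta x ^+ 2 * h x))
    (g := fun x => \sum_(j < n) \sum_(i < n) (2 * pi * eta ord0 i * (2 * pi * eta ord0 j)) * (Q f b t x * h2 i j x))).
    rewrite Rint_sum; last by move=> j; apply: integ_sum => i; exact: integZ.
    rewrite -sumrN mulr_suml; apply: eq_bigr => j _.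
    rewrite Rint_sum; last by move=> i; exact: integZ.
    rewrite -sumrN mulr_suml; apply: eq_bigr => i _.
    by rewrite RintZ//; ring.
  move=> x; rewrite /wv expr2 !mulr_sumr mulr_suml mulrC mulr_suml.
  apply: eq_bigr => j _.
  rewrite !mulr_suml; apply: eq_bigr => i _; rewrite /h2; ring.
under eq_bigr => j _.
  rewrite Rint_sum//.
  under eq_bigr => i _ do rewrite (Q_tensor c tf t0 (th2 i j) (tD i j)).2 !ID.
  over.
rewrite /=.
have -> : \sum_(j < n) \sum_(i < n) ((\int[lebesgue_measure]_x (Q f c t x * h2 i j x)) *
     (- (2 * pi * eta ord0 i * (2 * pi * eta ord0 j)) * I0) - (\int[lebesgue_measure]_x (Q f (c + pi / 2) t x * h2 i j x)) *
     (- (2 * pi * eta ord0 i * (2 * pi * eta ord0 j)) * I1)) =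
   - (\int[lebesgue_measure]_x (Q f c t x * (wv eta x ^+ 2 * h x))) * I0 -
   - (\int[lebesgue_measure]_x (Q f (c + pi / 2) t x * (wv eta x ^+ 2 * h x))) * I1.
  under eq_bigr do rewrite sumrB.
  by rewrite sumrB; congr (_ - _); exact: sumE.
have tw : tst (fun x => wv eta x ^+ 2 * h x).
  by apply: tst_mull => //; apply: smooth_exp; exact: smooth_wv.
have split b : \int[lebesgue_measure]_x (Q f b t x * schr eta h x) =
    \int[lebesgue_measure]_x (Q f b t x * 'D_(1 : R) ('D_(1 : R) h) x) -
    \int[lebesgue_measure]_x (Q f b t x * (wv eta x ^+ 2 * h x)).
  have cq := @Q_continuous f b t tf t0.
  rewrite -RintB; [|exact: continuous_tst_integ|exact: continuous_tst_integ].
  by apply: eq_Rint => x; rewrite /schr; ring.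
rewrite (split c) (split (c + pi / 2)); exact: weak_pair_algebra.
Qed.

(** [Q_weak_pair] at the phases c and c + pi / 2 gives two linear equations for the two defects,
    because a shift by pi changes the sign. The determinant is a^2 + b^2, and with k the cutoff
    times the wave itself a is the integral of a nonnegative function with value 1 at 0. *)
Lemma Q_weak f c t (h : R -> R) : tst f -> 0 <= t -> tst h ->
  \int[lebesgue_measure]_x (Q f c t x * schr eta h x) =
  \int[lebesgue_measure]_x (Q (schr eta f) c t x * h x).
Proof.
move=> tf t0 th; have tS := tst_schr eta tf; have tSh := tst_schr eta th.
pose k z := chi z * wave eta 0 z.
have tk : tst k by apply: tst_mulr (@tst_chi R n) (smooth_wave eta 0).
have I0 : \int[leb n]_w (wave eta 0 w * k w) != 0.
  have tb := @tst_bump R; have tc : tst (fun w => wave eta 0 w * k w) by apply: tst_mull (smooth_wave eta 0) tk.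
  have : 0 < \int[haar]_x (bump x.1 * (wave eta 0 x.2 * k x.2)).
    apply: (@int_test_gt0 R n _ 0 (tensor_test tb tc)) => [x|].
      rewrite mulr_ge0 ?bump_ge0// /k mulrCA mulr_ge0 ?chi_ge0// -expr2 sqr_ge0//.
    by rewrite /= /k bump0 chi0 /wave dotv0 mulr0 addr0 cos0 !mulr1.
  have [_ ->] := Rint_haarE (tst1_integ tb) (tstV_integ tc).
  by apply: contraTneq => ->; rewrite mulr0 ltxx.
have h1 := Q_weak_pair c tf t0 th tk.
have h2 := Q_weak_pair (c + pi / 2) tf t0 th tk.
have pi2 : c + pi / 2 + pi / 2 = c + pi by rewrite -addrA -splitr.
have N f' h' : tst f' -> tst h' -> \int[lebesgue_measure]_x (Q f' (c + pi / 2 + pi / 2) t x * h' x) =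
    - \int[lebesgue_measure]_x (Q f' c t x * h' x).
  move=> tf' th'; rewrite -RintN; last exact: continuous_tst_integ (@Q_continuous f' c t tf' t0) th'.
  by apply: eq_Rint => x; rewrite pi2 Q_addpi// mulNr.
rewrite (N f _ tf tSh) (N _ h tS th) in h2.
move: h1 h2 I0.
set s1 := \int[lebesgue_measure]_x (Q f c t x * schr eta h x).
set s2 := \int[lebesgue_measure]_x (Q (schr eta f) c t x * h x).
set u1 := \int[lebesgue_measure]_x (Q f (c + pi / 2) t x * schr eta h x).
set u2 := \int[lebesgue_measure]_x (Q (schr eta f) (c + pi / 2) t x * h x).
set a := \int[leb n]_w (wave eta 0 w * k w).
set b := \int[leb n]_w (wave eta (pi / 2) w * k w).
move: s1 s2 u1 u2 a b => s1 s2 u1 u2 a b h1 h2 a0.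
apply/eqP; rewrite -subr_eq0.
have : (a ^+ 2 + b ^+ 2) * (s1 - s2) = 0.
  transitivity (a * ((s1 - s2) * a - (u1 - u2) * b) + b * ((u1 - u2) * a + (s1 - s2) * b)); first by ring.
  by rewrite h1 h2; ring.
move=> /eqP; rewrite mulf_eq0 => /orP[|//].
by rewrite paddr_eq0 ?sqr_ge0// sqrf_eq0 (negPf a0).
Qed.

End partial_fourier.

(** * Weak solutions in one variable *)

Section one_dim.
Context {R : realType}.
Local Notation mu := (@lebesgue_measure R).

Lemma Rint_support (D : set R) (h : R -> R) : measurable D -> (forall x, ~ D x -> h x = 0) ->
  \int[mu]_x h x = \int[mu]_(x in D) h x.
Proof.
move=> mD h0; rewrite [RHS]Rintegral_mkcond; congr (Rintegral _ _ _).
by apply/funext => x; rewrite patchE; case: ifPn => // /negP xD; apply: h0 => Dx; apply: xD; rewrite inE.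
Qed.

Lemma Rint_shift1 (h : R -> R) (c : R) : measurable_fun setT h ->
  (integ mu (fun x => h (x + c)) <-> integ mu h) /\ \int[mu]_x h (x + c) = \int[mu]_x h x.
Proof.
move=> mh; apply: (@Rint_preserving _ _ _ mu (fun x : R => x + c)) => //.
  by apply: continuous_measurable_fun => x; apply: cvgD; [exact: cvg_id|exact: cvg_cst].
by move=> f mf f0; exact: lebesgue_shift.
Qed.

Lemma tst1_int_derive0 (f : R -> R) : tst f -> \int[mu]_x 'D_(1 : R) f x = 0.
Proof.
move=> tf.
have := @int_derive0 R 0 _ (1, 0) (tensor_test tf (@tst_chi R 0)).
have E : chi (0 : 'rV[R]_0) = 1 by exact: chi0.
rewrite (eq_Rint haar (g := fun x => 'D_(1 : R) f x.1 * chi x.2)); last first.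
  move=> x; have d1 := derive_fst x (1, 0) tf.1; have d2 := derive_snd 1 x (1, 0) (@smooth_chi R 0).
  have [_ h] := is_deriveM d1 d2.
  transitivity (f x.1 * (1 * 'D_0 chi (1 *: x.2)) + chi (1 *: x.2) * ('D_(1 : R) f x.1 * 1)).
    by rewrite -[RHS]h; congr ('D_(1, 0) _ x); apply/funext => y;
      exact: (congr1 (fun z => f y.1 * chi z) (esym (scale1r y.2))).
  by rewrite derive_dir0 scale1r; ring.
have [_ ->] := Rint_haarE (tst1_integ (tst_derive1 tf)) (tstV_integ (@tst_chi R 0)).
rewrite (_ : \int[leb 0]_y chi y = 1) ?mulr1//.
have m := @measurable_continuous_rV R 0 (@chi R 0) (@smooth_continuous R 'rV[R]_0 (@chi R 0) (@smooth_chi R 0)).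
by rewrite /Rintegral ge0_integral_leb0 ?E//; exact/measurable_EFinP.
Qed.

Lemma smooth_primitive (F g : R -> R) : smooth g -> (forall x : R, is_derive x (1 : R) F (g x)) -> smooth F.
Proof.
move=> sg dF; pose P f := smooth f \/ exists2 g, smooth g & forall x : R, is_derive x 1 f (g x).
have : P F by right; exists g.
apply: smooth1_ind => {F g sg dF} f.
  move=> c [sf|[g sg df]]; [left|right].
    by apply: smooth_mul; [exact: smooth_cst|].
  exists (fun x => c * g x); first by apply: smooth_mul; [exact: smooth_cst|].
  by move=> x; have := is_deriveZ c (df x).
move=> [sf|[g sg df]].
  by exists ('D_(1 : R) f); [left; exact: smoothD|move=> x; exact: smooth_is_derive].
by exists g => //; left.
Qed.

(** Mean zero is what makes the primitive from minus infinity vanish again to the right of the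
    support. *)
Lemma tst_primitive (f : R -> R) (C : R) : tst f -> (forall x : R, C < `|x| -> f x = 0) ->
  \int[mu]_x f x = 0 ->
  exists F : R -> R, [/\ tst F, (forall x : R, C < `|x| -> F x = 0) &
    forall x : R, is_derive x (1 : R) F (f x)].
Proof.
move=> tf fC f0; have i := tst1_integ tf; have sf := tf.1.
pose F x := (\int[mu]_(t in [set` `]-oo, x]]) f t)%R.
have dF (x : R) : is_derive x (1 : R) F (f x).
  have [||||d e] := @continuous_FTC1 R f -oo%O x (x + 1).
  - by rewrite ltrDl.
  - by apply: integrableS i.
  - by rewrite /= ltNyr.
  - exact: smooth_continuous.
  by apply: DeriveDef; rewrite -?derive1E.
have FC x : C < `|x| -> F x = 0.
  rewrite /F; have [x0|x0] := leP 0 x => xC.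
    rewrite -f0; apply/esym; apply: Rint_support => // y /= hy; apply: fC.
    apply: lt_le_trans xC _; rewrite ger0_norm// ger0_norm; move/negP: hy; rewrite in_itv /= -ltNge => h; last exact: ltW (le_lt_trans x0 h).
    exact: ltW.
  rewrite Rintegral_mkcond -[RHS](Rint0 mu); apply: eq_Rint => y; rewrite patchE.
  case: ifPn => //; rewrite inE /= in_itv /= => yx; apply: fC; apply: lt_le_trans xC _.
  by rewrite !ltr0_norm ?lerN2//; exact: le_lt_trans x0.
exists F; split; [split; [exact: smooth_primitive dF|]|exact: FC|exact: dF].
by exists C.
Qed.

Definition bumpn (a : R) m y : R := bump ((y - a) * m.+1%:R).

Lemma tst_bumpn a m : tst (bumpn a m).
Proof.
split.
  apply: smooth_comp; first exact: smooth_bump.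
  apply: smooth_mul; last exact: smooth_cst.
  by apply: smooth_add; [exact: smooth_id|exact: smooth_cst].
exists (`|a| + 1) => y hy; apply: bump_out; rewrite normrM [X in _ * X]ger0_norm//.
have h1 : 1 <= `|y - a|.
  have := ler_normB (y - a) (- a); rewrite opprK subrK normrN; lra.
by rewrite (le_trans h1)// ler_peMr// ler1n.
Qed.

Lemma bumpn_ge0 a m y : 0 <= bumpn a m y. Proof. exact: bump_ge0. Qed.

Lemma bumpn_out a m y : m.+1%:R^-1 <= `|y - a| -> bumpn a m y = 0.
Proof.
by move=> h; apply: bump_out; rewrite normrM [X in _ * X]ger0_norm// -ler_pdivrMr ?ltr0n// mul1r.
Qed.

Definition cbump m : R := \int[mu]_y bumpn 0 m y.

Lemma bumpn_shift a m y : bumpn a m y = bumpn 0 m (y - a).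
Proof. by rewrite /bumpn subr0. Qed.

Lemma measurable_bumpn a m : measurable_fun setT (bumpn a m).
Proof. by apply: continuous_measurable_fun; exact: smooth_continuous (tst_bumpn a m).1. Qed.

Lemma int_bumpn a m : \int[mu]_y bumpn a m y = cbump m.
Proof.
rewrite /cbump -(Rint_shift1 (- a) (measurable_bumpn 0 m)).2.
by apply: eq_Rint => y; rewrite bumpn_shift.
Qed.

Lemma cbump_gt0 m : 0 < cbump m.
Proof.
have tb := tst_bumpn 0 m; have tc := @tst_chi R 0.
have : 0 < \int[@haar R 0]_x (bumpn 0 m x.1 * chi x.2).
  apply: (@int_test_gt0 R 0 _ 0 (tensor_test tb tc)) => [x|].
    by rewrite mulr_ge0 ?bumpn_ge0 ?chi_ge0.
  by rewrite /= chi0 /bumpn subrr mul0r bump0 mulr1.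
have [_ ->] := Rint_haarE (tst1_integ tb) (tstV_integ tc).
have c0 : 0 <= cbump m by apply: Rint_ge0 => y; exact: bumpn_ge0.
have d0 : 0 <= \int[leb 0]_y @chi R 0 y by apply: Rint_ge0 => y; exact: chi_ge0.
rewrite -/(cbump m); case: (ltgtP (cbump m) 0) c0 => // ->; first by rewrite mul0r ltxx.
Qed.

Lemma mollify_cvg (v : R -> R) a : {for a, continuous v} ->
  (forall m, integ mu (fun y => v y * bumpn a m y)) ->
  (\int[mu]_y (v y * bumpn a m y)) / cbump m @[m --> \oo] --> v a.
Proof.
move=> cv iv; apply/cvgrPdist_le => e e0.
have /cvgrPdist_le/(_ e e0)/nbhs_ballP[r /= r0 hr] := cv.
have /cvgrPdist_lt/(_ r r0)[N _ hN] := @cvg_harmonic R.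
exists N => // m Nm; have := hN m Nm; rewrite /= sub0r normrN ger0_norm ?invr_ge0// => mr.
have c0 := cbump_gt0 m; have ib := tst1_integ (tst_bumpn a m).
rewrite -[v a](mulfK (lt0r_neq0 c0)) -mulrBl -{1}(int_bumpn a m) -RintZ//.
rewrite -RintB//; last exact: integZ.
rewrite normrM [X in _ * X]gtr0_norm ?invr_gt0// ler_pdivrMr//.
rewrite -{1}(int_bumpn a m) -RintZ//; apply: Rint_norm_le => [||y]; [by apply: integB => //; exact: integZ|exact: integZ|].
rewrite -mulrBl normrM (ger0_norm (bumpn_ge0 _ _ _)).
have [h|h] := ltP `|y - a| m.+1%:R^-1; last by rewrite bumpn_out// !mulr0.
rewrite ler_wpM2r ?bumpn_ge0//; apply: hr; rewrite -ball_normE /= distrC.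
exact: lt_trans h mr.
Qed.

Lemma int_xbumpn a m : \int[mu]_y (y * bumpn a m y) = a * cbump m + \int[mu]_y (y * bumpn 0 m y).
Proof.
have t1 b : tst (fun y : R => y * bumpn b m y) := tst_mull smooth_id (tst_bumpn b m).
rewrite -(Rint_shift1 a (integ_measurable (tst1_integ (t1 a)))).2.
rewrite -RintZ; last exact: tst1_integ (tst_bumpn 0 m).
rewrite -RintD; [|by apply: integZ; exact: tst1_integ (tst_bumpn 0 m)|exact: tst1_integ].
by apply: eq_Rint => y; rewrite bumpn_shift addrK; ring.
Qed.

(* Second differences of bumps are second derivatives of test functions. *)
Lemma weak_affine (v : R -> R) (K : R) : continuous v -> 2 <= K ->
  (forall h, tst h -> (forall x, K < `|x| -> h x = 0) ->
    \int[mu]_y (v y * 'D_(1 : R) ('D_(1 : R) h) y) = 0) ->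
  forall x, `|x| <= K - 1 -> v x = (1 - x) * v 0 + x * v 1.
Proof.
move=> cv K2 H x xK.
(* The point x is the combination of 0 and 1 with weights 1 - x and x, so the integral and the first
   moment of this difference both vanish. That is the condition for it to be the second derivative
   of a test function. *)
pose f m y := bumpn x m y - (1 - x) * bumpn 0 m y - x * bumpn 1 m y.
have fE m : f m = fun y => (bumpn x m y + (- (1 - x)) * bumpn 0 m y) + (- x) * bumpn 1 m y.
  by apply/funext => y; rewrite /f; ring.
have tc (c : R) g : tst g -> tst (fun y : R => c * g y) by move=> tg; exact: tst_mull (smooth_cst c) tg.
have tf m : tst (f m).
  rewrite fE; apply: tst_add; last exact/tc/tst_bumpn.
  by apply: tst_add; [exact: tst_bumpn|exact/tc/tst_bumpn].
have out a m y : `|a| <= K - 1 -> K < `|y| -> bumpn a m y = 0.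
  move=> aK yK; apply: bumpn_out; apply: (@le_trans _ _ 1); first exact: natSV_le1.
  have := ler_normB (y - a) (- a); rewrite opprK subrK normrN; lra.
have fK m y : K < `|y| -> f m y = 0.
  by move=> yK; rewrite /f !out//; rewrite ?normr0 ?normr1; lra.
have ib a m := tst1_integ (tst_bumpn a m).
have i0 m : \int[mu]_y f m y = 0.
  rewrite fE RintD; [|by apply: integD => //; exact: integZ|exact: integZ].
  rewrite RintD//; last exact: integZ.
  by rewrite !RintZ// !int_bumpn; ring.
have ixb a m : integ mu (fun y => y * bumpn a m y).
  by apply: tst1_integ; apply: tst_mull smooth_id (tst_bumpn a m).
have i1 m : \int[mu]_y (y * f m y) = 0.
  rewrite (eq_Rint mu (g := fun y => (y * bumpn x m y + (- (1 - x)) * (y * bumpn 0 m y)) + (- x) * (y * bumpn 1 m y))).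
    rewrite RintD; [|by apply: integD => //; exact: integZ|exact: integZ].
    rewrite RintD//; last exact: integZ.
    by rewrite !RintZ// (int_xbumpn x) (int_xbumpn 1); ring.
  by move=> y; rewrite /f; ring.
have key m : \int[mu]_y (v y * f m y) = 0.
  have [F [tF FK dF]] := tst_primitive (tf m) (fK m) (i0 m).
  (* By parts, the integral of the primitive F is minus the first moment of [f m]. *)
  have F0 : \int[mu]_y F y = 0.
    have txF : tst (fun y : R => y * F y) by apply: tst_mull smooth_id tF.
    have := tst1_int_derive0 txF.
    rewrite (eq_Rint mu (g := fun y => F y + y * f m y)); last first.
      move=> y; have [_] := is_deriveM (is_derive_id y (1 : R)) (dF y).
      by rewrite /GRing.scale /= mulr1 addrC => <-.
    rewrite RintD; [|exact: tst1_integ|by apply: tst1_integ; apply: tst_mull smooth_id (tf m)].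
    by rewrite i1 addr0.
  have [h [th hK dh]] := tst_primitive tF FK F0.
  rewrite -(H h th hK); apply: eq_Rint => y.
  have -> : 'D_(1 : R) h = F by apply/funext => z; have [_] := dh z.
  by have [_ ->] := dF y.
have iv a m : integ mu (fun y => v y * bumpn a m y) by exact: continuous_tst_integ (tst_bumpn a m).
have c a := mollify_cvg (cv a) (iv a).
have l1 := c x.
have l2 : ((1 - x) * ((\int[mu]_y (v y * bumpn 0 m y)) / cbump m) + x * ((\int[mu]_y (v y * bumpn 1 m y)) / cbump m))
    @[m --> \oo] --> (1 - x) * v 0 + x * v 1.
  by apply: cvgD; apply: cvgM; [exact: cvg_cst|exact: c|exact: cvg_cst|exact: c].
apply: (cvg_unique (@norm_hausdorff _ _) l1).
rewrite (_ : (fun m => _) = fun m => (1 - x) * ((\int[mu]_y (v y * bumpn 0 m y)) / cbump m) + x * ((\int[mu]_y (v y * bumpn 1 m y)) / cbump m)); first exact: l2.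
apply/funext => m; rewrite !mulrA -mulrDl; congr (_ / _).
have := key m; rewrite (eq_Rint mu (g := fun y => v y * bumpn x m y - ((1 - x) * (v y * bumpn 0 m y) + x * (v y * bumpn 1 m y)))); last first.
  by move=> y; rewrite /f; ring.
rewrite RintB//; last by apply: integD; exact: integZ.
rewrite RintD; [|exact: integZ|exact: integZ].
by rewrite !RintZ// => /eqP; rewrite subr_eq0 => /eqP.
Qed.

Lemma local_primitive (q : R -> R) (a a' b' b : R) : a < a' -> b' < b ->
  (forall x, a < x < b -> {for x, continuous q}) ->
  exists P : R -> R, forall x : R, a' < x < b' -> is_derive x (1 : R) P (q x).
Proof.
move=> aa bb cq; exists (fun x => \int[mu]_(t in [set` `[a', x]]) q t) => x /andP[ax xb].
have i : mu.-integrable `[a', b'] (EFin \o q).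
  apply: continuous_compact_integrable; first exact: segment_compact.
  apply: continuous_in_subspaceT => y; rewrite inE /= in_itv /= => /andP[h1 h2].
  by apply: cq; rewrite (lt_le_trans aa h1) (le_lt_trans h2 bb).
have c : {for x, continuous q} by apply: cq; rewrite (lt_trans aa ax) (lt_trans xb bb).
have [d e] := @continuous_FTC1_closed R q a' x b' xb i ax c.
by apply: DeriveDef; rewrite -?derive1E.
Qed.

(** The boundary terms are taken at the endpoints of [-D, D] with C < D < N: there g and g1 already
    vanish, while f is still twice differentiable. *)
Lemma ibp_C2 (f f1 f2 g g1 g2 : R -> R) (C N : R) : C < N ->
  (forall x : R, `|x| < N -> is_derive x (1 : R) f (f1 x)) ->
  (forall x : R, `|x| < N -> is_derive x (1 : R) f1 (f2 x)) ->
  (forall x : R, `|x| < N -> {for x, continuous f2}) ->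
  (forall x : R, is_derive x (1 : R) g (g1 x)) ->
  (forall x : R, is_derive x (1 : R) g1 (g2 x)) -> continuous g2 ->
  (forall x : R, C < `|x| -> g x = 0) ->
  \int[mu]_x (f x * g2 x) = \int[mu]_x (f2 x * g x).
Proof.
move=> CN df df1 cf2 dg dg1 cg2 gC.
have [C0|C0] := ltP C 0.
  have g0 : g = fun=> 0 by apply/funext => x; apply: gC; exact: lt_le_trans C0 _.
  have g10 : g1 = fun=> 0.
    by apply/funext => x; have [_ <-] := dg x; rewrite g0 derive_cst.
  rewrite (eq_Rint mu (g := fun=> 0)); last first.
    by move=> x; have [_ <-] := dg1 x; rewrite g10 derive_cst mulr0.
  by apply/esym; rewrite (eq_Rint mu (g := fun=> 0))// => x; rewrite g0 mulr0.
pose D := (C + N) / 2.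
have CD : C < D by rewrite /D; lra.
have DN : D < N by rewrite /D; lra.
have D0 : 0 < D by exact: le_lt_trans CD.
have g1C (x : R) : C < `|x| -> g1 x = 0.
  by move=> xC; have [_ <-] := dg x; exact: bsupp_derive xC.
have g2C (x : R) : C < `|x| -> g2 x = 0.
  by move=> xC; have [_ <-] := dg1 x; exact: bsupp_derive xC.
pose F x := f x * g1 x - f1 x * g x.
pose F' x := f x * g2 x - f2 x * g x.
have inN x : - D <= x <= D -> `|x| < N.
  by rewrite -ler_norml => h; exact: le_lt_trans DN.
have dF x : - D <= x <= D -> is_derive x (1 : R) F (F' x).
  move=> /inN xN.
  have := is_deriveB (is_deriveM (df x xN) (dg1 x)) (is_deriveM (df1 x xN) (dg x)).
  rewrite /GRing.scale /= => h; rewrite (_ : F' x = f x * g2 x + g1 x * f1 x - (f1 x * g1 x + g x * f2 x)); first exact: h.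
  by rewrite /F'; ring.
have cF x : - D <= x <= D -> {for x, continuous F}.
  by move=> /dF [d _]; apply: differentiable_continuous; exact/derivable1_diffP.
have cf x : - D <= x <= D -> {for x, continuous f}.
  by move=> /inN /df [d _]; apply: differentiable_continuous; exact/derivable1_diffP.
have cg x : {for x, continuous g}.
  by have [d _] := dg x; apply: differentiable_continuous; exact/derivable1_diffP.
have ND : - D < D by lra.
have cF' x : - D <= x <= D -> {for x, continuous F'}.
  move=> xD; apply: cvgB; apply: cvgM; [exact: cf|exact: cg2|apply: cf2; exact: inN|exact: cg].
have wF' : {within `[- D, D], continuous F'}.
  by apply: continuous_in_subspaceT => x; rewrite inE /= in_itv /=; exact: cF'.
have FTC : (\int[mu]_(x in `[(- D)%R, D]) (F' x)%:E = (F D)%:E - (F (- D))%:E)%E.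
  apply: continuous_FTC2 => //.
    split.
    - by move=> x; rewrite in_itv /= => /andP[h1 h2]; have [] := dF x; rewrite ?(ltW h1) ?(ltW h2).
    - by apply: cvg_at_right_filter; apply: cF; rewrite lexx ltW.
    - by apply: cvg_at_left_filter; apply: cF; rewrite lexx ltW.
  move=> x; rewrite in_itv /= => /andP[h1 h2]; rewrite derive1E.
  by have [] := dF x; rewrite ?(ltW h1) ?(ltW h2).
have nD : C < `|D| by rewrite ger0_norm// ltW.
rewrite /F !gC ?normrN// !g1C ?normrN// !mulr0 !subrr in FTC.
have out (h : R -> R) x : (forall y, C < `|y| -> h y = 0) -> ~ (`[- D, D]%classic : set R) x -> h x = 0.
  move=> hC /= /negP; rewrite in_itv /= -ler_norml -ltNge => hD; apply: hC; exact: lt_trans CD hD.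
have mI : measurable (`[- D, D]%classic : set R) by [].
have integI h : (forall x, - D <= x <= D -> {for x, continuous h}) -> mu.-integrable `[- D, D] (EFin \o h).
  move=> ch; apply: continuous_compact_integrable; first exact: segment_compact.
  by apply: continuous_in_subspaceT => x; rewrite inE /= in_itv /=; exact: ch.
rewrite (Rint_support mI); last by move=> x; apply: (out (fun y => f y * g2 y)) => y yC; rewrite g2C// mulr0.
rewrite [RHS](Rint_support mI); last by move=> x; apply: (out (fun y => f2 y * g y)) => y yC; rewrite gC// mulr0.
apply/eqP; rewrite -subr_eq0 -RintegralB//; last 2 first.
  by apply: integI => x xD; apply: cvgM; [exact: cf|exact: cg2].
  by apply: integI => x xD; apply: cvgM; [apply: cf2; exact: inN|exact: cg].
apply/eqP; transitivity (fine (0%:E - 0%:E)%E : R); last by rewrite /= subr0.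
by rewrite /Rintegral; congr fine; exact: FTC.
Qed.

(** A double primitive [q2] of q near x0 has the same weak second derivative as u, so their
    difference is affine by [weak_affine], and u inherits the regularity of [q2]. *)
Lemma weak_C2 (u q : R -> R) : continuous u -> continuous q ->
  (forall h, tst h -> \int[mu]_x (u x * 'D_(1 : R) ('D_(1 : R) h) x) = \int[mu]_x (q x * h x)) ->
  forall x : R, derivable u x 1 /\ is_derive x (1 : R) ('D_(1 : R) u) (q x).
Proof.
move=> cu cq H x0; pose K := `|x0| + 3.
have [q1 dq1] : exists P : R -> R, forall x : R, - (K + 2) < x < K + 2 -> is_derive x (1 : R) P (q x).
  by apply: (@local_primitive q (- (K + 3)) _ _ (K + 3)); [lra|lra|move=> x _; exact: cq].
have [q2 dq2] : exists P : R -> R, forall x : R, - (K + 1) < x < K + 1 -> is_derive x (1 : R) P (q1 x).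
  apply: (@local_primitive q1 (- (K + 2)) _ _ (K + 2)); [lra|lra|move=> x /dq1 [d _]].
  by apply: differentiable_continuous; exact/derivable1_diffP.
have K0 : 0 < K by rewrite /K ltr_wpDl.
have {}dq1 (x : R) : `|x| < K + 1 -> is_derive x (1 : R) q1 (q x).
  by rewrite ltr_norml => /andP[h1 h2]; apply: dq1; apply/andP; split; lra.
have {}dq2 (x : R) : `|x| < K + 1 -> is_derive x (1 : R) q2 (q1 x).
  by rewrite ltr_norml; exact: dq2.
(* The projection of the line onto [-K, K]. Composition with it extends [q2], known only near that
   interval, to a continuous function on the whole line. *)
pose cl (y : R) := (`|y + K| - `|y - K|) / 2.
have ccl : continuous cl.
  move=> y; apply: cvgM; last exact: cvg_cst.
  by apply: cvgB; apply: cvg_norm; [apply: cvgD|apply: cvgB]; (exact: cvg_id || exact: cvg_cst).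
have clK y : `|cl y| < K + 1.
  rewrite /cl ltr_norml; have := ler_normB (y + K) (2 * K); have := ler_normD (y - K) (2 * K).
  rewrite (_ : y - K + 2 * K = y + K); last by ring.
  rewrite (_ : y + K - 2 * K = y - K); last by ring.
  rewrite (@ger0_norm _ (2 * K)); last by lra.
  move: (`|y + K|) (`|y - K|) => a b h1 h2; apply/andP; split; lra.
have clE y : `|y| <= K -> cl y = y.
  rewrite ler_norml => /andP[h1 h2]; rewrite /cl ger0_norm; last by lra.
  by rewrite ler0_norm; [lra|lra].
pose w y := q2 (cl y).
have cw : continuous w.
  move=> y; apply: (@continuous_comp _ _ _ cl q2); first exact: ccl.
  by have [d _] := dq2 _ (clK y); apply: differentiable_continuous; exact/derivable1_diffP.
pose v y := u y - w y.
have cv : continuous v by move=> y; apply: cvgB; [exact: cu|exact: cw].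
have aff := @weak_affine v K cv.
have {}aff : forall x, `|x| <= K - 1 -> v x = (1 - x) * v 0 + x * v 1.
  apply: aff; first by rewrite /K; have := normr_ge0 x0; lra.
  move=> h th hK; have t2 := tst_derive1 (tst_derive1 th).
  have h2K := bsupp_derive (1 : R) (bsupp_derive (1 : R) hK).
  rewrite (eq_Rint mu (g := fun y => u y * 'D_(1 : R) ('D_(1 : R) h) y - w y * 'D_(1 : R) ('D_(1 : R) h) y)); last first.
    by move=> y; rewrite /v mulrBl.
  rewrite RintB; [|exact: continuous_tst_integ|exact: continuous_tst_integ].
  apply/eqP; rewrite subr_eq0 H//; apply/eqP.
  rewrite (eq_Rint mu (f := fun y => w y * _) (g := fun y => q2 y * 'D_(1 : R) ('D_(1 : R) h) y)); last first.
    move=> y; have [yK|yK] := leP `|y| K; first by rewrite /w clE.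
    by rewrite (h2K y yK) !mulr0.
  apply/esym; apply: (@ibp_C2 q2 q1 q h ('D_(1 : R) h) ('D_(1 : R) ('D_(1 : R) h)) K (K + 1)) => //.
  - by rewrite ltrDl.
  - by move=> x _; exact: cq.
  - by move=> x; exact: smooth_is_derive th.1.
  - by move=> x; exact: smooth_is_derive (tst_derive1 th).1.
  - exact: smooth_continuous t2.1.
have uE (x : R) : `|x| < K - 1 -> u x = q2 x + (v 0 + (v 1 - v 0) * x).
  move=> xK; have := aff x (ltW xK); rewrite /v /w [cl x]clE; last by lra.
  by move: (u 0 - _) (u 1 - _) => a b e; rewrite -[u x](subrK (q2 x)) e; ring.
have nearK (x : R) : `|x| < K - 1 -> \forall y \near x, `|y| < K - 1.
  move=> xK; have o : open [set y : R | `|y| < K - 1].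
    by apply: (@open_comp _ _ (fun y : R => `|y|) [set y | y < K - 1]);
      [move=> y _; exact: norm_continuous|exact: open_lt].
  exact: open_nbhs_nbhs (conj o xK).
have du (x : R) : `|x| < K - 1 -> is_derive x (1 : R) u (q1 x + (v 1 - v 0)).
  move=> xK; have xK1 : `|x| < K + 1 by lra.
  have d1 : is_derive x (1 : R) (fun x => q2 x + (v 0 + (v 1 - v 0) * x)) (q1 x + (v 1 - v 0)).
    have := is_deriveD (dq2 x xK1) (is_deriveD (is_derive_cst (v 0) x (1 : R)) (is_deriveZ (v 1 - v 0) (is_derive_id x (1 : R)))).
    by rewrite /GRing.scale /= mulr1 add0r.
  have [d e] := d1.
  have [h1 h2] : (derivable u x 1 <-> derivable (fun x => q2 x + (v 0 + (v 1 - v 0) * x)) x 1) /\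
      'D_1 u x = 'D_1 (fun x => q2 x + (v 0 + (v 1 - v 0) * x)) x.
    by apply: derive_local; apply: filterS (nearK x xK) => y; exact: uE.
  by apply: DeriveDef; [exact/h1|rewrite h2].
have x0K : `|x0| < K - 1 by rewrite /K; lra.
split; first by have [] := du x0 x0K.
have d2 : is_derive x0 (1 : R) (fun x => q1 x + (v 1 - v 0)) (q x0).
  have x0K1 : `|x0| < K + 1 by lra.
  have := is_deriveD (dq1 x0 x0K1) (is_derive_cst (v 1 - v 0) x0 (1 : R)).
  by rewrite addr0.
have [d e] := d2.
have [h1 h2] : (derivable ('D_(1 : R) u) x0 1 <-> derivable (fun x => q1 x + (v 1 - v 0)) x0 1) /\
    'D_1 ('D_(1 : R) u) x0 = 'D_1 (fun x => q1 x + (v 1 - v 0)) x0.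
  by apply: derive_local; apply: filterS (nearK x0 x0K) => y /du [].
by apply: DeriveDef; [exact/h1|rewrite h2].
Qed.

End one_dim.

(** * Maximum principle and barriers *)

Section real_derivatives.
Context {R : realType}.

Lemma is_deriveP (f : R -> R) (x d : R) : is_derive x (1 : R) f d <->
  forall e : R, 0 < e -> exists2 q : R, 0 < q & forall h, h != 0 -> `|h| < q ->
    `|h^-1 * (f (x + h) - f x) - d| <= e.
Proof.
have E (e l : R) : (\forall h \near 0^', `|l - h^-1 *: (f (h *: 1 + x) - f x)| <= e) <->
    exists2 q : R, 0 < q & forall h, h != 0 -> `|h| < q -> `|h^-1 * (f (x + h) - f x) - l| <= e.
  split=> [/nbhs_ballP[q /= q0 hq]|[q q0 hq]].
    exists q => // h h0 hh; have := hq h; rewrite -ball_normE /= sub0r normrN => /(_ hh h0).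
    by rewrite /GRing.scale /= mulr1 distrC [h + x]addrC.
  apply/nbhs_ballP; exists q => // h; rewrite -ball_normE /= sub0r normrN => hh h0.
  by rewrite /GRing.scale /= mulr1 distrC [h + x]addrC; exact: hq.
split=> [[df <-] e e0|H].
  by apply/E; have /cvgrPdist_le/(_ e e0) := df.
have c : h^-1 *: (f (h *: 1 + x) - f x) @[h --> 0^'] --> d.
  by apply/cvgrPdist_le => e e0; apply/E/H.
apply: DeriveDef; last exact: (cvg_lim (@norm_hausdorff _ _) c).
by apply/cvg_ex; exists d.
Qed.

Lemma is_derive_left_max (f : R -> R) (s d r : R) : is_derive s (1 : R) f d -> 0 < r ->
  (forall h, 0 < h < r -> f (s - h) <= f s) -> 0 <= d.
Proof.
move=> /is_deriveP df r0 H; rewrite leNgt; apply/negP => d0.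
have e0 : 0 < - d / 2 by lra.
have [q q0 hq] := df _ e0.
pose h := Num.min q r / 2.
have m0 : 0 < Num.min q r by rewrite lt_min q0.
have h0 : 0 < h by rewrite /h divr_gt0.
have hm : h < Num.min q r by rewrite /h ltr_pdivrMr// ltr_pMr// ltr1n.
move: hm; rewrite lt_min => /andP[h1 h2].
have := hq (- h); rewrite oppr_eq0 gt_eqF// normrN gtr0_norm// => /(_ isT h1).
have : 0 <= (- h)^-1 * (f (s - h) - f s).
  by rewrite mulr_le0// ?invr_le0 ?oppr_le0 ?(ltW h0)// subr_le0 H// h0.
by move: (_ * _) => y y0; rewrite ler_norml => /andP[_]; lra.
Qed.

Lemma is_derive_max (f : R -> R) (s d r : R) : is_derive s (1 : R) f d -> 0 < r ->
  (forall y, `|y - s| < r -> f y <= f s) -> d = 0.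
Proof.
move=> df r0 H; apply/eqP; rewrite eq_le; apply/andP; split; last first.
  apply: (is_derive_left_max df r0) => h /andP[h0 hr]; apply: H.
  by rewrite addrAC subrr sub0r normrN gtr0_norm.
rewrite -oppr_ge0; apply: (@is_derive_left_max (fun y => f (- y)) (- s) (- d) r) => //.
  have d1 : is_derive (- s) (1 : R) (fun y : R => - y) (- 1).
    by have := is_deriveN (is_derive_id (- s) (1 : R)).
  have d2 : is_derive (- - s) (1 : R) f d by rewrite opprK.
  by have := @is_derive1_comp R f (fun y => - y) (- s) _ _ d2 d1; rewrite mulrN1.
move=> h /andP[h0 hr]; rewrite opprK opprD !opprK; apply: H.
by rewrite addrAC subrr add0r gtr0_norm.
Qed.

Lemma is_derive_continuous (f : R -> R) (x d : R) : is_derive x (1 : R) f d -> {for x, continuous f}.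
Proof. by move=> [df _]; apply: differentiable_continuous; exact/derivable1_diffP. Qed.

Lemma is_derive_mvt (f f1 : R -> R) (a b : R) : a < b ->
  (forall x, a <= x <= b -> is_derive x (1 : R) f (f1 x)) ->
  exists2 c, a < c < b & f b - f a = f1 c * (b - a).
Proof.
move=> ab df; have [||c] := @MVT R f f1 a b ab.
- by move=> x; rewrite in_itv /= => /andP[h1 h2]; apply: df; rewrite !ltW.
- apply: continuous_in_subspaceT => x; rewrite inE /= in_itv /= => h.
  exact: is_derive_continuous (df x h).
by rewrite in_itv /= => h e; exists c.
Qed.

Lemma second_derivative_max (f f1 : R -> R) (x d r : R) : 0 < r ->
  (forall y, is_derive y (1 : R) f (f1 y)) -> is_derive x (1 : R) f1 d ->
  (forall y, `|y - x| < r -> f y <= f x) -> d <= 0.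
Proof.
move=> r0 df /is_deriveP df1 H; rewrite leNgt; apply/negP => d0.
have f10 : f1 x = 0 by exact: is_derive_max (df x) r0 H.
have e0 : 0 < d / 2 by lra.
have [q q0 hq] := df1 _ e0.
pose h := Num.min q r / 2.
have m0 : 0 < Num.min q r by rewrite lt_min q0.
have h0 : 0 < h by rewrite /h divr_gt0.
have hm : h < Num.min q r by rewrite /h ltr_pdivrMr// ltr_pMr// ltr1n.
move: hm; rewrite lt_min => /andP[h1 h2].
have xh : x < x + h by rewrite ltrDl.
have [c /andP[xc ch] e] := @is_derive_mvt f f1 x (x + h) xh (fun y _ => df y).
have : 0 < f (x + h) - f x.
  rewrite e addrAC subrr add0r mulr_gt0//.
  have k0 : 0 < c - x by rewrite subr_gt0.
  have := hq (c - x); rewrite gt_eqF// gtr0_norm// => /(_ isT).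
  have kq : c - x < q by apply: lt_trans h1; lra.
  move=> /(_ kq); rewrite addrCA subrr addr0 f10 subr0 => h3.
  have : 0 < (c - x)^-1 * f1 c.
    by move: h3; move: (_ * _) => y; rewrite ler_norml => /andP[h4 _]; lra.
  by rewrite pmulr_rgt0// invr_gt0.
apply/negP; rewrite -leNgt subr_le0; apply: H.
by rewrite addrAC subrr add0r gtr0_norm.
Qed.

(* Perturbing by [delta (1 + x^2 + 3 s)] makes the inequality strict and forces
   the maximum to be attained. *)
Lemma max_principle (V : R -> R) (T M : R) (m mt mx mxx : R -> R -> R) :
  (forall x, 0 <= V x) ->
  continuous (fun z : R * R => m `|z.1| z.2) ->
  (forall s x : R, 0 <= s <= T -> m s x <= M) ->
  (forall x, m 0 x <= 0) ->
  (forall s x : R, 0 < s <= T -> [/\ is_derive s (1 : R) (fun s => m s x) (mt s x),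
     is_derive x (1 : R) (m s) (mx s x), is_derive x (1 : R) (mx s) (mxx s x) &
     mt s x <= mxx s x - V x * m s x]) ->
  forall s x : R, 0 <= s <= T -> m s x <= 0.
Proof.
move=> V0 cm mM m0 dm s1 x1 s1T.
have T0 : 0 <= T by case/andP: s1T => h1 h2; exact: le_trans h2.
pose E (s x : R) := 1 + x ^+ 2 + 3 * s.
have E1 s x : 0 <= s -> 1 + x ^+ 2 <= E s x by move=> s0; rewrite /E lerDl mulr_ge0.
suff H (d : R) : 0 < d -> m s1 x1 <= d * E s1 x1.
  apply/ler_addgt0Pr => e e0; rewrite add0r.
  have E0 : 0 < E s1 x1.
    by apply: lt_le_trans (E1 s1 x1 _); [have := sqr_ge0 x1; lra|case/andP: s1T].
  by apply: (le_trans (H _ (divr_gt0 e0 E0))); rewrite divfK// gt_eqF.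
move=> d0; rewrite leNgt; apply/negP => hm.
(* So large that d (1 + X^2) exceeds |M|: a point with |x| = X cannot be a positive maximum, so the
   maximum is interior in x. *)
pose X := `|x1| + (`|M| / d + 1).
have X1 : 1 <= X by rewrite /X addrA lerDr addr_ge0// divr_ge0// ltW.
have dX : `|M| < d * (1 + X ^+ 2).
  have h1 : `|M| <= d * X.
    rewrite mulrC -ler_pdivrMr// /X; have := normr_ge0 x1; lra.
  apply: (le_lt_trans h1); rewrite ltr_pM2l//.
  have : X <= X ^+ 2 by rewrite expr2 ler_peMl//; lra.
  lra.
(* The absolute value extends the function evenly to negative times, which turns continuity up to
   time 0 into continuity on the plane. *)
pose D (z : R * R) := m `|z.1| z.2 - d * E `|z.1| z.2.
have cD : continuous D.
  move=> z; apply: cvgB; first exact: cm.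
  apply: cvgM; first exact: cvg_cst.
  apply: cvgD; last first.
    by apply: cvgM; [exact: cvg_cst|apply: cvg_norm; exact: cvg_fst].
  apply: cvgD; first exact: cvg_cst.
  by under eq_fun do rewrite expr2; rewrite expr2; apply: cvgM; exact: cvg_snd.
pose K : set (R * R) := `[0, T] `*` `[- X, X].
have cK : compact K by apply: compact_setX; exact: segment_compact.
have K1 : K (s1, x1).
  split=> /=; rewrite in_itv /= //; rewrite -ler_norml /X lerDl.
  by rewrite addr_ge0// divr_ge0// ltW.
have [[s0 x0] + hmax] : exists2 c, c \in K & forall t, t \in K -> D t <= D c.
  apply: compact_EVT_max => //; first by exists (s1, x1).
  exact: continuous_subspaceT.
rewrite inE => -[/=]; rewrite !in_itv /= => s0T x0X.
have {}hmax s x : 0 <= s <= T -> - X <= x <= X -> m s x - d * E s x <= m s0 x0 - d * E s0 x0.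
  move=> sT xX; have := hmax (s, x); rewrite inE /D /=.
  have /andP[sp _] := sT; have /andP[s0p _] := s0T.
  by rewrite (ger0_norm sp) (ger0_norm s0p); apply; split; rewrite /= in_itv.
have D0 : 0 < m s0 x0 - d * E s0 x0.
  have := hmax s1 x1 s1T; have := K1.2; rewrite /= in_itv /= => h /(_ h).
  by apply: lt_le_trans; rewrite subr_gt0.
have /andP[s0p s0T'] := s0T.
have mpos : 0 < m s0 x0.
  have : 0 < d * E s0 x0.
    by rewrite mulr_gt0//; apply: lt_le_trans (E1 s0 x0 s0p); have := sqr_ge0 x0; lra.
  by move: D0; lra.
have s00 : 0 < s0.
  rewrite lt_def s0p andbT; apply/eqP => s00.
  by move: mpos; rewrite s00 ltNge m0.
have x0X' : `|x0| < X.
  rewrite ltNge; apply/negP => Xx0.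
  have h1 : X ^+ 2 <= x0 ^+ 2.
    by rewrite -[x0 ^+ 2]real_normK ?num_real// lerXn2r ?nnegrE//; exact: le_trans ler01 _.
  have h2 : `|M| < d * E s0 x0.
    apply: (lt_le_trans dX); rewrite ler_wpM2l ?(ltW d0)//.
    by apply: le_trans (E1 s0 x0 s0p); lra.
  have := mM s0 x0 s0T; have := ler_norm M; move: D0; lra.
have s0I : 0 < s0 <= T by rewrite s00.
have [d1 d2 d3 le] := dm s0 x0 s0I.
have r0 : 0 < X - `|x0| by rewrite subr_gt0.
have dE (x : R) : is_derive x (1 : R) (fun x => d * E s0 x) (d * (2 * x)).
  have := is_deriveZ d (is_deriveD (is_deriveD (is_derive_cst (1 : R) x (1 : R)) (is_deriveM (is_derive_id x (1 : R)) (is_derive_id x (1 : R)))) (is_derive_cst (3 * s0) x (1 : R))).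
  by rewrite add0r addr0 /GRing.scale /= mulr1 -mulr2n -[x *+ 2]mulr_natl.
have dE1 : is_derive x0 (1 : R) (fun x : R => d * (2 * x)) (d * 2).
  have := is_deriveZ d (is_deriveZ (2 : R) (is_derive_id x0 (1 : R))).
  by rewrite /GRing.scale /= mulr1.
have hxx : mxx s0 x0 - d * 2 <= 0.
  apply: (@second_derivative_max (fun x => m s0 x - d * E s0 x) (fun x => mx s0 x - d * (2 * x)) x0 _ _ r0).
  - move=> y; have [_ e2 _ _] := dm s0 y s0I.
    exact: is_deriveB e2 (dE y).
  - move=> y yr; apply: hmax => //; rewrite -ler_norml.
    have := ler_normD (y - x0) x0; rewrite subrK; lra.
have dEs : is_derive s0 (1 : R) (fun s => d * E s x0) (d * 3).
  have := is_deriveZ d (is_deriveD (is_derive_cst (1 + x0 ^+ 2) s0 (1 : R)) (is_deriveZ (3 : R) (is_derive_id s0 (1 : R)))).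
  by rewrite add0r /GRing.scale /= mulr1.
(* The maximum may lie at the final time, so it is compared with earlier times only. *)
have ht : 0 <= mt s0 x0 - d * 3.
  apply: (@is_derive_left_max (fun s => m s x0 - d * E s x0) s0 _ s0 _ s00).
  move=> h /andP[h0 hs]; apply: hmax => //.
  by rewrite subr_ge0 (ltW hs) (le_trans _ s0T')// gerBl ltW.
(* At the maximum 3 d <= mt <= mxx - V m <= 2 d, a contradiction; this is why the perturbation
   contains 3 s next to x^2. *)
have : 0 <= V x0 * m s0 x0 by rewrite mulr_ge0// ltW.
move: le hxx ht; lra.
Qed.

End real_derivatives.

Section schroedinger.
Context {R : realType} {n : nat} (eta : 'rV[R]_n).
Local Notation V := (R * 'rV[R]_n)%type.
Local Notation haar := (@haar R n).
Local Notation test := (@test_function R V).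
Local Notation A := (@sublaplacian R n).
Variables (S : R -> (V -> R) -> (V -> R)) (p : R -> V -> R).
Hypothesis gen : generated_by haar (friedrichs haar test A) S.
Hypothesis hp : forall t, 0 < t -> continuous (p t) /\ forall f, test f ->
  {ae haar, forall h : V, S t f h = \int[haar]_g (f (Gmul h g) * p t g)}.
Implicit Types f : R -> R.

Lemma Q_lip2 f (c : R) : tst f -> exists2 M : R, 0 <= M & forall r t x, 0 <= r -> 0 <= t ->
  `|Q eta p f c t x - Q eta p f c r x| <= M * `|t - r|.
Proof.
move=> tf; have [M M0 hM] := Q_lip eta gen hp c tf.
exists M => // r t x r0 t0; have [rt|/ltW tr] := leP r t.
  by rewrite (@ger0_norm _ (t - r)) ?subr_ge0// hM// r0.
by rewrite distrC (distrC t) (@ger0_norm _ (r - t)) ?subr_ge0// hM// t0.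
Qed.

(** [Q_taylor] expands forward from its base time. For h < 0 the expansion starts at s + h, and the
    coefficient is moved back to s by its Lipschitz bound, again at quadratic cost. *)
Lemma Q_dt f (c s x : R) : tst f -> 0 < s ->
  is_derive s (1 : R) (fun s => Q eta p f c s x) (Q eta p (schr eta f) c s x).
Proof.
move=> tf s0; have tS := tst_schr eta tf.
have [M M0 hM] := Q_taylor eta gen hp c tf.
have [M' M'0 hM'] := Q_lip2 c tS.
apply/is_deriveP => e e0.
have k0 : 0 < M + M' + 1 by rewrite ltr_wpDl// addr_ge0.
exists (Num.min s (e / (M + M' + 1))); first by rewrite lt_min s0 divr_gt0.
move=> h h0; rewrite lt_min => /andP[hs he].
have he' : (M + M') * `|h| <= e.
  move: he; rewrite ltr_pdivlMr// => /ltW; apply: le_trans.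
  by rewrite mulrC ler_wpM2l// lerDl.
have sh0 : 0 <= s + h by move: hs; rewrite ltr_norml => /andP[h1 _]; lra.
suff : `|Q eta p f c (s + h) x - Q eta p f c s x - h * Q eta p (schr eta f) c s x| <= (M + M') * `|h| ^+ 2.
  move=> h1; apply: le_trans he'.
  rewrite -(ler_pM2l (x := `|h|)) ?normr_gt0// -normrM mulrBr mulrA mulfV// mul1r.
  by rewrite mulrCA -expr2.
rewrite real_normK ?num_real//.
have [hp0|hn] := leP 0 h.
  have := hM s (s + h) x; rewrite (ltW s0) lerDl => /(_ hp0).
  rewrite (_ : s + h - s = h); last by ring.
  move=> /le_trans; apply.
  by rewrite ler_wpM2r ?sqr_ge0// lerDl.
have rt : 0 <= s + h <= s by rewrite sh0 gerDl ltW.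
have := hM (s + h) s x rt; have := hM' (s + h) s x sh0 (ltW s0).
rewrite (_ : s - (s + h) = - h); last by ring.
rewrite normrN (ltr0_norm hn) sqrrN => h1 h2.
rewrite (_ : Q eta p f c (s + h) x - _ - _ = - (Q eta p f c s x - Q eta p f c (s + h) x - - h * Q eta p (schr eta f) c (s + h) x) -
   h * (Q eta p (schr eta f) c s x - Q eta p (schr eta f) c (s + h) x)); last by ring.
apply: (le_trans (ler_normB _ _)); rewrite normrN mulrDl; apply: lerD => //.
rewrite normrM (ltr0_norm hn) -sqrrN expr2 mulrA [M' * _]mulrC.
by rewrite -mulrA ler_wpM2l// oppr_ge0 ltW.
Qed.

(** Joint continuity from a Lipschitz bound in time uniform in x and continuity in x at one fixed
    time. *)
Lemma Q_joint f (c t0 : R) : tst f -> 0 <= t0 -> continuous (fun z : R * R => Q eta p f c (t0 + `|z.1|) z.2).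
Proof.
move=> tf t00 z0; have [M M0 hM] := Q_lip2 c tf.
apply/cvgrPdist_le => e e0.
have c1 : M * `|(t0 + `|z0.1|) - (t0 + `|z.1|)| @[z --> z0] --> M * `|(t0 + `|z0.1|) - (t0 + `|z0.1|)|.
  apply: cvgM; first exact: cvg_cst.
  apply: cvg_norm; apply: cvgB; first exact: cvg_cst.
  by apply: cvgD; [exact: cvg_cst|apply: cvg_norm; exact: cvg_fst].
have c2 : Q eta p f c (t0 + `|z0.1|) z.2 @[z --> z0] --> Q eta p f c (t0 + `|z0.1|) z0.2.
  apply: (@continuous_comp _ _ _ (fun z : R * R => z.2) (Q eta p f c (t0 + `|z0.1|))); first exact: cvg_snd.
  by apply: (@Q_continuous R n eta S p gen hp f c); rewrite ?addr_ge0.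
rewrite subrr normr0 mulr0 in c1.
have e2 : 0 < e / 2 by rewrite divr_gt0.
have /cvgrPdist_le/(_ _ e2) n1 := c1; have /cvgrPdist_le/(_ _ e2) n2 := c2.
apply: filterS2 n1 n2 => z; rewrite sub0r normrN => h1 h2.
rewrite [e]splitr.
rewrite (_ : _ - _ = (Q eta p f c (t0 + `|z0.1|) z0.2 - Q eta p f c (t0 + `|z0.1|) z.2) +
  (Q eta p f c (t0 + `|z0.1|) z.2 - Q eta p f c (t0 + `|z.1|) z.2)); last by rewrite addrA subrK.
apply: (le_trans (ler_normD _ _)); apply: lerD => //.
apply: (le_trans (hM _ _ _ _ _)); rewrite ?addr_ge0//.
exact: le_trans (ler_norm _) h1.
Qed.

(** At fixed time Q satisfies weakly that its second derivative is wv^2 Q plus the transform of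
    [schr eta f]. The right-hand side is continuous, so the equation holds classically. *)
Lemma Q_space f (c t x : R) : tst f -> 0 <= t ->
  is_derive x (1 : R) (Q eta p f c t) ('D_(1 : R) (Q eta p f c t) x) /\
  is_derive x (1 : R) ('D_(1 : R) (Q eta p f c t)) (wv eta x ^+ 2 * Q eta p f c t x + Q eta p (schr eta f) c t x).
Proof.
move=> tf t0; have tS := tst_schr eta tf.
have cQ := @Q_continuous R n eta S p gen hp f c t tf t0.
have cS := @Q_continuous R n eta S p gen hp (schr eta f) c t tS t0.
have cw : continuous (wv eta) by apply: smooth_continuous; exact: smooth_wv.
have cq : continuous (fun x => wv eta x ^+ 2 * Q eta p f c t x + Q eta p (schr eta f) c t x).
  move=> y; apply: cvgD; last exact: cS.
  apply: cvgM; last exact: cQ.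
  under eq_fun do rewrite expr2; rewrite expr2; apply: cvgM; exact: cw.
have [h th|d1 d2] := weak_C2 cQ cq _ x; last first.
  by split=> //; exact: DeriveDef.
have th2 := tst_derive1 (tst_derive1 th).
have i1 := continuous_tst_integ cQ th2.
have tw : tst (fun x => wv eta x ^+ 2 * h x).
  by apply: tst_mull => //; apply: smooth_exp; exact: smooth_wv.
have i2 := continuous_tst_integ cQ tw; have i3 := continuous_tst_integ cS th.
have := Q_weak eta gen hp c tf t0 th.
rewrite (eq_Rint lebesgue_measure (f := fun x => Q eta p f c t x * schr eta h x)
  (g := fun x => Q eta p f c t x * 'D_(1 : R) ('D_(1 : R) h) x - Q eta p f c t x * (wv eta x ^+ 2 * h x))); last first.
  by move=> y; rewrite /schr mulrBr.
rewrite RintB// => /eqP; rewrite subr_eq => /eqP ->.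
rewrite -RintD//; apply: eq_Rint => y; ring.
Qed.

(** For a comparison function C exp(phi), being a supersolution reads phi_xx + phi_x^2 - V <= phi_s.
    The sign [sg] gives bounds on both sides, and the starting time t0 allows one barrier to take
    over from another. *)
Lemma Q_barrier f (c t0 T sg C : R) (phi phis phix phixx : R -> R -> R) :
  tst f -> 0 <= t0 -> sg ^+ 2 = 1 -> 0 <= C ->
  continuous (fun z : R * R => phi `|z.1| z.2) ->
  (forall x, sg * Q eta p f c t0 x <= C * expR (phi 0 x)) ->
  (forall s x : R, 0 < s <= T -> [/\ is_derive s (1 : R) (fun s => phi s x) (phis s x),
     is_derive x (1 : R) (phi s) (phix s x), is_derive x (1 : R) (phix s) (phixx s x) &
     phixx s x + phix s x ^+ 2 - wv eta x ^+ 2 <= phis s x]) ->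
  forall s x : R, 0 <= s <= T -> sg * Q eta p f c (t0 + s) x <= C * expR (phi s x).
Proof.
move=> tf t00 sg1 C0 cphi h0 dphi s1 x1 s1T; rewrite -subr_le0.
have tS := tst_schr eta tf.
have [Mf hMf] := tst1_bounded tf.
have sgn : `|sg| = 1 by apply/eqP; rewrite -sqrp_eq1// real_normK ?num_real// sg1.
pose B s x := C * expR (phi s x).
have B0 s x : 0 <= B s x by rewrite mulr_ge0// expR_ge0.
apply: (@max_principle R (fun x => wv eta x ^+ 2) T Mf (fun s x => sg * Q eta p f c (t0 + s) x - B s x)
  (fun s x => sg * Q eta p (schr eta f) c (t0 + s) x - B s x * phis s x)
  (fun s x => sg * 'D_(1 : R) (Q eta p f c (t0 + s)) x - B s x * phix s x)
  (fun s x => sg * (wv eta x ^+ 2 * Q eta p f c (t0 + s) x + Q eta p (schr eta f) c (t0 + s) x) -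
     (B s x * phixx s x + B s x * phix s x ^+ 2))) => //.
- by move=> x; exact: sqr_ge0.
- move=> z; apply: cvgB.
    by apply: cvgM; [exact: cvg_cst|exact: Q_joint].
  apply: cvgM; first exact: cvg_cst.
  apply: (@continuous_comp _ _ _ (fun z : R * R => phi `|z.1| z.2) expR); first exact: cphi.
  exact: continuous_expR.
- move=> s x /andP[s0 _]; rewrite lerBlDr; apply: (@le_trans _ _ Mf); last by rewrite lerDl.
  apply: (le_trans (ler_norm _)); rewrite normrM sgn mul1r.
  by apply: (Q_le eta gen hp _ _ tf hMf); rewrite addr_ge0.
- by move=> x; rewrite addr0 subr_le0.
move=> s x sT; have /andP[s0 _] := sT; have ts0 : 0 < t0 + s by rewrite ltr_wpDl.
have [d1 d2 d3 le] := dphi s x sT.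
have [e1 e2] := Q_space c x tf (ltW ts0).
have dB (g : R -> R) (y g1 : R) : is_derive y (1 : R) g g1 ->
    is_derive y (1 : R) (fun y => C * expR (g y)) (C * expR (g y) * g1).
  move=> dg; have := is_deriveZ C (@is_derive1_comp R expR g y _ _ (is_derive_expR (g y)) dg).
  by rewrite /GRing.scale /= mulrA.
split.
- apply: is_deriveB (dB _ _ _ d1).
  have ds : is_derive s (1 : R) (fun s => t0 + s) 1.
    by have := is_deriveD (is_derive_cst t0 s (1 : R)) (is_derive_id s (1 : R)); rewrite add0r.
  have := is_deriveZ sg (@is_derive1_comp R (fun s => Q eta p f c s x) (fun s => t0 + s) s _ _ (Q_dt c x tf ts0) ds).
  by rewrite /GRing.scale /= mulr1.
- exact: is_deriveB (is_deriveZ sg e1) (dB _ _ _ d2).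
- apply: is_deriveB (is_deriveZ sg e2) _.
  have := is_deriveM (dB _ _ _ d2) d3.
  rewrite /GRing.scale /= (_ : _ + _ = B s x * phixx s x + B s x * phix s x ^+ 2)//.
  by rewrite /B; ring.
- have := ler_wpM2l (B0 s x) le; rewrite mulrBr mulrDr; move: (B s x * _) (B s x * _) (B s x * phis s x).
  move=> a b d; lra.
Qed.

End schroedinger.

(** * Explicit comparison functions *)

Section barriers.
Context {R : realType} {n : nat}.
Local Notation V := (R * 'rV[R]_n)%type.
Local Notation haar := (@haar R n).
Local Notation test := (@test_function R V).
Local Notation A := (@sublaplacian R n).
Variables (S : R -> (V -> R) -> (V -> R)) (p : R -> V -> R).
Hypothesis gen : generated_by haar (friedrichs haar test A) S.
Hypothesis hp : forall t, 0 < t -> continuous (p t) /\ forall f, test f ->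
  {ae haar, forall h : V, S t f h = \int[haar]_g (f (Gmul h g) * p t g)}.
Implicit Types (f : R -> R) (eta : 'rV[R]_n).

Lemma Q_0 eta f (c x : R) : Q eta p f c 0 x = cos c * f x.
Proof. by rewrite /Q eqxx. Qed.

Lemma Q_barrier_at eta f (c t0 T t sg C : R) (phi phis phix phixx : R -> R -> R) (x : R) :
  tst f -> t = t0 + T -> 0 <= T -> 0 <= t0 -> sg ^+ 2 = 1 -> 0 <= C ->
  continuous (fun z : R * R => phi `|z.1| z.2) ->
  (forall y, sg * Q eta p f c t0 y <= C * expR (phi 0 y)) ->
  (forall s y : R, 0 < s <= T -> [/\ is_derive s (1 : R) (fun s => phi s y) (phis s y),
     is_derive y (1 : R) (phi s) (phix s y), is_derive y (1 : R) (phix s) (phixx s y) &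
     phixx s y + phix s y ^+ 2 - wv eta y ^+ 2 <= phis s y]) ->
  sg * Q eta p f c t x <= C * expR (phi T x).
Proof.
move=> tf -> T0 t00 sg1 C0 cphi h0 dphi.
by apply: (Q_barrier gen hp tf t00 sg1 C0 cphi h0 dphi); rewrite T0 lexx.
Qed.

Lemma Q_nonpos eta f (c sg t x : R) : tst f -> sg ^+ 2 = 1 -> 0 <= t ->
  (forall y, sg * (cos c * f y) <= 0) -> sg * Q eta p f c t x <= 0.
Proof.
move=> tf sg1 t0 h0.
rewrite -(mul0r (expR 0)).
(* With C = 0 the barrier is the zero solution. *)
apply: (@Q_barrier_at eta f c 0 t t sg 0 (fun _ _ => 0) (fun _ _ => 0) (fun _ _ => 0) (fun _ _ => 0) x tf _ t0 (lexx _) sg1 (lexx _)).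
- by rewrite add0r.
- by move=> z; exact: cvg_cst.
- by move=> y; rewrite Q_0 mul0r.
- move=> s y _; split; try exact: is_derive_cst.
  by rewrite expr0n add0r sub0r oppr_le0 sqr_ge0.
Qed.

Lemma Q_ge0 eta f (t x : R) : tst f -> (forall y, 0 <= f y) -> 0 <= t -> 0 <= Q eta p f 0 t x.
Proof.
move=> tf f0 t0; rewrite -oppr_le0 -mulN1r; apply: Q_nonpos => //; first by rewrite sqrrN expr1n.
by move=> y; rewrite cos0 mul1r mulN1r oppr_le0.
Qed.

(** The initial value carries the factor cos(pi / 2) = 0, so the maximum principle keeps this
    component at 0: the transformed kernel is real. *)
Lemma Q_sin eta f (t x : R) : tst f -> 0 <= t -> Q eta p f (pi / 2) t x = 0.
Proof.
move=> tf t0; apply/eqP; rewrite eq_le; apply/andP; split.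
  rewrite -[leLHS]mul1r; apply: Q_nonpos => //; first by rewrite expr1n.
  by move=> y; rewrite cos_pihalf mul0r mulr0.
rewrite -oppr_le0 -mulN1r; apply: Q_nonpos => //; first by rewrite sqrrN expr1n.
by move=> y; rewrite cos_pihalf mul0r mulr0.
Qed.

Lemma norm_sg_le (y B : R) : (forall sg : R, sg ^+ 2 = 1 -> sg * y <= B) -> `|y| <= B.
Proof.
move=> H; rewrite ler_norml; apply/andP; split.
  by rewrite lerNl -mulN1r H// sqrrN expr1n.
by rewrite -[leLHS]mul1r H// expr1n.
Qed.

Lemma expR_norm_le (y b x C : R) : (forall tau : R, tau ^+ 2 = 1 -> y <= C * expR (b + tau * x)) ->
  y <= C * expR (b - `|x|).
Proof.
move=> H; have [x0|x0] := leP 0 x.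
  by rewrite ger0_norm//; have := H (-1); rewrite sqrrN expr1n mulN1r => /(_ erefl).
by rewrite ltr0_norm// opprK; have := H 1; rewrite expr1n mul1r => /(_ erefl).
Qed.

(** The barriers exp(s + tau x) with tau = 1 and tau = -1 solve the free heat equation. The factor M
    e^D makes both exceed a datum bounded by M and supported in [-D, D]. *)
Lemma Q_decay eta f (c : R) : tst f -> exists2 C : R, 0 <= C & forall s x, 0 <= s ->
  `|Q eta p f c s x| <= C * expR (s - `|x|).
Proof.
move=> tf; have [M hM] := tst1_bounded tf; have [_ [D fD]] := tf.
have M0 : 0 <= M by rewrite (le_trans _ (hM 0)).
exists (M * expR D); first by rewrite mulr_ge0// expR_ge0.
move=> s x s0; apply: norm_sg_le => sg sg1; apply: expR_norm_le => tau tau1.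
apply: (@Q_barrier_at eta f c 0 s s sg (M * expR D) (fun s x => s + tau * x)
  (fun _ _ => 1) (fun _ _ => tau) (fun _ _ => 0) x tf _ s0 (lexx _) sg1).
- by rewrite add0r.
- by rewrite mulr_ge0// expR_ge0.
- move=> z; apply: cvgD; first by apply: cvg_norm; exact: cvg_fst.
  by apply: cvgM; [exact: cvg_cst|exact: cvg_snd].
- move=> y; rewrite Q_0 add0r; apply: (le_trans (ler_norm _)).
  have sgn : `|sg| = 1 by apply/eqP; rewrite -sqrp_eq1// real_normK ?num_real// sg1.
  have taun : `|tau| = 1 by apply/eqP; rewrite -sqrp_eq1// real_normK ?num_real// tau1.
  rewrite normrM sgn mul1r normrM.
  apply: (@le_trans _ _ `|f y|).
    by rewrite ler_piMl// ler_norml cos_geN1 cos_le1.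
  have [yD|yD] := ltP D `|y|; first by rewrite fD// normr0 !mulr_ge0// expR_ge0.
  rewrite -mulrA -expRD -[leLHS]mulr1 ler_pM// -expR0 ler_expR.
  have : `|tau * y| <= D by rewrite normrM taun mul1r.
  by rewrite ler_norml => /andP[h _]; lra.
- move=> r y _; split.
  + by have := is_deriveD (is_derive_id r (1 : R)) (is_derive_cst (tau * y) r (1 : R)); rewrite addr0.
  + have := is_deriveD (is_derive_cst r y (1 : R)) (is_deriveZ tau (is_derive_id y (1 : R))).
    by rewrite add0r /GRing.scale /= mulr1.
  + exact: is_derive_cst.
  + by rewrite add0r tau1 gerBl sqr_ge0.
Qed.

Lemma is_derive_invD (u b : R) : 0 < u + b ->
  is_derive u (1 : R) (fun s : R => (s + b)^-1) (- (u + b) ^- 2).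
Proof.
move=> ub; have [d e] := is_deriveD (is_derive_id u (1 : R)) (is_derive_cst b u (1 : R)).
have nz : u + b != 0 by rewrite gt_eqF.
apply: DeriveDef; first exact: (@derivableV _ _ (fun s : R => s + b) u 1 nz d).
rewrite (@deriveV _ _ (fun s : R => s + b) u 1 nz d).
by rewrite [X in _ *: X]e addr0 /GRing.scale /= mulr1.
Qed.

Lemma cbumpE m : cbump m = cbump 0 * m.+1%:R^-1 :> R.
Proof.
have m0 : m.+1%:R != 0 :> R by rewrite pnatr_eq0.
have E (y : R) : bumpn 0 m y = bumpn 0 0 (m.+1%:R * y) by rewrite /bumpn !subr0 mulr1 mulrC.
apply: (mulIf m0); rewrite divfK//; apply: EFin_inj.
have i0 := tst1_integ (@tst_bumpn R 0 0); have i1 := tst1_integ (@tst_bumpn R 0 m).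
rewrite mulrC EFinM /cbump (EFin_Rint i0) (EFin_Rint i1).
have := @lebesgue_scale R (fun y => (bumpn 0 0 y)%:E) _ m0.
rewrite ger0_norm// => <-; last by move=> y; rewrite lee_fin bumpn_ge0.
  by congr (_ * _)%E; apply: eq_integral => y _; rewrite E.
by apply/measurable_EFinP; exact: measurable_bumpn.
Qed.

(* The barrier is a Gaussian started at the scale of the bump.  Since V >= 0 is
   all that is used, the constant does not depend on eta. *)
Lemma Q_gauss (t : R) : 0 < t -> exists2 C : R, 0 <= C & forall eta a m c x,
  `|Q eta p (bumpn a m) c t x| <= C * cbump m.
Proof.
move=> t0; pose c0 : R := cbump 0; have c00 : 0 < c0 by exact: cbump_gt0.
(* The last factor is t^(-1/2), written as an exponential to match the exponent of the barrier; c0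
   converts the bump scale into the bump mass through [cbumpE]. *)
exists (expR (4^-1) / c0 * expR (- (ln t / 2))).
  by rewrite !mulr_ge0// ?expR_ge0// invr_ge0 ltW.
move=> eta a m c x; rewrite cbumpE -/c0.
set e := m.+1%:R^-1; have e0 : 0 < e by exact: natSV_gt0.
rewrite (_ : _ * (c0 * e) = expR (4^-1) * e * expR (- (ln t / 2))); last first.
  by field; rewrite gt_eqF.
apply: norm_sg_le => sg sg1.
have tb := @tst_bumpn R a m.
(* The barrier is a heat kernel without its constant, started at time e^2. On the support of the
   bump its initial value is at least e^(-1) e^(-1/4), which the prefactor e^(1/4) e raises to at
   least 1. *)
pose b := e ^+ 2; have b0 : 0 < b by rewrite exprn_gt0.
pose phi s x := - (ln (s + b) / 2) - (x - a) ^+ 2 / 4 * (s + b)^-1.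
apply: (@le_trans _ _ (expR (4^-1) * e * expR (phi t x))); last first.
  rewrite ler_wpM2l ?mulr_ge0 ?expR_ge0 ?(ltW e0)// ler_expR.
  have tb0 : 0 < t + b by rewrite addr_gt0.
  apply: (@le_trans _ _ (- (ln (t + b) / 2))).
    by rewrite gerBl mulr_ge0// ?invr_ge0 ?(ltW tb0)// mulr_ge0// sqr_ge0.
  by rewrite lerN2 ler_pM2r ?invr_gt0// ler_ln ?posrE// lerDl ltW.
apply: (@Q_barrier_at eta (bumpn a m) c 0 t t sg (expR (4^-1) * e) phi
  (fun s x => - ((s + b)^-1 / 2) + (x - a) ^+ 2 / 4 * (s + b) ^- 2)
  (fun s x => - ((x - a) / 2 * (s + b)^-1)) (fun s x => - (2^-1 * (s + b)^-1)) x tb _ (ltW t0) (lexx _) sg1).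
- by rewrite add0r.
- by rewrite mulr_ge0 ?expR_ge0// ltW.
- have pos (z : R * R) : 0 < `|z.1| + b by rewrite ltr_wpDl.
  have ca : continuous (fun z : R * R => `|z.1| + b).
    by move=> z; apply: cvgD; [apply: cvg_norm; exact: cvg_fst|exact: cvg_cst].
  move=> z; apply: cvgB.
    apply: cvgN; apply: cvgM; last exact: cvg_cst.
    apply: (@continuous_comp _ _ _ (fun z : R * R => `|z.1| + b) (@ln R)); first exact: ca.
    by apply: continuous_ln.
  apply: cvgM.
    apply: cvgM; last exact: cvg_cst.
    under eq_fun do rewrite expr2; rewrite expr2.
    by apply: cvgM; (apply: cvgB; [exact: cvg_snd|exact: cvg_cst]).
  by apply: cvgV; [rewrite gt_eqF|exact: ca].
- move=> y; rewrite Q_0 /phi add0r; apply: (le_trans (ler_norm _)).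
  have sgn : `|sg| = 1 by apply/eqP; rewrite -sqrp_eq1// real_normK ?num_real// sg1.
  rewrite normrM sgn mul1r normrM.
  apply: (@le_trans _ _ `|bumpn a m y|).
    by rewrite ler_piMl// ler_norml cos_geN1 cos_le1.
  rewrite ger0_norm ?bumpn_ge0//.
  have [ye|ye] := leP e `|y - a|; first by rewrite bumpn_out// !mulr_ge0 ?expR_ge0// ltW.
  apply: (@le_trans _ _ 1); first exact: bump_le1.
  rewrite expRD.
  have lb : expR (- (ln b / 2)) = e^-1.
    by rewrite /b lnXn// mulr2n mulrDl -splitr expRN lnK.
  rewrite lb mulrA mulfK ?gt_eqF// -expRD -expR0 ler_expR.
  rewrite subr_ge0 ler_pdivrMr// mulrC ler_pM2l// /b -[leLHS]real_normK ?num_real//.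
  by rewrite lerXn2r ?nnegrE// ltW.
- move=> s y /andP[s0 _]; have sb : 0 < s + b by rewrite addr_gt0.
  have di := is_derive_invD sb; split.
  + have dl : is_derive s (1 : R) (fun s => ln (s + b)) (s + b)^-1.
      have d1 := is_deriveD (is_derive_id s (1 : R)) (is_derive_cst b s (1 : R)).
      have d2 : is_derive (s + b) (1 : R) (@ln R) (s + b)^-1 by exact: is_derive1_ln.
      by have := @is_derive1_comp R (@ln R) (fun s => s + b) s _ _ d2 d1; rewrite addr0 mulr1.
    have := is_deriveB (is_deriveN (is_deriveZ (2^-1 : R) dl)) (is_deriveZ ((y - a) ^+ 2 / 4) di).
    rewrite /GRing.scale /= mulrN opprK => h.
    rewrite [X in is_derive _ _ _ X](_ : _ = - (2^-1 * (s + b)^-1) + (y - a) ^+ 2 / 4 * (s + b) ^- 2); last by rewrite mulrC.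
    rewrite [X in is_derive _ _ X _](_ : _ = - (2^-1 \*: (fun s0 => ln (s0 + b))) - ((y - a) ^+ 2 / 4 \*: (fun s0 => (s0 + b)^-1))); first exact: h.
    apply/funext => r; transitivity (- (2^-1 * ln (r + b)) - (y - a) ^+ 2 / 4 * (r + b)^-1) => //.
    by rewrite /phi [ln _ / 2]mulrC.
  + have d1 := is_deriveD (is_derive_id y (1 : R)) (is_derive_cst (- a) y (1 : R)).
    have d2 := is_deriveM d1 d1.
    have := is_deriveB (is_derive_cst (- (ln (s + b) / 2)) y (1 : R)) (is_deriveZ (4^-1 * (s + b)^-1) d2).
    rewrite addr0 sub0r /GRing.scale /= => h.
    rewrite [X in is_derive _ _ _ X](_ : _ = - (4^-1 * (s + b)^-1 * ((y - a) * 1 + (y - a) * 1))); last first.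
      by field; rewrite gt_eqF.
    rewrite [X in is_derive _ _ X _](_ : _ = cst (- (ln (s + b) / 2)) - (4^-1 * (s + b)^-1 \*: ((id + cst (- a)) * (id + cst (- a))))); first exact: h.
    apply/funext => r.
    transitivity (- (ln (s + b) / 2) - 4^-1 * (s + b)^-1 * ((r - a) * (r - a))) => //.
    by rewrite /phi; move: ((s + b)^-1) (ln _ / 2) => u w; ring.
  + have d1 := is_deriveD (is_derive_id y (1 : R)) (is_derive_cst (- a) y (1 : R)).
    have := is_deriveN (is_deriveZ (2^-1 * (s + b)^-1) d1).
    rewrite addr0 /GRing.scale /= mulr1 => h.
    rewrite [X in is_derive _ _ X _](_ : _ = - (2^-1 * (s + b)^-1 \*: (id + cst (- a)))); first exact: h.
    apply/funext => r; transitivity (- (2^-1 * (s + b)^-1 * (r - a))) => //.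
    by move: ((s + b)^-1) => u; ring.
  + rewrite sqrrN lerBlDr.
    rewrite (_ : - (2^-1 * _) + _ = - ((s + b)^-1 / 2) + (y - a) ^+ 2 / 4 * (s + b) ^- 2); last first.
      by field; rewrite gt_eqF.
    by rewrite lerDl sqr_ge0.
Qed.

(* Started from [Q_gauss] at time t / 2, with barrier exp(K s -+ s x). *)
Lemma Q_exp_decay eta (t K0 : R) : 0 < t -> (forall x, `|x| - K0 <= wv eta x ^+ 2) ->
  exists C k : R, [/\ 0 <= C, 0 < k & forall a m c x,
    `|Q eta p (bumpn a m) c t x| <= C * cbump m * expR (- (k * `|x|))].
Proof.
move=> t0 hK; have t2 : 0 < t / 2 by rewrite divr_gt0.
have [C C0 hC] := Q_gauss t2.
(* For phi = K s + tau s x the requirement is s^2 - wv^2 <= K + tau x. It follows from wv^2 >= |x| -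
   K0, s <= t and |tau x| = |x|. *)
pose K := K0 + t ^+ 2.
exists (C * expR (K * (t / 2))), (t / 2); split => //; first by rewrite mulr_ge0// expR_ge0.
move=> a m c x; apply: norm_sg_le => sg sg1.
have cb0 : 0 <= C * cbump m by rewrite mulr_ge0// ltW// cbump_gt0.
rewrite (_ : _ * expR (- _) = C * cbump m * (expR (K * (t / 2)) * expR (- (t / 2 * `|x|)))); last by ring.
rewrite -expRD.
have -> : - (t / 2 * `|x|) = - `|t / 2 * x| by rewrite normrM gtr0_norm.
apply: expR_norm_le => tau tau1.
have sgn : `|sg| = 1 by apply/eqP; rewrite -sqrp_eq1// real_normK ?num_real// sg1.
have taun : `|tau| = 1 by apply/eqP; rewrite -sqrp_eq1// real_normK ?num_real// tau1.
have E : K * (t / 2) + tau * (t / 2 * x) = (fun s x => K * s + tau * (s * x)) (t / 2) x by [].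
rewrite E.
apply: (@Q_barrier_at eta (bumpn a m) c (t / 2) (t / 2) t sg (C * cbump m)
  (fun s x => K * s + tau * (s * x)) (fun s x => K + tau * x) (fun s x => tau * s) (fun s x => 0)
  x (@tst_bumpn R a m) (splitr t) (ltW t2) (ltW t2) sg1 cb0).
- move=> z; apply: cvgD.
    by apply: cvgM; [exact: cvg_cst|apply: cvg_norm; exact: cvg_fst].
  apply: cvgM; first exact: cvg_cst.
  by apply: cvgM; [apply: cvg_norm; exact: cvg_fst|exact: cvg_snd].
- move=> y; rewrite mulr0 mul0r mulr0 addr0 expR0 mulr1.
  by apply: (le_trans (ler_norm _)); rewrite normrM sgn mul1r.
- move=> s y /andP[s0 st]; split.
  + have := is_deriveD (is_deriveZ K (is_derive_id s (1 : R))) (is_deriveZ tau (is_deriveZ y (is_derive_id s (1 : R)))).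
    rewrite /GRing.scale /= !mulr1 => h.
    rewrite [X in is_derive _ _ X _](_ : _ = (K \*: id) + (tau \*: (y \*: id))); first exact: h.
    by apply/funext => r /=; rewrite /GRing.scale /=; congr (_ + _ * _); rewrite mulrC.
  + have := is_deriveD (is_derive_cst (K * s) y (1 : R)) (is_deriveZ tau (is_deriveZ s (is_derive_id y (1 : R)))).
    by rewrite /GRing.scale /= !mulr1 add0r.
  + exact: is_derive_cst.
  + rewrite add0r exprMn tau1 mul1r.
    have h1 := hK y; have h2 : `|tau * y| = `|y| by rewrite normrM taun mul1r.
    have h3 := ler_norm (- (tau * y)); rewrite normrN h2 in h3.
    have h4 : s ^+ 2 <= t ^+ 2.
      by rewrite lerXn2r ?nnegrE ?(ltW s0) ?(ltW t0)// (le_trans st)// ler_piMr ?(ltW t0)// invf_le1// ler1n.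
    rewrite /K; move: h1 h3 h4; move: (wv eta y ^+ 2) (tau * y) `|y| (s ^+ 2) (t ^+ 2).
    move=> A1 A2 A3 A4 A5; lra.
Qed.

End barriers.

(** For |x| >= 1 a common factor |x|^m can be taken out of the leading monomial and of the bound on
    the others, leaving |wv| >= a |x| - s. *)
Lemma wv_growth {R : realType} (m : nat) (eta : 'rV[R]_m.+2) : eta ord0 ord_max != 0 ->
  exists K0 : R, forall x, `|x| - K0 <= wv eta x ^+ 2.
Proof.
move=> e0; pose a := 2 * pi * `|eta ord0 ord_max| / (m.+1)`!%:R.
have pi0 : 0 < pi :> R by exact: pi_gt0.
have f0 k : 0 < k`!%:R :> R by rewrite ltr0n fact_gt0.
have a0 : 0 < a by rewrite /a divr_gt0// mulr_gt0 ?normr_gt0// mulr_gt0.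
pose s := 2 * pi * \sum_(i < m.+1) `|eta ord0 (widen_ord (leqnSn m.+1) i)| / i`!%:R.
have s0 : 0 <= s.
  by rewrite /s mulr_ge0 ?mulr_ge0 ?(ltW pi0)// sumr_ge0// => i _; rewrite divr_ge0.
have low (x : R) : 1 <= `|x| -> a * `|x| - s <= `|wv eta x|.
  move=> x1; have [h|h] := leP (a * `|x| - s) 0; first exact: le_trans h _.
  have xm : 1 <= `|x| ^+ m by rewrite exprn_ege1.
  apply: (@le_trans _ _ (`|x| ^+ m * (a * `|x| - s))); first by rewrite ler_peMl// ltW.
  rewrite /wv big_ord_recr /= [\sum_(_ < _) _ + _]addrC.
  apply: (@le_trans _ _ (`|2 * pi * (eta ord0 ord_max * cf m.+1 x)| -
    `|2 * pi * \sum_(i < m.+1) eta ord0 (widen_ord (leqnSn m.+1) i) * cf i x|)); last first.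
    rewrite lerBlDr; have := ler_normB (2 * pi * (eta ord0 ord_max * cf m.+1 x) +
      2 * pi * \sum_(i < m.+1) eta ord0 (widen_ord (leqnSn m.+1) i) * cf i x)
      (2 * pi * \sum_(i < m.+1) eta ord0 (widen_ord (leqnSn m.+1) i) * cf i x).
    by rewrite addrK -mulrDr.
  rewrite mulrBr; apply: lerB.
    rewrite /cf !normrM (@gtr0_norm _ pi)// (@gtr0_norm _ 2)// normrX normfV (@gtr0_norm _ _ (f0 _)).
    by rewrite /a exprS; move: (`|x| ^+ m) `|x| `|eta _ _| (_`!%:R^-1) => b1 b2 b3 b4; rewrite le_eqVlt; apply/orP; left; apply/eqP; ring.
  rewrite normrM (@gtr0_norm _ (2 * pi)) ?mulr_gt0// /s mulrCA ler_wpM2l ?mulr_ge0 ?(ltW pi0)//.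
  apply: (le_trans (ler_norm_sum _ _ _)); rewrite mulr_sumr; apply: ler_sum => i _.
  rewrite /cf !normrM normrX normfV (@gtr0_norm _ _ (f0 _)) [leRHS]mulrCA ler_wpM2l//.
  rewrite ler_wpM2r ?invr_ge0//; apply: ler_weXn2l => //; by rewrite -ltnS ltn_ord.
(* From y^2 >= 2 c y - c^2 with 2 c = 1 / a, the linear lower bound of slope a on |wv| becomes one
   of slope 1 on its square. *)
pose c := (2 * a)^-1; have c0 : 0 < c by rewrite invr_gt0 mulr_gt0.
exists (s / a + c ^+ 2 + 1) => x; have [x1|x1] := leP 1 `|x|; last first.
  apply: (@le_trans _ _ 0); last exact: sqr_ge0.
  have : 0 <= s / a by rewrite divr_ge0// ltW.
  have := sqr_ge0 c; lra.
rewrite -[wv eta x ^+ 2]real_normK ?num_real//.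
have h1 := low x x1.
have h2 : 2 * c * `|wv eta x| - c ^+ 2 <= `|wv eta x| ^+ 2.
  rewrite -subr_ge0 (_ : _ - _ = (`|wv eta x| - c) ^+ 2) ?sqr_ge0//; ring.
apply: le_trans h2.
have h3 : 2 * c = a^-1 by rewrite /c; field; rewrite gt_eqF.
rewrite h3.
have h4 : a^-1 * (a * `|x| - s) <= a^-1 * `|wv eta x| by rewrite ler_wpM2l// invr_ge0 ltW.
apply: (@le_trans _ _ (a^-1 * (a * `|x| - s) - c ^+ 2)); last by rewrite lerD2r.
rewrite mulrBr mulrA mulVf ?gt_eqF// mul1r [a^-1 * s]mulrC; lra.
Qed.

Lemma compact_bounded_at {R : realType} (T : topologicalType) (K : set T) (H : T -> R) :
  compact K -> (forall z, K z -> {for z, continuous H}) ->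
  exists2 M : R, 0 <= M & forall z, K z -> `|H z| <= M.
Proof.
move=> cK cH.
have cHK : {within K, continuous H}.
  by apply: continuous_in_subspaceT => z /set_mem; exact: cH.
have /compact_bounded[M [_ HM]] := continuous_compact cHK cK.
exists (`|M| + 1) => [|z Kz]; first by rewrite addr_ge0.
apply: (HM (`|M| + 1)); last by exists z.
by rewrite (le_lt_trans (ler_norm M))// ltrDl.
Qed.

Section one_dim_integrals.
Context {R : realType}.
Local Notation mu := (@lebesgue_measure R).

(** Dominated by the exponential density at x plus the one at -x, divided by c. *)
Lemma integ_expR_norm (c : R) : 0 < c -> integ mu (fun x => expR (- (c * `|x|))).
Proof.
move=> c0.
have i1 : integ mu (exponential_pdf c) := integrable_exponential_pdf c0.
have mN : measurable_fun setT (fun x : R => - x).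
  by apply: continuous_measurable_fun => x; exact: oppr_continuous.
have [h1 _] := @Rint_preserving _ _ _ mu _ mN (@lebesgue_opp R) _ (integ_measurable i1).
have i2 : integ mu (fun x => exponential_pdf c (- x)) by apply/h1.
have cm : measurable_fun setT (fun x : R => expR (- (c * `|x|))).
  apply: continuous_measurable_fun => x.
  apply: continuous_comp; last exact: continuous_expR.
  by apply: cvgN; apply: cvgM; [exact: cvg_cst|exact: norm_continuous].
apply: (@le_integ _ _ _ mu _ (fun x : R => c^-1 * (exponential_pdf c x + exponential_pdf c (- x))) _ _ _);
  [exact: cm | move=> x | exact: (integZ c^-1 (integD i1 i2))].
rewrite ger0_norm ?expR_ge0//.
have pg y : 0 <= c^-1 * exponential_pdf c y.
  apply: mulr_ge0; first by rewrite invr_ge0 ltW.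
  by apply: exponential_pdf_ge0; exact: ltW.
have [x0|x0] := leP 0 x.
  have -> : exponential_pdf c x = c * expR (- c * x) by exact: exponential_pdfE.
  rewrite ger0_norm// mulrDr mulrA mulVf ?gt_eqF// mul1r.
  by rewrite mulNr lerDl.
rewrite ltr0_norm//.
have nx0 : 0 <= - x by rewrite oppr_ge0 ltW.
have -> : exponential_pdf c (- x) = c * expR (- c * - x) by exact: exponential_pdfE.
rewrite mulrDr [in X in _ + X]mulrA mulVf ?gt_eqF// mul1r.
by rewrite mulNr lerDr.
Qed.

Lemma box_integ (H : R * R -> R) (C M : R) :
  measurable_fun [set: measurableTypeR R * measurableTypeR R] H ->
  (forall z, `|H z| <= M) -> (forall z, C < `|z.1| -> H z = 0) ->
  (forall z, C < `|z.2| -> H z = 0) -> integ (mu \x mu)%E H.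
Proof.
move=> mH HM H1 H2.
have mi : measurable ([set` `[- C, C]] : set (measurableTypeR R)) by exact: measurable_itv.
apply: (@integ_bounded_support _ _ _ (mu \x mu)%E ([set` `[- C, C]] `*` [set` `[- C, C]]) H M).
- exact: measurableX.
- have hC : (mu `[(- C)%R, C]%classic < +oo)%E := compact_finite_measure (@segment_compact _ _ _).
  rewrite [ltLHS](product_measure1E mu mu mi mi).
  by apply: lte_mul_pinfty => //; rewrite ge0_fin_numE.
- exact: mH.
- exact: HM.
- move=> z nz; have [z1|z1] := ltP C `|z.1|; first exact: H1.
  have [z2|z2] := ltP C `|z.2|; first exact: H2.
  by exfalso; apply: nz; split => /=; rewrite in_itv /= -ler_norml.
Qed.

Lemma is_derive_Rint (f f1 : R -> R -> R) (a u v : R) (G : R -> R) :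
  u < a < v -> (forall s, u < s < v -> integ mu (f s)) ->
  (forall s y : R, u < s < v -> is_derive s (1 : R) (f^~ y) (f1 s y)) ->
  (forall s y, u < s < v -> `|f1 s y| <= G y) -> integ mu G ->
  is_derive a (1 : R) (fun s => \int[mu]_y f s y) (\int[mu]_y f1 a y).
Proof.
move=> auv fi fd fG Gi.
have Ia : [set` `]u, v[] a by rewrite /= in_itv.
have Iuv s : [set` `]u, v[] s -> u < s < v by rewrite /= in_itv.
have d1 s y : u < s < v -> partial1of2 f s y = f1 s y.
  by move=> suv; rewrite partial1of2E; have /@derive_val := fd s y suv.
have G0 y : 0 <= G y by rewrite (le_trans _ (fG a y auv)).
have h1 s (Is : [set` `]u, v[] s) : mu.-integrable setT (EFin \o f s) := fi s (Iuv s Is).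
have h2 s y : [set` `]u, v[] s -> setT y -> derivable (f^~ y) s 1.
  by move=> /Iuv suv _; have [] := fd s y suv.
have h3 s y : [set` `]u, v[] s -> setT y -> `|partial1of2 f s y| <= G y.
  by move=> /Iuv suv _; rewrite d1//; exact: fG.
have de := @derivable_under_integral R _ _ mu f setT measurableT a u v Ia h1 h2 G G0 Gi h3.
have dv := @differentiation_under_integral R _ _ mu f setT measurableT a u v Ia h1 h2 G G0 Gi h3.
apply: DeriveDef; first exact: de.
by rewrite -derive1E dv; apply: eq_Rint => y; rewrite d1.
Qed.

Lemma continuous_Rint (f : R -> R -> R) (a u v : R) (G : R -> R) :
  u < a < v -> (forall s, u < s < v -> integ mu (f s)) ->
  (forall s y, u < s < v -> {for s, continuous (f^~ y)}) ->
  (forall s y, u < s < v -> `|f s y| <= G y) -> integ mu G ->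
  {for a, continuous (fun s => \int[mu]_y f s y)}.
Proof.
move=> auv fi fc fG Gi.
have Iuv s : [set` `]u, v[] s -> u < s < v by rewrite /= in_itv.
apply: (@continuity_under_integral R _ _ mu f setT measurableT u v _ _ G Gi).
- by move=> s /Iuv; exact: fi.
- by apply: aeW => y _ s /set_mem /Iuv; exact: fc.
- by move=> s /Iuv suv; apply: aeW => y _; exact: fG.
- by apply/mem_set; rewrite /= in_itv.
Qed.

End one_dim_integrals.

(** * Pairing with the fundamental solution *)

Section boxes.
Context {R : realType}.
Local Notation mu := (@lebesgue_measure R).

Lemma bsupp_compact (f : R -> R) : bsupp f -> compactly_supported f.
Proof.
move=> [C fC]; apply: (subclosed_compact _ (@segment_compact R (- C) C)).
  exact: closed_closure.
have sub : [set x | f x != 0] `<=` [set` `[- C, C]].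
  move=> x /= fx; rewrite in_itv /= -ler_norml leNgt.
  by apply/negP => /fC h; rewrite h eqxx in fx.
exact: (subset_trans (closure_subset sub) (@itv_closed _ R (- C) C)).
Qed.

(** Continuity on a compact box gives a constant bound M; the function M e^(C - |x|) is at least M
    where F lives and is integrable on the line. *)
Lemma box_dominated (F : R * R -> R) (u v C : R) :
  (forall s x, u <= s <= v -> {for (s, x), continuous F}) ->
  (forall s x, C < `|x| -> F (s, x) = 0) ->
  exists2 G : R -> R, integ mu G & forall s x, u <= s <= v -> `|F (s, x)| <= G x.
Proof.
move=> cF F0.
have cK := compact_setX (@segment_compact R u v) (@segment_compact R (- C) C).
have [|M M0 HM] := compact_bounded_at (H := F) cK.
  by move=> [s x] /= [suv _]; apply: cF; move: suv; rewrite in_itv.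
exists (fun x => (M * expR C) * expR (- (1 * `|x|))).
  exact: (integZ _ (integ_expR_norm ltr01)).
move=> s x suv; have [Cx|xC] := ltP C `|x|.
  by rewrite F0// normr0 !mulr_ge0// expR_ge0.
have h : `|F (s, x)| <= M.
  by apply: HM; split; rewrite /= in_itv//= -ler_norml.
apply: (le_trans h); rewrite -mulrA -expRD mul1r -[leLHS]mulr1 ler_wpM2l//.
by rewrite -expR0 ler_expR subr_ge0.
Qed.

Lemma bsupp_continuous_integ (h : R -> R) (C : R) : continuous h ->
  (forall x, C < `|x| -> h x = 0) -> integ mu h.
Proof.
move=> ch hC.
have [|M _ HM] := compact_bounded_at (H := h) (@segment_compact R (- C) C).
  by move=> x _; exact: ch.
apply: (@bounded_support_integ1 R h C `|M|) => //; first exact: continuous_measurable_fun.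
move=> x; have [Cx|xC] := ltP C `|x|; first by rewrite hC ?normr0.
by apply: le_trans (ler_norm M); apply: HM; rewrite /= in_itv /= -ler_norml.
Qed.

Lemma cvg_pairr (s x : R) : (fun y : R => (s, y)) @ x --> (s, x).
Proof.
apply: (@continuous_pair R R R (fun=> s) id) => y; [exact: cvg_cst|exact: cvg_id].
Qed.

Lemma cvg_pairl (s x : R) : (fun y : R => (y, x)) @ s --> (s, x).
Proof.
apply: (@continuous_pair R R R id (fun=> x)) => y; [exact: cvg_id|exact: cvg_cst].
Qed.

Lemma continuous_section (F : R * R -> R) (s : R) :
  (forall x, {for (s, x), continuous F}) -> continuous (fun x => F (s, x)).
Proof.
move=> cF x; apply: (@cvg_comp _ _ _ (fun x => (s, x)) F); last exact: cF.
exact: cvg_pairr.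
Qed.

Lemma is_derive_box (f f1 : R * R -> R) (u v a C : R) : u < a < v ->
  (forall s x : R, u <= s <= v -> [/\ is_derive s (1 : R) (fun s => f (s, x)) (f1 (s, x)),
     {for (s, x), continuous f} & {for (s, x), continuous f1}]) ->
  (forall s x, C < `|x| -> f (s, x) = 0) -> (forall s x, C < `|x| -> f1 (s, x) = 0) ->
  is_derive a (1 : R) (fun s => \int[mu]_y f (s, y)) (\int[mu]_y f1 (a, y)).
Proof.
move=> auv H z z1.
have [|G Gi HG] := box_dominated (u := u) (v := v) _ z1.
  by move=> s x suv; have [] := H s x suv.
have w s : u < s < v -> u <= s <= v by move=> /andP[a1 b1]; rewrite !ltW.
apply: (is_derive_Rint (f := fun s y => f (s, y)) (f1 := fun s y => f1 (s, y)) auv _ _ _ Gi).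
- move=> s /w suv; apply: (bsupp_continuous_integ (C := C)); last by move=> x; exact: z.
  by apply: continuous_section => x; have [] := H s x suv.
- by move=> s y /w suv; have [] := H s y suv.
- by move=> s y /w suv; exact: HG.
Qed.

Lemma continuous_box (f : R * R -> R) (u v a C : R) : u < a < v ->
  (forall s x : R, u <= s <= v -> {for (s, x), continuous f}) ->
  (forall s x, C < `|x| -> f (s, x) = 0) ->
  {for a, continuous (fun s => \int[mu]_y f (s, y))}.
Proof.
move=> auv H z.
have [G Gi HG] := box_dominated H z.
have w s : u < s < v -> u <= s <= v by move=> /andP[a1 b1]; rewrite !ltW.
apply: (continuous_Rint (f := fun s y => f (s, y)) auv _ _ _ Gi).
- move=> s /w suv; apply: (bsupp_continuous_integ (C := C)); last by move=> x; exact: z.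
  by apply: continuous_section => x; exact: H.
- move=> s y /w suv; apply: (@cvg_comp _ _ _ (fun s => (s, y)) f); last exact: H.
  exact: cvg_pairl.
- by move=> s y /w suv; exact: HG.
Qed.

Lemma box_swap (K : R * R -> R) (h f : R -> R) : continuous K -> continuous h ->
  continuous f -> bsupp h -> bsupp f ->
  [/\ integ mu (fun y => (\int[mu]_x (K (x, y) * h x)) * f y),
      integ mu (fun x => (\int[mu]_y (K (x, y) * f y)) * h x) &
      \int[mu]_y ((\int[mu]_x (K (x, y) * h x)) * f y) =
      \int[mu]_x ((\int[mu]_y (K (x, y) * f y)) * h x)].
Proof.
move=> cK ch cf [C hC] [D fD].
pose H z : R := K z * h z.1 * f z.2.
have cH : continuous H.
  move=> z; apply: cvgM; last by apply: cvg_comp; [exact: cvg_snd|exact: cf].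
  by apply: cvgM; [exact: cK|apply: cvg_comp; [exact: cvg_fst|exact: ch]].
have cc := compact_setX (@segment_compact R (- C) C) (@segment_compact R (- D) D).
have [|M M0 HM] := compact_bounded_at (H := H) cc; first by move=> z _; exact: cH.
have H1 z : C < `|z.1| -> H z = 0 by move=> zC; rewrite /H hC// mulr0 mul0r.
have H2 z : D < `|z.2| -> H z = 0 by move=> zC; rewrite /H fD// mulr0.
have Hi : integ (mu \x mu)%E H.
  apply: (@box_integ R H (Num.max C D) M).
  - exact: measurable_continuous_prod.
  - move=> z; have [zC|zC] := ltP C `|z.1|; first by rewrite H1// normr0.
    have [zD|zD] := ltP D `|z.2|; first by rewrite H2// normr0.
    by apply: HM; split => /=; rewrite in_itv /= -ler_norml.
  - by move=> z; rewrite gt_max => /andP[zC _]; exact: H1.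
  - by move=> z; rewrite gt_max => /andP[_ zC]; exact: H2.
have [i1 e1] := Rint_prod1 Hi; have [i2 e2] := Rint_prod2 Hi.
have s1 x : \int[mu]_y H (x, y) = (\int[mu]_y (K (x, y) * f y)) * h x.
  rewrite mulrC -RintZ.
    by apply: eq_Rint => y; rewrite /H /=; ring.
  apply: (bsupp_continuous_integ (C := D)); last by move=> y yD; rewrite fD// mulr0.
  move=> y; apply: cvgM; last exact: cf.
  by apply: (@continuous_section K) => ?; exact: cK.
have s2 y : \int[mu]_x H (x, y) = (\int[mu]_x (K (x, y) * h x)) * f y.
  rewrite mulrC -RintZ.
    by apply: eq_Rint => x; rewrite /H /=; ring.
  apply: (bsupp_continuous_integ (C := C)); last by move=> x xC; rewrite hC// mulr0.
  move=> x; apply: cvgM; last exact: ch.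
  apply: (@cvg_comp _ _ _ (fun x => (x, y)) K); last exact: cK.
  exact: cvg_pairl.
split.
- by apply: eq_integ i2 => y; exact: s2.
- by apply: eq_integ i1 => x; exact: s1.
- transitivity (\int[mu]_y \int[mu]_x H (x, y)); first by apply: eq_Rint => y; rewrite s2.
  by rewrite -e2 e1; apply: eq_Rint => x; rewrite s1.
Qed.

End boxes.

Lemma unit_dist_le {R : realType} (x y : R) : x <= y <= x + 1 -> `|y - x| <= 1.
Proof. by move=> /andP[y1 y2]; rewrite ler_norml; lra. Qed.

Lemma unit_dist_norm {R : realType} (s T x y : R) : s <= T -> x <= y <= x + 1 ->
  s - `|y| <= T + 1 - `|x|.
Proof.
move=> sT /unit_dist_le; have : `|x| <= `|y| + `|y - x| by rewrite -{1}(subKr y x) ler_normB.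
by lra.
Qed.

Lemma gradient_algebra {R : realType} (E C1 K a1 a2 a3 a4 a5 a6 : R) :
  a3 <= a6 -> a2 <= a6 -> a5 <= a4 -> a1 <= a2 + a3 -> a6 <= C1 * E -> a4 <= K * E ->
  a1 + a5 <= (2 * C1 + K) * E.
Proof. by move=> *; rewrite mulrDl; lra. Qed.

Lemma gradient_eq {R : realType} (a b d e x : R) : a = d * (x + 1 - x) -> d - e = b -> e = a - b.
Proof. by move=> -> <-; ring. Qed.

(** * Decay of the space derivative *)

Section gradient_decay.
Context {R : realType} {n : nat}.
Local Notation V := (R * 'rV[R]_n)%type.
Local Notation haar := (@haar R n).
Local Notation test := (@test_function R V).
Local Notation A := (@sublaplacian R n).
Variables (S : R -> (V -> R) -> (V -> R)) (p : R -> V -> R).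
Hypothesis gen : generated_by haar (friedrichs haar test A) S.
Hypothesis hp : forall t, 0 < t -> continuous (p t) /\ forall f, test f ->
  {ae haar, forall h : V, S t f h = \int[haar]_g (f (Gmul h g) * p t g)}.
Implicit Types (f : R -> R) (eta : 'rV[R]_n).

(** The rate 1/4 lets the square of [wv] grow at most like e^(|x|/2), so that its product with a
    function decaying like e^(-|x|) still decays like e^(-|x|/2). *)
Lemma cf_expR (i : nat) (x : R) : `|cf i x| <= 4 ^+ i * expR (`|x| / 4).
Proof.
have x4 : 0 <= `|x| / 4 by rewrite divr_ge0.
rewrite /cf normrM normfV normrX [`|i`!%:R|]ger0_norm//.
have -> : `|x| ^+ i / i`!%:R = 4 ^+ i * ((`|x| / 4) ^+ i / i`!%:R).
  by rewrite mulrA -exprMn mulrCA divff// mulr1.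
rewrite ler_wpM2l ?exprn_ge0//.
case: i => [|i]; first by rewrite expr0 fact0 divr1 -expR0 ler_expR.
by apply: le_trans (expR_ge1Dxn i x4); rewrite lerDr.
Qed.

Lemma wv_expR eta : exists2 C : R, 0 <= C & forall x, wv eta x ^+ 2 <= C * expR (`|x| / 2).
Proof.
pose B := \sum_(i < n) `|eta ord0 i| * 4 ^+ i.
have B0 : 0 <= B by apply: sumr_ge0 => i _; rewrite mulr_ge0// exprn_ge0.
exists ((2 * pi * B) ^+ 2); first exact: sqr_ge0.
move=> x.
have -> : expR (`|x| / 2) = expR (`|x| / 4) ^+ 2.
  by rewrite expr2 -expRD; congr expR; field.
rewrite -exprMn -real_normK ?num_real// ler_pXn2r// ?nnegrE//; last first.
  by rewrite !mulr_ge0 ?expR_ge0 ?pi_ge0.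
have pi2 : 0 <= 2 * pi :> R by rewrite mulr_ge0 ?pi_ge0.
rewrite /wv normrM (ger0_norm pi2) -[leRHS]mulrA ler_wpM2l//.
apply: (le_trans (ler_norm_sum _ _ _)); rewrite /B mulr_suml.
by apply: ler_sum => i _; rewrite normrM -mulrA ler_wpM2l// cf_expR.
Qed.

(** Interpolation on [x, x + 1]: the first derivative is a unit difference of Q minus a bounded
    multiple of the second derivative at an intermediate point. The equation expresses that second
    derivative through functions known to decay. *)
Lemma Q_dx_decay eta f (c T : R) : tst f -> 0 <= T ->
  exists2 C : R, 0 <= C & forall s x, 0 <= s <= T ->
    `|'D_(1 : R) (Q eta p f c s) x| <= C * expR (- (2^-1 * `|x|)).
Proof.
move=> tf T0.
have [C1 C10 h1] := Q_decay gen hp eta c tf.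
have [C2 C20 h2] := Q_decay gen hp eta c (tst_schr eta tf).
have [C3 C30 h3] := wv_expR eta.
exists ((2 * C1 + (C3 * C1 + C2)) * expR (T + 1)).
  by rewrite mulr_ge0 ?expR_ge0// addr_ge0 ?mulr_ge0// addr_ge0// mulr_ge0.
move=> s x /andP[s0 sT].
pose q := Q eta p f c s.
pose q2 y : R := wv eta y ^+ 2 * q y + Q eta p (schr eta f) c s y.
have dq (y : R) := @Q_space R n eta S p gen hp f c s y tf s0.
have x1 : x < x + 1 by rewrite ltrDl.
have [xi /andP[xi1 xi2] e1] := is_derive_mvt x1 (fun y _ => (dq y).1).
have [ze /andP[ze1 ze2] e2] := is_derive_mvt xi1 (fun y _ => (dq y).2).
have dec y (xy : x <= y <= x + 1) := unit_dist_norm sT xy.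
have bq y : x <= y <= x + 1 -> `|q y| <= C1 * expR (T + 1 - `|x|).
  move=> yx; apply: (le_trans (h1 s y s0)); rewrite ler_wpM2l// ler_expR.
  exact: dec.
have e0 : expR (T + 1 - `|x|) <= expR (T + 1) * expR (- (2^-1 * `|x|)).
  by rewrite -expRD ler_expR lerB// ler_piMl// invf_le1// ler1n.
have bq2 : `|q2 ze| <= (C3 * C1 + C2) * (expR (T + 1) * expR (- (2^-1 * `|x|))).
  have zex : x <= ze <= x + 1 by rewrite !ltW// (lt_trans ze2).
  apply: (le_trans (ler_normD _ _)); rewrite mulrDl lerD//.
    rewrite normrM normrX real_normK ?num_real//.
    apply: (@le_trans _ _ ((C3 * expR (`|ze| / 2)) * (C1 * expR (s - `|ze|)))).
      by rewrite ler_pM ?sqr_ge0// h1.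
    rewrite mulrACA ler_wpM2l ?mulr_ge0// -!expRD ler_expR.
    by have := dec _ zex; move: sT; clear; lra.
  apply: (le_trans (h2 s ze s0)); rewrite ler_wpM2l//.
  by apply: le_trans e0; rewrite ler_expR; exact: dec.
have -> : 'D_(1 : R) (Q eta p f c s) x = (q (x + 1) - q x) - q2 ze * (xi - x).
  exact: (gradient_eq e1 e2).
have d01 : `|xi - x| <= 1 by apply: unit_dist_le; rewrite !ltW.
apply: (le_trans (ler_normB _ _)).
have b1 := bq (x + 1) (introT andP (conj (ltW x1) (lexx _))).
have b0 := bq x (introT andP (conj (lexx _) (ltW x1))).
have b2 : `|q2 ze * (xi - x)| <= `|q2 ze| by rewrite normrM ler_piMr.
have b3 : `|q (x + 1) - q x| <= `|q (x + 1)| + `|q x| := ler_normB _ _.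
have b4 : C1 * expR (T + 1 - `|x|) <= C1 * (expR (T + 1) * expR (- (2^-1 * `|x|))).
  by rewrite ler_wpM2l.
rewrite -mulrA; exact: (gradient_algebra b0 b1 b2 b3 b4 bq2).
Qed.

End gradient_decay.

Section wide_cutoff.
Context {R : realType}.

Definition wide m (x : R) : R := bump (x * m.+1%:R^-1).

Lemma derive_wide (h : R -> R) m (x : R) : smooth h ->
  is_derive x (1 : R) (fun x => h (x * m.+1%:R^-1)) (m.+1%:R^-1 * 'D_(1 : R) h (x * m.+1%:R^-1)).
Proof.
move=> sh.
have d1 : is_derive x (1 : R) (fun x : R => x * m.+1%:R^-1) m.+1%:R^-1.
  rewrite (_ : (fun x : R => _) = m.+1%:R^-1 \*: id); last by apply/funext => y; rewrite /= mulrC.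
  have := is_deriveZ m.+1%:R^-1 (is_derive_id x (1 : R)).
  by rewrite /GRing.scale /= mulr1.
by rewrite mulrC; exact: is_derive1_comp (smooth_is_derive _ _ sh) d1.
Qed.

Lemma tst_wide m : tst (wide m).
Proof.
split.
  apply: smooth_comp; first exact: smooth_bump.
  by apply: smooth_mul; [exact: smooth_id|exact: smooth_cst].
exists m.+1%:R => y hy; apply: bump_out; rewrite normrM [X in _ * X]ger0_norm//.
by rewrite ler_pdivlMr// mul1r ltW.
Qed.

Lemma wide_le : exists2 B : R, 0 <= B & forall m x,
  `|'D_(1 : R) (wide m) x| + `|'D_(1 : R) ('D_(1 : R) (wide m)) x| <= B * m.+1%:R^-1.
Proof.
have [B1 h1] := tst1_bounded (tst_derive1 (@tst_bump R)).
have [B2 h2] := tst1_bounded (tst_derive1 (tst_derive1 (@tst_bump R))).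
have B10 : 0 <= B1 := le_trans (normr_ge0 _) (h1 0).
have B20 : 0 <= B2 := le_trans (normr_ge0 _) (h2 0).
exists (B1 + B2) => [|m x]; first exact: addr_ge0.
have e1 y : 'D_(1 : R) (wide m) y = m.+1%:R^-1 * 'D_(1 : R) bump (y * m.+1%:R^-1).
  exact: (@derive_val _ _ _ _ _ _ _ (derive_wide m y smooth_bump)).
have e2 : 'D_(1 : R) ('D_(1 : R) (wide m)) x =
    m.+1%:R^-1 * (m.+1%:R^-1 * 'D_(1 : R) ('D_(1 : R) bump) (x * m.+1%:R^-1)).
  rewrite (funext e1 : 'D_(1 : R) (wide m) = _).
  have dd := is_deriveZ m.+1%:R^-1 (derive_wide m x (smoothD (1 : R) (@smooth_bump R))).
  by rewrite /GRing.scale /= in dd; exact: (@derive_val _ _ _ _ _ _ _ dd).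
have i0 : 0 <= m.+1%:R^-1 :> R by rewrite invr_ge0.
have i1 : m.+1%:R^-1 <= 1 :> R := natSV_le1 m.
rewrite e1 e2 !normrM (ger0_norm i0) mulrDl lerD// mulrC.
  by rewrite ler_wpM2r.
rewrite ler_wpM2r// (le_trans _ (h2 (x * m.+1%:R^-1)))//.
by rewrite ler_piMl.
Qed.

Lemma wide_norm_le1 m x : `|wide m x| <= 1.
Proof. by rewrite ger0_norm ?bump_ge0// bump_le1. Qed.

End wide_cutoff.
Lemma err_algebra {R : realType} (d1 d2 b v w E C1 C2 : R) : 0 <= d1 -> 0 <= d2 ->
  d1 + d2 <= b -> 0 <= v -> 0 <= w -> v <= C1 * E -> w <= C2 * E ->
  d2 * v + 2 * (d1 * w) <= b * (C1 + 2 * C2) * E.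
Proof.
move=> d10 d20 db v0 w0 vE wE.
have b0 : 0 <= b by lra.
have h1 : d2 * v <= b * (C1 * E) by apply: ler_pM => //; lra.
have h2 : d1 * w <= b * (C2 * E) by apply: ler_pM => //; lra.
by rewrite (_ : b * _ * E = b * (C1 * E) + 2 * (b * (C2 * E))); [lra|ring].
Qed.

Lemma f1_algebra {R : realType} (K X v q kt : R) :
  K * (X * - q) + X * v * kt = kt * (X * v) - K * (X * q).
Proof. by ring. Qed.

Lemma h1_algebra {R : realType} (X v x1 v1 : R) : X * v1 + v * x1 = x1 * v + X * v1.
Proof. by ring. Qed.

Lemma h2_algebra {R : realType} (X x1 x2 v v1 q : R) :
  x1 * v1 + v * x2 + (X * q + v1 * x1) = x2 * v + 2 * (x1 * v1) + X * q.
Proof. by ring. Qed.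

Lemma f1q_algebra {R : realType} (kxx w K X v q : R) :
  (kxx - w * K) * (X * v) - K * (X * q) = kxx * (X * v) - K * (X * (w * v + q)).
Proof. by ring. Qed.

Lemma mix_algebra {R : realType} (M W B I j : R) : M * (W * B * I) * j = M * (W * j * B) * I.
Proof. by ring. Qed.

Lemma third_algebra {R : realType} (t u : R) : 0 < t -> 0 < u -> u <= t / 3 ->
  [/\ u < t, 0 < t - u < t & u < t - u].
Proof. by move=> *; split; [|apply/andP; split|]; lra. Qed.

Section pairing.
Context {R : realType} {n : nat} (eta : 'rV[R]_n).
Local Notation V := (R * 'rV[R]_n)%type.
Local Notation haar := (@haar R n).
Local Notation test := (@test_function R V).
Local Notation A := (@sublaplacian R n).
Local Notation mu := (@lebesgue_measure R).
Variables (S : R -> (V -> R) -> (V -> R)) (p : R -> V -> R).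
Hypothesis gen : generated_by haar (friedrichs haar test A) S.
Hypothesis hp : forall t, 0 < t -> continuous (p t) /\ forall f, test f ->
  {ae haar, forall h : V, S t f h = \int[haar]_g (f (Gmul h g) * p t g)}.
Variables (Vp : R -> R) (k : R -> R -> R -> R).
Hypothesis fs : fundamental_solution Vp k.
Hypothesis Vpe : forall x, Vp x = wv eta x ^+ 2.
Variables (g : R -> R) (t : R).
Hypothesis tg : tst g.
Hypothesis t0 : 0 < t.

(** The transformed semigroup run backwards from the final time t. The matter of interest is s <= t;
    the absolute value keeps the function continuous in (s, x) on the whole plane. *)
Let vv f (s x : R) : R := Q eta p f 0 `|t - s| x.
Let vx (s x : R) : R := 'D_(1 : R) (Q eta p g 0 `|t - s|) x.

Let vv_joint f : tst f -> continuous (fun z : R * R => vv f z.1 z.2).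
Proof.
move=> tf z.
have := @Q_joint R n eta S p gen hp f 0 0 tf (lexx _) (t - z.1, z.2).
under eq_fun do rewrite add0r.
move=> h; apply: (@cvg_comp _ _ _ (fun z : R * R => (t - z.1, z.2)) _ _ _ _ _ h).
apply: (@continuous_pair (R * R)%type R R (fun z => t - z.1) (fun z => z.2)) => y; last exact: cvg_snd.
by apply: cvgB; [exact: cvg_cst|exact: cvg_fst].
Qed.

Let vv_cont f s : tst f -> continuous (vv f s).
Proof. by move=> tf; apply: (@Q_continuous R n eta S p gen hp f 0 `|t - s| tf). Qed.

Let vv_dt f (s x : R) : tst f -> s < t ->
  is_derive s (1 : R) (fun s => vv f s x) (- vv (schr eta f) s x).
Proof.
move=> tf st; have ts0 : 0 < t - s by rewrite subr_gt0.
have d1 := @Q_dt R n eta S p gen hp f 0 (t - s) x tf ts0.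
have d2 := is_deriveB (is_derive_cst t s (1 : R)) (is_derive_id s (1 : R)).
have := @is_derive1_comp R (fun s => Q eta p f 0 s x) (fun s => t - s) s _ _ d1 d2.
have -> : vv (schr eta f) s x = Q eta p (schr eta f) 0 (t - s) x by rewrite /vv gtr0_norm.
rewrite sub0r mulrN1.
apply: near_eq_is_derive.
near=> r; rewrite /= /vv gtr0_norm// subr_gt0.
near: r; exact: lt_nbhsl.
Unshelve. all: by end_near. Qed.

Let vv_dx s x : is_derive x (1 : R) (vv g s) (vx s x) /\
  is_derive x (1 : R) (vx s) (wv eta x ^+ 2 * vv g s x + vv (schr eta g) s x).
Proof. exact: (@Q_space R n eta S p gen hp g 0 `|t - s| x tg (normr_ge0 _)). Qed.

Let vx_cont s : continuous (vx s).
Proof. by move=> x; exact: is_derive_continuous (vv_dx s x).2. Qed.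

Let k_joint s y x : 0 < s -> {for (s, x), continuous (fun z : R * R => k z.1 z.2 y)}.
Proof.
move=> s0; apply: (@cvg_comp _ _ _ (fun z : R * R => (z, y)) (fun q : R * R * R => k q.1.1 q.1.2 q.2)
  _ _ _ _ (@fs_cont _ _ _ fs s x y s0)).
apply: (@continuous_pair (R * R)%type (R * R)%type R id (fun=> y)) => z; [exact: cvg_id|exact: cvg_cst].
Qed.

Let k_joint_ty s y x : 0 < s -> {for (s, y), continuous (fun z : R * R => k z.1 x z.2)}.
Proof.
move=> s0; have c : continuous (fun z : R * R => (z.1, x, z.2)).
  apply: (@continuous_pair (R * R)%type (R * R)%type R (fun z : R * R => (z.1, x)) (fun z : R * R => z.2)).
    apply: (@continuous_pair (R * R)%type R R (fun z : R * R => z.1) (fun=> x)) => w; [exact: cvg_fst|exact: cvg_cst].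
  by move=> z; exact: cvg_snd.
exact: (@cvg_comp _ _ _ (fun z : R * R => (z.1, x, z.2)) (fun q : R * R * R => k q.1.1 q.1.2 q.2)
  _ _ _ (c (s, y)) (@fs_cont _ _ _ fs s x y s0)).
Qed.

Let k_joint_xy s : 0 < s -> continuous (fun z : R * R => k s z.1 z.2).
Proof.
move=> s0 [x y]; have c : continuous (fun z : R * R => (s, z.1, z.2)).
  apply: (@continuous_pair (R * R)%type (R * R)%type R (fun z : R * R => (s, z.1)) (fun z : R * R => z.2)).
    apply: (@continuous_pair (R * R)%type R R (fun=> s) (fun z : R * R => z.1)) => w; [exact: cvg_cst|exact: cvg_fst].
  by move=> z; exact: cvg_snd.
exact: (@cvg_comp _ _ _ (fun z : R * R => (s, z.1, z.2)) (fun q : R * R * R => k q.1.1 q.1.2 q.2)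
  _ _ _ (c (x, y)) (@fs_cont _ _ _ fs s x y s0)).
Qed.

(** The commutator of the second derivative with the cutoff, (X v)'' = X v'' + err. Since v and its
    derivative decay exponentially, it is integrable with size governed by the derivatives of X. *)
Let err (X : R -> R) s x : R :=
  'D_(1 : R) ('D_(1 : R) X) x * vv g s x + 2 * ('D_(1 : R) X x * vx s x).

Let err_cont X s : tst X -> continuous (err X s).
Proof.
move=> tX x; have tX1 := tst_derive1 tX; have tX2 := tst_derive1 tX1.
apply: cvgD; first by apply: cvgM; [exact: smooth_continuous tX2.1 x|exact: vv_cont].
apply: cvgM; first exact: cvg_cst.
by apply: cvgM; [exact: smooth_continuous tX1.1 x|exact: vx_cont].
Qed.

Let err_out X (C : R) : (forall x, C < `|x| -> X x = 0) -> forall s x, C < `|x| -> err X s x = 0.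
Proof.
move=> XC s x xC; have X1 := bsupp_derive (1 : R) XC; have X2 := bsupp_derive (1 : R) X1.
by rewrite /err X1// X2// !mul0r mulr0 addr0.
Qed.

Let err_le : exists2 B : R, 0 <= B & forall X (b : R) s x,
  `|'D_(1 : R) X x| + `|'D_(1 : R) ('D_(1 : R) X) x| <= b -> 0 <= s <= t ->
  `|err X s x| <= b * B * expR (- (2^-1 * `|x|)).
Proof.
have [C1 C10 h1] := Q_decay gen hp eta 0 tg.
have [C2 C20 h2] := Q_dx_decay gen hp eta 0 tg (ltW t0).
exists (C1 * expR t + 2 * C2); first by rewrite addr_ge0 ?mulr_ge0 ?expR_ge0.
move=> X b s x; set d1 := `|'D_(1 : R) X x|; set d2 := `|'D_(1 : R) _ x| => db /andP[s0 st].
have ts : 0 <= `|t - s| <= t by rewrite normr_ge0 ger0_norm ?subr_ge0// gerBl.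
have b1 : `|vv g s x| <= C1 * expR t * expR (- (2^-1 * `|x|)).
  apply: (le_trans (h1 _ x (normr_ge0 _))); rewrite -mulrA ler_wpM2l// -expRD ler_expR.
  case/andP: ts => _ ts; apply: lerD => //; rewrite lerN2.
  by rewrite ler_piMl// invf_le1// ler1n.
have b2 := h2 _ x ts.
apply: (le_trans (ler_normD _ _)); rewrite !normrM -/d1 -/d2 (ger0_norm (ler0n _ 2)).
exact: (@err_algebra R d1 d2 b _ _ _ _ _ (normr_ge0 _) (normr_ge0 _) db (normr_ge0 _) (normr_ge0 _) b1 b2).
Qed.

(** [k] solves the equation forward in s and [vv] backward. After two integrations by parts the time
    derivatives and the potential cancel, and only the commutator with the cutoff survives. *)
Let psi_derive X y s : tst X -> 0 < s < t ->
  is_derive s (1 : R) (fun s => \int[mu]_x (k s x y * (X x * vv g s x)))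
    (\int[mu]_x (k s x y * err X s x)).
Proof.
move=> tX /andP[s0 st]; have [sX [C XC]] := tX.
have sX1 := smoothD (1 : R) sX.
pose f (z : R * R) : R := k z.1 z.2 y * (X z.2 * vv g z.1 z.2).
pose kt s x : R := derive1 (fun r => k r x y) s.
pose f1 (z : R * R) : R := kt z.1 z.2 * (X z.2 * vv g z.1 z.2) -
  k z.1 z.2 y * (X z.2 * vv (schr eta g) z.1 z.2).
have cX z : {for z, continuous (fun z : R * R => X z.2)}.
  by apply: cvg_comp; [exact: cvg_snd|exact: smooth_continuous sX z.2].
have cXv h (th : tst h) z : {for z, continuous (fun z : R * R => X z.2 * vv h z.1 z.2)}.
  by apply: cvgM; [exact: cX|exact: (vv_joint th)].
have tsg := tst_schr eta tg.
have D : is_derive s (1 : R) (fun s => \int[mu]_x f (s, x)) (\int[mu]_x f1 (s, x)).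
  apply: (@is_derive_box R f f1 (s / 2) ((s + t) / 2) s C).
  - by apply/andP; split; lra.
  - move=> r x /andP[r1 r2].
    have r0 : 0 < r by lra.
    have rt : r < t by lra.
    split.
    + have [d1 _ _] := @fs_derivable _ _ _ fs r x y r0.
      have dk : is_derive r (1 : R) (fun r => k r x y) (kt r x).
        by rewrite /kt derive1E; exact: derivableP.
      have dX := is_deriveZ (X x) (vv_dt x tg rt).
      have := is_deriveM dk dX.
      rewrite /GRing.scale /= /f1 /= => h.
      apply: (is_derive_eq h); exact: f1_algebra.
    + by apply: cvgM; [exact: k_joint|exact: cXv].
    + apply: cvgB; last by apply: cvgM; [exact: k_joint|exact: cXv].
      apply: cvgM; last exact: cXv.
      by have [h _ _] := @fs_C12 _ _ _ fs r x y r0.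
  - by move=> r x xC; rewrite /f /= XC// mul0r mulr0.
  - by move=> r x xC; rewrite /f1 /= XC// !mul0r !mulr0 subrr.
suff <- : \int[mu]_x f1 (s, x) = \int[mu]_x (k s x y * err X s x) by [].
pose h x : R := X x * vv g s x.
pose q x : R := X x * (wv eta x ^+ 2 * vv g s x + vv (schr eta g) s x).
pose kx w := derive1 (fun w => k s w y) w.
pose kxx w := derive1n 2 (fun w => k s w y) w.
have kcont : continuous (fun x => k s x y).
  by apply: (@continuous_section _ (fun z : R * R => k z.1 z.2 y)) => x; exact: k_joint.
have kxxcont : continuous kxx.
  apply: (@continuous_section _ (fun q : R * R => derive1n 2 (fun w => k q.1 w y) q.2)) => x.
  by have [_ _] := @fs_C12 _ _ _ fs s x y s0.
have Xcont : continuous X := smooth_continuous sX.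
have hcont : continuous h by move=> x; apply: cvgM; [exact: Xcont|exact: vv_cont].
have qcont : continuous q.
  move=> x; apply: cvgM; first exact: Xcont.
  apply: cvgD; last exact: vv_cont.
  apply: cvgM; last exact: vv_cont.
  by apply: (smooth_continuous (smooth_exp 2 (smooth_wv eta))).
have sDX (Y : R -> R) (x : R) : smooth Y -> is_derive x (1 : R) Y ('D_(1 : R) Y x).
  by move=> sY; exact: smooth_is_derive.
have ibp : \int[mu]_x (k s x y * (err X s x + q x)) = \int[mu]_x (kxx x * h x).
  pose h1 (x : R) := 'D_(1 : R) X x * vv g s x + X x * vx s x.
  refine (@ibp_C2 R (fun x => k s x y) kx kxx h h1 (fun x => err X s x + q x) C (C + 1) _ _ _ _ _ _ _ _).
  - by rewrite ltrDl.
  - move=> x _; rewrite /kx derive1E; apply: derivableP.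
    by have [_ d _] := @fs_derivable _ _ _ fs s x y s0.
  - move=> x _; rewrite /kxx /= derive1E; apply: derivableP.
    by have [_ _ d] := @fs_derivable _ _ _ fs s x y s0.
  - by move=> x _; exact: kxxcont.
  - move=> x; have := is_deriveM (sDX X x sX) (vv_dx s x).1.
    by rewrite /GRing.scale /= => hh; apply: (is_derive_eq hh); rewrite /h1; exact: h1_algebra.
  - move=> x; have := is_deriveD (is_deriveM (sDX _ x sX1) (vv_dx s x).1)
      (is_deriveM (sDX X x sX) (vv_dx s x).2).
    rewrite /GRing.scale /= => hh; apply: (is_derive_eq hh); exact: h2_algebra.
  - by move=> x; apply: cvgD; [exact: err_cont|exact: qcont].
  - by move=> x xC; rewrite /h XC// mul0r.
have i1 : integ mu (fun x => k s x y * err X s x).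
  apply: (@bsupp_continuous_integ R _ C) => x; last by move=> xC; rewrite (err_out XC)// mulr0.
  by apply: cvgM; [exact: kcont|exact: err_cont].
have i2 : integ mu (fun x => k s x y * q x).
  apply: (@bsupp_continuous_integ R _ C) => x; last by move=> xC; rewrite /q XC// mul0r mulr0.
  by apply: cvgM; [exact: kcont|exact: qcont].
have i3 : integ mu (fun x => kxx x * h x).
  apply: (@bsupp_continuous_integ R _ C) => x; last by move=> xC; rewrite /h XC// mul0r mulr0.
  by apply: cvgM; [exact: kxxcont|exact: hcont].
transitivity (\int[mu]_x (kxx x * h x - k s x y * q x)).
  apply: eq_Rint => x; rewrite /f1 /kt /= (@fs_equation _ _ _ fs s x y s0) Vpe.
  exact: f1q_algebra.
rewrite RintB// -ibp.
have -> : \int[mu]_x (k s x y * (err X s x + q x)) =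
    \int[mu]_x (k s x y * err X s x) + \int[mu]_x (k s x y * q x).
  by rewrite -RintD//; apply: eq_Rint => x; rewrite mulrDr.
by rewrite addrK.
Qed.

Let k_bound (u v C D : R) : 0 < u -> exists2 M : R, 0 <= M &
  forall s x y, u <= s <= v -> `|x| <= C -> `|y| <= D -> `|k s x y| <= M.
Proof.
move=> u0.
have cc := compact_setX (compact_setX (@segment_compact R u v) (@segment_compact R (- C) C))
  (@segment_compact R (- D) D).
have [|M M0 HM] := compact_bounded_at (H := fun q : R * R * R => k q.1.1 q.1.2 q.2) cc.
  move=> [[s x] y] /= [[]] ; rewrite !in_itv /= => /andP[us _] _ _.
  by apply: (@fs_cont _ _ _ fs s x y); exact: lt_le_trans us.
exists M => // s x y suv xC yD; apply: (HM (s, x, y)).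
by split; [split|]; rewrite /= in_itv//= -ler_norml.
Qed.

(* Up to the cutoff [X], [Phi X f s] is the pairing at time [s] of the solution
   with datum [f] produced by [k] with the backward solution with final datum [g]. *)
Let Phi X f s : R := \int[mu]_y ((\int[mu]_x (k s x y * (X x * vv g s x))) * f y).
Let sol f s x : R := \int[mu]_y (k s x y * f y).

Let cut_cont X s : tst X -> continuous (fun x => X x * vv g s x).
Proof. by move=> tX x; apply: cvgM; [exact: smooth_continuous tX.1 x|exact: vv_cont]. Qed.

Let swap (h f : R -> R) s : tst f -> continuous h -> bsupp h -> 0 < s ->
  [/\ integ mu (fun y => (\int[mu]_x (k s x y * h x)) * f y),
      integ mu (fun x => sol f s x * h x) &
      \int[mu]_y ((\int[mu]_x (k s x y * h x)) * f y) = \int[mu]_x (sol f s x * h x)].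
Proof.
move=> tf ch bh s0.
exact: (box_swap (k_joint_xy s0) ch (smooth_continuous tf.1) bh tf.2).
Qed.

Let Phi_swap X f s : tst X -> tst f -> 0 < s -> [/\
  integ mu (fun y => (\int[mu]_x (k s x y * (X x * vv g s x))) * f y),
  integ mu (fun x => sol f s x * (X x * vv g s x)) &
  Phi X f s = \int[mu]_x (sol f s x * (X x * vv g s x))].
Proof.
move=> tX tf s0; apply: swap => //; first exact: cut_cont.
by have [_ [C XC]] := tX; exists C => x xC; rewrite XC// mul0r.
Qed.

Let err_swap X f s : tst X -> tst f -> 0 < s -> [/\
  integ mu (fun y => (\int[mu]_x (k s x y * err X s x)) * f y),
  integ mu (fun x => sol f s x * err X s x) &
  \int[mu]_y ((\int[mu]_x (k s x y * err X s x)) * f y) = \int[mu]_x (sol f s x * err X s x)].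
Proof.
move=> tX tf s0; apply: swap => //; first exact: err_cont.
by have [_ [C XC]] := tX; exists C => x xC; rewrite (err_out XC).
Qed.

Let Phi_derive X f s : tst X -> tst f -> 0 < s < t ->
  is_derive s (1 : R) (Phi X f) (\int[mu]_x (sol f s x * err X s x)).
Proof.
move=> tX tf /andP[s0 st].
have [_ _ <-] := err_swap tX tf s0.
have [_ [C XC]] := tX; have [_ [D fD]] := tf.
have [b1 h1] := tst1_bounded (tst_derive1 tX).
have [b2 h2] := tst1_bounded (tst_derive1 (tst_derive1 tX)).
have [B B0 hB] := err_le.
have s20 : 0 < s / 2 by lra.
have [M M0 hM] := k_bound ((s + t) / 2) C D s20.
have b10 : 0 <= b1 := le_trans (normr_ge0 _) (h1 0).
have b20 : 0 <= b2 := le_trans (normr_ge0 _) (h2 0).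
pose E := M * ((b1 + b2) * B).
have E0 : 0 <= E by rewrite !mulr_ge0// addr_ge0.
have half0 : 0 < 2^-1 :> R by rewrite invr_gt0.
have iE := integZ E (integ_expR_norm half0).
pose I := \int[mu]_x (E * expR (- (2^-1 * `|x|))).
apply: (@is_derive_Rint R (fun s y => (\int[mu]_x (k s x y * (X x * vv g s x))) * f y)
  (fun s y => (\int[mu]_x (k s x y * err X s x)) * f y) s (s / 2) ((s + t) / 2) (fun y => I * `|f y|)).
- by apply/andP; split; lra.
- move=> r /andP[r1 r2]; have r0 : 0 < r by lra.
  by have [] := Phi_swap tX tf r0.
- move=> r y /andP[r1 r2].
  have r0t : 0 < r < t by apply/andP; split; lra.
  have := is_deriveM (psi_derive y tX r0t) (is_derive_cst (f y) r (1 : R)).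
  move=> h; apply: (is_derive_eq h); by rewrite scaler0 add0r /GRing.scale /= mulrC.
- move=> r y /andP[r1 r2]; rewrite normrM.
  have [yD|yD] := ltP D `|y|; first by rewrite fD// normr0 !mulr0.
  rewrite ler_wpM2r//.
  have r0 : 0 < r by lra.
  have r0t : 0 <= r <= t by apply/andP; split; lra.
  apply: Rint_norm_le.
  + apply: (@bsupp_continuous_integ R _ C) => x; last by move=> xC; rewrite (err_out XC)// mulr0.
    apply: cvgM; last exact: err_cont.
    by apply: (@continuous_section _ (fun z : R * R => k z.1 z.2 y)) => w; exact: k_joint.
  + exact: iE.
  + move=> x; have [xC|xC] := ltP C `|x|.
      by rewrite (err_out XC)// mulr0 normr0 mulr_ge0// expR_ge0.
    rewrite normrM /E -mulrA ler_pM//.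
      by apply: hM => //; rewrite !ltW.
    apply: hB => //; exact: lerD.
- exact: (integZ _ (integ_norm (tst1_integ tf))).
Qed.

(** The uniqueness clause [fs_bounded] enters here: the solution produced by [k] is bounded up to
    time t while the backward solution decays exponentially. One majorant serves both for removing
    the cutoff and for the limits in s. *)
Let dom f : tst f -> exists2 G : R -> R, integ mu G & forall m s x, 0 < s <= t ->
  `|sol f s x * (wide m x * vv g s x)| <= G x /\ `|sol f s x * vv g s x| <= G x.
Proof.
move=> tf.
have cf := smooth_continuous tf.1.
have [M hM] := @fs_bounded _ _ _ fs f cf (bsupp_compact tf.2) t.
have [C C0 hC] := Q_decay gen hp eta 0 tg.
have i := integZ (`|M| * (C * expR t)) (integ_expR_norm (c := 1) ltr01).
exists (fun x => (`|M| * (C * expR t)) * expR (- (1 * `|x|))) => // m s x /andP[s0 st].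
have h1 : `|sol f s x| <= `|M| by apply: le_trans (hM s x _) (ler_norm _); rewrite s0.
have h2 : `|vv g s x| <= C * expR t * expR (- (1 * `|x|)).
  apply: (le_trans (hC _ x (normr_ge0 _))); rewrite -mulrA ler_wpM2l// -expRD ler_expR mul1r.
  by rewrite lerD// ger0_norm ?subr_ge0// gerBl ltW.
have h3 : `|sol f s x * vv g s x| <= `|M| * (C * expR t) * expR (- (1 * `|x|)).
  by rewrite normrM -[leRHS]mulrA ler_pM.
split => //; apply: le_trans h3; rewrite mulrCA normrM ler_piMl//.
exact: wide_norm_le1.
Qed.

Let wide_cvg x : wide m x @[m --> \oo] --> (1 : R).
Proof. exact: bump_cvg. Qed.

Let Phi_cvg f s : tst f -> 0 < s <= t -> integ mu (fun x => sol f s x * vv g s x) /\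
  Phi (wide m) f s @[m --> \oo] --> \int[mu]_x (sol f s x * vv g s x).
Proof.
move=> tf st; have [G Gi hG] := dom tf; have /andP[s0 _] := st.
have e m := Phi_swap (tst_wide m) tf s0.
have -> : (fun m => Phi (wide m) f s) =
    fun m => \int[mu]_x (sol f s x * (wide m x * vv g s x)).
  by apply/funext => m; have [] := e m.
apply: (@Rint_cvg _ _ _ mu (fun m x => sol f s x * (wide m x * vv g s x)) _ G _ _ Gi).
- by move=> m; have [_ i _] := e m; exact: integ_measurable i.
- move=> x; apply: cvgM; first exact: cvg_cst.
  rewrite -[X in _ --> X]mul1r; apply: cvgM; [exact: wide_cvg|exact: cvg_cst].
- by move=> m x; have [] := hG m s x st.
Qed.

(** By the mean value theorem the truncated pairing changes by its derivative at some time, which is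
    O(1/m) for a cutoff of width m + 1; then m tends to infinity. *)
Let Phi_const f s r : tst f -> 0 < s -> s < r -> r < t ->
  \int[mu]_x (sol f r x * vv g r x) = \int[mu]_x (sol f s x * vv g s x).
Proof.
move=> tf s0 sr rt.
have st : s < t := lt_trans sr rt.
have [|_ c1] := @Phi_cvg f r tf; first by rewrite (lt_trans s0 sr) ltW.
have [|_ c2] := @Phi_cvg f s tf; first by rewrite s0 ltW.
have [M hM] := @fs_bounded _ _ _ fs f (smooth_continuous tf.1) (bsupp_compact tf.2) t.
have [B B0 hB] := err_le.
have [W W0 hW] := @wide_le R.
pose I := \int[mu]_x (expR (- (2^-1 * `|x|))).
have iI : integ mu (fun x : R => expR (- (2^-1 * `|x|))).
  by apply: integ_expR_norm; rewrite invr_gt0.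
apply/eqP; rewrite -subr_eq0 -normr_le0.
have c : Phi (wide m) f r - Phi (wide m) f s @[m --> \oo] -->
    \int[mu]_x (sol f r x * vv g r x) - \int[mu]_x (sol f s x * vv g s x).
  by apply: cvgB; [exact: c1|exact: c2].
apply: (@cvg_norm_le R (fun m => Phi (wide m) f r - Phi (wide m) f s) _ 0
  (`|M| * (W * B * I) * (r - s)) c) => m.
have dP u : s <= u <= r -> is_derive u (1 : R) (Phi (wide m) f) (\int[mu]_x (sol f u x * err (wide m) u x)).
  move=> /andP[u1 u2]; apply: Phi_derive => //; first exact: tst_wide.
  by rewrite (lt_le_trans s0 u1) (le_lt_trans u2 rt).
have [u /andP[u1 u2] ->] := is_derive_mvt sr dP.
have u0 : 0 < u := lt_trans s0 u1.
have ut : u < t := lt_trans u2 rt.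
have rs0 : 0 <= r - s by rewrite subr_ge0 ltW.
rewrite add0r normrM (ger0_norm rs0) mulrAC ler_wpM2r//.
have -> : `|M| * (W * B * I) * m.+1%:R^-1 =
    \int[mu]_x (`|M| * (W * m.+1%:R^-1 * B) * expR (- (2^-1 * `|x|))).
  by rewrite RintZ// -/I; exact: mix_algebra.
have [_ i _] := err_swap (tst_wide m) tf u0.
apply: (Rint_norm_le i (integZ _ iI)) => x.
rewrite normrM -[leRHS]mulrA ler_pM//.
  by apply: le_trans (hM u x _) (ler_norm _); rewrite u0 ltW.
by apply: hB => //; rewrite !ltW.
Qed.

Let sol_cvg0 f (u : nat -> R) x : tst f -> (forall m, 0 < u m) -> u m @[m --> \oo] --> (0 : R) ->
  sol f (u m) x @[m --> \oo] --> f x.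
Proof.
move=> tf u0 uc.
have := @fs_initial _ _ _ fs f (smooth_continuous tf.1) (bsupp_compact tf.2) x.
by move=> /cvg_at_rightP; apply; split.
Qed.

Let sol_cvgt f (u : nat -> R) x : tst f -> u m @[m --> \oo] --> t ->
  sol f (u m) x @[m --> \oo] --> sol f t x.
Proof.
move=> tf uc; have [_ [C fC]] := tf.
have c : {for t, continuous (fun s => sol f s x)}.
  apply: (@continuous_box R (fun z : R * R => k z.1 x z.2 * f z.2) (t / 2) (2 * t) t C).
  - by move: t0 => h; apply/andP; split; lra.
  - move=> s y /andP[s1 _]; have s0 : 0 < s by move: t0 => h; lra.
    apply: cvgM; first exact: k_joint_ty.
    by apply: cvg_comp; [exact: cvg_snd|exact: smooth_continuous tf.1 y].
  - by move=> s y yC; rewrite fC// mulr0.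
exact: (@cvg_comp _ _ _ u (fun s => sol f s x) _ _ _ uc c).
Qed.

Let vv_cvg (u : nat -> R) s x : u m @[m --> \oo] --> s -> vv g (u m) x @[m --> \oo] --> vv g s x.
Proof.
move=> uc.
have c : {for s, continuous (fun s => vv g s x)}.
  exact: (@cvg_comp _ _ _ (fun s => (s, x)) (fun z : R * R => vv g z.1 z.2) _ _ _
    (@cvg_pairl R s x) (@vv_joint g tg (s, x))).
exact: (@cvg_comp _ _ _ u (fun s => vv g s x) _ _ _ uc c).
Qed.

Let sol_meas f s : tst f -> 0 < s -> measurable_fun setT (sol f s).
Proof.
move=> tf s0; have [_ [C fC]] := tf.
apply: continuous_measurable_fun => a.
apply: (@continuous_box R (fun z : R * R => k s z.1 z.2 * f z.2) (a - 1) (a + 1) a C).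
- by apply/andP; split; lra.
- move=> x y _; apply: cvgM; first exact: k_joint_xy.
  by apply: cvg_comp; [exact: cvg_snd|exact: smooth_continuous tf.1 y].
- by move=> x y yC; rewrite fC// mulr0.
Qed.

Let pair_cvg f (u : nat -> R) (h l : R -> R) : tst f -> (forall m, 0 < u m < t) ->
  (forall x, sol f (u m) x @[m --> \oo] --> h x) ->
  (forall x, vv g (u m) x @[m --> \oo] --> l x) ->
  \int[mu]_x (sol f (u m) x * vv g (u m) x) @[m --> \oo] --> \int[mu]_x (h x * l x).
Proof.
move=> tf ut ch cl; have [G Gi hG] := dom tf.
apply: (proj2 (@Rint_cvg _ _ _ mu (fun m x => sol f (u m) x * vv g (u m) x) _ G _ _ Gi _)).
- move=> m; have /andP[u0 _] := ut m; apply: measurable_funM; first exact: sol_meas.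
  by apply: continuous_measurable_fun; exact: vv_cont.
- by move=> x; apply: cvgM; [exact: ch|exact: cl].
- by move=> m x; have [|] := hG 0%N (u m) x => //; have /andP[-> /ltW] := ut m.
Qed.

(** The constant value of the pairing is read off at both ends: as s tends to 0 the solution of [k]
    tends to its datum f, and as s tends to t the backward solution tends to g. *)
Let duality f : tst f -> \int[mu]_x (f x * Q eta p g 0 t x) = \int[mu]_x (sol f t x * g x).
Proof.
move=> tf.
(* The factor 1/3 keeps u m < t - u m, so both times lie in the open interval in the order
   [Phi_const] expects. *)
pose u m : R := t / 3 * m.+1%:R^-1.
have t30 : 0 < t / 3 by rewrite divr_gt0.
have u0 m : 0 < u m by rewrite mulr_gt0.
have ut m : u m <= t / 3 by rewrite ler_piMr ?natSV_le1// ltW.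
have uc : u m @[m --> \oo] --> (0 : R).
  rewrite -(mulr0 (t / 3)); apply: cvgM; first exact: cvg_cst.
  exact: cvg_harmonic.
have tuc : t - u m @[m --> \oo] --> t.
  by rewrite -[X in _ --> X]subr0; apply: cvgB; [exact: cvg_cst|exact: uc].
have third m := third_algebra t0 (u0 m) (ut m).
have hu m : 0 < u m < t by have [-> _ _] := third m; rewrite u0.
have htu m : 0 < t - u m < t by have [] := third m.
have c1 := pair_cvg tf hu (fun x => @sol_cvg0 f u x tf u0 uc) (fun x => @vv_cvg u 0 x uc).
have c2 := pair_cvg tf htu (fun x => @sol_cvgt f _ x tf tuc) (fun x => @vv_cvg _ t x tuc).
have e m : \int[mu]_x (sol f (t - u m) x * vv g (t - u m) x) =
    \int[mu]_x (sol f (u m) x * vv g (u m) x).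
  have [_ /andP[_ h1] h2] := third m.
  by apply: Phi_const.
rewrite (funext e) in c2.
have vv0 x : vv g 0 x = Q eta p g 0 t x by rewrite /vv subr0 gtr0_norm.
transitivity (\int[mu]_x (f x * vv g 0 x)); first by apply: eq_Rint => x; rewrite vv0.
transitivity (\int[mu]_x (sol f t x * vv g t x)); first exact: (cvg_unique (@norm_hausdorff _ _) c1 c2).
by apply: eq_Rint => x; rewrite /vv subrr normr0 Q_0 cos0 mul1r.
Qed.

(** Duality with bumps at y as data f; both sides are continuous in y, so the identity becomes
    pointwise. The datum g sits on the first argument of [k], as suits the trace k_t(x + a, x). *)
Lemma fundamental_solution_pairing y : Q eta p g 0 t y = \int[mu]_x (k t x y * g x).
Proof.
have [sg [C gC]] := tg; have cg := smooth_continuous sg.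
have c1 : continuous (Q eta p g 0 t) := @Q_continuous R n eta S p gen hp g 0 t tg (ltW t0).
have c2 : continuous (fun y => \int[mu]_x (k t x y * g x)).
  move=> a.
  apply: (@continuous_box R (fun z : R * R => k t z.2 z.1 * g z.2) (a - 1) (a + 1) a C).
  - by apply/andP; split; lra.
  - move=> x z _; apply: cvgM; last by apply: cvg_comp; [exact: cvg_snd|exact: cg].
    have c : continuous (fun z : R * R => (z.2, z.1)).
      apply: (@continuous_pair (R * R)%type R R (fun z : R * R => z.2) (fun z : R * R => z.1)) => w;
        [exact: cvg_snd|exact: cvg_fst].
    exact: (@cvg_comp _ _ _ (fun z : R * R => (z.2, z.1)) (fun z : R * R => k t z.1 z.2) _ _ _
      (c (x, z)) (@k_joint_xy t t0 (z, x))).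
  - by move=> x z zC; rewrite gC// mulr0.
have l1 := mollify_cvg (c1 y) (fun m => continuous_tst_integ c1 (tst_bumpn y m)).
have l2 := mollify_cvg (c2 y) (fun m => continuous_tst_integ c2 (tst_bumpn y m)).
apply: (cvg_unique (@norm_hausdorff _ _) l1).
rewrite (_ : (fun m => _) = fun m => (\int[mu]_z (\int[mu]_x (k t x z * g x) * bumpn y m z)) / cbump m)//.
apply/funext => m; congr (_ / _).
have [_ _ e] := swap (tst_bumpn y m) cg tg.2 t0.
rewrite e -(duality (tst_bumpn y m)).
by apply: eq_Rint => x; rewrite mulrC.
Qed.

End pairing.

Lemma gauss_ode_algebra {R : realType} (p N y I F : R) : 0 < p -> 0 < N ->
  p / N ^+ 2 / p * I + 2 * p * y * F = 0 -> I = - (2 * p * N ^+ 2 * y) * F.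
Proof.
move=> p0 N0 /eqP; rewrite addr_eq0 => /eqP h.
have -> : I = N ^+ 2 * (p / N ^+ 2 / p * I) by field; rewrite !gt_eqF.
by rewrite h; ring.
Qed.

Lemma gauss_dx_algebra {R : realType} (p g co si b x y : R) : 0 < p ->
  g * (co * (2 * p * y)) + si * (- (2 * b * x) * g) =
  b / p * (g * (- si * (2 * p * x))) + 2 * p * y * (g * co).
Proof. by move=> p0; field; rewrite gt_eqF. Qed.

Section transfer.
Context d1 d2 (T1 : measurableType d1) (T2 : measurableType d2) (R : realType).
Variables (m1 : {measure set T1 -> \bar R}) (m2 : {measure set T2 -> \bar R}).

(** A change of variables with Jacobian w, extended from nonnegative to signed functions; w >= 0
    lets it pass through positive and negative parts. *)
Lemma Rint_transfer (phi : T1 -> T2) (w : T1 -> R) :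
  measurable_fun setT phi -> measurable_fun setT w -> (forall x, 0 <= w x) ->
  (forall F : T2 -> \bar R, measurable_fun setT F -> (forall x, 0 <= F x)%E ->
    (\int[m2]_x F x = \int[m1]_x (F (phi x) * (w x)%:E))%E) ->
  forall f : T2 -> R, measurable_fun setT f ->
    (integ m2 f <-> integ m1 (fun x => f (phi x) * w x)) /\
    \int[m2]_x f x = \int[m1]_x (f (phi x) * w x).
Proof.
move=> mphi mw w0 h f mf.
have mf' : measurable_fun setT (fun x => f (phi x) * w x).
  by apply: measurable_funM => //; exact: measurableT_comp.
split.
  have E : (\int[m1]_x (`|f (phi x) * w x|)%:E = \int[m2]_x (`|f x|)%:E)%E.
    rewrite (h (fun x => (`|f x|)%:E))//; last first.
      by apply/measurable_EFinP; exact: measurableT_comp.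
    by apply: eq_integral => x _; rewrite normrM (ger0_norm (w0 x)) EFinM.
  split=> /integrableP[_ hh]; apply/integrableP; split; try exact/measurable_EFinP.
    by rewrite (_ : (\int[m1]_x _)%E = (\int[m1]_x (`|f (phi x) * w x|)%:E)%E) ?E.
  by rewrite (_ : (\int[m2]_x _)%E = (\int[m2]_x (`|f x|)%:E)%E) -?E.
rewrite /Rintegral; congr fine.
rewrite [in LHS]integralE [in RHS]integralE; congr (_ - _)%E.
  have mp : measurable_fun setT ((EFin \o f)^\+)%E.
    by apply: measurable_funepos; exact/measurable_EFinP.
  rewrite [LHS](h _ mp (fun x => funepos_ge0 _ x)).
  apply: eq_integral => x _; rewrite !funeposE /=.
  by rewrite maxe_pMl ?lee_fin// mul0e EFinM.
have mn : measurable_fun setT ((EFin \o f)^\-)%E.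
  by apply: measurable_funeneg; exact/measurable_EFinP.
rewrite [LHS](h _ mn (fun x => funeneg_ge0 _ x)).
apply: eq_integral => x _; rewrite !funenegE /=.
by rewrite maxe_pMl ?lee_fin// mul0e -EFinM mulNr.
Qed.

End transfer.

(** * Gaussian Fourier inversion *)

Section gaussian.
Context {R : realType}.
Local Notation mu := (@lebesgue_measure R).

Lemma Rint_lebS m (f : 'rV[R]_m.+1 -> R) : measurable_fun setT f ->
  (integ (leb m.+1) f <-> integ (mu \x leb m)%E (fun z => f (rV_cons z))) /\
  \int[leb m.+1]_v f v = \int[(mu \x leb m)%E]_z f (rV_cons z).
Proof.
move=> mf.
have h (F : 'rV[R]_m.+1 -> \bar R) : measurable_fun setT F -> (forall x, 0 <= F x)%E ->
    (\int[leb m.+1]_v F v = \int[(mu \x leb m)%E]_z (F (rV_cons z) * (1%:E)))%E.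
  move=> mF F0; under [RHS]eq_integral do rewrite mule1.
  rewrite ge0_integral_lebS// (@fubini_tonelli1 _ _ _ _ _ _ _ (fun z => F (rV_cons z)))//.
  exact: measurableT_comp mF (@measurable_rV_cons R m).
have [h1 h2] := @Rint_transfer _ _ _ _ _ (mu \x leb m)%E (leb m.+1) (@rV_cons R m) (fun=> 1)
  (@measurable_rV_cons R m) (measurable_cst _) (fun=> ler01) h f mf.
split.
  split => [/h1|h3]; first by apply: eq_integ => x; rewrite mulr1.
  by apply/h1; apply: eq_integ h3 => x; rewrite mulr1.
by rewrite h2; apply: eq_Rint => x; rewrite mulr1.
Qed.

Lemma smooth_expR : smooth (@expR R).
Proof.
apply: (@smooth1_ind R (fun f => exists c, f = fun x => c * expR x)).
- by move=> _ c [b ->]; exists (c * b); apply/funext => x; rewrite mulrA.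
- move=> _ [b ->]; exists (fun x => b * expR x); first by exists b.
  by move=> x; have := is_deriveZ b (is_derive_expR x).
- by exists 1; apply/funext => x; rewrite mul1r.
Qed.

(** Wide cutoffs reduce to bounded support: the derivative of a cutoff of width m + 1 is O(1/m) and
    meets the integrable G. *)
Lemma smooth_int_derive0 (G : R -> R) : smooth G -> integ mu G -> integ mu ('D_(1 : R) G) ->
  \int[mu]_x 'D_(1 : R) G x = 0.
Proof.
move=> sG iG iG1.
have [W W0 hW] := @wide_le R.
have mw m : measurable_fun setT (@wide R m).
  by apply: continuous_measurable_fun; exact: smooth_continuous (tst_wide m).1.
have mw1 m : measurable_fun setT ('D_(1 : R) (@wide R m)).
  by apply: continuous_measurable_fun; exact: smooth_continuous (tst_derive1 (tst_wide m)).1.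
have c : \int[mu]_x (wide m x * 'D_(1 : R) G x) @[m --> \oo] --> \int[mu]_x 'D_(1 : R) G x.
  apply: (proj2 (@Rint_cvg _ _ _ mu (fun m x => wide m x * 'D_(1 : R) G x) _ _ _ _ (integ_norm iG1) _)).
  - by move=> m; apply: measurable_funM; [exact: mw|exact: integ_measurable iG1].
  - move=> x; rewrite -[X in _ --> X]mul1r; apply: cvgM; [exact: bump_cvg|exact: cvg_cst].
  - by move=> m x; rewrite normrM ler_piMl// wide_norm_le1.
apply/eqP; rewrite -normr_le0.
apply: (cvg_norm_le (K := W * \int[mu]_x `|G x|) c) => m; rewrite add0r.
have i1 : integ mu (fun x => wide m x * 'D_(1 : R) G x).
  apply: (integ_mulr_bounded (C := 1) iG1 (mw m)) => x; exact: wide_norm_le1.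
have hw x : `|'D_(1 : R) (wide m) x| <= W * m.+1%:R^-1.
  by apply: le_trans (hW m x); rewrite lerDl.
have i2 : integ mu (fun x => 'D_(1 : R) (wide m) x * G x).
  exact: (integ_mulr_bounded iG (mw1 m) hw).
have e : \int[mu]_x (wide m x * 'D_(1 : R) G x) = - \int[mu]_x ('D_(1 : R) (wide m) x * G x).
  apply/eqP; rewrite -addr_eq0 -RintD//; apply/eqP.
  rewrite -[RHS](tst1_int_derive0 (tst_mulr (tst_wide m) sG)).
  apply: eq_Rint => x.
  have := is_deriveM (smooth_is_derive x (1 : R) (tst_wide m).1) (smooth_is_derive x (1 : R) sG).
  by move=> [_ ->]; rewrite /GRing.scale /= [G x * _]mulrC.
rewrite e normrN.
have -> : W * (\int[mu]_x `|G x|) * m.+1%:R^-1 = \int[mu]_x (W * m.+1%:R^-1 * `|G x|).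
  by rewrite (RintZ (W * m.+1%:R^-1) (integ_norm iG)) mulrAC.
apply: (Rint_norm_le i2 (integZ _ (integ_norm iG))) => x.
by rewrite normrM ler_wpM2r.
Qed.

Lemma gauss1 (N : R) : 0 < N -> integ mu (fun x => expR (- (pi / N ^+ 2 * x ^+ 2))) /\
  \int[mu]_x expR (- (pi / N ^+ 2 * x ^+ 2)) = N.
Proof.
move=> N0; have pi0 : 0 < pi :> R by exact: pi_gt0.
pose c : R := Num.sqrt pi / N.
have s0 : 0 < Num.sqrt pi :> R by rewrite sqrtr_gt0.
have c0 : 0 < c by rewrite divr_gt0.
have ec x : gauss_fun (c * x) = expR (- (pi / N ^+ 2 * x ^+ 2)).
  by rewrite /gauss_fun exprMn /c expr_div_n sqr_sqrtr ?pi_ge0.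
have mg : measurable_fun setT (fun x : R => (gauss_fun x)%:E).
  by apply/measurable_EFinP; exact: measurable_gauss_fun.
have := lebesgue_scale_pos c0 mg (fun x => gauss_fun_ge0 x).
rewrite integralT_gauss => h.
have h2 : (\int[mu]_x (expR (- (pi / N ^+ 2 * x ^+ 2)))%:E = N%:E)%E.
  under eq_integral do rewrite -ec.
  have : (c^-1%:E * (c%:E * \int[mu]_x (gauss_fun (c * x))%:E) = c^-1%:E * (Num.sqrt pi)%:E)%E.
    by rewrite h.
  rewrite muleA -EFinM mulVf ?gt_eqF// mul1e => ->.
  by rewrite -EFinM /c invf_div mulfVK ?gt_eqF.
have i : integ mu (fun x => expR (- (pi / N ^+ 2 * x ^+ 2))).
  apply: integE.
  - rewrite (_ : (fun x => _) = fun x => gauss_fun (c * x)); last by apply/funext => x; rewrite ec.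
    by apply: measurableT_comp => //; exact: measurable_gauss_fun.
  - by move=> x; exact: expR_ge0.
  - by rewrite h2 ltry.
by split=> //; apply/EFin_inj; rewrite EFin_Rint.
Qed.

Lemma gauss1_integ (b : R) : 0 < b -> integ mu (fun x => expR (- (b * x ^+ 2))).
Proof.
move=> b0; have pi0 : 0 < pi :> R by exact: pi_gt0.
have N0 : 0 < Num.sqrt (pi / b) by rewrite sqrtr_gt0 divr_gt0.
have [i _] := gauss1 N0.
have e : pi / Num.sqrt (pi / b) ^+ 2 = b.
  by rewrite sqr_sqrtr ?divr_ge0 ?ltW// invf_div mulrCA divff ?gt_eqF// mulr1.
by apply: eq_integ i => x; rewrite e.
Qed.

Lemma gauss1_moment (b : R) : 0 < b -> integ mu (fun x => `|x| * expR (- (b * x ^+ 2))).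
Proof.
move=> b0; have b2 : 0 < b / 2 by rewrite divr_gt0.
have i := integZ (2^-1 + b^-1) (gauss1_integ b2).
apply: le_integ i.
  apply: continuous_measurable_fun => x; apply: cvgM; first exact: norm_continuous.
  apply: continuous_comp; last exact: continuous_expR.
  apply: cvgN; apply: cvgM; [exact: cvg_cst|exact: exprn_continuous].
move=> x; rewrite normrM normr_id (ger0_norm (expR_ge0 _)).
(* Half of the exponent is kept as majorant, and the other half absorbs |x| <= (1/2 + 1/b) (1 + b
   x^2 / 2). *)
have -> : expR (- (b * x ^+ 2)) = expR (- (b / 2 * x ^+ 2)) * expR (- (b / 2 * x ^+ 2)).
  by rewrite -expRD; congr expR; field.
rewrite mulrA ler_wpM2r ?expR_ge0//.
rewrite expRN ler_pdivrMr ?expR_gt0//.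
apply: (@le_trans _ _ ((2^-1 + b^-1) * (1 + b / 2 * x ^+ 2))).
  rewrite (_ : _ * _ = 2^-1 + 2^-1 * x ^+ 2 + (b^-1 + b / 4 * x ^+ 2)); last first.
    by field; rewrite gt_eqF.
  have : 0 <= b^-1 + b / 4 * x ^+ 2.
    apply: addr_ge0; first by rewrite invr_ge0 ltW.
    by apply: mulr_ge0; [rewrite divr_ge0// ltW|exact: sqr_ge0].
  have := sqr_ge0 (`|x| - 1); rewrite -[x ^+ 2]real_normK ?num_real//.
  by move: (`|x|) (b^-1 + _) => u v; rewrite !expr2; lra.
apply: ler_wpM2l; last exact: expR_ge1Dx.
by rewrite addr_ge0// invr_ge0 ltW.
Qed.

(* As a function of [y] the integral solves F' = - 2 pi N^2 y F. *)
Lemma gauss1_fourier (N y c : R) : 0 < N ->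
  \int[mu]_x (expR (- (pi / N ^+ 2 * x ^+ 2)) * cos (2 * pi * (x * y) + c)) =
  cos c * (N * expR (- (pi * N ^+ 2 * y ^+ 2))).
Proof.
move=> N0; have pi0 : 0 < pi :> R by exact: pi_gt0.
pose b : R := pi / N ^+ 2.
have b0 : 0 < b by rewrite divr_gt0// exprn_gt0.
pose g (x : R) := expR (- (b * x ^+ 2)).
have g0 x : 0 <= g x by exact: expR_ge0.
have sg : smooth g.
  apply: smooth_comp; first exact: smooth_expR.
  rewrite (_ : (fun x => _) = fun x : R => (- b) * x ^+ 2); last by apply/funext => x; rewrite mulNr.
  by apply: smooth_mul; [exact: smooth_cst|apply: smooth_exp; exact: smooth_id].
have cg := smooth_continuous sg.
have ig : integ mu g := gauss1_integ b0.
have ixg : integ mu (fun x => `|x| * g x) := gauss1_moment b0.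
have sph y' : smooth (fun x : R => 2 * pi * (x * y') + c).
  apply: smooth_add; last exact: smooth_cst.
  by apply: smooth_mul; [exact: smooth_cst|apply: smooth_mul; [exact: smooth_id|exact: smooth_cst]].
have scos y' : smooth (fun x : R => cos (2 * pi * (x * y') + c)).
  by apply: (smooth_comp (@smooth_cos R)); exact: sph.
have ssin y' : smooth (fun x : R => sin (2 * pi * (x * y') + c)).
  by apply: (smooth_comp (@smooth_sin R)); exact: sph.
have mc (h : R -> R) : smooth h -> measurable_fun setT h.
  by move=> sh; apply: continuous_measurable_fun; exact: smooth_continuous.
have cos1 u : `|cos u| <= 1 :> R by rewrite ler_norml cos_geN1 cos_le1.
have sin1 u : `|sin u| <= 1 :> R by rewrite ler_norml sin_geN1 sin_le1.
pose F y := \int[mu]_x (g x * cos (2 * pi * (x * y) + c)).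
have iF y' : integ mu (fun x => g x * cos (2 * pi * (x * y') + c)).
  apply: le_integ ig; first exact: measurable_funM (mc _ sg) (mc _ (scos y')).
  by move=> x; rewrite normrM (ger0_norm (g0 x)) ler_piMr.
have dy (x y' : R) : is_derive y' (1 : R) (fun y => 2 * pi * (x * y) + c) (2 * pi * x).
  have := is_deriveD (is_deriveZ (2 * pi * x) (is_derive_id y' (1 : R))) (is_derive_cst c y' (1 : R)).
  rewrite addr0 /GRing.scale /= mulr1.
  by rewrite (_ : _ + cst c = fun y => 2 * pi * (x * y) + c)//; apply/funext => z; rewrite /= !fctE mulrA.
have dx (x y' : R) : is_derive x (1 : R) (fun x => 2 * pi * (x * y') + c) (2 * pi * y').
  have := is_deriveD (is_deriveZ (2 * pi * y') (is_derive_id x (1 : R))) (is_derive_cst c x (1 : R)).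
  rewrite addr0 /GRing.scale /= mulr1.
  by rewrite (_ : _ + cst c = fun x => 2 * pi * (x * y') + c)//; apply/funext => z;
    change (2 * pi * y' * z + c = 2 * pi * (z * y') + c); ring.
have dg (x : R) : is_derive x (1 : R) g (- (2 * b * x) * g x).
  have d1 : is_derive x (1 : R) (fun x : R => - (b * x ^+ 2)) (- (2 * b * x)).
    have := is_deriveZ (- b) (is_deriveX 2 (is_derive_id x (1 : R))).
    rewrite /GRing.scale /= expr1 mulr1 => h.
    rewrite (_ : (fun x : R => _) = (- b) \*: (fun x : R => x ^+ 2)); last first.
      by apply/funext => z; change (- (b * z ^+ 2) = - b * z ^+ 2); rewrite mulNr.
    by apply: (is_derive_eq h); ring.
  by rewrite mulrC; exact: (is_derive1_comp (is_derive_expR _) d1).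
have dF y' : is_derive y' (1 : R) F (\int[mu]_x (g x * (- sin (2 * pi * (x * y') + c) * (2 * pi * x)))).
  apply: (@is_derive_Rint R (fun y x => g x * cos (2 * pi * (x * y) + c))
    (fun y x => g x * (- sin (2 * pi * (x * y) + c) * (2 * pi * x))) y' (y' - 1) (y' + 1)
    (fun x => 2 * pi * (`|x| * g x))).
  - by apply/andP; split; lra.
  - by move=> z _; exact: iF.
  - move=> z x _; rewrite !normrM normrN (ger0_norm (g0 x)) (ger0_norm (ltW pi0)) ger0_norm//.
    rewrite [leRHS](_ : _ = g x * (1 * (2 * pi * `|x|))); last by ring.
    by rewrite ler_wpM2l// ler_wpM2r// mulr_ge0// mulr_ge0// ltW.
  - exact: integZ.
have ode y' : \int[mu]_x (g x * (- sin (2 * pi * (x * y') + c) * (2 * pi * x))) =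
    - (2 * pi * N ^+ 2 * y') * F y'.
  pose G x := g x * sin (2 * pi * (x * y') + c).
  have sG : smooth G by exact: (smooth_mul sg (ssin y')).
  have eG x : 'D_(1 : R) G x = b / pi * (g x * (- sin (2 * pi * (x * y') + c) * (2 * pi * x))) +
      2 * pi * y' * (g x * cos (2 * pi * (x * y') + c)).
    have := is_deriveM (dg x) (is_derive1_comp (is_derive_sin _) (dx x y')).
    move=> [_ ->]; rewrite /GRing.scale /=.
    exact: (gauss_dx_algebra _ _ _ _ _ _ pi0).
  have iS : integ mu (fun x => g x * (- sin (2 * pi * (x * y') + c) * (2 * pi * x))).
    apply: (le_integ _ _ (integZ (2 * pi) ixg)).
      apply: measurable_funM; first exact: (mc _ sg).
      apply: measurable_funM; first exact: (measurable_funN (mc _ (ssin y'))).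
      by apply: measurable_funM => //; exact: measurable_cst.
    move=> x; rewrite !normrM normrN (ger0_norm (g0 x)) (ger0_norm (ltW pi0)) ger0_norm//.
    rewrite [leRHS](_ : _ = g x * (1 * (2 * pi * `|x|))); last by ring.
    by rewrite ler_wpM2l// ler_wpM2r// mulr_ge0// mulr_ge0// ltW.
  have iG : integ mu G.
    apply: le_integ ig; first exact: measurable_funM (mc _ sg) (mc _ (ssin y')).
    by move=> x; rewrite normrM (ger0_norm (g0 x)) ler_piMr.
  have iG1 : integ mu ('D_(1 : R) G).
    by rewrite (funext eG); apply: integD; [exact: integZ|apply: integZ; exact: iF].
  have := smooth_int_derive0 sG iG iG1.
  under eq_Rint do rewrite eG.
  rewrite RintD; [|exact: integZ|apply: integZ; exact: iF].
  rewrite (RintZ (b / pi) iS) (RintZ (2 * pi * y') (iF y')).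
  exact: (gauss_ode_algebra pi0 N0).
(* Multiplication by the integrating factor gives a function with zero derivative, whose value at 0
   is the Gaussian mass times cos c. *)
pose H y := F y * expR (pi * N ^+ 2 * y ^+ 2).
have dH y' : is_derive y' (1 : R) H 0.
  have d1 : is_derive y' (1 : R) (fun x : R => pi * N ^+ 2 * x ^+ 2) (2 * (pi * N ^+ 2) * y').
    have h := is_deriveZ (pi * N ^+ 2) (is_deriveX 2 (is_derive_id y' (1 : R))).
    rewrite /GRing.scale /= expr1 mulr1 in h.
    by apply: (is_derive_eq h); ring.
  have := is_deriveM (dF y') (is_derive1_comp (is_derive_expR _) d1).
  rewrite ode /GRing.scale /= => h; apply: (is_derive_eq h); ring.
have := is_derive_0_is_cst y 0 dH.
rewrite /H expr0n mulr0 expR0 mulr1.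
have -> : F 0 = cos c * N.
  have [_ e] := gauss1 N0.
  transitivity (\int[mu]_x (cos c * g x)).
    by apply: eq_Rint => x; rewrite !mulr0 add0r mulrC.
  by rewrite RintZ// e.
by move=> h; rewrite -/(F y) mulrA -h expRN mulfK// gt_eqF// expR_gt0.
Qed.

End gaussian.

Section gauss_n.
Context {R : realType}.
Local Notation mu := (@lebesgue_measure R).

Definition gau n (b : R) (w : 'rV[R]_n) : R := expR (- (b * \sum_(i < n) w ord0 i ^+ 2)).

Lemma gau_ge0 n b (w : 'rV[R]_n) : 0 <= gau b w. Proof. exact: expR_ge0. Qed.

Lemma gau_le1 n (b : R) (w : 'rV[R]_n) : 0 <= b -> gau b w <= 1.
Proof.
move=> b0; rewrite -expR0 ler_expR oppr_le0 mulr_ge0//.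
by apply: sumr_ge0 => i _; exact: sqr_ge0.
Qed.

Lemma gau_cons n (b x : R) (w : 'rV[R]_n) :
  gau b (rV_cons (x, w)) = expR (- (b * x ^+ 2)) * gau b w.
Proof.
rewrite /gau big_ord_recl rV_cons0 mulrDr opprD expRD.
by congr (_ * expR (- (_ * _))); apply: eq_bigr => i _; rewrite rV_consS.
Qed.

Lemma dotv_cons n (x : R) (eta : 'rV[R]_n) (w : 'rV[R]_n.+1) :
  dotv (rV_cons (x, eta)) w = x * w ord0 ord0 + dotv eta (\row_j w ord0 (lift ord0 j)).
Proof.
rewrite /dotv big_ord_recl rV_cons0; congr (_ + _).
by apply: eq_bigr => i _; rewrite rV_consS mxE.
Qed.

Lemma measurable_gau n b : measurable_fun setT (@gau n b).
Proof.
rewrite /gau; apply: measurableT_comp => //.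
apply: measurableT_comp => //; apply: measurable_funM => //.
by apply: measurable_sum => i; apply: measurable_funX; exact: measurable_coor.
Qed.

Lemma measurable_dotv d (T : measurableType d) n (f g : T -> 'rV[R]_n) :
  measurable_fun setT f -> measurable_fun setT g ->
  measurable_fun setT (fun x => dotv (f x) (g x)).
Proof.
move=> mf mg; apply: measurable_sum => i.
by apply: measurable_funM; [exact: measurableT_comp (measurable_coor i) mf|
  exact: measurableT_comp (measurable_coor i) mg].
Qed.

Lemma measurable_cos_comp d (T : measurableType d) (f : T -> R) :
  measurable_fun setT f -> measurable_fun setT (fun x => cos (f x)).
Proof.
move=> mf; apply: measurableT_comp mf.
by apply: continuous_measurable_fun; exact: continuous_cos.
Qed.

Lemma rV0_all (w : 'rV[R]_0) : w = 0.
Proof. by apply/rowP => -[]. Qed.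

Lemma Rint_leb0 (f : 'rV[R]_0 -> R) : integ (leb 0) f /\ \int[leb 0]_w f w = f 0.
Proof.
have fE w : f w = f 0 by rewrite (rV0_all w).
have mf : measurable_fun setT f.
  by rewrite (_ : f = cst (f 0))//; apply/funext => w; rewrite fE.
have e1 : (\int[@leb R 0]_w (1%:E) = 1%:E)%E.
  by rewrite (@ge0_integral_leb0 R (fun=> 1%:E)).
have i1 : integ (@leb R 0) (fun=> 1 : R).
  by apply: integE => //; rewrite e1 ltry.
have e : (fun w : 'rV[R]_0 => f 0 * 1) = f by apply/funext => w; rewrite mulr1 fE.
have i := integZ (f 0) i1.
rewrite e in i; split=> //.
rewrite -[in LHS]e (RintZ (f 0) i1).
by rewrite /Rintegral e1 /= mulr1.
Qed.

(** The free phase c makes the induction run with cosines alone: when the first variable is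
    integrated, the contribution of all the others is absorbed into the phase. *)
Lemma gau_fourier n (N : R) : 0 < N -> forall (w : 'rV[R]_n) (c : R),
  integ (leb n) (fun v => gau (pi / N ^+ 2) v * cos (2 * pi * dotv v w + c)) /\
  \int[leb n]_v (gau (pi / N ^+ 2) v * cos (2 * pi * dotv v w + c)) =
    cos c * (N ^+ n * gau (pi * N ^+ 2) w).
Proof.
move=> N0; elim: n => [|n IH] w c.
  have [i ->] := @Rint_leb0 (fun v => gau (pi / N ^+ 2) v * cos (2 * pi * dotv v w + c)).
  split=> //; rewrite /gau /dotv !big_ord0 !mulr0 oppr0 add0r expR0 expr0.
  by rewrite !mul1r mulr1.
pose f v : R := gau (pi / N ^+ 2) v * cos (2 * pi * dotv v w + c).
have mf : measurable_fun setT f.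
  apply: measurable_funM; first exact: measurable_gau.
  apply: measurable_cos_comp; apply: measurable_funD => //.
  by apply: measurable_funM => //; exact: measurable_dotv.
pose w' := \row_j w ord0 (lift ord0 j) : 'rV[R]_n.
pose g (x : R) := expR (- (pi / N ^+ 2 * x ^+ 2)).
pose e (x : R) (v : 'rV[R]_n) := 2 * pi * (x * w ord0 ord0) + (2 * pi * dotv v w' + c).
have fE x v : f (rV_cons (x, v)) = gau (pi / N ^+ 2) v * (g x * cos (e x v)).
  rewrite /f gau_cons dotv_cons /e mulrDr addrA -/(g x) -/w'; ring.
have [i1 _] := gauss1 N0.
have [ig _] := IH 0 0.
have ig' : integ (leb n) (gau (pi / N ^+ 2) : 'rV[R]_n -> R).
  apply: eq_integ ig => v; rewrite (_ : dotv v 0 = 0) ?mulr0 ?addr0 ?cos0 ?mulr1//.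
  by rewrite /dotv big1// => i _; rewrite mxE mulr0.
have it := (Rint_tensor i1 ig').1.
have [hi he] := Rint_lebS mf.
have mfc : measurable_fun setT (fun z => f (rV_cons z)).
  exact: measurableT_comp mf (@measurable_rV_cons R n).
have ifc : integ (mu \x leb n)%E (fun z => f (rV_cons z)).
  apply: (le_integ mfc _ it) => -[x v]; rewrite fE /= normrM ger0_norm ?gau_ge0//.
  rewrite normrM ger0_norm ?expR_ge0// mulrCA mulrA ler_piMr ?mulr_ge0 ?expR_ge0//.
  by rewrite ler_norml cos_geN1 cos_le1.
split; first exact/hi.
rewrite he (Rint_prod2 ifc).2.
have cosin x v : `|cos (e x v)| <= 1 by rewrite ler_norml cos_geN1 cos_le1.
transitivity (\int[leb n]_v ((N * expR (- (pi * N ^+ 2 * w ord0 ord0 ^+ 2))) *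
    (gau (pi / N ^+ 2) v * cos (2 * pi * dotv v w' + c)))).
  apply: eq_Rint => v.
  transitivity (\int[mu]_x (gau (pi / N ^+ 2) v * (g x * cos (e x v)))).
    by apply: eq_Rint => x; rewrite fE.
  rewrite RintZ; last first.
    apply: (le_integ _ _ i1) => [|x]; last by rewrite normrM ger0_norm ?expR_ge0// ler_piMr ?expR_ge0.
    apply: measurable_funM; first exact: integ_measurable i1.
    apply: measurable_cos_comp; apply: measurable_funD => //.
    by apply: measurable_funM => //; apply: measurable_funM.
  by rewrite gauss1_fourier//; ring.
have [i2 e2] := IH w' c.
rewrite RintZ// e2 [N ^+ n.+1]exprS.
have -> : gau (pi * N ^+ 2) w = expR (- (pi * N ^+ 2 * w ord0 ord0 ^+ 2)) * gau (pi * N ^+ 2) w'.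
  rewrite -gau_cons; congr gau; apply/rowP => i.
  have [j ->|->] := unliftP ord0 i; [by rewrite rV_consS mxE|by rewrite rV_cons0].
ring.
Qed.

Lemma dotv0r n (v : 'rV[R]_n) : dotv v 0 = 0.
Proof. by rewrite /dotv big1// => i _; rewrite mxE mulr0. Qed.

Lemma gau_integ n (N : R) : 0 < N -> integ (leb n) (gau (pi / N ^+ 2) : 'rV[R]_n -> R) /\
  \int[leb n]_v gau (pi / N ^+ 2) v = N ^+ n.
Proof.
move=> N0; have [i e] := @gau_fourier n N N0 0 0.
have h (v : 'rV[R]_n) : gau (pi / N ^+ 2) v * cos (2 * pi * dotv v 0 + 0) = gau (pi / N ^+ 2) v.
  by rewrite dotv0r mulr0 addr0 cos0 mulr1.
split; first by apply: eq_integ i.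
rewrite -(eq_Rint _ h) e cos0 mul1r /gau big1 ?mulr0 ?oppr0 ?expR0 ?mulr1//.
by move=> i0 _; rewrite mxE expr0n.
Qed.

Lemma gau_integ_inv n (N : R) : 0 < N -> integ (leb n) (gau (pi * N ^+ 2) : 'rV[R]_n -> R) /\
  \int[leb n]_v (N ^+ n * gau (pi * N ^+ 2) v) = 1.
Proof.
move=> N0; have Ni0 : 0 < N^-1 by rewrite invr_gt0.
have := @gau_integ n _ Ni0; rewrite exprVn invrK => -[i e]; split=> //.
by rewrite RintZ// e exprVn divff// expf_neq0// gt_eqF.
Qed.

End gauss_n.

Section sigma_finite_haar.
Context {R : realType} {n : nat}.

(* [haar] is only declared as a measure, Fubini's theorem needs it to be sigma-finite. *)
Definition sfhaar : set (measurableTypeR R * 'rV[R]_n)%type -> \bar R := @haar R n.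

HB.instance Definition _ := isMeasure.Build _ _ _ sfhaar
  (measure0 (@haar R n)) (@measure_ge0 _ _ _ (@haar R n)) (@measure_semi_sigma_additive _ _ _ (@haar R n)).

Let sfhaar_sigma_finite : sigma_finite setT sfhaar.
Proof.
exists (fun k => [set v : R * 'rV[R]_n | `|v| <= k%:R]).
  rewrite predeqE => v; split=> // _; exists (Num.bound `|v|) => //=.
  by apply: ltW; exact: archi_boundP.
move=> k; split; [exact: (@measurable_prod_norm_le R n k%:R)|exact: (@haar_ball_fin R n k%:R)].
Qed.

HB.instance Definition _ := Measure_isSigmaFinite.Build _ _ _ sfhaar sfhaar_sigma_finite.

End sigma_finite_haar.

Section inversion.
Context {R : realType} {n : nat}.
Local Notation V := (R * 'rV[R]_n)%type.
Local Notation haar := (@haar R n).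
Local Notation test := (@test_function R V).
Local Notation A := (@sublaplacian R n).
Local Notation mu := (@lebesgue_measure R).
Variables (S : R -> (V -> R) -> (V -> R)) (p : R -> V -> R).
Hypothesis gen : generated_by haar (friedrichs haar test A) S.
Hypothesis hp : forall t, 0 < t -> continuous (p t) /\ forall f, test f ->
  {ae haar, forall h : V, S t f h = \int[haar]_g (f (Gmul h g) * p t g)}.
Implicit Types (f : R -> R).

Lemma tst_p_integ f t : tst f -> 0 < t -> integ haar (fun g => f g.1 * p t g).
Proof.
move=> tf t0; have [M hM] := tst1_bounded tf.
have [ip _] := p_integ gen hp t0.
apply: (integ_mulr_bounded ip) => [|g]; last exact: hM.
apply: (measurableT_comp _ measurable_fst).
by apply: continuous_measurable_fun; exact: smooth_continuous tf.1.
Qed.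

Lemma Q_origin eta f c t : 0 < t ->
  Q eta p f c t 0 = \int[haar]_g (cos (2 * pi * dotv eta g.2 + c) * (f g.1 * p t g)).
Proof.
move=> t0; rewrite (Q_pos _ _ _ _ _ t0); apply: eq_Rint => g.
have -> : Gmul (0, 0) g = g := Gmul0 g.
by rewrite add0r /wave mulrAC mulrC.
Qed.

(** As the imaginary part of the transform vanishes, multiplying by cos th amounts to shifting the
    phase. A product of a cosine with Q thus becomes a single cosine under the integral. *)
Lemma Q_rotate eta f t x (th : R) : tst f -> 0 <= t ->
  cos th * Q eta p f 0 t x = Q eta p f (- th) t x.
Proof.
move=> tf t0; have := @Q_add R n eta S p gen hp f 0 (- th) t x tf t0.
by rewrite add0r [0 + _]add0r (Q_sin gen hp)// mulr0 addr0 cosN.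
Qed.

(** The Gaussian weight in eta makes Fubini's theorem applicable. The integral over eta is then a
    Gaussian Fourier transform, and what remains is p_t averaged near z at the scale 1/N. *)
Lemma Q_gauss_weighted f (N t c : R) (z : 'rV[R]_n) : tst f -> 0 < N -> 0 < t ->
  integ (leb n) (fun eta => gau (pi / N ^+ 2) eta *
    (cos (2 * pi * dotv eta z + c) * Q eta p f 0 t 0)) /\
  \int[leb n]_eta (gau (pi / N ^+ 2) eta *
    (cos (2 * pi * dotv eta z + c) * Q eta p f 0 t 0)) =
  cos c * \int[haar]_g (f g.1 * p t g * (N ^+ n * gau (pi * N ^+ 2) (g.2 - z))).
Proof.
move=> tf N0 t0.
pose hr : {sigma_finite_measure set (measurableTypeR R * 'rV[R]_n)%type -> \bar R} := sfhaar.
have ifp : integ hr (fun g : V => f g.1 * p t g) := tst_p_integ tf t0.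
have [ig _] := @gau_integ R n N N0.
pose H (u : 'rV[R]_n * V) : R :=
  gau (pi / N ^+ 2) u.1 * (cos (2 * pi * dotv u.1 (u.2.2 - z) - c) * (f u.2.1 * p t u.2)).
have mH : measurable_fun [set: 'rV[R]_n * (measurableTypeR R * 'rV[R]_n)] H.
  apply: measurable_funM; first exact: measurableT_comp (@measurable_gau R n _) measurable_fst.
  apply: measurable_funM; last exact: measurableT_comp (integ_measurable ifp) measurable_snd.
  apply: measurable_cos_comp; apply: measurable_funB => //.
  apply: measurable_funM => //; apply: measurable_dotv => //.
  apply: measurable_fun_addrV => //.
  exact: measurableT_comp measurable_snd measurable_snd.
have iH : integ (leb n \x hr)%E H.
  apply: (le_integ mH _ (Rint_tensor ig (integ_norm ifp)).1) => u.
  rewrite /H normrM ger0_norm ?gau_ge0// ler_wpM2l ?gau_ge0// normrM ler_piMl//.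
  by rewrite ler_norml cos_geN1 cos_le1.
have [i1 e1] := Rint_prod1 iH; have [i2 e2] := Rint_prod2 iH.
have dotB (eta : 'rV[R]_n) (g : V) : dotv eta (g.2 - z) = dotv eta g.2 - dotv eta z.
  by rewrite addrC -scaleN1r dotv_lin mulN1r addrC.
have s1 eta : \int[hr]_g H (eta, g) =
    gau (pi / N ^+ 2) eta * (cos (2 * pi * dotv eta z + c) * Q eta p f 0 t 0).
  rewrite Q_rotate ?ltW// Q_origin//.
  transitivity (\int[hr]_g (gau (pi / N ^+ 2) eta *
     (cos (2 * pi * dotv eta g.2 - (2 * pi * dotv eta z + c)) * (f g.1 * p t g)))).
    by apply: eq_Rint => g; rewrite /H /= dotB mulrBr opprD addrA.
  rewrite RintZ//; apply: (integ_mulr_bounded (C := 1) ifp).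
    apply: measurable_cos_comp; apply: measurable_funB => //.
    by apply: measurable_funM => //; apply: measurable_dotv => //; exact: measurable_snd.
  by move=> g; rewrite ler_norml cos_geN1 cos_le1.
split; first by apply: eq_integ i1 => eta; exact: s1.
transitivity (\int[leb n]_eta \int[hr]_g H (eta, g)); first by apply: eq_Rint => eta; rewrite s1.
rewrite -e1 e2 -RintZ; last first.
  have [M hM] : exists M : R, forall g : V, `|N ^+ n * gau (pi * N ^+ 2) (g.2 - z)| <= M.
    have pN0 : 0 <= pi * N ^+ 2 by rewrite mulr_ge0 ?pi_ge0// exprn_ge0// ltW.
    have NN0 : 0 <= N ^+ n by rewrite exprn_ge0// ltW.
    exists (N ^+ n) => g; rewrite ger0_norm; last by rewrite mulr_ge0 ?gau_ge0.
    by apply: ler_piMr => //; exact: gau_le1.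
  apply: (eq_integ _ (integ_mulr_bounded ifp _ hM)) => [g|]; first by rewrite mulrC.
  apply: measurable_funM => //; apply: (measurableT_comp (@measurable_gau R n _)).
  by apply: measurable_fun_addrV => //; exact: measurable_snd.
apply: eq_Rint => g.
have [i3 e3] := @gau_fourier R n N N0 (g.2 - z) (- c).
transitivity (\int[leb n]_eta ((f g.1 * p t g) *
    (gau (pi / N ^+ 2) eta * cos (2 * pi * dotv eta (g.2 - z) + - c)))).
  by apply: eq_Rint => eta; rewrite /H /=; ring.
by rewrite RintZ// e3 cosN; ring.
Qed.

End inversion.

Lemma gau_tail_algebra {R : realType} (p s r2 N2 : R) : 0 <= p -> 0 <= s -> r2 <= s -> 1 <= N2 ->
  - (p * N2 * s) <= - (p * r2 / 2 * N2) + - (p / 2 ^+ 2 * s).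
Proof.
move=> p0 s0 rs N1; rewrite -opprD lerN2.
have h1 : p * r2 * N2 <= p * s * N2 by rewrite ler_wpM2r ?ler_wpM2l// (le_trans ler01).
have h2 : p * s <= p * s * N2 by rewrite ler_peMr// mulr_ge0.
have h3 : 0 <= p * s by rewrite mulr_ge0.
rewrite (_ : p * r2 / 2 * N2 = p * r2 * N2 / 2); last by ring.
rewrite (_ : p / 2 ^+ 2 * s = p * s / 4); last by field.
by rewrite (_ : p * N2 * s = p * s * N2); [lra|ring].
Qed.

Lemma approx_algebra {R : realType} (e c k P C I K : R) : 0 <= c -> 0 <= k -> 0 <= P ->
  I <= C * c -> k * (C + P * K + 1) <= e -> 0 <= e ->
  e * c + k * (I + P * (c * K)) <= 2 * e * c.
Proof.
move=> c0 k0 P0 IC ke e0.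
have h1 : k * I <= k * (C * c) by rewrite ler_wpM2l.
have h2 : k * (C + P * K + 1) * c <= e * c by rewrite ler_wpM2r.
have h3 : 0 <= k * c by rewrite mulr_ge0.
have -> : k * (I + P * (c * K)) = k * I + (k * (C + P * K + 1) * c - k * (C * c) - k * c) by ring.
lra.
Qed.

(** For N >= 1, e^(c N^2) >= e^(c N) >= (c N)^(n+1) / (n+1)!, one power of N more than has to be
    beaten. *)
Lemma power_gauss_small {R : realType} (c e : R) n : 0 < c -> 0 < e -> exists J : nat,
  forall j, (J <= j)%N -> j.+1%:R ^+ n * expR (- (c * j.+1%:R ^+ 2)) <= e.
Proof.
move=> c0 e0.
pose K : R := n.+1`!%:R / c ^+ n.+1.
have f0 : 0 < n.+1`!%:R :> R by rewrite ltr0n fact_gt0.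
have K0 : 0 < K by rewrite divr_gt0// exprn_gt0.
exists (Num.bound (K / e)) => j Jj.
have N0 : 0 < j.+1%:R :> R by rewrite ltr0n.
have Ke : K / e <= j.+1%:R.
  apply: ltW; apply: (lt_le_trans (archi_boundP _)); first by rewrite ltW// divr_gt0.
  by rewrite ler_nat leqW.
set N := j.+1%:R in N0 Ke *.
have N1 : 1 <= N by rewrite /N ler1n.
have cN0 : 0 <= c * N by rewrite ltW// mulr_gt0.
have h1 : (c * N) ^+ n.+1 / n.+1`!%:R <= expR (c * N ^+ 2).
  apply: (@le_trans _ _ (expR (c * N))).
    by apply: le_trans (expR_ge1Dxn n cN0); rewrite lerDr.
  by rewrite ler_expR ler_wpM2l ?(ltW c0)// expr2 ler_peMr// ltW.
rewrite expRN ler_pdivrMr ?expR_gt0//.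
apply: (@le_trans _ _ (e * ((c * N) ^+ n.+1 / n.+1`!%:R))); last by rewrite ler_wpM2l// ltW.
have -> : e * ((c * N) ^+ n.+1 / n.+1`!%:R) = N ^+ n * (e * N / K).
  rewrite /K exprMn [N ^+ n.+1]exprS; field.
  by rewrite !gt_eqF// ?exprn_gt0.
rewrite -[leLHS]mulr1 ler_wpM2l ?exprn_ge0 ?(ltW N0)//.
by rewrite ler_pdivlMr// mul1r mulrC -ler_pdivrMr.
Qed.

Section approximate_identity.
Context {R : realType} {n : nat}.
Local Notation V := (R * 'rV[R]_n)%type.
Local Notation haar := (@haar R n).
Local Notation test := (@test_function R V).
Local Notation A := (@sublaplacian R n).
Local Notation mu := (@lebesgue_measure R).

(** Away from the centre half of the exponent gives a small constant, and the rest still dominates a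
    Gaussian of fixed width. The width 2 puts that Gaussian into the form whose mass is computed in
    [gau_integ]. *)
Lemma gau_tail (N r : R) (w : 'rV[R]_n) : 1 <= N -> 0 <= r -> r <= `|w| ->
  gau (pi * N ^+ 2) w <= expR (- (pi * r ^+ 2 / 2 * N ^+ 2)) * gau (pi / 2 ^+ 2) w.
Proof.
move=> N1 r0 rw; rewrite /gau -expRD ler_expR.
set s := \sum_(i < n) _.
have s0 : 0 <= s by apply: sumr_ge0 => i _; exact: sqr_ge0.
have ws : `|w| <= Num.sqrt s.
  apply: rV_norm_le => [|i]; first exact: sqrtr_ge0.
  rewrite -(ler_pXn2r (n := 2)) ?nnegrE ?sqrtr_ge0// sqr_sqrtr// real_normK ?num_real//.
  by rewrite /s (bigD1 i)//= lerDl sumr_ge0// => j _; exact: sqr_ge0.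
have rs : r ^+ 2 <= s.
  rewrite -(sqr_sqrtr s0) ler_pXn2r ?nnegrE ?sqrtr_ge0//; exact: le_trans rw ws.
have N21 : 1 <= N ^+ 2 by rewrite exprn_ege1.
exact: (gau_tail_algebra (pi_ge0 R) s0 rs N21).
Qed.

Lemma Rint_leb_shift (f : 'rV[R]_n -> R) (c : 'rV[R]_n) : measurable_fun setT f ->
  integ (leb n) f -> integ (leb n) (fun w => f (w - c)) /\
  \int[leb n]_w f (w - c) = \int[leb n]_w f w.
Proof.
move=> mf i.
have mc : measurable_fun setT (fun w : 'rV[R]_n => w - c).
  by apply: measurable_fun_addrV.
have [[_ h1] h2] := @Rint_preserving _ _ _ (leb n) _ mc
  (fun F mF F0 => @leb_shift R n F (- c) mF F0) f mf.
by split => //; apply: h1.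
Qed.

Variables (S : R -> (V -> R) -> (V -> R)) (p : R -> V -> R).
Hypothesis gen : generated_by haar (friedrichs haar test A) S.
Hypothesis hp : forall t, 0 < t -> continuous (p t) /\ forall f, test f ->
  {ae haar, forall h : V, S t f h = \int[haar]_g (f (Gmul h g) * p t g)}.

(* The central variable carries no decay estimate for [p t]; its tails are
   controlled by [Q_gauss] at eta = 0, uniformly in [m]. *)
Lemma heat_approx t (a : R) (z : 'rV[R]_n) (e : R) : 0 < t -> 0 < e ->
  exists J m0 : nat, forall j m, (J <= j)%N -> (m0 <= m)%N ->
  `|(\int[haar]_g (bumpn a m g.1 * p t g *
      (j.+1%:R ^+ n * gau (pi * j.+1%:R ^+ 2) (g.2 - z)))) / cbump m - p t (a, z)| <= e.
Proof.
move=> t0 e0; have [cp _] := hp t0.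
set P := p t (a, z); have P0 : 0 <= P := p_ge0 gen hp _ t0.
have pg0 g : 0 <= p t g := p_ge0 gen hp g t0.
have e20 : 0 < e / 2 by rewrite divr_gt0.
have [r r0 hr] : exists2 r : R, 0 < r & forall g : V, `|g.1 - a| < r -> `|g.2 - z| < r ->
    `|p t g - P| <= e / 2.
  have /cvgrPdist_le/(_ _ e20)/nbhs_ballP[r /= r0 hr] := cp (a, z).
  exists r => // g g1 g2; rewrite distrC; apply: hr.
  by split; rewrite /= -ball_normE /ball_ /= distrC.
have [C C0 hC] := Q_gauss gen hp t0.
pose D := C + P * 2 ^+ n.
have D0 : 0 <= D by rewrite addr_ge0// mulr_ge0// exprn_ge0.
have D10 : 0 < D + 1 by rewrite ltr_wpDl.
have c0 : 0 < pi * r ^+ 2 / 2 :> R by rewrite divr_gt0// mulr_gt0 ?pi_gt0// exprn_gt0.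
have [J hJ] := power_gauss_small n c0 (divr_gt0 e20 D10).
exists J, (Num.bound r^-1) => j m Jj mm.
have mr : m.+1%:R^-1 <= r.
  rewrite -[r]invrK lef_pV2 ?posrE ?invr_gt0//.
  apply: ltW; apply: (lt_le_trans (archi_boundP _)); first by rewrite invr_ge0 ltW.
  by rewrite ler_nat leqW.
have N1 : 1 <= j.+1%:R :> R by rewrite ler1n.
have N0 : 0 < j.+1%:R :> R by rewrite ltr0n.
have kD := hJ j Jj.
set N := j.+1%:R in N0 N1 kD *.
set kap := N ^+ n * _ in kD.
have kap0 : 0 <= kap by rewrite mulr_ge0 ?expR_ge0// exprn_ge0// ltW.
pose G (w : 'rV[R]_n) := N ^+ n * gau (pi * N ^+ 2) (w - z).
pose E (w : 'rV[R]_n) := gau (pi / 2 ^+ 2) (w - z).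
have G0 w : 0 <= G w by rewrite mulr_ge0 ?gau_ge0// exprn_ge0// ltW.
have E0 w : 0 <= E w := gau_ge0 _ _.
have pi20 : 0 <= pi / 2 ^+ 2 :> R by rewrite divr_ge0 ?pi_ge0// exprn_ge0.
have E1 w : E w <= 1 := gau_le1 _ pi20.
have b0 y : 0 <= bumpn a m y := bumpn_ge0 a m y.
have cb0 := @cbump_gt0 R m.
have tb := tst_bumpn a m.
have ib := tst1_integ tb.
have mgau b : measurable_fun setT (@gau R n b) by exact: measurable_gau.
have [iG0 eG0] := @gau_integ_inv R n N N0.
have [iG eG] : integ (leb n) G /\ \int[leb n]_w G w = 1.
  rewrite -eG0; apply: (@Rint_leb_shift (fun w => N ^+ n * gau (pi * N ^+ 2) w)); last exact: integZ.
  by apply: measurable_funM.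
have [iE eE] : integ (leb n) E /\ \int[leb n]_w E w = 2 ^+ n.
  have [i <-] := @gau_integ R n 2 (ltr0n _ 2).
  exact: Rint_leb_shift.
have [ibG ebG] := Rint_haarE ib iG; have [ibE ebE] := Rint_haarE ib iE.
rewrite int_bumpn eG mulr1 in ebG; rewrite int_bumpn eE in ebE.
have ibp : integ haar (fun g : V => bumpn a m g.1 * p t g) := tst_p_integ gen hp tb t0.
have ebp : \int[haar]_g (bumpn a m g.1 * p t g) <= C * cbump m.
  apply: le_trans (hC 0 a m 0 0); apply: le_trans (ler_norm _).
  rewrite Q_origin// le_eqVlt; apply/orP; left; apply/eqP; apply: eq_Rint => g.
  by rewrite (_ : dotv 0 g.2 = 0) ?mulr0 ?addr0 ?cos0 ?mul1r// /dotv big1// => i _; rewrite mxE mul0r.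
have mG2 : measurable_fun [set: measurableTypeR R * 'rV[R]_n] (fun g => G g.2).
  exact: measurableT_comp (integ_measurable iG) measurable_snd.
have ibpG : integ haar (fun g : V => bumpn a m g.1 * p t g * G g.2).
  apply: (eq_integ _ (@integ_mulr_bounded _ _ _ haar _ (fun g : V => G g.2) (N ^+ n) ibp mG2 _)) => [g|g].
    by rewrite mulrC.
  rewrite ger0_norm// ler_piMr ?exprn_ge0 ?(ltW N0)// gau_le1//.
  by rewrite mulr_ge0 ?pi_ge0// exprn_ge0// ltW.
rewrite -/(G _).
have -> : (\int[haar]_g (bumpn a m g.1 * p t g * G g.2)) / cbump m - P =
    (\int[haar]_g (bumpn a m g.1 * p t g * G g.2 - P * (bumpn a m g.1 * G g.2))) / cbump m.
  rewrite RintB//; last exact: integZ.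
  by rewrite RintZ// ebG mulrBl mulfK ?gt_eqF.
rewrite normrM [`|_^-1|]ger0_norm ?invr_ge0 ?(ltW cb0)// ler_pdivrMr//.
(* Within r of z the continuity of p_t gives e / 2 times the narrow Gaussian. Farther out [gau_tail]
   replaces G by [kap] times the fixed Gaussian E <= 1, and |p_t - P| <= p_t + P. *)
have idom : integ haar (fun g : V => e / 2 * (bumpn a m g.1 * G g.2) +
    kap * (bumpn a m g.1 * p t g + P * (bumpn a m g.1 * E g.2))).
  apply: integD; first exact: integZ.
  by apply: integZ; apply: integD => //; exact: integZ.
apply: (@le_trans _ _ (\int[haar]_g (e / 2 * (bumpn a m g.1 * G g.2) +
    kap * (bumpn a m g.1 * p t g + P * (bumpn a m g.1 * E g.2))))).
  apply: Rint_norm_le => //; first by apply: integB => //; exact: integZ.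
  move=> g.
  have -> : bumpn a m g.1 * p t g * G g.2 - P * (bumpn a m g.1 * G g.2) =
      bumpn a m g.1 * ((p t g - P) * G g.2) by ring.
  have -> : e / 2 * (bumpn a m g.1 * G g.2) + kap * (bumpn a m g.1 * p t g + P * (bumpn a m g.1 * E g.2)) =
      bumpn a m g.1 * (e / 2 * G g.2 + kap * (p t g + P * E g.2)) by ring.
  rewrite normrM ger0_norm//.
  have [g1|g1] := leP m.+1%:R^-1 `|g.1 - a|; first by rewrite bumpn_out// !mul0r.
  rewrite ler_wpM2l// normrM (ger0_norm (G0 _)).
  have [g2|g2] := ltP `|g.2 - z| r.
    rewrite -[leLHS]addr0 lerD//.
      by rewrite ler_wpM2r// hr//; exact: lt_le_trans mr.
    by rewrite mulr_ge0// addr_ge0// mulr_ge0.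
  rewrite -[leLHS]add0r lerD//; first by rewrite mulr_ge0// ltW.
  have Gk : G g.2 <= kap * E g.2.
    by rewrite /kap -mulrA ler_wpM2l ?exprn_ge0 ?(ltW N0)// gau_tail// ltW.
  have pP : `|p t g - P| <= p t g + P.
    by rewrite (le_trans (ler_normB _ _))// !ger0_norm.
  apply: (@le_trans _ _ ((p t g + P) * (kap * E g.2))).
    by rewrite ler_pM// addr_ge0.
  rewrite mulrCA ler_wpM2l// mulrDl lerD//.
  by rewrite ler_piMr.
rewrite RintD; [|exact: integZ|by apply: integZ; apply: integD => //; exact: integZ].
rewrite !RintZ//; last by apply: integD => //; exact: integZ.
rewrite RintD//; last exact: integZ.
rewrite RintZ// ebG ebE.
have -> : e * cbump m = 2 * (e / 2) * cbump m by rewrite mulrCA divff ?mulr1//.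
apply: (approx_algebra (ltW cb0) kap0 P0 ebp _ (ltW e20)).
by rewrite -/D; move: kD; rewrite ler_pdivlMr.
Qed.

End approximate_identity.

(** * Coadjoint coordinates and the kernel formula *)

Section coadjoint.
Context {R : realType}.
Local Notation mu := (@lebesgue_measure R).

(* The coefficients of [potential L] by increasing degree: there is no x^(n-2) term. *)
Definition pot_coef m (L : 'rV[R]_m.+1) : 'rV[R]_m.+2 :=
  \row_(i < m.+2) (if (i < m)%N then L ord0 (inord i) else
                   if i == m :> nat then 0 else L ord0 ord_max).

(* Coadjoint action of exp(xX): for lambda_{n-1} <> 0 the pairs (L, x) parametrise
   the dense open set of frequencies eta with eta_n <> 0. *)
Definition coad m (L : 'rV[R]_m.+1) (x : R) : 'rV[R]_m.+2 :=
  \row_(j < m.+2) \sum_(i < m.+2) pot_coef L ord0 i * (if (j <= i)%N then cf (i - j) x else 0).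

Lemma pot_coef_consS m u (L : 'rV[R]_m.+1) (i : 'I_m.+2) :
  pot_coef (rV_cons (u, L)) ord0 (lift ord0 i) = pot_coef L ord0 i.
Proof.
rewrite [LHS]mxE [RHS]mxE lift0 ltnS eqSS; case: ifP => im.
  rewrite (_ : inord i.+1 = lift ord0 (inord i : 'I_m.+1)) ?rV_consS//.
  by apply: val_inj; rewrite /= /fintype.bump /= add1n !inordK// ltnS// ltnW.
case: ifP => // _; rewrite (_ : ord_max = lift ord0 (ord_max : 'I_m.+1)) ?rV_consS//.
exact: val_inj.
Qed.

Lemma pot_coef_cons0 m u (L : 'rV[R]_m.+1) : pot_coef (rV_cons (u, L)) ord0 ord0 = u.
Proof.
rewrite mxE /=; rewrite (_ : inord 0 = ord0) ?rV_cons0//.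
by apply: val_inj; rewrite /= inordK.
Qed.

Definition coad_shift m (L : 'rV[R]_m.+1) (x : R) : R :=
  \sum_(i < m.+2) pot_coef L ord0 i * cf i.+1 x.

(** Adding a coefficient u of degree 0 only translates the new first coordinate by a quantity
    independent of u. Each such step has Jacobian 1. *)
Lemma coad_cons m u (L : 'rV[R]_m.+1) (x : R) :
  coad (rV_cons (u, L)) x = rV_cons (u + coad_shift L x, coad L x).
Proof.
apply/rowP => j; rewrite mxE big_ord_recl pot_coef_cons0.
have [i ->|->] := unliftP ord0 j.
  rewrite rV_consS mxE /= mulr0 add0r; apply: eq_bigr => k _.
  by rewrite pot_coef_consS /fintype.bump /= !add1n ltnS subSS.
rewrite rV_cons0 /= subn0 /cf expr0 fact0 divr1 mulr1; congr (_ + _).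
by apply: eq_bigr => k _; rewrite pot_coef_consS /fintype.bump /= add1n subn0.
Qed.

(** In the smallest case the map is (lambda, x) -> (lambda x, lambda): the origin of the Jacobian
    |lambda_{n-1}|. *)
Lemma coad0E (L : 'rV[R]_1) (x : R) : coad L x = rV_cons (L ord0 ord0 * x, L).
Proof.
apply/rowP => j; rewrite [LHS]mxE big_ord_recl big_ord1 ![pot_coef _ _ _]mxE /= mul0r add0r.
have -> : (ord_max : 'I_1) = ord0 by exact: val_inj.
have [i ->|->] := unliftP ord0 j.
  by rewrite rV_consS (ord1 i) /cf /= subnn expr0 fact0 divr1 mulr1.
by rewrite rV_cons0 /cf /= subn0 expr1 divr1.
Qed.

Lemma measurable_rV_cons2 d (T : measurableType d) m (f : T -> R) (g : T -> 'rV[R]_m) :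
  measurable_fun setT f -> measurable_fun setT g ->
  measurable_fun setT (fun x => rV_cons (f x : measurableTypeR R, g x)).
Proof.
move=> mf mg; apply: (measurableT_comp (@measurable_rV_cons R m)).
by apply/measurable_fun_pairP.
Qed.

Lemma measurable_pot_coef m (i : 'I_m.+2) :
  measurable_fun setT (fun L : 'rV[R]_m.+1 => pot_coef L ord0 i).
Proof.
rewrite /pot_coef; under eq_fun do rewrite mxE.
have [_|_] := ltnP i m; first exact: measurable_coor.
by have [_|_] := eqVneq (nat_of_ord i) m; [exact: measurable_cst|exact: measurable_coor].
Qed.

Lemma measurable_cf i : measurable_fun setT (@cf R i).
Proof.
by apply: continuous_measurable_fun; exact: smooth_continuous (@smooth_cf R i).
Qed.

Lemma measurable_coad m :
  measurable_fun setT (fun u : 'rV[R]_m.+1 * measurableTypeR R => coad u.1 u.2).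
Proof.
apply: measurable_fun_coor => j.
under eq_fun do rewrite mxE.
apply: measurable_sum => i; apply: measurable_funM.
  exact: measurableT_comp (@measurable_pot_coef m i) measurable_fst.
case: (j <= i)%N => //; exact: measurableT_comp (@measurable_cf (i - j)) measurable_snd.
Qed.

(** Induction on m: the base case is a dilation of x by lambda, and each further coordinate is a
    translation, so the Jacobian found at the start persists. *)
Lemma coad_change_of_variables m (Phi : 'rV[R]_m.+2 -> \bar R) :
  measurable_fun setT Phi -> (forall v, 0 <= Phi v)%E ->
  (\int[leb m.+2]_v Phi v =
   \int[leb m.+1]_L \int[mu]_x (Phi (coad L x) * `|L ord0 ord_max|%:E))%E.
Proof.
elim: m Phi => [|m IH] Phi mPhi Phi0.
  rewrite (ge0_integral_lebS_swap mPhi Phi0).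
  have mc : measurable_fun setT (fun u : 'rV[R]_1 * measurableTypeR R => Phi (rV_cons (u.2, u.1))).
    apply: measurableT_comp => //.
    by apply: measurable_rV_cons2; [exact: measurable_snd|exact: measurable_fst].
  pose F (w : 'rV[R]_1) := (\int[mu]_x Phi (rV_cons (x, w)))%E.
  pose G (w : 'rV[R]_1) := (\int[mu]_x (Phi (coad w x) * `|w ord0 ord_max|%:E))%E.
  have mF : measurable_fun setT F by exact: (measurable_fun_fubini_tonelli_F _ mc).
  have mG : measurable_fun setT G.
    apply: (@measurable_fun_fubini_tonelli_F _ _ _ _ _ mu
      (fun u : 'rV[R]_1 * measurableTypeR R => (Phi (coad u.1 u.2) * `|u.1 ord0 ord_max|%:E)%E));
      last by move=> u; rewrite mule_ge0.
    apply: emeasurable_funM; first exact: measurableT_comp mPhi (@measurable_coad 0).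
    apply/measurable_EFinP; apply: measurableT_comp => //.
    exact: measurableT_comp (measurable_coor ord_max) measurable_fst.
  have F0 w : (0 <= F w)%E by exact: integral_ge0.
  have G0 w : (0 <= G w)%E by apply: integral_ge0 => x _; rewrite mule_ge0.
  rewrite -/(F _) -/(G _) (ge0_integral_lebS mF F0) (ge0_integral_lebS mG G0).
  pose c (x : measurableTypeR R) : 'rV[R]_1 := rV_cons (x, 0).
  have mc1 : measurable_fun setT c.
    by apply: measurable_rV_cons2; [exact: measurable_id|exact: measurable_cst].
  have e0 (H : 'rV[R]_1 -> \bar R) x : measurable_fun setT H ->
      (\int[leb 0]_w H (rV_cons (x, w)) = H (c x))%E.
    move=> mH; rewrite ge0_integral_leb0//.
    apply: measurableT_comp => //.
    by apply: measurable_rV_cons2; [exact: measurable_cst|exact: measurable_id].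
  under eq_integral do rewrite (e0 _ _ mF).
  under [RHS]eq_integral do rewrite (e0 _ _ mG).
  apply: ge0_ae_eq_integral => //.
  - exact: measurableT_comp mF mc1.
  - exact: measurableT_comp mG mc1.
  (* At lambda = 0 the dilation degenerates, so the two inner integrals are compared off a null
     set. *)
  exists [set 0]; split; [exact: measurable_set1|exact: lebesgue_measure_set1|].
  move=> x /=; apply: contra_notP => /= /eqP x0 _; rewrite /F /G.
  have cx : c x ord0 ord_max = x by rewrite (_ : ord_max = ord0) ?rV_cons0//; exact: val_inj.
  have cx0 : c x ord0 ord0 = x by rewrite rV_cons0.
  have mf : measurable_fun setT (fun y : R => Phi (rV_cons (y, c x))).
    apply: measurableT_comp => //.
    by apply: measurable_rV_cons2; [exact: measurable_id|exact: measurable_cst].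
  have xm : measurable_fun setT (fun y : R => x * y) by exact: measurable_funM.
  rewrite -(lebesgue_scale x0 mf)//.
  under [RHS]eq_integral do rewrite coad0E cx cx0.
  rewrite ge0_integralZr ?lee_fin// 1?muleC//.
  exact: measurableT_comp mf xm.
have mc : measurable_fun setT (fun u : 'rV[R]_m.+2 * measurableTypeR R => Phi (rV_cons (u.2, u.1))).
  apply: measurableT_comp => //.
  by apply: measurable_rV_cons2; [exact: measurable_snd|exact: measurable_fst].
pose F (w : 'rV[R]_m.+2) := (\int[mu]_x Phi (rV_cons (x, w)))%E.
have mF : measurable_fun setT F by exact: (measurable_fun_fubini_tonelli_F _ mc).
have F0 w : (0 <= F w)%E by exact: integral_ge0.
have wmax (u : R) (L : 'rV[R]_m.+1) : rV_cons (u, L) ord0 ord_max = L ord0 ord_max.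
  by rewrite (_ : ord_max = lift ord0 (ord_max : 'I_m.+1)) ?rV_consS//; exact: val_inj.
rewrite (ge0_integral_lebS_swap mPhi Phi0) (IH F mF F0).
have mK : measurable_fun setT (fun u : 'rV[R]_m.+2 * measurableTypeR R =>
    (Phi (coad u.1 u.2) * `|u.1 ord0 ord_max|%:E)%E).
  apply: emeasurable_funM; first exact: measurableT_comp mPhi (@measurable_coad m.+1).
  apply/measurable_EFinP; apply: measurableT_comp => //.
  exact: measurableT_comp (measurable_coor ord_max) measurable_fst.
pose G (w : 'rV[R]_m.+2) := (\int[mu]_x (Phi (coad w x) * `|w ord0 ord_max|%:E))%E.
have mG : measurable_fun setT G.
  by apply: (measurable_fun_fubini_tonelli_F _ mK) => u; rewrite mule_ge0.
have G0 w : (0 <= G w)%E by apply: integral_ge0 => x _; rewrite mule_ge0.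
rewrite -/(G _) (ge0_integral_lebS_swap mG G0).
apply: eq_integral => L _.
have ml : measurable_fun setT (fun u : measurableTypeR R * measurableTypeR R =>
    (Phi (coad (rV_cons (u.1, L)) u.2) * `|L ord0 ord_max|%:E)%E).
  have mi : measurable_fun setT (fun u : measurableTypeR R * measurableTypeR R => (rV_cons (u.1, L), u.2)).
    apply/measurable_fun_pairP; split; last exact: measurable_snd.
    by apply: measurable_rV_cons2; [exact: measurable_fst|exact: measurable_cst].
  have := measurableT_comp mK mi.
  by apply: eq_measurable_fun => u _ /=; rewrite wmax.
have h := fubini_tonelli _ ml.
transitivity (\int[mu]_x \int[mu]_u (Phi (coad (rV_cons (u, L)) x) * `|L ord0 ord_max|%:E))%E; last first.
  rewrite -h; last by move=> u; rewrite mule_ge0.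
  by apply: eq_integral => u _; apply: eq_integral => x _; rewrite wmax.
apply: eq_integral => x _; rewrite /F.
have mf : measurable_fun setT (fun y : R => Phi (rV_cons (y, coad L x))).
  apply: measurableT_comp => //.
  by apply: measurable_rV_cons2; [exact: measurable_id|exact: measurable_cst].
rewrite -(@lebesgue_shift R _ (coad_shift L x) mf)//.
rewrite -ge0_integralZr ?lee_fin//.
  by apply: eq_integral => u _; rewrite coad_cons.
apply: measurableT_comp mf _.
by apply: measurable_funD.
Qed.

(** [coad] is the transpose of the action on z of left translation by exp(xX). *)
Lemma dotv_coad m (L : 'rV[R]_m.+1) (x : R) (g : R * 'rV[R]_m.+2) :
  dotv (coad L x) g.2 = dotv (pot_coef L) (Gmul (x, 0) g).2.
Proof.
rewrite /dotv; under eq_bigr do rewrite mxE mulr_suml.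
rewrite exchange_big; apply: eq_bigr => i _ /=.
rewrite [in RHS]mxE /=.
have -> : crd (0 : 'rV[R]_m.+2) i.+1 = 0 by rewrite /crd; case: insub => // ?; rewrite mxE.
rewrite /crd; under eq_bigr do rewrite -mulrA.
rewrite -mulr_sumr; congr (_ * _).
rewrite add0r big_mkord.
transitivity (\sum_(j < m.+2 | (j < i.+1)%N) cf (i - j) x * g.2 ord0 j).
  rewrite [RHS]big_mkcond /=; apply: eq_bigr => j _.
  by rewrite ltnS; case: ifP => // _; rewrite mul0r.
rewrite (big_ord_narrow (ltn_ord i)) (reindex_inj rev_ord_inj) /=.
apply: eq_bigr => j _ /=.
have ji : (j <= i)%N by rewrite -ltnS.
rewrite subSS subKn// /cf; congr (_ * _).
rewrite subSn//=.
case: insubP => [k _ kj|]; last by rewrite (leq_ltn_trans (leq_subr _ _) (ltn_ord i)).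
by congr (g.2 ord0 _); apply: val_inj; rewrite /= kj subSS.
Qed.

End coadjoint.

Section closed_forms.
Context {R : realType}.

(** The zero entry in degree m drops out, leaving the top term and a sum over the lower degrees: the
    shape shared by [potential] and [phase]. *)
Lemma pot_coef_sum m (L : 'rV[R]_m.+1) (F : nat -> R) :
  \sum_(i < m.+2) pot_coef L ord0 i * F i =
  crd L m.+1 * F m.+1 + \sum_(1 <= k < m.+1) crd L k * F k.-1.
Proof.
rewrite !big_ord_recr /= addrC; congr (_ * _ + _).
  rewrite mxE /= ltnNge leqnSn /= gtn_eqF// /crd /=.
  by case: insubP => [i _ im|]; rewrite ?ltnSn//; congr (L _ _); apply: val_inj; rewrite /= im.
rewrite mxE /= ltnn eqxx mul0r addr0 big_add1 /= big_mkord; apply: eq_bigr => i _.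
rewrite mxE /= ltn_ord /crd /=; congr (_ * _).
case: insubP => [j _ ij|]; last by rewrite ltnS ltnW.
by congr (L _ _); apply: val_inj; rewrite /= inordK ?ij// ltnS ltnW.
Qed.

Lemma potentialE m (L : 'rV[R]_m.+1) (x : R) : @potential R m.+2 L x = wv (pot_coef L) x ^+ 2.
Proof.
rewrite /wv (pot_coef_sum L (fun i => cf i x)) /potential /= /cf !exprMn.
rewrite (_ : 2 ^+ 2 = 4 :> R); last by ring.
congr (_ * (_ + _) ^+ 2); first by rewrite mulrA mulrAC.
by apply: eq_bigr => i _; rewrite mulrA mulrAC.
Qed.

Lemma BpolyE n (i : 'I_n) (x : R) (z : 'rV[R]_n) :
  Bpoly i.+1 x z = (Gmul (x, 0) (0, z)).2 ord0 i.
Proof.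
rewrite mxE /=.
have -> : crd (0 : 'rV[R]_n) i.+1 = 0 by rewrite /crd; case: insub => // ?; rewrite mxE.
rewrite add0r /Bpoly big_add1 /= big_nat_rev /= add0n !big_mkord.
apply: eq_bigr => j _; have ji : (j <= i)%N by rewrite -ltnS.
by rewrite !subSS subKn// subSn// mulrAC -mulrA mulrC.
Qed.

Lemma phaseE m (L : 'rV[R]_m.+1) (x : R) (z : 'rV[R]_m.+2) :
  @phase R m.+2 L x z = dotv (coad L x) z.
Proof.
rewrite (dotv_coad L x (0, z)) /phase.
transitivity (\sum_(i < m.+2) pot_coef L ord0 i * Bpoly i.+1 x z).
  rewrite (pot_coef_sum L (fun i => Bpoly i.+1 x z)); congr (_ + _).
  by apply: eq_big_nat => -[].
by apply: eq_bigr => i _; rewrite BpolyE.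
Qed.

End closed_forms.

(** * The kernel as an integral of traces *)

Section trace_formula.
Context {R : realType} {m : nat}.
Local Notation n := m.+2.
Local Notation V := (R * 'rV[R]_n)%type.
Local Notation haar := (@haar R n).
Local Notation test := (@test_function R V).
Local Notation A := (@sublaplacian R n).
Local Notation mu := (@lebesgue_measure R).
Variables (S : R -> (V -> R) -> (V -> R)) (p : R -> V -> R).
Hypothesis gen : generated_by haar (friedrichs haar test A) S.
Hypothesis hp : forall t, 0 < t -> continuous (p t) /\ forall f, test f ->
  {ae haar, forall h : V, S t f h = \int[haar]_g (f (Gmul h g) * p t g)}.
Variable (k : 'rV[R]_m.+1 -> R -> R -> R -> R).
Hypothesis hk : forall L : 'rV[R]_m.+1, crd L m.+1 != 0 ->
  fundamental_solution (@potential R n L) (k L).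
Variables (t a : R).
Hypothesis t0 : 0 < t.
Implicit Types (L : 'rV[R]_m.+1) (x : R).

Let last_coord L : crd L m.+1 = L ord0 ord_max.
Proof.
rewrite /crd /=; case: insubP => [i _ im|]; rewrite ?ltnSn//.
by congr (L _ _); apply: val_inj; rewrite /= im.
Qed.

Let kk L x : R := k L t (x + a) x.
Let Qm j (eta : 'rV[R]_n) : R := Q eta p (bumpn a j) 0 t 0 / cbump j.

(** Translation by x can be charged either to the frequency or to the evaluation point, where it
    also moves the bump to x + a. This is where the trace k_t(x + a, x) comes from. *)
Lemma Q_coad L x j : Q (coad L x) p (bumpn a j) 0 t 0 = Q (pot_coef L) p (bumpn (x + a) j) 0 t x.
Proof.
rewrite Q_origin// (Q_pos _ _ _ _ _ t0); apply: eq_Rint => g.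
rewrite dotv_coad /wave /bumpn mulrA; congr (_ * _); rewrite mulrC; congr (bump (_ * _) * _).
by rewrite opprD addrACA subrr add0r.
Qed.

Let k_section L y : crd L m.+1 != 0 -> continuous (fun x => k L t x y).
Proof.
move=> L0 x.
have c : continuous (fun x : R => (t, x, y)).
  apply: (@continuous_pair R (R * R)%type R (fun x => (t, x)) (fun=> y)) => z; last exact: cvg_cst.
  exact: cvg_pairr.
exact: (@cvg_comp _ _ _ (fun x => (t, x, y)) (fun q : R * R * R => k L q.1.1 q.1.2 q.2)
  _ _ _ (c x) (@fs_cont _ _ _ (hk L0) t x y t0)).
Qed.

Let kk_cont L : crd L m.+1 != 0 -> continuous (kk L).
Proof.
move=> L0 x.
have c : continuous (fun x : R => (t, x + a, x)).
  apply: (@continuous_pair R (R * R)%type R (fun x => (t, x + a)) id) => z; last exact: cvg_id.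
  apply: (@continuous_pair R R R (fun=> t) (fun x => x + a)) => w; first exact: cvg_cst.
  by apply: cvgD; [exact: cvg_id|exact: cvg_cst].
exact: (@cvg_comp _ _ _ (fun x => (t, x + a, x)) (fun q : R * R * R => k L q.1.1 q.1.2 q.2)
  _ _ _ (c x) (@fs_cont _ _ _ (hk L0) t (x + a) x t0)).
Qed.

Let Qm_cvg L x : crd L m.+1 != 0 -> Qm j (coad L x) @[j --> \oo] --> kk L x.
Proof.
move=> L0.
have := mollify_cvg (@k_section L x L0 (x + a))
  (fun j => continuous_tst_integ (@k_section L x L0) (tst_bumpn (x + a) j)).
rewrite (_ : (fun j => _) = fun j => Qm j (coad L x))//.
apply/funext => j; rewrite /Qm Q_coad; congr (_ / _).
exact/esym/(fundamental_solution_pairing gen hp (hk L0) (potentialE L) (tst_bumpn (x + a) j) t0).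
Qed.

Let Qm_ge0 j eta : 0 <= Qm j eta.
Proof.
rewrite divr_ge0 ?(ltW (cbump_gt0 _))//; apply: (Q_ge0 gen hp) => //; last exact: ltW.
  exact: tst_bumpn.
by move=> y; exact: bumpn_ge0.
Qed.

Let kk_ge0 L x : crd L m.+1 != 0 -> 0 <= kk L x.
Proof.
move=> L0; rewrite -(cvg_lim _ (Qm_cvg (x := x) L0))//.
apply: limr_ge; first by apply/cvg_ex; exists (kk L x); exact: Qm_cvg.
by apply: nearW => j; exact: Qm_ge0.
Qed.

(** The decay of [Q_exp_decay] is proportional to the mass of the bump, so it passes to the limit in
    which the bump shrinks; lambda_{n-1} <> 0 supplies the growth of the potential. *)
Let kk_integ L : crd L m.+1 != 0 -> integ mu (kk L).
Proof.
move=> L0.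
have max0 : pot_coef L ord0 ord_max != 0.
  by rewrite mxE /= ltnNge leqnSn /= gtn_eqF// -last_coord.
have [K0 hK0] := wv_growth max0.
have [C [c [C0 c0 hC]]] := Q_exp_decay gen hp t0 hK0.
apply: (le_integ _ _ (integZ C (integ_expR_norm c0))).
  by apply: continuous_measurable_fun; exact: kk_cont.
move=> x; apply: (@cvg_norm_le R _ _ _ 0 (Qm_cvg (x := x) L0)) => j.
rewrite mul0r addr0 /Qm Q_coad normrM [`|_^-1|]ger0_norm ?invr_ge0 ?(ltW (cbump_gt0 _))//.
by rewrite ler_pdivrMr ?cbump_gt0// mulrAC; exact: hC.
Qed.

Let lam (u : 'rV[R]_m.+1 * measurableTypeR R) : R := `|u.1 ord0 ord_max|.
Let co (u : 'rV[R]_m.+1 * measurableTypeR R) : 'rV[R]_n := coad u.1 u.2.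
Let hh (u : 'rV[R]_m.+1 * measurableTypeR R) : R := kk u.1 u.2 * lam u.

Let mlam : measurable_fun setT lam.
Proof.
by apply: measurableT_comp => //; exact: measurableT_comp (measurable_coor ord_max) measurable_fst.
Qed.

Let mco : measurable_fun setT co.
Proof. exact: measurable_coad. Qed.

Let hh_ge0 u : 0 <= hh u.
Proof.
(* Nothing is assumed about [k] when lambda_{n-1} = 0; the weight makes the product 0 there. *)
rewrite /hh /lam; have [->|l0] := eqVneq (u.1 ord0 ord_max) 0; first by rewrite normr0 mulr0.
by rewrite mulr_ge0// kk_ge0// last_coord.
Qed.

Let hh_cvg u : Qm j (co u) * lam u @[j --> \oo] --> hh u.
Proof.
rewrite /hh /lam; have [->|l0] := eqVneq (u.1 ord0 ord_max) 0.
  rewrite normr0 mulr0; under eq_fun do rewrite mulr0.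
  exact: cvg_cst.
by apply: cvgM; [apply: Qm_cvg; rewrite last_coord|exact: cvg_cst].
Qed.

Let M := (leb m.+1 \x mu)%E.

Let transfer (f : 'rV[R]_n -> R) : integ (leb n) f ->
  integ M (fun u => f (co u) * lam u) /\ \int[M]_u (f (co u) * lam u) = \int[leb n]_v f v.
Proof.
move=> i.
have h (F : 'rV[R]_n -> \bar R) : measurable_fun setT F -> (forall v, 0 <= F v)%E ->
    (\int[leb n]_v F v = \int[M]_u (F (co u) * (lam u)%:E))%E.
  move=> mF F0; rewrite (coad_change_of_variables mF F0).
  rewrite (@fubini_tonelli1 _ _ _ _ _ _ _ (fun u => (F (co u) * (lam u)%:E)%E))//.
    apply: emeasurable_funM; first exact: measurableT_comp mF mco.
    by apply/measurable_EFinP.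
  by move=> u; apply: mule_ge0 => //; rewrite lee_fin normr_ge0.
have [h1 h2] := @Rint_transfer _ _ _ _ _ M (leb n) co lam mco mlam
  (fun u => normr_ge0 _) h f (integ_measurable i).
by split; [apply/h1|rewrite h2].
Qed.

Let ph (z : 'rV[R]_n) (c : R) (u : 'rV[R]_m.+1 * measurableTypeR R) : R :=
  cos (2 * pi * dotv (co u) z + c).

Let ph_le1 z c u : `|ph z c u| <= 1.
Proof. by rewrite ler_norml cos_geN1 cos_le1. Qed.

Let mph z c : measurable_fun setT (ph z c).
Proof.
apply: measurable_cos_comp; apply: measurable_funD => //.
by apply: measurable_funM => //; apply: measurable_dotv.
Qed.

Let gN (N : nat) (u : 'rV[R]_m.+1 * measurableTypeR R) : R := gau (pi / N.+1%:R ^+ 2) (co u).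
Let X (z : 'rV[R]_n) N j : R := (\int[haar]_g (bumpn a j g.1 * p t g *
  (N.+1%:R ^+ n * gau (pi * N.+1%:R ^+ 2) (g.2 - z)))) / cbump j.

Let pN0 (N : nat) : 0 <= pi / N.+1%:R ^+ 2 :> R.
Proof. by rewrite divr_ge0 ?pi_ge0. Qed.

Let step1 z c N j : integ M (fun u => gN N u * (ph z c u * (Qm j (co u) * lam u))) /\
  \int[M]_u (gN N u * (ph z c u * (Qm j (co u) * lam u))) = cos c * X z N j.
Proof.
have N0 : 0 < N.+1%:R :> R by rewrite ltr0n.
have [i e] := Q_gauss_weighted gen hp c z (tst_bumpn a j) N0 t0.
have [i1 e1] := transfer (integZ (cbump j)^-1 i).
have E u : (cbump j)^-1 * (gau (pi / N.+1%:R ^+ 2) (co u) *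
    (cos (2 * pi * dotv (co u) z + c) * Q (co u) p (bumpn a j) 0 t 0)) * lam u =
    gN N u * (ph z c u * (Qm j (co u) * lam u)).
  by rewrite /gN /ph /Qm; ring.
split; first by apply: eq_integ i1.
by rewrite -(eq_Rint _ E) e1 RintZ// e /X mulrCA [_^-1 * _]mulrC.
Qed.

(** The bump shrinks at a fixed Gaussian. The majorant is a constant times the Gaussian in eta with
    its Jacobian, since the bound of [Q_gauss] is independent of eta and proportional to the mass of
    the bump. *)
Let step2 z c N : integ M (fun u => gN N u * (ph z c u * hh u)) /\
  cos c * X z N j @[j --> \oo] --> \int[M]_u (gN N u * (ph z c u * hh u)).
Proof.
have N0 : 0 < N.+1%:R :> R by rewrite ltr0n.
have [C C0 hC] := Q_gauss gen hp t0.
have [ig _] := @gau_integ R n _ N0.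
have [iG _] := transfer (integZ C ig).
have -> : (fun j => cos c * X z N j) =
    fun j => \int[M]_u (gN N u * (ph z c u * (Qm j (co u) * lam u))).
  by apply/funext => j; rewrite (step1 z c N j).2.
apply: (Rint_cvg _ _ iG).
- by move=> j; exact: integ_measurable (step1 z c N j).1.
- by move=> u; apply: cvgM; [exact: cvg_cst|apply: cvgM; [exact: cvg_cst|exact: hh_cvg]].
- move=> j u; rewrite normrM [`|gN _ _|]ger0_norm ?gau_ge0// normrM [`|Qm _ _ * _|]normrM [`|lam u|]normr_id.
  have q1 : `|Qm j (co u)| <= C.
    rewrite /Qm normrM [`|_^-1|]ger0_norm ?invr_ge0 ?(ltW (cbump_gt0 _))//.
    by rewrite ler_pdivrMr ?cbump_gt0//; exact: hC.
  rewrite [C * _]mulrC -[leRHS]mulrA ler_wpM2l ?gau_ge0// mulrA ler_wpM2r//.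
  by rewrite -[leRHS]mul1r ler_pM.
Qed.

(** The error in [heat_approx] is bounded uniformly in small bumps, so the bound survives the limit
    in j before N tends to infinity. *)
Let step3 z c : \int[M]_u (gN N u * (ph z c u * hh u)) @[N --> \oo] --> cos c * p t (a, z).
Proof.
apply/cvgrPdist_le => e e0.
have [J [j0 hJ]] := heat_approx gen hp a z t0 e0.
exists J => // N /= JN.
have [_ cX] := step2 z c N.
have cd : cos c * p t (a, z) - cos c * X z N j @[j --> \oo] -->
    cos c * p t (a, z) - \int[M]_u (gN N u * (ph z c u * hh u)).
  by apply: cvgB; [exact: cvg_cst|exact: cX].
have cn : `|cos c * p t (a, z) - cos c * X z N j| @[j --> \oo] -->
    `|cos c * p t (a, z) - \int[M]_u (gN N u * (ph z c u * hh u))|.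
  by apply: cvg_norm; exact: cd.
rewrite -(cvg_lim _ cn)//.
apply: limr_le; first by apply/cvg_ex; eexists; exact: cn.
exists j0 => // j /= jj.
rewrite -mulrBr normrM distrC -[leRHS]mul1r ler_pM//; last exact: hJ.
by rewrite ler_norml cos_geN1 cos_le1.
Qed.

Let gN_cvg u : gN N u @[N --> \oo] --> (1 : R).
Proof.
rewrite /gN /gau -[X in _ --> X]expR0.
have h : - (pi / N.+1%:R ^+ 2 * \sum_(i < n) co u ord0 i ^+ 2) @[N --> \oo] --> (0 : R).
  rewrite -[X in _ --> X](mulr0 (- (pi * \sum_(i < n) co u ord0 i ^+ 2))).
  rewrite (_ : (fun N => _) = fun N => - (pi * \sum_(i < n) co u ord0 i ^+ 2) *
      (N.+1%:R^-1 * N.+1%:R^-1)); last first.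
    by apply/funext => N; rewrite -expr2 exprVn mulNr mulrAC.
  apply: cvgM; first exact: cvg_cst.
  by rewrite -[X in _ --> X](mulr0 0); apply: cvgM; exact: cvg_harmonic.
exact: (@cvg_comp _ _ _ _ (@expR R) _ _ _ h (@continuous_expR R 0)).
Qed.

(** At z = 0 and c = 0 the phase factor is 1 and the regularised integrals converge, hence are
    eventually bounded by p_t(a, 0) + 1. The shift by [N0] discards the initial terms for Fatou's
    lemma. *)
Let hh_integ : integ M hh.
Proof.
have c := @step3 0 0.
have ph0 u : ph 0 0 u = 1 by rewrite /ph dotv0r mulr0 addr0 cos0.
have [N0 _ hN0] := (cvgrPdist_le _ _).1 c 1 ltr01.
apply: (proj1 (@integ_fatou _ _ _ M (fun N u => gN (N + N0) u * (ph 0 0 u * hh u)) hh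
  (cos 0 * p t (a, 0) + 1) _ _ _ _)).
- by move=> N; exact: (step2 0 0 (N + N0)).1.
- by move=> N u; rewrite ph0 mul1r mulr_ge0 ?gau_ge0.
- move=> u; rewrite -[X in _ --> X]mul1r; apply: cvgM.
    by rewrite (cvg_shiftn N0 (fun N => gN N u)); exact: gN_cvg.
  by rewrite ph0; under eq_fun do rewrite mul1r; exact: cvg_cst.
- move=> N; have := hN0 (N + N0)%N (leq_addl _ _).
  by rewrite ler_distlC => /andP[_]; rewrite -lerBlDl lerBlDr.
Qed.

Let trace_integral z c : integ M (fun u => ph z c u * hh u) /\
  \int[M]_u (ph z c u * hh u) = cos c * p t (a, z).
Proof.
have mh := integ_measurable hh_integ.
have [i cv] : integ M (fun u => ph z c u * hh u) /\
    \int[M]_u (gN N u * (ph z c u * hh u)) @[N --> \oo] --> \int[M]_u (ph z c u * hh u).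
  apply: (Rint_cvg _ _ hh_integ).
  - by move=> N; exact: integ_measurable (step2 z c N).1.
  - move=> u; rewrite -[X in _ --> X]mul1r; apply: cvgM; [exact: gN_cvg|exact: cvg_cst].
  - move=> N u; rewrite normrM normrM (ger0_norm (hh_ge0 u)) [`|gN N u|]ger0_norm ?gau_ge0//.
    rewrite mulrA ler_piMl// -[leRHS]mul1r ler_pM ?gau_ge0//.
    by apply: gau_le1; exact: pN0.
by split=> //; exact: (cvg_unique (@norm_hausdorff _ _) cv (@step3 z c)).
Qed.

Lemma trace_kernel (z : 'rV[R]_n) :
  let inner L x : R[i] := (expi (2 * pi * @phase R n L x z) * (k L t (x + a) x)%:C%C) in
  let outer L : R[i] := (cintegral mu (inner L) * `|crd L m.+1|%:C%C) in
  [/\ forall L, crd L m.+1 != 0 -> cintegrable mu (inner L),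
      cintegrable (leb m.+1) outer &
      (p t (a, z))%:C%C = cintegral (leb m.+1) outer].
Proof.
move=> inner outer.
have cphase L x c : ph z c (L, x) = cos (2 * pi * @phase R n L x z + c) by rewrite phaseE.
have reE L x : complex.Re (inner L x) = ph z 0 (L, x) * kk L x.
  by rewrite cphase addr0 /inner /expi /= mulr0 subr0.
(* The sine is a cosine of phase - pi / 2, so both parts of the complex integral are instances of
   [trace_integral]; the imaginary one carries the factor cos(pi / 2) = 0. *)
have imE L x : complex.Im (inner L x) = ph z (- (pi / 2)) (L, x) * kk L x.
  by rewrite cphase cosB cos_pihalf sin_pihalf mulr0 mulr1 add0r /inner /expi /= mulr0 add0r.
have iph c L : crd L m.+1 != 0 -> integ mu (fun x => ph z c (L, x) * kk L x).
  move=> L0; apply: (integ_mulr_bounded (kk_integ L0) _ (fun x => ph_le1 z c (L, x))).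
  exact: (measurable_fun_pair2 L (mph z c)).
(* The weight is moved inside the integral over x; when it vanishes both sides are 0, whatever the
   inner integral is. *)
have sec c L : (\int[mu]_x (ph z c (L, x) * kk L x)) * `|crd L m.+1| =
    \int[mu]_x (ph z c (L, x) * hh (L, x)).
  rewrite last_coord; have [l0|l0] := eqVneq (L ord0 ord_max) 0.
    rewrite l0 normr0 mulr0 -(Rint0 mu); apply: eq_Rint => x.
    by rewrite /hh /lam /= l0 normr0 !mulr0.
  rewrite mulrC -RintZ; last by apply: iph; rewrite last_coord.
  by apply: eq_Rint => x; rewrite /hh /lam /= mulrC mulrA.
have reO L : complex.Re (outer L) = \int[mu]_x (ph z 0 (L, x) * hh (L, x)).
  by rewrite /outer /cintegral /= mulr0 subr0 -sec; congr (_ * _); apply: eq_Rint => x; exact: reE.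
have imO L : complex.Im (outer L) = \int[mu]_x (ph z (- (pi / 2)) (L, x) * hh (L, x)).
  by rewrite /outer /cintegral /= mulr0 add0r -sec; congr (_ * _); apply: eq_Rint => x; exact: imE.
have [ir er] := trace_integral z 0; have [ii ei] := trace_integral z (- (pi / 2)).
have [ir1 er1] := Rint_prod1 ir; have [ii1 ei1] := Rint_prod1 ii.
split.
- move=> L L0; split.
    by apply: eq_integ (iph 0 L L0) => x; rewrite reE.
  by apply: eq_integ (iph (- (pi / 2)) L L0) => x; rewrite imE.
- split; first by apply: eq_integ ir1 => L; rewrite reO.
  by apply: eq_integ ii1 => L; rewrite imO.
- rewrite /cintegral; congr (_ +i* _)%C.
    by rewrite (eq_Rint _ reO) -er1 er cos0 mul1r.
  by rewrite (eq_Rint _ imO) -ei1 ei cosN cos_pihalf mul0r.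
Qed.

End trace_formula.

Theorem theorem4p2 (R : realType) (n : nat)
    (p : R -> R * 'rV[R]_n -> R) (k : 'rV[R]_n.-1 -> R -> R -> R -> R)
    (hn : (2 <= n)%N)
    (hp : hypoelliptic_heat_kernel p)
    (hk : forall L : 'rV[R]_n.-1, crd L n.-1 != 0 ->
      fundamental_solution (potential L) (k L))
    (t : R) (ht : 0 < t) (a : R) (z : 'rV[R]_n) :
  let inner (L : 'rV[R]_n.-1) (x : R) : R[i] :=
    expi (2 * pi * phase L x z) * (k L t (x + a) x)%:C%C in
  let outer (L : 'rV[R]_n.-1) : R[i] :=
    cintegral lebesgue_measure (inner L) * `|crd L n.-1|%:C%C in
  [/\ forall L, crd L n.-1 != 0 -> cintegrable lebesgue_measure (inner L),
      cintegrable (leb n.-1) outer &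
      (p t (a, z))%:C%C = cintegral (leb n.-1) outer].
Proof.
case: n p k hn hp hk z => [|[|m]] // p k _ [S gen hp] hk z.
exact: (trace_kernel gen hp hk a ht z).
Qed.
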